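(* Let $E=T^*\mathbf R^n\simeq\mathbf R^n\times(\mathbf R^n)^*$, let $m$ be an order function on $E\times E^*$ and let $a\in\widetilde S(m)$. Then $a^w$ has an effective kernel $K^{\rm eff}_{a^w}(x,y)$ on $E\times E$ (defined via a Bargmann transform as in the context) satisfying $$|K^{\rm eff}_{a^w}(x,y)|\le C(a)\,m\Big(\frac{x+y}2,J^{-1}(y-x)\Big),\qquad x,y\in E,$$ where $C(a)$ is an $\widetilde S(m)$ norm of $a$ (i.e. a constant independent of $a$ times $\|a\|_{\widetilde S(m)}$). In particular, if $M(x,y)=m\big(\frac{x+y}2,J^{-1}(y-x)\big)$ is the integral kernel of an operator that is bounded on $L^2(E)$, then $a^w$ is bounded $L^2(\mathbf R^n)\to L^2(\mathbf R^n)$.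
   Context: An order function on a finite dimensional real vector space $V$ is a function $m:V\to]0,\infty[$ for which there are $C_0>0$, $N_0\ge1$ with $m(\rho)\le C_0\langle\rho-\mu\rangle^{N_0}m(\mu)$ for all $\rho,\mu\in V$, where $\langle\rho\rangle=(1+|\rho|^2)^{1/2}$. A lattice in $V$ is the set of integer combinations of a basis. Weyl quantization: for a symbol $b$ on $W\times W^*$, $W$ a real vector space of dimension $k$, $b^wu(x)=(2\pi)^{-k}\iint e^{i(x-y)\cdot\theta}b(\frac{x+y}2,\theta)u(y)\,dy\,d\theta$. In particular $a\in\mathcal S'(E)$ defines $a^w:\mathcal S(\mathbf R^n)\to\mathcal S'(\mathbf R^n)$. Symbol space: fix a lattice $\Gamma\subset E\times E^*$ and $\chi\in\mathcal S(E\times E^* )$ with $\sum_{\gamma\in\Gamma}\chi_\gamma=1$, $\chi_\gamma(\rho)=\chi(\rho-\gamma)$. Then $\widetilde S(m)$ is the set of $a\in\mathcal S'(E)$ such that $\|\chi_\gamma^wa\|_{L^2(E)}\le C\,m(\gamma)$ for all $\gamma\in\Gamma$ and some $C$; $\|a\|_{\widetilde S(m)}$ is the smallest such $C$. $J:E^*\to E$ maps a linear form $\ell$ on $E$ to its (constant) Hamilton field: with coordinates $(x,\xi)$ on $E$, $J\ell=H_\ell=(\ell'_\xi,-\ell'_x)$. Bargmann transform: $Tu(x)=c\int_{\mathbf R^n} e^{i\phi(x,y)}u(y)\,dy$, $x\in\mathbf C^n$, where $\phi$ is a (holomorphic) quadratic form on $\mathbf C^n\times\mathbf C^n$ with $\det\phi''_{xy}\ne0$,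 $\mathrm{Im}\,\phi''_{yy}>0$, and $c>0$ is chosen so that $T:L^2(\mathbf R^n)\to H_\Phi(\mathbf C^n)$ is unitary. Here $\Phi(x)=\sup_{y\in\mathbf R^n}-\mathrm{Im}\,\phi(x,y)$, $H_\Phi(\mathbf C^n)$ is the space of holomorphic functions on $\mathbf C^n$ in $L^2(e^{-2\Phi}L(dx))$, and $L(dx)$ is Lebesgue measure on $\mathbf C^n$. The associated complex linear canonical transformation is $\kappa_T:(y,-\phi'_y(x,y))\mapsto(x,\phi'_x(x,y))$, and $\kappa_T(E)=\Lambda_\Phi=\{(x,\frac2i\frac{\partial\Phi}{\partial x}(x)):x\in\mathbf C^n\}$. One identifies $x\in\mathbf C^n$ with the point $\kappa_T^{-1}(x,\frac2i\frac{\partial\Phi}{\partial x}(x))\in E$. An effective kernel of $a^w$ is a function $K^{\rm eff}_{a^w}(x,y)$ on $\mathbf C^n\times\mathbf C^n$, viewed as a function on $E\times E$ by this identification, such that $T a^w T^{-1}u(x)=\int_{\mathbf C^n}e^{\Phi(x)}K^{\rm eff}_{a^w}(x,y)u(y)e^{-\Phi(y)}L(dy)$ for $u\in T(\mathcal S(\mathbf R^n))$ ($T$ being extended to $\mathcal S'(\mathbf R^n)$). Such a kernel is not unique. *)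

(* Defs.v *)
(* MathComp and MathComp-Analysis; complex numbers are R[i] from
   mathcomp-real-closed. *)
From HB Require Import structures.
From mathcomp Require Import all_boot all_order all_algebra.
From mathcomp Require Import complex.
From mathcomp Require Import all_classical all_reals all_analysis.

Set Implicit Arguments.
Unset Strict Implicit.
Unset Printing Implicit Defensive.

Import Order.TTheory GRing.Theory Num.Theory.
Import numFieldNormedType.Exports.
Import Normc.

Local Open Scope classical_set_scope.
Local Open Scope ring_scope.
Local Open Scope complex_scope.

(** * Lebesgue measure on ['rV[R]_k] *)

Section rV_measurable.
Context {R : realType} {k : nat}.

Let coords : 'I_k -> 'rV[R]_k -> R := fun i x => x ord0 i.

Let rV_set0 : g_sigma_preimage coords set0.
Proof. exact: sigma_algebra0. Qed.

Let rV_setC A : g_sigma_preimage coords A -> g_sigma_preimage coords (~` A).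
Proof. exact: sigma_algebraC. Qed.

Let rV_bigcup (F : (set 'rV[R]_k)^nat) :
  (forall i, g_sigma_preimage coords (F i)) ->
  g_sigma_preimage coords (\bigcup_i (F i)).
Proof. exact: sigma_algebra_bigcup. Qed.

HB.instance Definition _ := @isMeasurable.Build default_measure_display
  'rV[R]_k (g_sigma_preimage coords) rV_set0 rV_setC rV_bigcup.

End rV_measurable.

Lemma measurable_coord (R : realType) k (i : 'I_k) :
  measurable_fun [set: 'rV[R]_k] (fun x => x ord0 i).
Proof.
move=> _ Y mY; rewrite setTI; apply: sub_sigma_algebra => /=.
rewrite -bigcup_seq/=; exists i => /=; first by rewrite mem_index_enum.
by exists Y => //; rewrite setTI.
Qed.

Lemma measurable_fun_rVP d (T : measurableType d) (R : realType) k
    (f : T -> 'rV[R]_k) :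
  measurable_fun [set: T] f <->
  forall i, measurable_fun [set: T] (fun t => f t ord0 i).
Proof.
split=> [mf i|mf].
  exact: (measurableT_comp (measurable_coord i) mf).
move=> _ A mA.
pose F := image_set_system setT f measurable.
suff : F A by rewrite /F /image_set_system/=.
apply: mA; split; first exact: sigma_algebra_image (sigma_algebra_measurable _).
move=> B; rewrite -bigcup_seq => -[i _ [C mC <-]].
rewrite /F /image_set_system/=.
have := mf i measurableT C mC.
by rewrite !setTI.
Qed.

Section rV_lebesgue.
Context {R : realType}.
Local Open Scope ereal_scope.

Definition rV_cons k (p : measurableTypeR R * 'rV[R]_k) : 'rV[R]_k.+1 :=
  row_mx (\row_(_ < 1) p.1) p.2.

Definition rV_uncons k (v : 'rV[R]_k.+1) : measurableTypeR R * 'rV[R]_k :=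
  (v ord0 ord0, \row_j v ord0 (lift ord0 j)).

Lemma rV_consK k : cancel (@rV_cons k) (@rV_uncons k).
Proof.
move=> [x v]; rewrite /rV_cons /rV_uncons; congr pair => /=.
  transitivity (row_mx (\row_(_ < 1) x) v ord0 (lshift k ord0)).
    by congr (row_mx _ _ _ _); exact: val_inj.
  by rewrite row_mxEl mxE.
apply/rowP => j; rewrite mxE.
transitivity (row_mx (\row_(_ < 1) x) v ord0 (rshift 1 j)).
  by congr (row_mx _ _ _ _); exact: val_inj.
by rewrite row_mxEr.
Qed.

Lemma measurable_rV_cons k : measurable_fun setT (@rV_cons k).
Proof.
apply/measurable_fun_rVP => i.
rewrite /rV_cons; case: (split_ordP (i : 'I_(1 + k))) => j ->.
  rewrite [X in measurable_fun _ X](_ : _ = fst).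
    exact: measurable_fst.
  by apply/funext => p; rewrite [LHS]row_mxEl mxE.
rewrite [X in measurable_fun _ X](_ : _ = (fun v : 'rV[R]_k => v ord0 j) \o snd).
  exact: (measurableT_comp (measurable_coord j) measurable_snd).
by apply/funext => p; rewrite [LHS]row_mxEr.
Qed.

Lemma measurable_rV_uncons k : measurable_fun setT (@rV_uncons k).
Proof.
apply/measurable_fun_pair; first exact: (measurable_coord (ord0 : 'I_k.+1)).
apply/measurable_fun_rVP => i; under eq_fun do rewrite mxE.
exact: measurable_coord.
Qed.

Section step.
Variables (k : nat) (mu : {sigma_finite_measure set 'rV[R]_k -> \bar R}).

Definition rV_lebesgue_step : set 'rV[R]_k.+1 -> \bar R :=
  pushforward (lebesgue_measure \x mu) (@rV_cons k).

Let preim A : measurable A -> measurable (@rV_cons k @^-1` A).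
Proof. by move=> mA; rewrite -[X in measurable X]setTI; exact: measurable_rV_cons. Qed.

Let step0 : rV_lebesgue_step set0 = 0.
Proof. by rewrite /rV_lebesgue_step /pushforward preimage_set0 measure0. Qed.

Let step_ge0 A : 0 <= rV_lebesgue_step A.
Proof. by rewrite /rV_lebesgue_step /pushforward measure_ge0. Qed.

Let step_sigma_additive : semi_sigma_additive rV_lebesgue_step.
Proof.
move=> F mF tF mUF; rewrite /rV_lebesgue_step /pushforward preimage_bigcup.
apply: measure_semi_sigma_additive.
- by move=> i; exact: preim.
- apply/trivIsetP => /= i j _ _ ij; rewrite -preimage_setI.
  by move/trivIsetP : tF => /(_ _ _ _ _ ij) ->//; rewrite preimage_set0.
- by rewrite -preimage_bigcup; exact: preim.
Qed.

HB.instance Definition _ := isMeasure.Build _ _ _ rV_lebesgue_step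
  step0 step_ge0 step_sigma_additive.

Let step_sigma_finite : sigma_finite setT rV_lebesgue_step.
Proof.
have /sigma_finiteP[F [TF ndF Foo]] := sigma_finiteT (@lebesgue_measure R).
have /sigma_finiteP[G [TG ndG Goo]] := sigma_finiteT mu.
exists (fun i => @rV_uncons k @^-1` (F i `*` G i)).
  rewrite -preimage_bigcup (_ : \bigcup_i (F i `*` G i) = setT).
    by rewrite preimage_setT.
  rewrite -setXTT TF TG predeqE => -[x y]; split=> [[i _ []/= ? ?]|].
    by split; exists i.
  move=> [/= [i _ Fix] [j _ Gjy]]; exists (maxn i j) => //; split.
  - by move: x Fix; exact/subsetPset/ndF/leq_maxl.
  - by move: y Gjy; exact/subsetPset/ndG/leq_maxr.
move=> i; have [mF ?] := Foo i; have [mG ?] := Goo i; split.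
  rewrite -[X in measurable X]setTI; apply: measurable_rV_uncons => //.
  exact: measurableX.
rewrite /rV_lebesgue_step /pushforward -comp_preimage.
rewrite (_ : _ \o _ = id); last by apply/funext => p; exact: rV_consK.
rewrite preimage_id.
by rewrite product_measure1E// lte_mul_pinfty// ge0_fin_numE.
Qed.

HB.instance Definition _ := Measure_isSigmaFinite.Build _ _ _
  rV_lebesgue_step step_sigma_finite.

End step.

Fixpoint rV_lebesgue k : {sigma_finite_measure set 'rV[R]_k -> \bar R} :=
  match k return {sigma_finite_measure set 'rV[R]_k -> \bar R} with
  | 0 => \d_ (0%R : 'rV[R]_0)
  | k'.+1 => rV_lebesgue_step (rV_lebesgue k')
  end.

End rV_lebesgue.

Lemma rV_lebesgue_box (R : realType) k (a b : 'rV[R]_k) :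
  (forall i, a ord0 i <= b ord0 i) ->
  rV_lebesgue k [set v | forall i, a ord0 i <= v ord0 i <= b ord0 i] =
  (\prod_(i < k) (b ord0 i - a ord0 i))%:E.
Proof.
elim: k a b => [|k IH] a b ab /=.
  rewrite big_ord0 /= /dirac indicE mem_set//.
  by case.
rewrite /rV_lebesgue_step /pushforward.
pose A : set (measurableTypeR R) := `[a ord0 ord0, b ord0 ord0]%classic.
pose a' : 'rV[R]_k := \row_j a ord0 (lift ord0 j).
pose b' : 'rV[R]_k := \row_j b ord0 (lift ord0 j).
pose B : set 'rV[R]_k := [set v | forall i, a' ord0 i <= v ord0 i <= b' ord0 i].
rewrite (_ : _ @^-1` _ = A `*` B); last first.
  have h0 (p : measurableTypeR R * 'rV[R]_k) : rV_cons p ord0 ord0 = p.1.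
    by have /(congr1 fst) := rV_consK p.
  have hS (p : measurableTypeR R * 'rV[R]_k) i :
      rV_cons p ord0 (lift ord0 i) = p.2 ord0 i.
    by have /(congr1 snd)/(congr1 (fun v : 'rV[R]_k => v ord0 i)) := rV_consK p;
       rewrite mxE.
  apply/seteqP; split=> p.
    move=> H; split.
      by rewrite /A/= in_itv/= -h0; exact: H.
    by move=> i; rewrite !mxE -hS; exact: H.
  move=> [pA pB] i; case: (unliftP ord0 i) => [j|] ->.
    by rewrite hS; have := pB j; rewrite !mxE.
  by rewrite h0; move: pA; rewrite /A/= in_itv.
have mB : measurable B.
  rewrite (_ : B = \big[setI/setT]_(i < k)
     ((fun v : 'rV[R]_k => v ord0 i) @^-1` `[a' ord0 i, b' ord0 i]%classic)).
    apply: bigsetI_measurable => i _.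
    rewrite -[X in measurable X]setTI.
    by apply: measurable_coord.
  rewrite -bigcap_seq; apply/seteqP; split=> v /=.
    by move=> H i _; rewrite /= in_itv/=; exact: H.
  by move=> H i; have := H i (mem_index_enum i); rewrite /= in_itv.
rewrite product_measure1E//; last exact: measurable_itv.
rewrite IH; last by move=> i; rewrite !mxE.
rewrite big_ord_recl EFinM; congr (_ * _)%E.
  rewrite [LHS]lebesgue_measure_itv/= lte_fin.
  case: ltP => // ba; have -> : b ord0 ord0 = a ord0 ord0.
    by apply/le_anti; rewrite ba ab.
  by rewrite subrr.
by congr EFin; apply: eq_bigr => i _; rewrite !mxE.
Qed.

(** * Complex-valued functions *)

(* Not the 'i of numClosedFieldType, which would take precedence. *)
Local Notation ii := (0 +i* 1).

Section complex_functions.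
Context {R : realType}.
Local Notation C := R[i].

Definition cexp (z : C) : C :=
  (expR (complex.Re z))%:C * (cos (complex.Im z) +i* sin (complex.Im z)).

Definition toC k (x : 'rV[R]_k) : 'rV[C]_k := map_mx (real_complex R) x.

(* (a, b) |-> a + i b; Lebesgue measure on C^n is the image of Lebesgue
   measure on R^(2n) under this map. *)
Definition cplx n (w : 'rV[R]_(n + n)) : 'rV[C]_n :=
  toC (lsubmx w) + ii *: toC (rsubmx w).

Definition rdot k (x y : 'rV[R]_k) : R := (x *m y^T) ord0 ord0.

Definition japanese k (x : 'rV[R]_k) : R := Num.sqrt (1 + rdot x x).

Definition holomorphic n (U : 'rV[C]_n -> C) : Prop :=
  forall x, differentiable (U : 'rV[C^o]_n -> C^o) x.

Section measure.
Context d (T : measurableType d) (mu : {measure set T -> \bar R}).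
Implicit Type f : T -> C.

Definition cmeasurable f : Prop :=
  measurable_fun setT (fun x => complex.Re (f x)) /\
  measurable_fun setT (fun x => complex.Im (f x)).

Definition cintegrable f : Prop :=
  mu.-integrable setT (fun x => (complex.Re (f x))%:E) /\
  mu.-integrable setT (fun x => (complex.Im (f x))%:E).

Definition cintegral f : C :=
  (\int[mu]_x complex.Re (f x)) +i* (\int[mu]_x complex.Im (f x)).

(* Integral with respect to the completion of mu: f only needs to agree
   almost everywhere with a mu-integrable function. *)
Definition ae_integral f (v : C) : Prop :=
  exists h, [/\ cintegrable h, (\forall x \ae mu, h x = f x) &
    cintegral h = v].

Definition L2norm f : \bar R := Lnorm mu 2%:E (fun x => (normc (f x))%:E).

Definition L2 f : Prop := cmeasurable f /\ (L2norm f < +oo)%E.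

End measure.

(* Sum over an arbitrary index set: limit along finite subsets. *)
Definition unordered_sum (I : choiceType) (G : set I) (f : I -> C) (l : C) :=
  forall e : R, 0 < e -> exists A : set I, [/\ finite_set A, A `<=` G &
    forall B, finite_set B -> A `<=` B -> B `<=` G ->
      normc (\sum_(g \in B) f g - l) < e].

End complex_functions.

Notation leb k := (rV_lebesgue k).

(** * Schwartz functions and tempered distributions *)

Section distributions.
Context {R : realType}.
Local Notation C := R[i].

Definition partial k (i : 'I_k) (u : 'rV[R]_k -> C) (x : 'rV[R]_k) : C :=
  'D_(delta_mx ord0 i) (fun y => complex.Re (u y)) x +i*
  'D_(delta_mx ord0 i) (fun y => complex.Im (u y)) x.

Definition partials k (s : seq 'I_k) (u : 'rV[R]_k -> C) : 'rV[R]_k -> C :=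
  foldr (@partial k) u s.

Definition smooth k (u : 'rV[R]_k -> C) : Prop :=
  forall s x, differentiable (fun y => complex.Re (partials s u y)) x /\
              differentiable (fun y => complex.Im (partials s u y)) x.

Definition schwartz k (u : 'rV[R]_k -> C) : Prop :=
  smooth u /\ forall (N : nat) (s : seq 'I_k), exists B : R,
    forall x, japanese x ^+ N * normc (partials s u x) <= B.

Definition schwartz_seminorm k (N : nat) (u : 'rV[R]_k -> C) : R :=
  sup [set r | exists s x, (size s <= N)%N /\
                           r = japanese x ^+ N * normc (partials s u x)].

(* A distribution is a functional on all functions, of which only the values
   on Schwartz functions are meaningful. The pairing is bilinear. *)
Definition distribution k := ('rV[R]_k -> C) -> C.

Definition tempered k (a : distribution k) : Prop :=
  (forall (l : C) u v, schwartz u -> schwartz v ->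
     a (fun x => l * u x + v x) = l * a u + a v) /\
  exists (A : R) (N : nat), forall u, schwartz u ->
    normc (a u) <= A * schwartz_seminorm N u.

Definition represents k (f : 'rV[R]_k -> C) (a : distribution k) : Prop :=
  forall u, schwartz u -> a u = cintegral (leb k) (fun x => f x * u x).

Definition distr_L2norm_le k (a : distribution k) (r : R) : Prop :=
  exists f, [/\ L2 (leb k) f, represents f a & (L2norm (leb k) f <= r%:E)%E].

(** * Weyl quantization *)

(* Points of W x W^* are rows (x, theta), W^* having the dual basis. *)

Definition weyl_kernel k (b : 'rV[R]_(k + k) -> C) (x y theta : 'rV[R]_k) : C :=
  cexp ((rdot (x - y) theta)%:C * ii) * b (row_mx (2^-1 *: (x + y)) theta).

Definition weyl k (b : 'rV[R]_(k + k) -> C) (u : 'rV[R]_k -> C) : 'rV[R]_k -> C :=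
  fun x => ((2 * pi) ^- k)%:C * cintegral (leb (k + k)) (fun w =>
    weyl_kernel b x (lsubmx w) (rsubmx w) * u (lsubmx w)).

(* The transpose of b^w for the pairing \int u v. *)
Definition weyl_transpose k (b : 'rV[R]_(k + k) -> C) (v : 'rV[R]_k -> C)
    : 'rV[R]_k -> C :=
  fun y => ((2 * pi) ^- k)%:C * cintegral (leb (k + k)) (fun w =>
    weyl_kernel b (lsubmx w) y (rsubmx w) * v (lsubmx w)).

(* b^w : S' -> S' for a Schwartz symbol b, extending weyl by duality. *)
Definition weyl_on_distr k (b : 'rV[R]_(k + k) -> C) (a : distribution k)
    : distribution k :=
  fun v => a (weyl_transpose b v).

(* For a symbol a in S', in <a^w u, v> = (2 pi)^-k \iiint e^(i(x-y).theta)
   a((x+y)/2, theta) u(y) v(x) dx dy dtheta substitute x = z + t/2,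
   y = z - t/2. *)
Definition wigner k (u v : 'rV[R]_k -> C) : 'rV[R]_(k + k) -> C :=
  fun w => let z := lsubmx w in let theta := rsubmx w in
    cintegral (leb k) (fun t => cexp ((rdot t theta)%:C * ii) *
      u (z - 2^-1 *: t) * v (z + 2^-1 *: t)).

Definition weyl_distr k (a : distribution (k + k)) (u : 'rV[R]_k -> C)
    : distribution k :=
  fun v => ((2 * pi) ^- k)%:C * a (wigner u v).

Definition weyl_bounded k (a : distribution (k + k)) : Prop :=
  exists A : R, forall u, schwartz u -> exists g, [/\ L2 (leb k) g,
    represents g (weyl_distr a u) &
    (L2norm (leb k) g <= A%:E * L2norm (leb k) u)%E].

(** * The symbol space S~(m) *)

Definition order_function k (m : 'rV[R]_k -> R) : Prop :=
  (forall rho, 0 < m rho) /\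
  exists C0 N0 : R, [/\ 0 < C0, 1 <= N0 &
    forall rho mu, m rho <= C0 * japanese (rho - mu) `^ N0 * m mu].

Definition lattice k (G : set 'rV[R]_k) : Prop :=
  exists2 B : 'M[R]_k, B \in unitmx &
    G = [set map_mx intr z *m B | z in [set: 'rV[int]_k]].

Definition translate k (chi : 'rV[R]_k -> C) (g : 'rV[R]_k) : 'rV[R]_k -> C :=
  fun rho => chi (rho - g).

Section symbol_space.
Variables (k : nat) (G : set 'rV[R]_(k + k)) (chi : 'rV[R]_(k + k) -> C).
Variable m : 'rV[R]_(k + k) -> R.

Definition symbol_bound (a : distribution k) (A : R) : Prop :=
  forall g, G g -> distr_L2norm_le (weyl_on_distr (translate chi g) a) (A * m g).

Definition symbol_space (a : distribution k) : Prop :=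
  tempered a /\ exists A, symbol_bound a A.

Definition symbol_norm (a : distribution k) : R := inf (symbol_bound a).

End symbol_space.

(** * The Hamilton map *)

(* A linear form x.l1 + xi.l2 on E is the row (l1, l2). *)
Definition hamJ n (l : 'rV[R]_(n + n)) : 'rV[R]_(n + n) :=
  row_mx (rsubmx l) (- lsubmx l).

Definition hamJinv n (v : 'rV[R]_(n + n)) : 'rV[R]_(n + n) :=
  row_mx (- rsubmx v) (lsubmx v).

Lemma hamJK n : cancel (@hamJ n) (@hamJinv n).
Proof.
by move=> l; rewrite /hamJ /hamJinv row_mxKl row_mxKr opprK hsubmxK.
Qed.

Lemma hamJinvK n : cancel (@hamJinv n) (@hamJ n).
Proof.
by move=> v; rewrite /hamJ /hamJinv row_mxKl row_mxKr opprK hsubmxK.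
Qed.

Definition kernel_weight n (m : 'rV[R]_((n + n) + (n + n)) -> R)
    (x y : 'rV[R]_(n + n)) : R :=
  m (row_mx (2^-1 *: (x + y)) (hamJinv (y - x))).

(* M is the integral kernel of a bounded operator on L^2(R^k). *)
Definition bounded_kernel k (M : 'rV[R]_k -> 'rV[R]_k -> R) : Prop :=
  exists A : R, forall f, L2 (leb k) f -> exists g, [/\ L2 (leb k) g,
    (\forall x \ae leb k, ae_integral (leb k) (fun y => (M x y)%:C * f y) (g x)) &
    (L2norm (leb k) g <= A%:E * L2norm (leb k) f)%E].

(** * Bargmann transforms *)

Section bargmann.
Variables (n : nat) (Q : 'M[C]_(n + n)).

(* Q is the Hessian of the quadratic form. *)
Definition phase (x y : 'rV[C]_n) : C :=
  2^-1 * (row_mx x y *m Q *m (row_mx x y)^T) ord0 ord0.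

Definition phase_x (x y : 'rV[C]_n) : 'rV[C]_n := lsubmx (row_mx x y *m Q).
Definition phase_y (x y : 'rV[C]_n) : 'rV[C]_n := rsubmx (row_mx x y *m Q).

Definition bargmann_phase : Prop :=
  [/\ Q^T = Q, \det (ursubmx Q) != 0 &
    forall y : 'rV[R]_n, y != 0 ->
      0 < rdot (y *m map_mx (@complex.Im R) (drsubmx Q)) y].

Definition Phi (x : 'rV[C]_n) : R :=
  sup (range (fun y : 'rV[R]_n => - complex.Im (phase x (toC y)))).

(* d/dx_j = (d/d(Re x_j) - i d/d(Im x_j)) / 2 *)
Definition dPhi (x : 'rV[C]_n) : 'rV[C]_n :=
  \row_j (2^-1 *
    (derive1 (fun t : R => Phi (x + t%:C *: delta_mx ord0 j)) 0
     -i* derive1 (fun t : R => Phi (x + (t%:C * ii) *: delta_mx ord0 j)) 0)).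

(* The graph of kappa_T. *)
Definition kappaT (p q : 'rV[C]_(n + n)) : Prop :=
  exists x y, p = row_mx y (- phase_y x y) /\ q = row_mx x (phase_x x y).

(* kappa_T^-1 (x, (2/i) dPhi/dx (x)), as a point of E. *)
Definition toE (x : 'rV[C]_n) : 'rV[R]_(n + n) :=
  xget 0 [set rho | kappaT (toC rho) (row_mx x ((2 / ii) *: dPhi x))].

Definition in_HPhi (U : 'rV[C]_n -> C) : Prop :=
  holomorphic U /\
  L2 (leb (n + n)) (fun w => U (cplx w) * (expR (- Phi (cplx w)))%:C).

Definition HPhi_norm (U : 'rV[C]_n -> C) : \bar R :=
  L2norm (leb (n + n)) (fun w => U (cplx w) * (expR (- Phi (cplx w)))%:C).

Variable c : R.

Definition bargmann (u : 'rV[R]_n -> C) (x : 'rV[C]_n) : C :=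
  c%:C * cintegral (leb n) (fun y => cexp (ii * phase x (toC y)) * u y).

Definition bargmann_distr (a : distribution n) (x : 'rV[C]_n) : C :=
  c%:C * a (fun y => cexp (ii * phase x (toC y))).

Definition bargmann_unitary : Prop :=
  (forall u, L2 (leb n) u ->
     in_HPhi (bargmann u) /\ HPhi_norm (bargmann u) = L2norm (leb n) u) /\
  (forall U, in_HPhi U ->
     exists2 u, L2 (leb n) u & forall x, bargmann u x = U x).

(* An element of T(S(R^n)) is bargmann u, with u Schwartz, so that
   T a^w T^-1 maps it to bargmann_distr (weyl_distr a u). *)
Definition effective_kernel (a : distribution (n + n))
    (K : 'rV[C]_n -> 'rV[C]_n -> C) : Prop :=
  cmeasurable (fun p : 'rV[R]_(n + n) * 'rV[R]_(n + n) =>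
    K (cplx p.1) (cplx p.2)) /\
  forall u, schwartz u -> forall x,
    let F w := let y := cplx w in
      (expR (Phi x))%:C * K x y * bargmann u y * (expR (- Phi y))%:C in
    cintegrable (leb (n + n)) F /\
    bargmann_distr (weyl_distr a u) x = cintegral (leb (n + n)) F.

End bargmann.
End distributions.

(* Main.v *)
Require Import Defs.
From HB Require Import structures.
From mathcomp Require Import all_boot all_order all_algebra.
From mathcomp Require Import complex.
From mathcomp Require Import all_classical all_reals all_analysis.
From mathcomp Require Import measurable_realfun ring lra zify.
Import Order.TTheory GRing.Theory Num.Theory.
Import numFieldNormedType.Exports.
Import Normc.
Set Implicit Arguments.
Unset Strict Implicit.
Unset Printing Implicit Defensive.
Local Open Scope classical_set_scope.
Local Open Scope ring_scope.
Local Open Scope complex_scope.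
Local Notation Re := complex.Re.
Local Notation Im := complex.Im.

(** The kernel of the operator T a^w T^-1 is, up to a constant, the matrix entry of
    a^w between two coherent states g_y and g_x, and such an entry is the value of a
    on the Wigner transform of the pair. A coherent state is a phase space
    translate of one Gaussian (coherentE), so this Wigner transform is the
    translate of a fixed Gaussian-like function G to the point ((x + y)/2,
    J^-1(y - x)) of E x E^* (wigner_tau). Everything therefore rests on the
    bound |a(tau_rho G)| <= C |a| m(rho) for phase space translates tau_rho G of a
    Schwartz function, with C independent of a (symbol_phase_space).

    For that bound, let chi_g be the translates of chi. Their quantizations cut a
    Schwartz function F into pieces which add up to a multiple of F in the
    Schwartz space (localization_cvg), and the piece of tau_rho F near g decreases
    rapidly with the distance from g to rho by covariance (weyl_covariance). The
    pieces with g near rho are controlled by the definition of the symbol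
    space. The remote ones are controlled, with a gain of a factor as small as
    one likes, by any bound on the quantity which is to be estimated, because a
    is reconstructed from its values a(tau_rho h) for a fixed window h
    (symbol_gabor). An a priori bound of polynomial growth, from the continuity of a,
    is thus improved: the bad constant is halved again and again, first with
    m plus a small multiple of a power of the Japanese bracket, a multiple which then
    tends to zero, and finally with m itself (symbol_bound_tau).

    The identity defining an effective kernel follows from the resolution of the
    identity by coherent states, which polarizes the unitarity of T
    (coherent_resolution). It has to be taken inside a, which is only a
    distribution; the Gabor representation makes this an application of
    Fubini's theorem (symbol_superposition).

    For the boundedness, the pairings of a^w u with the coherent states are
    integrals of the entries against T u, dominated by the operator with kernel M
    applied to |T u|. They are thus square integrable (symbol_entries_L2), and the
    adjoint of T, constructed by truncation and a series in the space of square
    integrable functions (coherent_adjoint), turns them into a square integrable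
    function which represents a^w u (symbol_weyl_bounded).

    The many integral transforms involved are Schwartz functions of all their
    variables for one reason, that oscillatory integrals with a nondegenerate
    quadratic phase and a Schwartz amplitude are (schwartz_osc). *)

(** * Complex numbers and complex sequences *)

Section complex_numbers.
Context {R : realType}.
Local Notation C := R[i].
Implicit Types x y z : C.

Lemma cReD x y : Re (x + y) = Re x + Re y.
Proof. by case: x => a b; case: y. Qed.
Lemma cImD x y : Im (x + y) = Im x + Im y.
Proof. by case: x => a b; case: y. Qed.
Lemma cReM x y : Re (x * y) = Re x * Re y - Im x * Im y.
Proof. by case: x => a b; case: y. Qed.
Lemma cImM x y : Im (x * y) = Re x * Im y + Im x * Re y.
Proof. by case: x => a b; case: y. Qed.
Lemma cReJ x : Re x^*%C = Re x. Proof. by case: x. Qed.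
Lemma cImJ x : Im x^*%C = - Im x. Proof. by case: x. Qed.
Lemma cReN x : Re (- x) = - Re x. Proof. by case: x. Qed.
Lemma cImN x : Im (- x) = - Im x. Proof. by case: x. Qed.
Lemma cReI (a b : R) : Re (a +i* b) = a. Proof. by []. Qed.
Lemma cImI (a b : R) : Im (a +i* b) = b. Proof. by []. Qed.
Definition ReImE := (cReD, cImD, cReM, cImM, cReJ, cImJ, cReN, cImN, cReI, cImI).
Lemma ReIm_inj x y : Re x = Re y -> Im x = Im y -> x = y.
Proof. by case: x => a b; case: y => c d /= -> ->. Qed.
Lemma normc_ge0 x : 0 <= normc x.
Proof. by case: x => a b; rewrite sqrtr_ge0. Qed.
Lemma normc_sq x : normc x ^+ 2 = Re x ^+ 2 + Im x ^+ 2.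
Proof. by case: x => a b; rewrite sqr_sqrtr // addr_ge0 // sqr_ge0. Qed.
Lemma normcR (r : R) : normc r%:C = `|r|.
Proof. by rewrite /= expr0n /= addr0 sqrtr_sqr. Qed.
Lemma normc_conj x : normc x^*%C = normc x.
Proof. by case: x => a b /=; rewrite sqrrN. Qed.
Lemma normc_Re x : `|Re x| <= normc x.
Proof. by case: x => a b /=; rewrite -sqrtr_sqr ler_wsqrtr // lerDl sqr_ge0. Qed.
Lemma normc_Im x : `|Im x| <= normc x.
Proof. by case: x => a b /=; rewrite -sqrtr_sqr ler_wsqrtr // lerDr sqr_ge0. Qed.
Lemma normc_leD x : normc x <= `|Re x| + `|Im x|.
Proof.
rewrite -ler_sqr ?nnegrE ?addr_ge0 ?normc_ge0 ?normr_ge0 // normc_sq.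
by rewrite sqrrD !real_normK ?num_real // lerD2r lerDl mulrn_wge0 ?mulr_ge0.
Qed.
Lemma le_normc_sum (I : Type) (r : seq I) (P : pred I) (F : I -> C) :
  normc (\sum_(i <- r | P i) F i) <= \sum_(i <- r | P i) normc (F i).
Proof.
elim/big_rec2: _ => [|i a b _ H]; first by rewrite normc0.
by rewrite (le_trans (le_normcD _ _)) // lerD2l.
Qed.

Lemma cexpD x y : cexp (x + y) = cexp x * cexp y.
Proof.
by apply: ReIm_inj; rewrite /cexp !ReImE /= ?mul0r ?mulr0 ?subr0 ?addr0 ?add0r
  expRD ?cosD ?sinD; ring.
Qed.
Lemma normc_cexp x : normc (cexp x) = expR (Re x).
Proof.
rewrite /cexp normcM normcR ger0_norm ?expR_ge0 //= cos2Dsin2 sqrtr1 mulr1 //.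
Qed.
Lemma cexp_real (r : R) : cexp r%:C = (expR r)%:C.
Proof. by rewrite /cexp /= cos0 sin0 mulr1. Qed.

Definition cis (r : R) : C := cexp (r%:C * (0 +i* 1)).
Lemma cisD r s : cis (r + s) = cis r * cis s.
Proof. by rewrite /cis -cexpD -mulrDl -rmorphD. Qed.
Lemma cisE r : cis r = cos r +i* sin r.
Proof.
rewrite /cis /cexp.
have -> : r%:C * (0 +i* 1) = 0 +i* r by apply: ReIm_inj; rewrite !ReImE /=; ring.
by rewrite /= expR0 mul1r.
Qed.
Lemma normc_cis r : normc (cis r) = 1.
Proof. by rewrite /cis normc_cexp /= !(mul0r, mulr0, subr0) expR0. Qed.
Lemma cisJ r : (cis r)^*%C = cis (- r).
Proof. by rewrite !cisE cosN sinN. Qed.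
Lemma cis0 : cis 0 = 1. Proof. by rewrite cisE cos0 sin0. Qed.

Definition ccvg (u : nat -> C) (l : C) :=
  (fun j => Re (u j)) @ \oo --> Re l /\ (fun j => Im (u j)) @ \oo --> Im l.

Lemma ccvgP (u : nat -> C) l :
  (fun j => normc (u j - l)) @ \oo --> (0 : R) <-> ccvg u l.
Proof.
split=> [H|[H1 H2]].
- have K (f : C -> R) : (forall z, `|f z| <= normc z) ->
    (forall x y, f (x - y) = f x - f y) ->
    (fun j => f (u j)) @ \oo --> f l.
    move=> fb fB; apply/cvgrPdist_le => e e0.
    move/cvgrPdist_le : H => /(_ e e0); apply: filterS => j.
    rewrite sub0r normrN ger0_norm ?normc_ge0 // => /(le_trans _); apply.
    by rewrite distrC -fB.
  by split; apply: K => [z|a b]; rewrite ?normc_Re ?normc_Im // ?(cReD, cImD) ?(cReN, cImN).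
- apply: (@squeeze_cvgr _ _ _ _ (cst 0) (fun j => `|Re (u j) - Re l| + `|Im (u j) - Im l|)).
  + near=> j; rewrite normc_ge0 /=; apply: le_trans (normc_leD _) _.
    by rewrite cReD cImD cReN cImN.
  + exact: cvg_cst.
  + rewrite -[X in _ --> X](addr0 0); apply: cvgD.
      by apply/norm_cvg0P/subr_cvg0.
    by apply/norm_cvg0P/subr_cvg0.
Unshelve. all: by end_near. Qed.

Lemma ccvg_unique u l l' : ccvg u l -> ccvg u l' -> l = l'.
Proof.
by move=> [a b] [c d]; apply: ReIm_inj; [exact: cvg_unique a c|exact: cvg_unique b d].
Qed.
Lemma ccvg_cst l : ccvg (fun=> l) l.
Proof. by split; exact: cvg_cst. Qed.
Lemma ccvgD u v l l' : ccvg u l -> ccvg v l' -> ccvg (fun j => u j + v j) (l + l').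
Proof.
move=> [a b] [c d]; split.
  by under eq_fun do rewrite cReD; rewrite cReD; exact: cvgD.
by under eq_fun do rewrite cImD; rewrite cImD; exact: cvgD.
Qed.
Lemma ccvgM u v l l' : ccvg u l -> ccvg v l' -> ccvg (fun j => u j * v j) (l * l').
Proof.
move=> [a b] [c d]; split.
  by under eq_fun do rewrite cReM; rewrite cReM; apply: cvgB; apply: cvgM.
by under eq_fun do rewrite cImM; rewrite cImM; apply: cvgD; apply: cvgM.
Qed.
Lemma ccvg_normc u l : ccvg u l -> (fun j => normc (u j)) @ \oo --> normc l.
Proof.
move/ccvgP => H; apply/cvgrPdist_le => e e0.
move/cvgrPdist_le : H => /(_ e e0); apply: filterS => j.
rewrite sub0r normrN ger0_norm ?normc_ge0 // => /(le_trans _); apply.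
rewrite ler_norml; apply/andP; split.
  rewrite lerBrDl -lerBrDr opprK addrC.
  by have := le_normcD (u j - l) l; rewrite subrK.
rewrite lerBlDr; have := le_normcD (l - u j) (u j); rewrite subrK.
by rewrite -(normcN (l - u j)) opprB.
Qed.
Lemma ccvg_normc_le u l B : ccvg u l -> (forall j, normc (u j) <= B) -> normc l <= B.
Proof.
move=> /ccvg_normc H uB; rewrite -(cvg_lim _ H) //; apply: limr_le.
  by apply/cvg_ex; exists (normc l).
by near=> j; apply: uB.
Unshelve. all: by end_near. Qed.

End complex_numbers.

(** * Integrals of complex functions *)

Section measurability.
Context {R : realType} d (T : measurableType d).
Local Notation C := R[i].
Implicit Types (f g : T -> C) (h : T -> R).

Lemma cmeas_cst (c : C) : cmeasurable (fun=> c : C) (T := T).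
Proof. by split; exact: measurable_cst. Qed.
Lemma cmeasD f g : cmeasurable f -> cmeasurable g -> cmeasurable (fun x => f x + g x).
Proof.
move=> [a b] [a' b']; split.
  by under eq_fun do rewrite cReD; exact: measurable_funD.
by under eq_fun do rewrite cImD; exact: measurable_funD.
Qed.
Lemma cmeasM f g : cmeasurable f -> cmeasurable g -> cmeasurable (fun x => f x * g x).
Proof.
move=> [a b] [a' b']; split.
  by under eq_fun do rewrite cReM; apply: measurable_funB; exact: measurable_funM.
by under eq_fun do rewrite cImM; apply: measurable_funD; exact: measurable_funM.
Qed.
Lemma cmeasJ f : cmeasurable f -> cmeasurable (fun x => (f x)^*%C).
Proof.
move=> [a b]; split; first by under eq_fun do rewrite cReJ.
by under eq_fun do rewrite cImJ; exact: measurableT_comp b.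
Qed.
Lemma cmeasR h : measurable_fun setT h -> cmeasurable (fun x => (h x)%:C).
Proof. by move=> mh; split=> //; exact: measurable_cst. Qed.
Lemma cmeas_sum (I : Type) (r : seq I) (P : pred I) (F : I -> T -> C) :
  (forall i, cmeasurable (F i)) ->
  cmeasurable (fun x => \sum_(i <- r | P i) F i x).
Proof.
move=> mF; elim: r => [|i r IH].
  by under eq_fun do rewrite big_nil; exact: cmeas_cst.
under eq_fun do rewrite big_cons; case: (P i) => //.
exact: cmeasD.
Qed.
Lemma cmeas_normc f : cmeasurable f -> measurable_fun setT (fun x => normc (f x)).
Proof.
move=> [a b].
have -> : (fun x => normc (f x)) = (fun x => Num.sqrt (Re (f x) ^+ 2 + Im (f x) ^+ 2)).
  by apply/funext => x; case: (f x).
apply: (measurableT_comp (continuous_measurable_fun (@sqrt_continuous R))).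
by apply: measurable_funD; exact: measurable_funX.
Qed.
Lemma cmeas_cis h : measurable_fun setT h -> cmeasurable (fun x => cis (h x)).
Proof.
move=> mh; split; under eq_fun do rewrite cisE.
  exact: (measurableT_comp (continuous_measurable_fun (@continuous_cos R)) mh).
exact: (measurableT_comp (continuous_measurable_fun (@continuous_sin R)) mh).
Qed.
Lemma cmeas_cvg (F : nat -> T -> C) f : (forall j, cmeasurable (F j)) ->
  (forall x, ccvg (F ^~ x) (f x)) -> cmeasurable f.
Proof.
move=> mF Ff; split.
  by apply: (measurable_fun_cvg (h := fun j x => Re (F j x))) => [j|x _]; [case: (mF j)|case: (Ff x)].
by apply: (measurable_fun_cvg (h := fun j x => Im (F j x))) => [j|x _]; [case: (mF j)|case: (Ff x)].
Qed.
End measurability.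

Lemma cmeas_comp (R : realType) d d' (T : measurableType d) (T' : measurableType d')
   (f : T' -> R[i]) (g : T -> T') :
  cmeasurable f -> measurable_fun setT g -> cmeasurable (fun x => f (g x)).
Proof. by move=> [a b] mg; split; [exact: measurableT_comp a mg|exact: measurableT_comp b mg]. Qed.

Section integration.
Context {R : realType} d (T : measurableType d) (mu : {measure set T -> \bar R}).
Local Notation C := R[i].
Local Notation rint f := (mu.-integrable setT (EFin \o f)).
Local Notation cint := (cintegrable mu).
Implicit Types (f g : T -> C) (h k : T -> R).

Lemma rint_meas h : rint h -> measurable_fun setT h.
Proof. by move=> /integrableP[/measurable_EFinP]. Qed.
Lemma rint_dom h k : measurable_fun setT h -> rint k ->
  (forall x, `|h x| <= k x) -> rint h.
Proof.
move=> mh ik hk; apply: (le_integrable measurableT _ _ ik).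
  exact/measurable_EFinP.
by move=> x _ /=; rewrite lee_fin (le_trans (hk x)) // ler_norm.
Qed.
Lemma rintD h k : rint h -> rint k -> rint (fun x => h x + k x).
Proof. by move=> ih ik; exact: (integrableD measurableT ih ik). Qed.
Lemma rintB h k : rint h -> rint k -> rint (fun x => h x - k x).
Proof. by move=> ih ik; exact: (integrableB measurableT ih ik). Qed.
Lemma rintZ (c : R) h : rint h -> rint (fun x => c * h x).
Proof. by move=> ih; exact: (integrableZl measurableT c ih). Qed.

Lemma cint_meas f : cint f -> cmeasurable f.
Proof. by move=> [/rint_meas ? /rint_meas ?]. Qed.
Lemma cint_dom f k : cmeasurable f -> rint k -> (forall x, normc (f x) <= k x) -> cint f.
Proof.
move=> [a b] ik fk; split; apply: (rint_dom _ ik) => // x.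
  exact: le_trans (normc_Re _) (fk x).
exact: le_trans (normc_Im _) (fk x).
Qed.
Lemma cint_normc f : cint f -> rint (fun x => normc (f x)).
Proof.
move=> If; have [a b] := If.
apply: (rint_dom (k := fun x => `|Re (f x)| + `|Im (f x)|)).
- exact/cmeas_normc/cint_meas.
- by apply: rintD; exact: integrable_norm.
- by move=> x; rewrite ger0_norm ?normc_ge0 // normc_leD.
Qed.
Lemma cintP f : cint f <-> cmeasurable f /\ rint (fun x => normc (f x)).
Proof.
split=> [H|[mf H]]; first by split; [exact: cint_meas|exact: cint_normc].
exact: cint_dom mf H _.
Qed.
Lemma cintD f g : cint f -> cint g -> cint (fun x => f x + g x).
Proof.
move=> /cintP[mf If] /cintP[mg Ig]; apply: (cint_dom _ (rintD If Ig)) => [|x].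
  exact: cmeasD.
exact: le_normcD.
Qed.
Lemma cintZ (c : C) f : cint f -> cint (fun x => c * f x).
Proof.
move=> /cintP[mf If]; apply: (cint_dom _ (rintZ (normc c) If)) => [|x].
  by apply: cmeasM => //; exact: cmeas_cst.
by rewrite normcM.
Qed.
Lemma cintJ f : cint f -> cint (fun x => (f x)^*%C).
Proof.
move=> /cintP[mf If]; apply: (cint_dom _ If) => [|x]; first exact: cmeasJ.
by rewrite normc_conj.
Qed.
Lemma cint0 : cint (fun=> 0).
Proof. by split; exact: integrable0. Qed.
Lemma cint_sum (I : Type) (r : seq I) (P : pred I) (F : I -> T -> C) :
  (forall i, cint (F i)) -> cint (fun x => \sum_(i <- r | P i) F i x).
Proof.
move=> mF; elim: r => [|i r IH]; first by under eq_fun do rewrite big_nil; exact: cint0.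
by under eq_fun do rewrite big_cons; case: (P i) => //; exact: cintD.
Qed.

Lemma eq_cintegral f g : f =1 g -> cintegral mu f = cintegral mu g.
Proof. by move=> /funext ->. Qed.
Lemma cintegralD f g : cint f -> cint g ->
  cintegral mu (fun x => f x + g x) = cintegral mu f + cintegral mu g.
Proof.
move=> [a b] [a' b']; apply: ReIm_inj; rewrite ?cReD ?cImD /cintegral /= -RintegralD //;
  by apply: eq_Rintegral => x _; rewrite ?cReD ?cImD.
Qed.
Lemma cintegralZ (c : C) f : cint f ->
  cintegral mu (fun x => c * f x) = c * cintegral mu f.
Proof.
move=> [a b]; apply: ReIm_inj.
  rewrite cReM /cintegral /= -!RintegralZl // -RintegralB //; try exact: rintZ.
  by apply: eq_Rintegral => x _; rewrite cReM.
rewrite cImM /cintegral /= -!RintegralZl // -RintegralD //; try exact: rintZ.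
by apply: eq_Rintegral => x _; rewrite cImM.
Qed.
Lemma cintegralZr (c : C) f : cint f ->
  cintegral mu (fun x => f x * c) = cintegral mu f * c.
Proof. by move=> If; rewrite mulrC -cintegralZ //; apply: eq_cintegral => x; rewrite mulrC. Qed.
Lemma cintegral0 : cintegral mu (fun=> 0) = 0.
Proof. by apply: ReIm_inj; rewrite /cintegral /= Rintegral_cst // mul0r. Qed.
Lemma cintegral_sum (I : Type) (r : seq I) (P : pred I) (F : I -> T -> C) :
  (forall i, cint (F i)) ->
  cintegral mu (fun x => \sum_(i <- r | P i) F i x) = \sum_(i <- r | P i) cintegral mu (F i).
Proof.
move=> mF; elim: r => [|i r IH].
  by rewrite big_nil; under eq_fun do rewrite big_nil; exact: cintegral0.
under eq_fun do rewrite big_cons; rewrite big_cons; case: (P i) => //.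
by rewrite cintegralD ?IH //; exact: cint_sum.
Qed.
Lemma cintegralJ f : cint f -> cintegral mu (fun x => (f x)^*%C) = (cintegral mu f)^*%C.
Proof.
move=> [a b]; apply: ReIm_inj; rewrite /cintegral /=.
  by apply: eq_Rintegral => x _; rewrite cReJ.
rewrite -mulN1r -RintegralZl //.
by apply: eq_Rintegral => x _; rewrite cImJ mulN1r.
Qed.
(** The constant 2 is not optimal; it is what separate bounds of the real and
    imaginary parts give. *)
Lemma normc_cintegral f k : cmeasurable f -> rint k ->
  (forall x, normc (f x) <= k x) -> normc (cintegral mu f) <= 2 * \int[mu]_x k x.
Proof.
move=> mf ik fk; have [a b] := cint_dom mf ik fk.
apply: le_trans (normc_leD _) _; rewrite mulr2n mulrDl mul1r /cintegral /=.
apply: lerD; apply: (le_trans (le_normr_Rintegral _ _)) => //;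
  apply: le_Rintegral => //; try exact: integrable_norm; move=> x _.
  exact: le_trans (normc_Re _) (fk x).
exact: le_trans (normc_Im _) (fk x).
Qed.
Lemma rint_dct (F : nat -> T -> R) h k : (forall j, measurable_fun setT (F j)) ->
  (forall x, F ^~ x @ \oo --> h x) -> rint k -> (forall j x, `|F j x| <= k x) ->
  rint h /\ (fun j => \int[mu]_x F j x) @ \oo --> \int[mu]_x h x.
Proof.
move=> mF Ff ik Fk.
have mh : measurable_fun setT h.
  by apply: (measurable_fun_cvg (h := F)) => // x _; exact: Ff.
have Fkj j : rint (F j) by apply: (rint_dom _ ik).
have [|||||Ih _ K] := @dominated_convergence _ _ _ mu setT measurableT
   (fun j => EFin \o F j) (EFin \o h) (EFin \o k).
- by move=> j; exact/measurable_EFinP.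
- exact/measurable_EFinP.
- by apply: aeW => x _ /=; apply: cvg_EFin; [exact: nearW|exact: Ff].
- exact: ik.
- by apply: aeW => x j _ /=; rewrite lee_fin.
split=> //; rewrite /Rintegral.
apply: fine_cvg; rewrite fineK //; exact: integrable_fin_num.
Qed.
Lemma cintegral_dct (F : nat -> T -> C) f k : (forall j, cmeasurable (F j)) ->
  (forall x, ccvg (F ^~ x) (f x)) -> rint k -> (forall j x, normc (F j x) <= k x) ->
  cint f /\ ccvg (fun j => cintegral mu (F j)) (cintegral mu f).
Proof.
move=> mF Ff ik Fk.
have [||||a b] := @rint_dct (fun j x => Re (F j x)) (fun x => Re (f x)) k.
- by move=> j; case: (mF j).
- by move=> x; case: (Ff x).
- exact: ik.
- by move=> j x; exact: le_trans (normc_Re _) (Fk j x).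
have [||||a' b'] := @rint_dct (fun j x => Im (F j x)) (fun x => Im (f x)) k.
- by move=> j; case: (mF j).
- by move=> x; case: (Ff x).
- exact: ik.
- by move=> j x; exact: le_trans (normc_Im _) (Fk j x).
by split; split.
Qed.
End integration.

(** * Lebesgue measure on row vectors *)

Section rV_topology.
Context {R : realType} {d : nat}.

(** The sigma-algebra is generated by the coordinates, so that it has to be seen
    that an open set is a countable union of rational boxes. *)
Lemma open_measurable_rV (U : set 'rV[R]_d) : open U -> measurable U.
Proof.
move=> oU.
pose B (p : 'rV[rat]_d * nat) : set 'rV[R]_d :=
  [set y | forall i, `|ratr (p.1 ord0 i) - y ord0 i| < p.2.+1%:R^-1].
have mB p : measurable (B p).
  rewrite (_ : B p = \big[setI/setT]_(i < d)
     ((fun v : 'rV[R]_d => v ord0 i) @^-1` ball (ratr (p.1 ord0 i) : R) p.2.+1%:R^-1)).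
    apply: bigsetI_measurable => i _; rewrite -[X in measurable X]setTI.
    by apply: measurable_coord => //; exact: measurable_ball.
  rewrite -bigcap_seq; apply/seteqP; split=> v /=.
    by move=> H i _; exact: H.
  by move=> H i; exact: (H i (mem_index_enum i)).
pose F p := if pselect (B p `<=` U) is left _ then B p else set0.
have -> : U = \bigcup_p F p; last first.
  apply: countable_bigcupT_measurable => // p; rewrite /F; by case: pselect.
apply/seteqP; split; last first.
  by move=> x [p _]; rewrite /F; case: pselect => // H; exact: H.
move=> x Ux; have /nbhs_ballP[e /= e0 eU] := open_nbhs_nbhs (conj oU Ux).
have [N eN] : exists N : nat, N.+1%:R^-1 + N.+1%:R^-1 <= e.
  have /ltr_add_invr[N] : (0 : R) < e / 2 by rewrite divr_gt0.
  by rewrite add0r => H; exists N; rewrite [e]splitr lerD // ltW.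
have N0 : (0 : R) < N.+1%:R^-1 by rewrite invr_gt0.
have /choice[q qP] : forall i, exists q : rat, `|ratr q - x ord0 i| < N.+1%:R^-1.
  move=> i; have /rat_in_itvoo[q] : x ord0 i - N.+1%:R^-1 < x ord0 i + N.+1%:R^-1.
    by rewrite ltrBlDr -addrA ltrDl addr_gt0.
  by rewrite in_itv /= => /andP[a b]; exists q; rewrite ltr_distl a b.
exists (\row_i q i, N) => //; rewrite /F; case: pselect => [H|]; first by
  move=> i; rewrite /= mxE.
case=> y By; apply: eU; split=> // i j; rewrite ord1 /ball /=.
apply: lt_le_trans eN; have := By j; rewrite /= mxE => K.
have -> : x ord0 j - y ord0 j = (x ord0 j - ratr (q j)) + (ratr (q j) - y ord0 j) by ring.
by apply: le_lt_trans (ler_normD _ _) _; rewrite ltrD // distrC.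
Qed.

Lemma continuous_measurable_rV (f : 'rV[R]_d -> R) :
  continuous f -> measurable_fun setT f.
Proof.
move=> cf; apply: (measurability _ (RGenOpens.measurableE R)) => //.
move=> _ [_ [a [b ->]] <-]; rewrite setTI; apply: open_measurable_rV.
by apply: open_comp => //; exact: interval_open.
Qed.
End rV_topology.

Section pushforward.
Context d1 d2 (X : measurableType d1) (Y : measurableType d2) (R : realType).
Variables (phi : X -> Y) (psi : Y -> X).
Hypotheses (mphi : measurable_fun setT phi) (mpsi : measurable_fun setT psi).
Hypothesis phiK : cancel phi psi.

(** The image as a bundled measure, to which uniqueness of the invariant measure can
    be applied. *)
Lemma sigma_finite_pushforward (mu : {sigma_finite_measure set X -> \bar R}) :
  exists nu : {sigma_finite_measure set Y -> \bar R}, forall A, nu A = mu (phi @^-1` A).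
Proof.
pose nu0' : {measure set Y -> \bar R} := pushforward mu phi.
pose nu0 := nu0' mphi.
have sf : sigma_finite setT nu0.
  have /sigma_finiteP[F [TF ndF Foo]] := sigma_finiteT mu.
  exists (fun i => psi @^-1` F i).
    by rewrite -preimage_bigcup -TF preimage_setT.
  move=> i; have [mF Fi] := Foo i; split.
    by rewrite -[X in measurable X]setTI; exact: mpsi.
  rewrite /nu0 /= /pushforward -comp_preimage (_ : psi \o phi = id) ?preimage_id //.
  by apply/funext => x /=; rewrite phiK.
pose nu : {sigma_finite_measure set Y -> \bar R} :=
  HB.pack (Measure.sort nu0) (Measure_isSigmaFinite.Build _ _ _ nu0 sf).
by exists nu.
Qed.
End pushforward.

Section pushforward_integral.
Context d1 d2 (X : measurableType d1) (Y : measurableType d2) (R : realType).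
Variables (mu : {measure set X -> \bar R}) (nu : {measure set Y -> \bar R}).
Variables (phi : X -> Y) (mphi : measurable_fun setT phi) (k : R) (k0 : 0 <= k).
Hypothesis nuE : forall A, measurable A -> mu (phi @^-1` A) = (k%:E * nu A)%E.

Lemma ge0_integral_change (f : Y -> \bar R) : measurable_fun setT f ->
  (forall y, (0 <= f y)%E) -> (\int[mu]_x f (phi x) = k%:E * \int[nu]_y f y)%E.
Proof.
move=> mf f0.
transitivity (\int[pushforward mu phi]_y f y)%E.
  by rewrite ge0_integral_pushforward //; rewrite preimage_setT.
transitivity (\int[mscale (NngNum k0) nu]_y f y)%E.
  by apply: eq_measure_integral => A mA _; first [exact/esym/nuE | exact: nuE].
by rewrite ge0_integral_mscale.
Qed.

Lemma rint_change (f : Y -> R) : nu.-integrable setT (EFin \o f) ->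
  mu.-integrable setT (EFin \o (fun x => f (phi x))).
Proof.
move=> If; have mf := rint_meas If; apply/integrableP; split.
  exact/measurable_EFinP/measurableT_comp.
rewrite (ge0_integral_change (f := fun y => `|(f y)%:E|%E)) //; last first.
  by apply: measurableT_comp => //; exact/measurable_EFinP.
by rewrite lte_mul_pinfty //; case/integrableP : If.
Qed.

Lemma Rintegral_change (f : Y -> R) : nu.-integrable setT (EFin \o f) ->
  \int[mu]_x f (phi x) = k * \int[nu]_y f y.
Proof.
move=> If; have mf := rint_meas If.
have H (g : Y -> R) : nu.-integrable setT (EFin \o g) -> (forall y, 0 <= g y) ->
    \int[mu]_x g (phi x) = k * \int[nu]_y g y.
  move=> Ig g0; rewrite /Rintegral.
  rewrite (ge0_integral_change (f := fun y => (g y)%:E)) ?fineM //.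
  - exact: integrable_fin_num.
  - exact/measurable_EFinP/(rint_meas Ig).
have [Ip In] := (integrable_funrpos measurableT If, integrable_funrneg measurableT If).
have fE : f = fun y => f^\+ y - f^\- y.
  by apply/funext => y; exact/esym/(congr1 (@^~ y) (funrposBneg f)).
rewrite fE RintegralB //; try exact: rint_change.
rewrite (RintegralB measurableT Ip In) mulrBr.
by rewrite (H _ Ip) ?(H _ In).
Qed.

Lemma cint_change (f : Y -> R[i]) : cintegrable nu f -> cintegrable mu (fun x => f (phi x)).
Proof.
by move=> [a b]; split; [exact: rint_change a|exact: rint_change b].
Qed.

Lemma cintegral_change (f : Y -> R[i]) : cintegrable nu f ->
  cintegral mu (fun x => f (phi x)) = k%:C * cintegral nu f.
Proof.
move=> [a b]; apply: ReIm_inj; rewrite ?cReM ?cImM /cintegral /= mul0r ?subr0 ?addr0.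
  exact: (Rintegral_change a).
exact: (Rintegral_change b).
Qed.
End pushforward_integral.

Section product_sigma_finite.
Local Open Scope ereal_scope.
Context d1 d2 (T1 : measurableType d1) (T2 : measurableType d2) (R : realType).
Variables (m1 : {sigma_finite_measure set T1 -> \bar R}).
Variables (m2 : {sigma_finite_measure set T2 -> \bar R}).

Lemma sigma_finite_product :
  exists nu : {sigma_finite_measure set (T1 * T2)%type -> \bar R}, forall A, nu A = (m1 \x m2) A.
Proof.
pose nu0 : {measure set (T1 * T2)%type -> \bar R} := m1 \x m2.
suff sf : sigma_finite setT nu0.
  pose nu : {sigma_finite_measure set (T1 * T2)%type -> \bar R} :=
    HB.pack (Measure.sort nu0) (Measure_isSigmaFinite.Build _ _ _ nu0 sf).
  by exists nu.
have /sigma_finiteP[F [TF ndF Foo]] := sigma_finiteT m1.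
have /sigma_finiteP[G [TG ndG Goo]] := sigma_finiteT m2.
exists (fun n => F n `*` G n) => [|k]; last first.
  have [? ?] := Foo k; have [? ?] := Goo k; split; first exact: measurableX.
  by rewrite /nu0 /= product_measure1E // lte_mul_pinfty // ge0_fin_numE.
apply/esym/seteqP; split=> // -[x y] _.
have [n _ Fx] : (\bigcup_i F i) x by rewrite -TF.
have [k _ Gy] : (\bigcup_i G i) y by rewrite -TG.
exists (maxn n k) => //; split.
  by move: x Fx; exact/subsetPset/ndF/leq_maxl.
by move: y Gy; exact/subsetPset/ndG/leq_maxr.
Qed.

End product_sigma_finite.

Section translation.
Context {R : realType}.
Local Open Scope ereal_scope.

Lemma lebesgue_measure_shift (a : R) (A : set (measurableTypeR R)) : measurable A ->
  lebesgue_measure ((fun x : R => x + a)%R @^-1` A) = lebesgue_measure A :> \bar R.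
Proof.
move=> mA; pose sh (b : R) : measurableTypeR R -> measurableTypeR R := fun x => ((x : R) + b)%R.
have msh b : measurable_fun setT (sh b).
  by apply: measurable_funD => //; exact: measurable_cst.
have K : cancel (sh a) (sh (- a)%R) by move=> x; rewrite /sh addrK.
have [nu nuE] := sigma_finite_pushforward (msh a) (msh (- a)%R) K (@lebesgue_measure R).
rewrite -[LHS](nuE A); apply/esym/(@lebesgue_measure_unique R nu) => // _ [[b c] _ <-].
transitivity (lebesgue_measure (sh a @^-1` `]b, c]%classic)); last exact/esym/nuE.
have -> : sh a @^-1` `]b, c]%classic = `](b - a)%R, (c - a)%R]%classic.
  by apply/seteqP; split=> x /=; rewrite !in_itv /= ltrBlDr lerBrDr.
rewrite !lebesgue_measure_itv /= !lte_fin ltrD2r; case: ifP => // _.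
by rewrite -!EFinB; congr EFin; ring.
Qed.

Lemma measurable_shift k (a : 'rV[R]_k) :
  measurable_fun setT (fun x : 'rV[R]_k => x + a)%R.
Proof.
apply/measurable_fun_rVP => i; under eq_fun do rewrite mxE.
by apply: measurable_funD; [exact: measurable_coord|exact: measurable_cst].
Qed.

Lemma product_shift d1 d2 (T1 : measurableType d1) (T2 : measurableType d2)
  (m1 : {sigma_finite_measure set T1 -> \bar R})
  (m2 : {sigma_finite_measure set T2 -> \bar R}) (f : T1 -> T1) (f' : T1 -> T1)
  (g : T2 -> T2) (g' : T2 -> T2) :
  measurable_fun setT f -> measurable_fun setT f' -> cancel f f' ->
  measurable_fun setT g -> measurable_fun setT g' -> cancel g g' ->
  (forall A, measurable A -> m1 (f @^-1` A) = m1 A) ->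
  (forall A, measurable A -> m2 (g @^-1` A) = m2 A) ->
  forall A, measurable A -> (m1 \x m2) ((fun p => (f p.1, g p.2)) @^-1` A) = (m1 \x m2) A.
Proof.
move=> mf mf' fK mg mg' gK f1 g2 A mA.
have mphi (h1 : T1 -> T1) (h2 : T2 -> T2) : measurable_fun setT h1 ->
    measurable_fun setT h2 -> measurable_fun setT (fun p => (h1 p.1, h2 p.2)).
  move=> mh1 mh2; apply/measurable_fun_pair.
    exact: measurableT_comp mh1 measurable_fst.
  exact: measurableT_comp mh2 measurable_snd.
have K : cancel (fun p => (f p.1, g p.2)) (fun p => (f' p.1, g' p.2)).
  by move=> [x y] /=; rewrite fK gK.
have [pr prE] := sigma_finite_product m1 m2.
have [nu nuE] := sigma_finite_pushforward (mphi _ _ mf mg) (mphi _ _ mf' mg') K pr.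
rewrite -prE -(nuE A); apply/esym/(@product_measure_unique _ _ _ _ _ m1 m2 nu) => // B D mB mD.
etransitivity; [exact: nuE|rewrite prE].
have -> : (fun p : T1 * T2 => (f p.1, g p.2)) @^-1` (B `*` D) = (f @^-1` B) `*` (g @^-1` D) by [].
rewrite product_measure1E; [by congr (_ * _); [exact: f1|exact: g2]| |].
  by rewrite -[X in measurable X]setTI; exact: mf.
by rewrite -[X in measurable X]setTI; exact: mg.
Qed.

Lemma rV_cons0 k (p : measurableTypeR R * 'rV[R]_k) : rV_cons p ord0 ord0 = p.1.
Proof. by have /(congr1 fst) := rV_consK p. Qed.
Lemma rV_consS k (p : measurableTypeR R * 'rV[R]_k) i :
  rV_cons p ord0 (lift ord0 i) = p.2 ord0 i.
Proof.
by have /(congr1 snd)/(congr1 (fun v : 'rV[R]_k => v ord0 i)) := rV_consK p; rewrite mxE.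
Qed.

Lemma leb_shift k (a : 'rV[R]_k) (A : set 'rV[R]_k) : measurable A ->
  leb k ((fun x => x + a)%R @^-1` A) = leb k A.
Proof.
elim: k a A => [|k IH] a A mA.
  by congr (leb 0 _); apply/seteqP; split=> x /=; rewrite (thinmx0 a) addr0.
rewrite /= /rV_lebesgue_step /pushforward.
pose a0 : R := a ord0 ord0; pose a' : 'rV[R]_k := \row_j a ord0 (lift ord0 j).
pose sh (b : R) : measurableTypeR R -> measurableTypeR R := fun x => ((x : R) + b)%R.
pose sv (b : 'rV[R]_k) : 'rV[R]_k -> 'rV[R]_k := fun x => (x + b)%R.
have E : (@rV_cons R k @^-1` ((fun x => x + a)%R @^-1` A)) =
    (fun p => (sh a0 p.1, sv a' p.2)) @^-1` (@rV_cons R k @^-1` A).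
  suff K (p : measurableTypeR R * 'rV[R]_k) :
      (rV_cons p + a = rV_cons (sh a0 p.1, sv a' p.2))%R.
    by apply/seteqP; split=> p; rewrite /preimage /= K.
  apply/rowP => i; rewrite mxE; case: (unliftP ord0 i) => [j|] ->.
    by rewrite !rV_consS /sv /= !mxE.
  by rewrite !rV_cons0.
have msh b : measurable_fun setT (sh b).
  by apply: measurable_funD => //; exact: measurable_cst.
have mA' : measurable (@rV_cons R k @^-1` A).
  by rewrite -[X in measurable X]setTI; exact: measurable_rV_cons.
rewrite E; apply: (@product_shift _ _ _ _ (@lebesgue_measure R) (leb k) (sh a0)
  (sh (- a0)%R) (sv a') (sv (- a')%R)) => //.
- by move=> x; rewrite /sh addrK.
- exact: measurable_shift.
- exact: measurable_shift.
- by move=> x; rewrite /sv addrK.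
- by move=> B mB; exact: lebesgue_measure_shift.
- by move=> B mB; exact: IH.
Qed.

Definition unit_box k : set 'rV[R]_k := [set v | forall i, (0 <= v ord0 i <= 1)%R].

Lemma leb_unit_box k : leb k (@unit_box k) = 1.
Proof.
have E : [set v : 'rV[R]_k | forall i, ((0%R : 'rV[R]_k) ord0 i <= v ord0 i <=
    (const_mx 1%R : 'rV[R]_k) ord0 i)%R] = @unit_box k.
  by apply/seteqP; split=> v H i; have := H i; rewrite !mxE.
by rewrite -E (rV_lebesgue_box (a := 0%R) (b := const_mx 1%R)); [rewrite big1 // => i _; rewrite !mxE subr0|move=> i; rewrite !mxE].
Qed.

Lemma measurable_box k (a b : 'I_k -> R) :
  measurable [set v : 'rV[R]_k | forall i, (a i <= v ord0 i <= b i)%R].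
Proof.
rewrite (_ : mkset _ = \big[setI/setT]_(i < k)
   ((fun v : 'rV[R]_k => v ord0 i) @^-1` `[a i, b i]%classic)).
  apply: bigsetI_measurable => i _; rewrite -[X in measurable X]setTI.
  exact: measurable_coord.
rewrite -bigcap_seq; apply/seteqP; split=> v /=.
  by move=> H i _; rewrite /= in_itv /=; exact: H.
by move=> H i; have := H i (mem_index_enum i); rewrite /= in_itv.
Qed.
Lemma measurable_unit_box k : measurable (@unit_box k).
Proof. exact: (measurable_box (fun=> 0%R) (fun=> 1%R)). Qed.

(** Averaging over translations against a fixed set shows that a translation
    invariant measure is a multiple of Lebesgue measure. *)
Lemma translation_invariant_unique k (mu : {sigma_finite_measure set 'rV[R]_k -> \bar R}) :
  (forall (a : 'rV[R]_k) (A : set 'rV[R]_k), measurable A -> mu ((fun x => x + a)%R @^-1` A) = mu A) ->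
  exists c : \bar R, forall A, measurable A -> mu A = c * leb k A.
Proof.
move=> muT.
pose B := @unit_box k; have lB : leb k B = 1 := leb_unit_box k.
have mB : measurable B := @measurable_unit_box k.
have mopp : measurable_fun setT (fun x : 'rV[R]_k => - x)%R.
  apply/measurable_fun_rVP => i; under eq_fun do rewrite mxE.
  exact: measurableT_comp (measurable_coord i).
have mB2 : measurable ((fun x : 'rV[R]_k => - x)%R @^-1` B).
  by rewrite -[X in measurable X]setTI; exact: mopp.
exists (mu ((fun x : 'rV[R]_k => - x)%R @^-1` B)) => A mA.
have indD (D : set 'rV[R]_k) : measurable D ->
    measurable_fun setT (fun x => (\1_D x)%:E : \bar R).
  by move=> mD; exact/measurable_EFinP/measurable_indic.
pose F p : \bar R := (\1_A p.1 * \1_B (p.2 - p.1))%:E.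
have mF : measurable_fun setT F.
  apply/measurable_EFinP/measurable_funM.
    exact: measurableT_comp (measurable_indic mA) measurable_fst.
  apply: (measurableT_comp (measurable_indic mB)).
  apply/measurable_fun_rVP => i; under eq_fun do rewrite !mxE.
  apply: measurable_funB.
    exact: measurableT_comp (measurable_coord i) measurable_snd.
  exact: measurableT_comp (measurable_coord i) measurable_fst.
have F0 p : 0 <= F p by rewrite lee_fin mulr_ge0.
have shiftI (m : {sigma_finite_measure set 'rV[R]_k -> \bar R})
    (mT : forall (a : 'rV[R]_k) (A : set 'rV[R]_k), measurable A -> m ((fun x => x + a)%R @^-1` A) = m A)
    (f : 'rV[R]_k -> \bar R) (a : 'rV[R]_k) : measurable_fun setT f ->
    (forall x, 0 <= f x) -> \int[m]_x f x = \int[m]_x f (x + a)%R.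
  move=> mf f0; rewrite (@ge0_integral_change _ _ _ _ R m m (fun x => x + a)%R
    (@measurable_shift k a) 1%R ler01 _ f mf f0) ?mul1e //.
  by move=> D mD; rewrite mul1e; exact: mT.
have intI (m : {measure set 'rV[R]_k -> \bar R}) (D : set 'rV[R]_k) : measurable D ->
    \int[m]_x (\1_D x)%:E = m D.
  by move=> mD; rewrite integral_indic // setIT.
have := @fubini_tonelli _ _ _ _ R mu (leb k) F mF F0.
have -> : \int[mu]_x \int[leb k]_y F (x, y) = mu A.
  transitivity (\int[mu]_x (\1_A x)%:E).
    apply: eq_integral => x _; rewrite /F /=.
    under eq_integral do rewrite EFinM.
    rewrite ge0_integralZl_EFin //; last first.
      by apply: (measurableT_comp (indD _ mB)); exact: measurable_shift.
    rewrite -(@shiftI (leb k) (@leb_shift k) (fun y => (\1_B y)%:E)) //; last exact: indD.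
    by rewrite (etrans (intI (leb k) _ mB) lB) mule1.
  exact: intI.
move=> ->.
transitivity (\int[leb k]_y \int[mu]_x ((\1_A (x + y))%:E * (\1_B (- x))%:E)).
  apply: eq_integral => y _.
  transitivity (\int[mu]_x F ((x + y)%R, y)).
    apply: (@shiftI mu muT (fun x => F (x, y)) y) => [|x]; last exact: F0.
    apply: (measurableT_comp mF); apply/measurable_fun_pair => //.
  apply: eq_integral => x _; rewrite /F /= EFinM; congr (_ * (\1_B _)%:E).
  by rewrite opprD addrCA subrr addr0.
have mG : measurable_fun setT (fun p : 'rV[R]_k * 'rV[R]_k =>
    (\1_A (p.1 + p.2))%:E * (\1_B (- p.1))%:E : \bar R).
  under eq_fun do rewrite -EFinM.
  apply/measurable_EFinP/measurable_funM.
    apply: (measurableT_comp (measurable_indic mA)).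
    apply/measurable_fun_rVP => i; under eq_fun do rewrite !mxE.
    apply: measurable_funD.
      exact: measurableT_comp (measurable_coord i) measurable_fst.
    exact: measurableT_comp (measurable_coord i) measurable_snd.
  apply: (measurableT_comp (measurable_indic mB)).
  exact: measurableT_comp mopp measurable_fst.
rewrite -(@fubini_tonelli _ _ _ _ R mu (leb k) (fun p => (\1_A (p.1 + p.2))%:E * (\1_B (- p.1))%:E) mG) /=; last first.
  by move=> p; rewrite mule_ge0 // lee_fin.
transitivity (\int[mu]_x ((\1_((fun x => - x)%R @^-1` B) x)%:E * leb k A)).
  apply: eq_integral => x _; under eq_integral do rewrite muleC [(x + _)%R]addrC.
  rewrite ge0_integralZl_EFin //; last first.
    exact: (measurableT_comp (indD _ mA) (measurable_shift x)).
  congr (_ * _).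
  rewrite -(@shiftI (leb k) (@leb_shift k) (fun y => (\1_A y)%:E)) //; last exact: indD.
  exact: intI.
rewrite ge0_integralZr //; last exact: indD.
by congr (_ * _); exact: intI.
Qed.
End translation.

Section linear_change.
Context {R : realType}.

Lemma measurable_mulmx k l (M : 'M[R]_(k, l)) :
  measurable_fun setT (fun x : 'rV[R]_k => x *m M).
Proof.
apply/measurable_fun_rVP => i; under eq_fun do rewrite mxE.
apply: measurable_sum => j; apply: measurable_funM; first exact: measurable_coord.
exact: measurable_cst.
Qed.

(** The image of Lebesgue measure is invariant under translations, hence a multiple
    of Lebesgue measure; the unit box and its image show that the factor is
    positive and finite. *)
Lemma leb_linear k (M : 'M[R]_k) : M \in unitmx -> exists2 c : R, 0 < c &
  forall A, measurable A -> leb k ((fun x => x *m M) @^-1` A) = (c%:E * leb k A)%E.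
Proof.
move=> uM; have K := mulmxK uM; have K' := mulmxKV uM.
have [nu nuE] := sigma_finite_pushforward (@measurable_mulmx _ _ M)
  (@measurable_mulmx _ _ (invmx M)) (K _) (leb k).
have [a A mA|c cE] := @translation_invariant_unique R k nu.
  rewrite !nuE -[RHS](leb_shift (a *m invmx M)); last first.
    by rewrite -[X in measurable X]setTI; exact: measurable_mulmx.
  by congr (leb k _); apply/seteqP; split=> x; rewrite /preimage /= mulmxDl K'.
have mB' : measurable ((fun x : 'rV[R]_k => x *m invmx M) @^-1` (@unit_box R k)).
  by rewrite -[X in measurable X]setTI; apply: measurable_mulmx => //; exact: measurable_unit_box.
have := cE _ mB'; rewrite nuE.
have -> : (fun x => x *m M) @^-1` ((fun x => x *m invmx M) @^-1` (@unit_box R k)) = @unit_box R k.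
  by apply/seteqP; split=> x; rewrite /preimage /= K.
rewrite leb_unit_box => c1.
have := cE _ (@measurable_unit_box R k); rewrite leb_unit_box mule1 => cB.
have c0 : (0 <= c)%E by rewrite -cB.
have cfin : c \is a fin_num.
  rewrite ge0_fin_numE //; rewrite ltNge leye_eq; apply/eqP => cy; move: c1; rewrite cy.
  have := measure_ge0 (leb k) ((fun x : 'rV[R]_k => x *m invmx M) @^-1` (@unit_box R k)).
  rewrite le_eqVlt => /orP[/eqP <-|L0]; first by rewrite mule0 => -[] /eqP; rewrite oner_eq0.
  by rewrite gt0_mulye.
exists (fine c).
  rewrite fine_gt0 // lt_neqAle c0 andbT -ge0_fin_numE // cfin andbT.
  by apply/eqP => cz; move: c1; rewrite -cz mul0e => -[] /eqP; rewrite oner_eq0.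
by move=> A mA; rewrite fineK // -cE // nuE.
Qed.
End linear_change.

(** * Product measures and the splitting of row vectors *)

Section split_fubini.
Context {R : realType}.
Local Notation C := R[i].

Lemma measurable_row_mx k l :
  measurable_fun setT (fun p : 'rV[R]_k * 'rV[R]_l => row_mx p.1 p.2).
Proof.
apply/measurable_fun_rVP => i; case: (split_ordP i) => j ->.
  under eq_fun do rewrite row_mxEl.
  exact: measurableT_comp (measurable_coord j) measurable_fst.
under eq_fun do rewrite row_mxEr.
exact: measurableT_comp (measurable_coord j) measurable_snd.
Qed.

Lemma measurable_lsubmx k l : measurable_fun setT (fun v : 'rV[R]_(k + l) => lsubmx v).
Proof. by apply/measurable_fun_rVP => i; under eq_fun do rewrite mxE; exact: measurable_coord. Qed.
Lemma measurable_rsubmx k l : measurable_fun setT (fun v : 'rV[R]_(k + l) => rsubmx v).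
Proof. by apply/measurable_fun_rVP => i; under eq_fun do rewrite mxE; exact: measurable_coord. Qed.

(** Both measures are invariant under translations and agree on the unit box. *)
Lemma leb_row_mx k l (A : set 'rV[R]_(k + l)) : measurable A ->
  (leb k \x leb l)%E ((fun p : 'rV[R]_k * 'rV[R]_l => row_mx p.1 p.2) @^-1` A) = leb (k + l) A.
Proof.
have [pr prE] := sigma_finite_product (@rV_lebesgue R k) (@rV_lebesgue R l).
pose psi (v : 'rV[R]_(k + l)) := (lsubmx v, rsubmx v).
have mpsi : measurable_fun setT psi.
  by apply/measurable_fun_pair; [exact: measurable_lsubmx|exact: measurable_rsubmx].
have K : cancel (fun p : 'rV[R]_k * 'rV[R]_l => row_mx p.1 p.2) psi.
  by move=> [x y]; rewrite /psi row_mxKl row_mxKr.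
have [nu nuE] := sigma_finite_pushforward (@measurable_row_mx k l) mpsi K pr.
have mpre (B : set 'rV[R]_(k + l)) : measurable B ->
    measurable ((fun p : 'rV[R]_k * 'rV[R]_l => row_mx p.1 p.2) @^-1` B).
  by move=> mB; rewrite -[X in measurable X]setTI; exact: measurable_row_mx.
have [a B mB|c cE] := @translation_invariant_unique R (k + l) nu.
  etransitivity; first exact: nuE.
  etransitivity; last exact/esym/nuE.
  etransitivity; first exact: prE.
  etransitivity; last exact/esym/prE.
  have PS := @product_shift R _ _ _ _ (leb k) (leb l)
    (fun x => x + lsubmx a) (fun x => x - lsubmx a)
    (fun x => x + rsubmx a) (fun x => x - rsubmx a)
    (measurable_shift _) (measurable_shift _) (fun x => addrK _ x)
    (measurable_shift _) (measurable_shift _) (fun x => addrK _ x)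
    (@leb_shift R k _) (@leb_shift R l _).
  etransitivity; last exact: (PS _ (mpre _ mB)).
  congr (_ _); apply/seteqP; split=> -[x y]; rewrite /preimage /=;
    by rewrite -add_row_mx hsubmxK.
move=> mA; rewrite -prE; etransitivity; first exact/esym/nuE.
rewrite cE //; suff -> : c = 1%E by rewrite mul1e.
have := cE _ (@measurable_unit_box R (k + l)); rewrite leb_unit_box mule1 => <-.
etransitivity; first exact: nuE.
rewrite prE.
have -> : (fun p : 'rV[R]_k * 'rV[R]_l => row_mx p.1 p.2) @^-1` (@unit_box R (k + l)) =
    @unit_box R k `*` @unit_box R l.
  apply/seteqP; split=> -[x y]; rewrite /preimage /unit_box /=.
    move=> H; split=> i.
      by have := H (lshift l i); rewrite row_mxEl.
    by have := H (rshift k i); rewrite row_mxEr.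
  by move=> [H1 H2] i; case: (split_ordP i) => j ->; rewrite ?row_mxEl ?row_mxEr.
etransitivity; first by apply: product_measure1E; exact: measurable_unit_box.
rewrite -[RHS]mule1; congr (_ * _)%E; exact: leb_unit_box.
Qed.

(** All integrals exchanged below are dominated by a product of two integrable
    functions of one variable each, which makes every slice integrable and not
    only almost every one. *)
Section fubini_dom.
Context d1 d2 (T1 : measurableType d1) (T2 : measurableType d2).
Variables (m1 : {sigma_finite_measure set T1 -> \bar R}).
Variables (m2 : {sigma_finite_measure set T2 -> \bar R}).
Variables (g : T1 -> R) (h : T2 -> R).
Hypotheses (Ig : m1.-integrable setT (EFin \o g)) (Ih : m2.-integrable setT (EFin \o h)).

Lemma rint_prod : (m1 \x m2)%E.-integrable setT (EFin \o (fun p => `|g p.1| * `|h p.2|)).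
Proof.
have mg := rint_meas Ig; have mh := rint_meas Ih.
apply/integrable12ltyP => /=.
  apply/measurable_EFinP/measurable_funM; apply: measurableT_comp => //.
    exact: measurableT_comp mg measurable_fst.
  exact: measurableT_comp mh measurable_snd.
under eq_integral => x _.
  under eq_integral do rewrite ger0_norm ?mulr_ge0 // EFinM.
  rewrite ge0_integralZl_EFin //; last by apply/measurable_EFinP; exact: measurableT_comp.
  over.
rewrite /= ge0_integralZr //; last 2 first.
- by apply/measurable_EFinP; exact: measurableT_comp.
- exact: integral_ge0.
case/integrableP : Ig => _ a; case/integrableP : Ih => _ b.
by rewrite lte_mul_pinfty // ?integral_ge0 // ge0_fin_numE // integral_ge0.
Qed.

Variable f : T1 -> T2 -> C.
Hypothesis mf : cmeasurable (fun p : T1 * T2 => f p.1 p.2).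
Hypothesis fgh : forall x y, normc (f x y) <= `|g x| * `|h y|.

Let If : cintegrable (m1 \x m2)%E (fun p => f p.1 p.2).
Proof. by apply: (cint_dom mf rint_prod) => -[x y]; exact: fgh. Qed.

Lemma fub_meas1 x : cmeasurable (f x).
Proof.
apply: (cmeas_comp (g := fun y => (x, y)) mf).
by apply/measurable_fun_pair => //; exact: measurable_cst.
Qed.
Lemma fub_meas2 y : cmeasurable (fun x => f x y).
Proof.
apply: (cmeas_comp (g := fun x => (x, y)) mf).
by apply/measurable_fun_pair => //; exact: measurable_cst.
Qed.
Lemma fub_int1 x : cintegrable m2 (f x).
Proof.
apply: (cint_dom (fub_meas1 x) _ (fgh x)).
by apply: rintZ; exact: integrable_norm.
Qed.
Lemma fub_int2 y : cintegrable m1 (fun x => f x y).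
Proof.
apply: (cint_dom (fub_meas2 y) _ (fun x => fgh x y)).
under eq_fun do rewrite mulrC.
by apply: rintZ; exact: integrable_norm.
Qed.

Lemma fub_meas_int1 : cmeasurable (fun x => cintegral m2 (f x)).
Proof.
have [a b] := If; split; apply: (measurableT_comp (fine_measurable measurableT)).
  exact: (measurable_fubini_F a).
exact: (measurable_fubini_F b).
Qed.
Lemma fub_meas_int2 : cmeasurable (fun y => cintegral m1 (fun x => f x y)).
Proof.
have [a b] := If; split; apply: (measurableT_comp (fine_measurable measurableT)).
  exact: (measurable_fubini_G a).
exact: (measurable_fubini_G b).
Qed.

Lemma fub_integral1 :
  cintegral m1 (fun x => cintegral m2 (f x)) = cintegral (m1 \x m2)%E (fun p => f p.1 p.2).
Proof.
have [a b] := If.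
apply: ReIm_inj; rewrite /cintegral /= {1}/Rintegral /Rintegral; congr fine.
  rewrite -(integral12_prod_meas1 a); apply: eq_integral => x _.
  by rewrite fineK //; apply: integrable_fin_num => //; case: (fub_int1 x).
rewrite -(integral12_prod_meas1 b); apply: eq_integral => x _.
by rewrite fineK //; apply: integrable_fin_num => //; case: (fub_int1 x).
Qed.
Lemma fub_integral2 :
  cintegral m2 (fun y => cintegral m1 (fun x => f x y)) = cintegral (m1 \x m2)%E (fun p => f p.1 p.2).
Proof.
have [a b] := If.
apply: ReIm_inj; rewrite /cintegral /= {1}/Rintegral /Rintegral; congr fine.
  rewrite -(integral21_prod_meas1 a); apply: eq_integral => x _.
  by rewrite fineK //; apply: integrable_fin_num => //; case: (fub_int2 x).
rewrite -(integral21_prod_meas1 b); apply: eq_integral => x _.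
by rewrite fineK //; apply: integrable_fin_num => //; case: (fub_int2 x).
Qed.
Lemma fub_swap : cintegral m1 (fun x => cintegral m2 (f x)) =
  cintegral m2 (fun y => cintegral m1 (fun x => f x y)).
Proof. by rewrite fub_integral1 fub_integral2. Qed.
End fubini_dom.

Lemma cintegral_shift k (a : 'rV[R]_k) (f : 'rV[R]_k -> C) : cintegrable (leb k) f ->
  cintegral (leb k) (fun x => f (x + a)) = cintegral (leb k) f.
Proof.
move=> If; have H A : measurable A ->
    leb k ((fun x => x + a) @^-1` A) = (1%:E * leb k A)%E by move=> mA; rewrite mul1e; exact: leb_shift.
by rewrite (cintegral_change (measurable_shift a) ler01 H) // rmorph1 mul1r.
Qed.
Lemma rint_shift k (a : 'rV[R]_k) (f : 'rV[R]_k -> R) :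
  (leb k).-integrable setT (EFin \o f) ->
  (leb k).-integrable setT (EFin \o (fun x => f (x + a))) /\
  \int[leb k]_x f (x + a) = \int[leb k]_x f x.
Proof.
move=> If; have H A : measurable A ->
    leb k ((fun x => x + a) @^-1` A) = (1%:E * leb k A)%E by move=> mA; rewrite mul1e; exact: leb_shift.
split; first exact: (rint_change (measurable_shift a) ler01 H).
by rewrite (Rintegral_change (measurable_shift a) ler01 H) // mul1r.
Qed.

Lemma cint_shift k (a : 'rV[R]_k) (f : 'rV[R]_k -> C) : cintegrable (leb k) f ->
  cintegrable (leb k) (fun x => f (x + a)).
Proof. by move=> [Ia Ib]; split; [have [] := rint_shift a Ia|have [] := rint_shift a Ib]. Qed.

Section fubini_rV.
Variables (k l : nat) (g : 'rV[R]_k -> R) (h : 'rV[R]_l -> R) (f : 'rV[R]_(k + l) -> C).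
Hypotheses (Ig : (leb k).-integrable setT (EFin \o g)).
Hypotheses (Ih : (leb l).-integrable setT (EFin \o h)).
Hypothesis mf : cmeasurable f.
Hypothesis fgh : forall x y, normc (f (row_mx x y)) <= `|g x| * `|h y|.

Let mf2 : cmeasurable (fun p : 'rV[R]_k * 'rV[R]_l => f (row_mx p.1 p.2)).
Proof. exact: cmeas_comp mf (@measurable_row_mx k l). Qed.

Let row_mxE (A : set 'rV[R]_(k + l)) : measurable A ->
  (leb k \x leb l)%E ((fun p : 'rV[R]_k * 'rV[R]_l => row_mx p.1 p.2) @^-1` A) =
  (1%:E * leb (k + l) A)%E.
Proof. by move=> mA; rewrite mul1e; exact: leb_row_mx. Qed.

Lemma cint_rV : cintegrable (leb (k + l)) f.
Proof.
pose G (v : 'rV[R]_(k + l)) : R := `|g (lsubmx v)| * `|h (rsubmx v)|.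
apply: (cint_dom mf _ (k := G)); last first.
  by move=> v; rewrite -{1}(hsubmxK v); exact: fgh.
have mgh : measurable_fun setT G.
  have mg := rint_meas Ig; have mh := rint_meas Ih.
  apply: measurable_funM; apply: measurableT_comp => //.
    exact: measurableT_comp mg (@measurable_lsubmx k l).
  exact: measurableT_comp mh (@measurable_rsubmx k l).
apply/integrableP; split; first exact/measurable_EFinP.
have := @ge0_integral_change _ _ _ _ R (leb k \x leb l)%E (leb (k + l)) _
  (@measurable_row_mx k l) 1 ler01 row_mxE
  (fun v => `|(EFin \o G) v|%E).
rewrite mul1e => <- //; last first.
  by apply: measurableT_comp => //; exact/measurable_EFinP.
have /integrableP[_] := rint_prod Ig Ih; congr (_ < _)%E.
by apply: eq_integral => -[x y] _ /=; rewrite /G row_mxKl row_mxKr.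
Qed.

Lemma fubini_rV1 : cintegral (leb (k + l)) f =
  cintegral (leb k) (fun x => cintegral (leb l) (fun y => f (row_mx x y))).
Proof.
rewrite (fub_integral1 Ig Ih (f := fun x y => f (row_mx x y))) //.
have := cintegral_change (@measurable_row_mx k l) ler01 row_mxE cint_rV.
by rewrite rmorph1 mul1r.
Qed.
Lemma fubini_rV2 : cintegral (leb (k + l)) f =
  cintegral (leb l) (fun y => cintegral (leb k) (fun x => f (row_mx x y))).
Proof. by rewrite fubini_rV1 (fub_swap Ig Ih (f := fun x y => f (row_mx x y))). Qed.
End fubini_rV.

End split_fubini.

(** * The Japanese bracket *)

Section japanese_bracket.
Context {R : realType}.
Implicit Types k l N : nat.

Lemma rdotE k (x y : 'rV[R]_k) : rdot x y = \sum_i x ord0 i * y ord0 i.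
Proof. by rewrite /rdot mxE; apply: eq_bigr => i _; rewrite mxE. Qed.
Lemma rdot_ge0 k (x : 'rV[R]_k) : 0 <= rdot x x.
Proof. by rewrite rdotE sumr_ge0 // => i _; rewrite -expr2 sqr_ge0. Qed.
Lemma rdotC k (x y : 'rV[R]_k) : rdot x y = rdot y x.
Proof. by rewrite !rdotE; apply: eq_bigr => i _; rewrite mulrC. Qed.
Lemma rdotDl k (x y z : 'rV[R]_k) : rdot (x + y) z = rdot x z + rdot y z.
Proof. by rewrite /rdot mulmxDl mxE. Qed.
Lemma rdotNl k (x z : 'rV[R]_k) : rdot (- x) z = - rdot x z.
Proof. by rewrite /rdot mulNmx mxE. Qed.
Lemma rdotZl k a (x z : 'rV[R]_k) : rdot (a *: x) z = a * rdot x z.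
Proof. by rewrite /rdot -scalemxAl mxE. Qed.
Lemma rdotDr k (x y z : 'rV[R]_k) : rdot z (x + y) = rdot z x + rdot z y.
Proof. by rewrite ![rdot z _]rdotC rdotDl. Qed.
Lemma rdotNr k (x z : 'rV[R]_k) : rdot z (- x) = - rdot z x.
Proof. by rewrite ![rdot z _]rdotC rdotNl. Qed.
Lemma rdotZr k a (x z : 'rV[R]_k) : rdot z (a *: x) = a * rdot z x.
Proof. by rewrite ![rdot z _]rdotC rdotZl. Qed.
Lemma rdot0l k (x : 'rV[R]_k) : rdot 0 x = 0.
Proof. by rewrite /rdot mul0mx mxE. Qed.
Lemma rdot_row k l (x x' : 'rV[R]_k) (y y' : 'rV[R]_l) :
  rdot (row_mx x y) (row_mx x' y') = rdot x x' + rdot y y'.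
Proof. by rewrite /rdot tr_row_mx mul_row_col mxE. Qed.

Lemma jp_sq k (x : 'rV[R]_k) : japanese x ^+ 2 = 1 + rdot x x.
Proof. by rewrite sqr_sqrtr // addr_ge0 // rdot_ge0. Qed.
Lemma jp_ge1 k (x : 'rV[R]_k) : 1 <= japanese x.
Proof. by rewrite -{1}(@sqrtr1 R) ler_wsqrtr // lerDl rdot_ge0. Qed.
Lemma jp_gt0 k (x : 'rV[R]_k) : 0 < japanese x.
Proof. exact: lt_le_trans ltr01 (jp_ge1 x). Qed.
Lemma jp_ge0 k (x : 'rV[R]_k) : 0 <= japanese x.
Proof. exact/ltW/jp_gt0. Qed.
Hint Resolve jp_ge1 jp_gt0 jp_ge0 : core.
Lemma jpX_ge1 k (x : 'rV[R]_k) N : 1 <= japanese x ^+ N.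
Proof. exact: exprn_ege1. Qed.
Lemma jpX_gt0 k (x : 'rV[R]_k) N : 0 < japanese x ^+ N.
Proof. exact: exprn_gt0. Qed.
Lemma le_jp k l (x : 'rV[R]_k) (y : 'rV[R]_l) (c : R) : 0 <= c ->
  1 + rdot x x <= c ^+ 2 * (1 + rdot y y) -> japanese x <= c * japanese y.
Proof.
by move=> c0 H; rewrite -ler_sqr ?nnegrE ?mulr_ge0 // exprMn !jp_sq.
Qed.
Lemma jpN k (x : 'rV[R]_k) : japanese (- x) = japanese x.
Proof. by rewrite /japanese rdotNl rdotNr opprK. Qed.
Lemma jp_coord k (x : 'rV[R]_k) i : `|x ord0 i| <= japanese x.
Proof.
rewrite -ler_sqr ?nnegrE // jp_sq real_normK ?num_real // rdotE (bigD1 i) //=.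
rewrite -expr2 addrCA lerDl addr_ge0 // sumr_ge0 // => j _.
by rewrite -expr2 sqr_ge0.
Qed.
Lemma jp_le_sum k (x : 'rV[R]_k) : japanese x <= 1 + \sum_i `|x ord0 i|.
Proof.
have S0 : 0 <= \sum_i `|x ord0 i| by apply: sumr_ge0.
rewrite -ler_sqr ?nnegrE ?addr_ge0 // jp_sq sqrrD expr1n mul1r -addrA lerD2l.
apply: le_trans (_ : (\sum_i `|x ord0 i|) ^+ 2 <= _); last by rewrite lerDr mulrn_wge0.
rewrite rdotE expr2 mulr_suml; apply: ler_sum => i _.
rewrite -expr2 -real_normK ?num_real // expr2 ler_wpM2l // (bigD1 i) //= lerDl.
by apply: sumr_ge0.
Qed.
(** A crude form of Peetre's inequality. *)
Lemma jpD k (x y : 'rV[R]_k) : japanese (x + y) <= 2 * (japanese x * japanese y).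
Proof.
have H : rdot (x + y) (x + y) <= 2 * (rdot x x + rdot y y).
  have := rdot_ge0 (x - y); rewrite !rdotDl !rdotDr !rdotNl !rdotNr (rdotC y x).
  by lra.
have := rdot_ge0 x; have := rdot_ge0 y => y0 x0.
rewrite -ler_sqr ?nnegrE ?mulr_ge0 // !exprMn !jp_sq.
by have := mulr_ge0 x0 y0; lra.
Qed.
Lemma jp_sub k (x y : 'rV[R]_k) : japanese x <= 2 * (japanese (x - y) * japanese y).
Proof. by have := jpD (x - y) y; rewrite subrK. Qed.
Lemma jp_rowl k l (x : 'rV[R]_k) (y : 'rV[R]_l) : japanese x <= japanese (row_mx x y).
Proof.
have := @le_jp _ _ x (row_mx x y) 1 ler01; rewrite expr1n !mul1r; apply.
by rewrite rdot_row addrA lerDl rdot_ge0.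
Qed.
Lemma jp_rowr k l (x : 'rV[R]_k) (y : 'rV[R]_l) : japanese y <= japanese (row_mx x y).
Proof.
have := @le_jp _ _ y (row_mx x y) 1 ler01; rewrite expr1n !mul1r; apply.
by rewrite rdot_row addrCA lerDr rdot_ge0.
Qed.
Lemma jp_row k l (x : 'rV[R]_k) (y : 'rV[R]_l) :
  japanese (row_mx x y) <= japanese x * japanese y.
Proof.
rewrite -ler_sqr ?nnegrE ?mulr_ge0 // exprMn !jp_sq rdot_row mulrDl mul1r mulrDr mulr1.
by have := mulr_ge0 (rdot_ge0 x) (rdot_ge0 y); lra.
Qed.
Lemma jp_mulmx k l (M : 'M[R]_(k, l)) : exists2 K : R, 1 <= K &
  forall x : 'rV[R]_k, japanese (x *m M) <= K * japanese x.
Proof.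
exists (1 + \sum_j \sum_i `|M i j|); first by rewrite lerDl !sumr_ge0 // => i _; rewrite sumr_ge0.
move=> x; apply: le_trans (jp_le_sum _) _; rewrite mulrDl mul1r; apply: lerD => //.
rewrite mulr_suml; apply: ler_sum => j _; rewrite mxE mulr_suml.
apply: le_trans (ler_norm_sum _ _ _) _; apply: ler_sum => i _.
by rewrite normrM mulrC ler_wpM2l // jp_coord.
Qed.

Lemma continuous_sum_rV k (I : Type) (r : seq I) (F : I -> 'rV[R]_k -> R) :
  (forall i, continuous (F i)) -> continuous (fun x => \sum_(i <- r) F i x).
Proof.
move=> cF; elim: r => [|i r IH].
  have -> : (fun x => \sum_(i <- [::]) F i x) = cst 0 by apply/funext => x; rewrite big_nil.
  exact: cst_continuous.
have -> : (fun x => \sum_(j <- i :: r) F j x) = (F i \+ (fun x => \sum_(j <- r) F j x)).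
  by apply/funext => x; rewrite big_cons.
by move=> x; apply: continuousD; [exact: cF|exact: IH].
Qed.
Lemma continuous_rdot k : continuous (fun x : 'rV[R]_k => rdot x x).
Proof.
have -> : (fun x : 'rV[R]_k => rdot x x) = (fun x => \sum_i x ord0 i * x ord0 i).
  by apply/funext => x; rewrite rdotE.
apply: continuous_sum_rV => i x.
by apply: continuousM; exact: coord_continuous.
Qed.
Lemma continuous_jp k : continuous (@japanese R k).
Proof.
move=> x; have c1 : {for x, continuous (fun x : 'rV[R]_k => 1 + rdot x x)}.
  by apply: continuousD; [exact: cst_continuous|exact: continuous_rdot].
exact: (continuous_comp c1 (@sqrt_continuous R _)).
Qed.
Lemma measurable_jp k : measurable_fun setT (@japanese R k).
Proof. exact: continuous_measurable_rV (@continuous_jp k). Qed.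

Definition wt k N (x : 'rV[R]_k) : R := (japanese x ^+ N)^-1.
Lemma wt_gt0 k N (x : 'rV[R]_k) : 0 < wt N x.
Proof. by rewrite invr_gt0 jpX_gt0. Qed.
Lemma wt_ge0 k N (x : 'rV[R]_k) : 0 <= wt N x.
Proof. exact/ltW/wt_gt0. Qed.
Hint Resolve wt_ge0 wt_gt0 : core.
Lemma wtD k N N' (x : 'rV[R]_k) : wt (N + N') x = wt N x * wt N' x.
Proof. by rewrite /wt exprD invfM. Qed.
Lemma wtK k N (x : 'rV[R]_k) : japanese x ^+ N * wt N x = 1.
Proof. by rewrite divff // gt_eqF // jpX_gt0. Qed.
Lemma wt_le1 k N (x : 'rV[R]_k) : wt N x <= 1.
Proof. by rewrite invf_le1 ?jpX_gt0 // jpX_ge1. Qed.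
Lemma wt_le k N N' (x : 'rV[R]_k) : (N <= N')%N -> wt N' x <= wt N x.
Proof. by move=> /subnKC <-; rewrite wtD ler_piMr ?wt_ge0 // wt_le1. Qed.
Lemma le_wt k N (x : 'rV[R]_k) (r B : R) : japanese x ^+ N * r <= B <-> r <= B * wt N x.
Proof. by rewrite /wt ler_pdivlMr ?jpX_gt0 // mulrC. Qed.
Lemma wtN k N (x : 'rV[R]_k) : wt N (- x) = wt N x.
Proof. by rewrite /wt jpN. Qed.
Lemma measurable_wt k N : measurable_fun setT (@wt k N).
Proof.
have c1 : continuous (fun x : 'rV[R]_k => japanese x ^+ N).
  move=> x; have c1 : {for x, continuous (@japanese R k)} by exact: continuous_jp.
  exact: (continuous_comp c1 (@exprn_continuous R N _)).
have c2 : continuous (fun x : 'rV[R]_k => (japanese x ^+ N)^-1).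
  move=> x; have n0 : japanese x ^+ N != 0 by rewrite gt_eqF // jpX_gt0.
  exact: (@continuousV _ _ (fun x : 'rV[R]_k => japanese x ^+ N) x n0 (c1 x)).
exact: continuous_measurable_rV c2.
Qed.
Lemma wt_row k l N N' (x : 'rV[R]_k) (y : 'rV[R]_l) :
  wt (N + N') (row_mx x y) <= wt N x * wt N' y.
Proof.
rewrite wtD; apply: ler_pM; rewrite ?wt_ge0 // lef_pV2 ?posrE ?jpX_gt0 //;
  apply: lerXn2r; rewrite ?nnegrE // ?jp_rowl ?jp_rowr //.
Qed.
(** Peetre's inequality for the weights. *)
Lemma wt_sub k N (x y : 'rV[R]_k) : wt N (x - y) <= 2 ^+ N * (japanese y ^+ N * wt N x).
Proof.
have H := jp_sub x y.
rewrite /wt mulrA ler_pdivlMr ?jpX_gt0 // mulrC ler_pdivrMr ?jpX_gt0 // -!exprMn.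
by apply: lerXn2r; rewrite ?nnegrE ?mulr_ge0 // -mulrA [japanese y * _]mulrC.
Qed.

Lemma oneDsqrV_ge0 (x : R) : 0 <= (oneDsqr x)^-1.
Proof. by rewrite invr_ge0 (le_trans ler01) // oneDsqr_ge1. Qed.
Lemma rint_oneDsqr : (@lebesgue_measure R).-integrable setT (EFin \o (fun x => (oneDsqr x)^-1)).
Proof.
apply/integrableP; split.
  by apply/measurable_EFinP; exact: (continuous_measurable_fun (@continuous_oneDsqrV R)).
under eq_integral => x _ do rewrite /= ger0_norm ?oneDsqrV_ge0 //.
rewrite ge0_symfun_integralT //.
- by rewrite -set_itvcy integral0y_oneDsqr lte_mul_pinfty // ltry.
- exact: continuous_oneDsqrV.
- by move=> x /=; rewrite /oneDsqr sqrrN.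
Qed.

Lemma rint_wt2 k : (leb k).-integrable setT (EFin \o (@wt k (k + k))).
Proof.
elim: k => [|k IH].
  apply: (rint_dom (k := cst 1)) => [||x]; first exact: measurable_wt.
    apply/integrableP; split; first exact/measurable_EFinP/measurable_cst.
    by under eq_integral do rewrite /= normr1; rewrite integral_cst //= mul1e diracT ltry.
  by rewrite ger0_norm ?wt_ge0 //; exact: wt_le1.
pose G (v : 'rV[R]_k.+1) : R := `|(oneDsqr (v ord0 ord0))^-1| * `|wt (k + k) (rV_uncons v).2|.
have mv : measurable_fun setT (fun v => (@rV_uncons R k v).2).
  exact: measurableT_comp measurable_snd (@measurable_rV_uncons R k).
have mG : measurable_fun setT G.
  apply: measurable_funM; apply: measurableT_comp => //.
    apply: (measurableT_comp (continuous_measurable_fun (@continuous_oneDsqrV R))).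
    exact: measurable_coord.
  exact: measurableT_comp (@measurable_wt k (k + k)) mv.
apply: (rint_dom (k := G)); first exact: measurable_wt; last first.
  move=> v; rewrite ger0_norm //.
  have vE : rdot v v = v ord0 ord0 ^+ 2 + rdot (rV_uncons v).2 (rV_uncons v).2.
    rewrite !rdotE big_ord_recl -expr2; congr (_ + _).
    by apply: eq_bigr => i _; rewrite /rV_uncons /= !mxE.
  rewrite /G !ger0_norm ?oneDsqrV_ge0 // addSn addnS -[_.+2]addn2 wtD mulrC.
  apply: ler_pM => //.
    rewrite /wt lef_pV2 ?posrE ?jpX_gt0 ?(lt_le_trans ltr01 (oneDsqr_ge1 _)) //.
    by rewrite jp_sq vE /oneDsqr addrA lerDl rdot_ge0.
  rewrite /wt lef_pV2 ?posrE ?jpX_gt0 //; apply: lerXn2r; rewrite ?nnegrE //.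
  rewrite -[leRHS]mul1r; apply: le_jp => //.
  by rewrite expr1n mul1r vE lerD2l lerDr sqr_ge0.
apply/integrableP; split; first exact/measurable_EFinP.
have H (A : set 'rV[R]_k.+1) : measurable A ->
   (lebesgue_measure \x leb k)%E (@rV_cons R k @^-1` A) = (1%:E * leb k.+1 A)%E.
  by rewrite mul1e.
have := @ge0_integral_change _ _ _ _ R (lebesgue_measure \x leb k)%E (leb k.+1) _
  (@measurable_rV_cons R k) 1 ler01 H (fun v => `|(EFin \o G) v|%E).
rewrite mul1e => <- //; last first.
  by apply: measurableT_comp => //; exact/measurable_EFinP.
have /integrableP[_ K] := rint_prod rint_oneDsqr IH.
apply: le_lt_trans K; rewrite le_eqVlt; apply/orP; left; apply/eqP.
by apply: eq_integral => p _ /=; rewrite /G rV_consK rV_cons0.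
Qed.

Lemma rint_wt k N : (k + k <= N)%N -> (leb k).-integrable setT (EFin \o (@wt k N)).
Proof.
move=> kN; apply: (rint_dom _ (rint_wt2 k)); first exact: measurable_wt.
by move=> x; rewrite ger0_norm // wt_le.
Qed.
End japanese_bracket.
#[export] Hint Extern 0 (is_true (1 <= japanese _)) => exact: jp_ge1 : core.
#[export] Hint Extern 0 (is_true (0 < japanese _)) => exact: jp_gt0 : core.
#[export] Hint Extern 0 (is_true (0 <= japanese _)) => exact: jp_ge0 : core.
#[export] Hint Extern 0 (is_true (0 <= wt _ _)) => exact: wt_ge0 : core.
#[export] Hint Extern 0 (is_true (0 < wt _ _)) => exact: wt_gt0 : core.

(** * Partial derivatives *)

Section partial_derivatives.
Context {R : realType}.
Local Notation C := R[i].
Local Notation e_ i := (delta_mx ord0 i).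

Lemma line_is_derive k (f : 'rV[R]_k -> R) (x v : 'rV[R]_k) (t df : R) :
  is_derive (x + t *: v) v f df -> is_derive t 1 (fun t => f (x + t *: v)) df.
Proof.
have E : (fun h : R => h^-1 *: ((f \o shift (x + t *: v)) (h *: v) - f (x + t *: v))) =
   (fun h : R => h^-1 *: (((fun t => f (x + t *: v)) \o shift t) (h *: (1 : R)) - f (x + t *: v))).
  apply/funext => h /=; congr (_ *: (f _ - _)).
  by rewrite [h *: 1]mulr1 scalerDl addrCA.
by move=> [a b]; split; [rewrite /derivable -E|rewrite /derive -E].
Qed.

Lemma line_is_derive0 k (f : 'rV[R]_k -> R) (x v : 'rV[R]_k) (df : R) :
  is_derive (0 : R) 1 (fun t => f (x + t *: v)) df -> is_derive x v f df.
Proof.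
have E : (fun h : R => h^-1 *: ((f \o shift x) (h *: v) - f x)) =
   (fun h : R => h^-1 *: (((fun t => f (x + t *: v)) \o shift 0) (h *: (1 : R)) - f (x + 0 *: v))).
  apply/funext => h /=; rewrite scale0r !addr0; congr (_ *: (f _ - _)).
  by rewrite [h *: 1]mulr1 addrC.
by move=> [a b]; split; [rewrite /derivable E|rewrite /derive E].
Qed.

Lemma is_derive_affine (a b t : R) : is_derive t 1 (fun t => a + t * b) b.
Proof.
have H := is_deriveD (is_derive_cst a t 1) (is_deriveM (is_derive_id t 1) (is_derive_cst b t 1)).
by apply: (is_derive_eq H); rewrite /GRing.scale /=; ring.
Qed.

Lemma lipschitz_line (f g : R -> R) (a B : R) :
  (forall t : R, is_derive t 1 f (g t)) -> (forall t, `|t| <= `|a| -> `|g t| <= B) ->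
  `|f a - f 0| <= B * `|a|.
Proof.
move=> fg gB.
have cf : continuous f by move=> t; apply/differentiable_continuous/derivable1_diffP/ex_derive.
have [a0|a0] := leP 0 a.
  have [c|c cI ->] := MVT_segment a0 (fun t _ => fg t).
    exact: continuous_subspaceT.
  rewrite subr0 normrM ler_wpM2r // gB //.
  by move: cI; rewrite in_itv /= => /andP[? ?]; rewrite !ger0_norm.
have [c|c cI] := MVT_segment (ltW a0) (fun t _ => fg t).
  exact: continuous_subspaceT.
rewrite sub0r distrC => ->; rewrite normrM normrN ler_wpM2r // gB //.
by move: cI; rewrite in_itv /= => /andP[? ?]; rewrite !ler0_norm ?lerN2 // ltW.
Qed.

(** Moving one coordinate at a time reduces the multivariate mean value
    inequality to the one variable one. *)
Lemma mean_value_coord k (f : 'rV[R]_k -> R) (g : 'I_k -> 'rV[R]_k -> R)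
  (x h : 'rV[R]_k) (B : R) :
  (forall i y, is_derive y (e_ i) f (g i y)) ->
  (forall i (d : 'rV[R]_k), (forall j, `|d ord0 j| <= `|h ord0 j|) -> `|g i (x + d)| <= B) ->
  `|f (x + h) - f x| <= B * \sum_i `|h ord0 i|.
Proof.
move=> fg gB.
pose H m : 'rV[R]_k := \row_i (if (i < m)%N then h ord0 i else 0).
have stepE m (mk : (m < k)%N) :
    `|f (x + H m.+1) - f (x + H m)| <= B * `|h ord0 (Ordinal mk)|.
  pose i := Ordinal mk.
  have HS : x + H m.+1 = (x + H m) + h ord0 i *: e_ i.
    apply/rowP => j; rewrite !mxE -addrA; congr (_ + _); rewrite eqxx /= ltnS leq_eqVlt.
    have [jm|jm] := eqVneq (j : nat) m.
      have -> : j = i by exact: val_inj.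
      by rewrite /= eqxx ltnn add0r mulr1.
    have -> : (j == i) = false by apply/negbTE; apply: contraNN jm => /eqP ->.
    by rewrite /= mulr0 addr0.
  have := @lipschitz_line (fun t => f ((x + H m) + t *: e_ i)) (fun t => g i ((x + H m) + t *: e_ i))
    (h ord0 i) B (fun t => line_is_derive (fg i _)).
  rewrite scale0r addr0 -HS; apply=> t tle; rewrite -addrA; apply: gB => j.
  rewrite !mxE eqxx /=; have [->|ji] := eqVneq j i.
    by rewrite ltnn add0r mulr1.
  by rewrite mulr0 addr0; case: ifP => // _; rewrite normr0.
have main m : (m <= k)%N -> `|f (x + H m) - f x| <= B * \sum_(i < k | (i < m)%N) `|h ord0 i|.
  elim: m => [|m IH] mk.
    rewrite big_pred0 ?mulr0; last by move=> i; rewrite ltn0.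
    suff -> : H 0 = 0 by rewrite addr0 subrr normr0.
    by apply/rowP => i; rewrite !mxE ltn0.
  rewrite (bigD1 (Ordinal mk)) //= mulrDr.
  rewrite (eq_bigl (fun i : 'I_k => (i < m)%N)); last first.
    move=> i; rewrite ltnS leq_eqVlt -val_eqE /=.
    by have [->|_] := eqVneq (i : nat) m; rewrite ?ltnn //= andbT.
  have -> : f (x + H m.+1) - f x = (f (x + H m.+1) - f (x + H m)) + (f (x + H m) - f x) by ring.
  by apply: le_trans (ler_normD _ _) _; rewrite lerD ?stepE // IH // ltnW.
have := main k (leqnn k).
rewrite (eq_bigl predT) => [|i]; last by rewrite ltn_ord.
suff -> : H k = h by [].
by apply/rowP => i; rewrite mxE ltn_ord.
Qed.

Lemma coord_norm k (x : 'rV[R]_k) i : `|x ord0 i| <= `|x|.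
Proof.
rewrite [leRHS]mx_normrE.
exact: (le_bigmax _ (fun ij : 'I_1 * 'I_k => `|x ij.1 ij.2|) (ord0, i)).
Qed.
Lemma sum_coord_norm k (x : 'rV[R]_k) : \sum_i `|x ord0 i| <= k%:R * `|x|.
Proof.
rewrite mulr_natl -[X in _ *+ X](card_ord k) -sumr_const.
by apply: ler_sum => i _; exact: coord_norm.
Qed.

(** Bounded second partial derivatives make the first ones Lipschitz continuous, so
    that the remainder of the linear approximation is quadratic. *)
Lemma differentiable_C2 k (f : 'rV[R]_k -> R) (g : 'I_k -> 'rV[R]_k -> R)
  (g2 : 'I_k -> 'I_k -> 'rV[R]_k -> R)
  (B : R) (x : 'rV[R]_k) :
  (forall i y, is_derive y (e_ i) f (g i y)) ->
  (forall i j y, is_derive y (e_ j) (g i) (g2 i j y)) ->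
  (forall i j y, `|g2 i j y| <= B) -> differentiable f x.
Proof.
move=> fg gg gB.
pose L (h : 'rV[R]_k) : R := \sum_i h ord0 i * g i x.
have Llin : linear L.
  move=> a u v; change (L (a *: u + v) = a * L u + L v).
  rewrite /L mulr_sumr -big_split /=; apply: eq_bigr => i _.
  by rewrite !mxE mulrDl mulrA.
pose LL : {linear 'rV[R]_k -> R} := HB.pack L (GRing.isLinear.Build _ _ _ _ L Llin).
have cL : continuous LL.
  apply: continuous_sum_rV => i y; apply: continuousM; first exact: coord_continuous.
  exact: cst_continuous.
have key h : `|f (x + h) - f x - L h| <= B * (\sum_i `|h ord0 i|) ^+ 2.
  pose F h := f (x + h) - L h.
  have := @mean_value_coord k F (fun i d => g i (x + d) - g i x) 0 h (B * \sum_i `|h ord0 i|).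
  have L0 : L 0 = 0 by rewrite /L big1 // => i _; rewrite mxE mul0r.
  rewrite /F addr0 add0r L0 subr0 expr2 mulrA [f _ - f _ - L _]addrAC; apply.
    move=> i d; apply: line_is_derive0.
    have D1 : is_derive (0 : R) 1 (fun t => f (x + (d + t *: e_ i))) (g i (x + d)).
      have -> : (fun t => f (x + (d + t *: e_ i))) = (fun t => f ((x + d) + t *: e_ i)).
        by apply/funext => t; rewrite addrA.
      by apply: line_is_derive; rewrite scale0r addr0.
    have D2 : is_derive (0 : R) 1 (fun t => L (d + t *: e_ i)) (g i x).
      have -> : (fun t => L (d + t *: e_ i)) = (fun t : R => L d + t * g i x).
        apply/funext => t; rewrite (addrC d) Llin addrC; congr (_ + t * _).
        rewrite /L (bigD1 i) //= big1 ?addr0 ?mxE ?eqxx ?mul1r // => j ji.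
        by rewrite mxE (negbTE ji) andbF mul0r.
      exact: is_derive_affine.
    exact: is_deriveB.
  move=> i d dh; rewrite add0r; apply: le_trans (mean_value_coord (gg i) _) _.
    by move=> j d' _; exact: gB.
  apply: ler_wpM2l; first exact: le_trans (normr_ge0 _) (gB i i x).
  by apply: ler_sum => j _; exact: dh.
have E (e : {posnum R}) :
    \forall h \near (0 : 'rV[R]_k), `|f (h + x) - (f x + L h)| <= e%:num * `|h|.
  pose K := `|B| * k%:R ^+ 2 + 1.
  have K0 : 0 < K by rewrite ltr_wpDl // mulr_ge0 // exprn_ge0.
  near=> h.
  rewrite (addrC h) opprD addrA; apply: le_trans (key h) _.
  have hs := sum_coord_norm h.
  have s0 : 0 <= \sum_i `|h ord0 i| by apply: sumr_ge0.
  apply: (@le_trans _ _ (K * `|h| * `|h|)).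
    rewrite -mulrA -expr2 /K mulrDl mul1r; apply: ler_wpDr; first exact: exprn_ge0.
    apply: (@le_trans _ _ (`|B| * (\sum_i `|h ord0 i|) ^+ 2)).
      by rewrite ler_wpM2r ?exprn_ge0 // ler_norm.
    by rewrite -mulrA -exprMn ler_wpM2l // lerXn2r ?nnegrE ?mulr_ge0.
  rewrite ler_wpM2r // -ler_pdivlMl // mulrC; near: h.
  have eK : 0 < e%:num / K by rewrite divr_gt0.
  apply/nbhs_ballP; exists (e%:num / K) => //= h.
  by rewrite -ball_normE /= sub0r normrN => /ltW.
have dE : 'd f x = LL :> ('rV[R]_k -> R).
  by apply: (diff_unique cL); apply/eqaddoP => _/posnumP[e]; exact: E.
by apply/diff_locallyP; rewrite dE; split=> //; apply/eqaddoP => _/posnumP[e]; exact: E.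
Unshelve. all: by end_near. Qed.

Definition is_partial k (i : 'I_k) (f g : 'rV[R]_k -> C) : Prop := forall x,
  is_derive x (e_ i) (fun y => Re (f y)) (Re (g x)) /\
  is_derive x (e_ i) (fun y => Im (f y)) (Im (g x)).

Lemma is_partialE k (i : 'I_k) f g : is_partial i f g -> partial i f = g.
Proof.
move=> H; apply/funext => x; have [[_ a] [_ b]] := H x.
by apply: ReIm_inj; rewrite /partial /= ?a ?b.
Qed.

Lemma smooth_is_partial k (i : 'I_k) f : smooth f -> is_partial i f (partial i f).
Proof.
move=> sf x; have [a b] := sf [::] x.
by split; apply/derivableP; apply: diff_derivable.
Qed.

Lemma partialsS k s (i : 'I_k) (f : 'rV[R]_k -> C) : partials s (partial i f) = partials (rcons s i) f.
Proof. by rewrite /partials -cats1 foldr_cat. Qed.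

(** A family of bounded functions stable under coordinate multiplications and
    partial derivatives consists of Schwartz functions; this is how membership
    in the Schwartz space is established throughout. *)
Lemma schwartz_criterion k (P : ('rV[R]_k -> C) -> Prop) :
  (forall f, P f -> exists B : R, forall x, normc (f x) <= B) ->
  (forall f i, P f -> exists2 g, P g & is_partial i f g) ->
  (forall f i, P f -> P (fun x => (x ord0 i)%:C * f x)) ->
  forall f, P f -> schwartz f.
Proof.
move=> Pb Pd Px.
have Ppart f i : P f -> P (partial i f) /\ is_partial i f (partial i f).
  by move=> Pf; have [g Pg fg] := Pd f i Pf; rewrite (is_partialE fg).
have Pparts f s : P f -> P (partials s f).
  by move=> Pf; elim: s => //= i s IH; have [] := Ppart _ i IH.
have Pdecay N f : P f -> exists B : R, forall x, japanese x ^+ N * normc (f x) <= B.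
  elim: N f => [|N IH] f Pf.
    by have [B fB] := Pb f Pf; exists B => x; rewrite expr0 mul1r.
  have [B0 fB0] := IH f Pf.
  have /choice[B fB] : forall i, exists B : R, forall x,
    japanese x ^+ N * normc ((x ord0 i)%:C * f x) <= B by move=> i; apply: IH; exact: Px.
  exists (B0 + \sum_i B i) => x; rewrite exprSr.
  apply: (@le_trans _ _ (japanese x ^+ N * ((1 + \sum_i `|x ord0 i|) * normc (f x)))).
    rewrite -mulrA; apply: ler_wpM2l; first exact: exprn_ge0.
    by apply: ler_wpM2r; [exact: normc_ge0|exact: jp_le_sum].
  rewrite mulrDl mul1r mulrDr; apply: lerD; first exact: fB0.
  rewrite mulr_suml mulr_sumr; apply: ler_sum => i _.
  by have := fB i x; rewrite normcM normcR.
move=> f Pf; split=> [s x|N s]; last exact/Pdecay/Pparts.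
have {}Pf := Pparts f s Pf; set F := partials s f in Pf *.
have PF2 i j : P (partial j (partial i F)).
  by have [] := Ppart _ j (Ppart _ i Pf).1.
have /choice[B FB] : forall ij : 'I_k * 'I_k, exists B : R, forall x,
  normc (partial ij.2 (partial ij.1 F) x) <= B by move=> ij; exact: Pb.
pose B' := \sum_ij `|B ij|.
have FB' i j y : normc (partial j (partial i F) y) <= B'.
  apply: le_trans (FB (i, j) y) _; rewrite /B' (bigD1 (i, j)) //=.
  by apply: ler_wpDr; [exact: sumr_ge0|exact: ler_norm].
split.
  apply: (@differentiable_C2 _ _ (fun i y => Re (partial i F y))
    (fun i j y => Re (partial j (partial i F) y)) B').
  - by move=> i y; exact: ((Ppart F i Pf).2 y).1.
  - by move=> i j y; exact: ((Ppart (partial i F) j (Ppart F i Pf).1).2 y).1.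
  - by move=> i j y; exact: le_trans (normc_Re _) (FB' i j y).
apply: (@differentiable_C2 _ _ (fun i y => Im (partial i F y))
  (fun i j y => Im (partial j (partial i F) y)) B').
- by move=> i y; exact: ((Ppart F i Pf).2 y).2.
- by move=> i j y; exact: ((Ppart (partial i F) j (Ppart F i Pf).1).2 y).2.
- by move=> i j y; exact: le_trans (normc_Im _) (FB' i j y).
Qed.

End partial_derivatives.

(** * Calculus of partial derivatives *)

Section schwartz_space.
Context {R : realType}.
Local Notation C := R[i].
Local Notation e_ i := (delta_mx ord0 i).
Implicit Types k N : nat.

Lemma is_partial_ext k (i : 'I_k) (f f' g g' : 'rV[R]_k -> C) :
  f =1 f' -> g =1 g' -> is_partial i f g -> is_partial i f' g'.
Proof. by move=> /funext -> /funext ->. Qed.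
Lemma is_partialD k (i : 'I_k) (f f' g g' : 'rV[R]_k -> C) :
  is_partial i f g -> is_partial i f' g' ->
  is_partial i (fun x => f x + f' x) (fun x => g x + g' x).
Proof.
move=> H H' x; have [a b] := H x; have [a' b'] := H' x; split.
  rewrite cReD; have -> : (fun y => Re (f y + f' y)) = (fun y => Re (f y)) \+ (fun y => Re (f' y)).
    by apply/funext => y; rewrite cReD.
  exact: is_deriveD.
rewrite cImD; have -> : (fun y => Im (f y + f' y)) = (fun y => Im (f y)) \+ (fun y => Im (f' y)).
  by apply/funext => y; rewrite cImD.
exact: is_deriveD.
Qed.
Lemma is_partialM k (i : 'I_k) (f f' g g' : 'rV[R]_k -> C) :
  is_partial i f g -> is_partial i f' g' ->
  is_partial i (fun x => f x * f' x) (fun x => g x * f' x + f x * g' x).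
Proof.
move=> H H' x; have [a b] := H x; have [a' b'] := H' x; split.
  have -> : (fun y => Re (f y * f' y)) =
      ((fun y => Re (f y)) * (fun y => Re (f' y)) - (fun y => Im (f y)) * (fun y => Im (f' y)))%R.
    by apply/funext => y; rewrite cReM.
  apply: (is_derive_eq (is_deriveB (is_deriveM a a') (is_deriveM b b'))).
  by rewrite cReD !cReM /GRing.scale /=; ring.
have -> : (fun y => Im (f y * f' y)) =
    ((fun y => Re (f y)) * (fun y => Im (f' y)) + (fun y => Im (f y)) * (fun y => Re (f' y)))%R.
  by apply/funext => y; rewrite cImM.
apply: (is_derive_eq (is_deriveD (is_deriveM a b') (is_deriveM b a'))).
by rewrite cImD !cImM /GRing.scale /=; ring.
Qed.
Lemma is_partial_cst k (i : 'I_k) (c : C) : is_partial i (fun=> c) (fun=> 0).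
Proof. by move=> x; split; exact: is_derive_cst. Qed.
Lemma is_partialZ k (i : 'I_k) (c : C) (f g : 'rV[R]_k -> C) :
  is_partial i f g -> is_partial i (fun x => c * f x) (fun x => c * g x).
Proof.
move=> H; apply: is_partial_ext (is_partialM (is_partial_cst i c) H) => x //.
by rewrite mul0r add0r.
Qed.
Lemma is_partialR k (i : 'I_k) (h h' : 'rV[R]_k -> R) :
  (forall x, is_derive x (e_ i) h (h' x)) ->
  is_partial i (fun x => (h x)%:C) (fun x => (h' x)%:C).
Proof. by move=> H x; split; [exact: H|exact: is_derive_cst]. Qed.
Lemma is_derive_rdot k (i : 'I_k) (c x : 'rV[R]_k) :
  is_derive x (e_ i) (fun y => rdot y c) (c ord0 i).
Proof.
apply: line_is_derive0.
have -> : (fun t => rdot (x + t *: e_ i) c) = (fun t : R => rdot x c + t * c ord0 i).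
  apply/funext => t; rewrite rdotDl rdotZl; congr (_ + _ * _).
  rewrite rdotE (bigD1 i) //= big1 ?addr0 ?mxE ?eqxx ?mul1r // => j ji.
  by rewrite mxE (negbTE ji) andbF mul0r.
exact: is_derive_affine.
Qed.
Lemma is_partial_rdot k (i : 'I_k) (c : 'rV[R]_k) :
  is_partial i (fun x => (rdot x c)%:C) (fun=> (c ord0 i)%:C).
Proof. apply: is_partialR => x; exact: is_derive_rdot. Qed.
Lemma rdot_delta k (x : 'rV[R]_k) i : rdot x (e_ i) = x ord0 i.
Proof.
rewrite rdotE (bigD1 i) //= big1 ?addr0 ?mxE ?eqxx ?mulr1 // => j ji.
by rewrite mxE (negbTE ji) andbF mulr0.
Qed.
Lemma is_partial_coord k (i j : 'I_k) :
  is_partial i (fun x : 'rV[R]_k => (x ord0 j)%:C) (fun=> ((i == j)%:R)%:C).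
Proof.
apply: is_partial_ext (is_partial_rdot i (e_ j)) => x; first by rewrite rdot_delta.
by rewrite mxE eqxx.
Qed.
Lemma is_partial_cis k (i : 'I_k) (h h' : 'rV[R]_k -> R) :
  (forall x, is_derive x (e_ i) h (h' x)) ->
  is_partial i (fun x => cis (h x)) (fun x => (0 +i* 1) * (h' x)%:C * cis (h x)).
Proof.
move=> H x.
have D : is_derive (0 : R) 1 (fun t => h (x + t *: e_ i)) (h' x).
  by apply: line_is_derive; rewrite scale0r addr0.
split; apply: line_is_derive0.
  have -> : (fun t => Re (cis (h (x + t *: e_ i)))) = cos \o (fun t => h (x + t *: e_ i)).
    by apply/funext => t; rewrite cisE.
  have := is_derive1_comp (is_derive_cos (h (x + 0 *: e_ i))) D.
  by move=> H1; apply: (is_derive_eq H1); rewrite scale0r addr0 cisE /=; ring.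
have -> : (fun t => Im (cis (h (x + t *: e_ i)))) = sin \o (fun t => h (x + t *: e_ i)).
  by apply/funext => t; rewrite cisE.
have := is_derive1_comp (is_derive_sin (h (x + 0 *: e_ i))) D.
by move=> H1; apply: (is_derive_eq H1); rewrite scale0r addr0 cisE /=; ring.
Qed.

(** * Stability properties of Schwartz functions *)

(** Partial derivatives of generators only need to be linear combinations of
    generators for the criterion to apply. *)
Inductive fspan k (G : ('rV[R]_k -> C) -> Prop) : ('rV[R]_k -> C) -> Prop :=
| fspan_gen f : G f -> fspan G f
| fspan_lin c f g : fspan G f -> fspan G g -> fspan G (fun x => c * f x + g x)
| fspan0 : fspan G (fun=> 0).

Lemma fspan_sum k (G : ('rV[R]_k -> C) -> Prop) (I : Type) (r : seq I) (c : I -> C) F :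
  (forall i, fspan G (F i)) -> fspan G (fun x => \sum_(i <- r) c i * F i x).
Proof.
move=> FG; elim: r => [|i r IH].
  by under eq_fun do rewrite big_nil; exact: fspan0.
by under eq_fun do rewrite big_cons; exact: fspan_lin.
Qed.

Lemma schwartz_span k (G : ('rV[R]_k -> C) -> Prop) :
  (forall f, G f -> exists B : R, forall x, normc (f x) <= B) ->
  (forall f i, G f -> exists2 g, fspan G g & is_partial i f g) ->
  (forall f i, G f -> fspan G (fun x : 'rV[R]_k => (x ord0 i)%:C * f x)) ->
  forall f, fspan G f -> schwartz f.
Proof.
move=> Gb Gd Gx; apply: schwartz_criterion => [f|f i|f i].
- elim=> [{}f Gf|c {}f g _ [B fB] _ [B' gB]|]; first exact: Gb.
    exists (normc c * B + B') => x; apply: le_trans (le_normcD _ _) _.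
    by rewrite normcM lerD // ler_wpM2l // normc_ge0.
  by exists 0 => x; rewrite normc0.
- elim=> [{}f Gf|c {}f g _ [f' sf ff'] _ [g' sg gg']|]; first exact: Gd.
    exists (fun x => c * f' x + g' x); first exact: fspan_lin.
    exact: is_partialD (is_partialZ c ff') gg'.
  by exists (fun=> 0); [exact: fspan0|exact: is_partial_cst].
- elim=> [{}f Gf|c {}f g _ sf _ sg|]; first exact: Gx.
    have -> : (fun x : 'rV[R]_k => (x ord0 i)%:C * (c * f x + g x)) =
        (fun x : 'rV[R]_k => c * ((x ord0 i)%:C * f x) + (x ord0 i)%:C * g x).
      by apply/funext => x; ring.
    exact: fspan_lin.
  have -> : (fun x : 'rV[R]_k => (x ord0 i)%:C * 0) = (fun=> 0 : C).
    by apply/funext => x; rewrite mulr0.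
  exact: fspan0.
Qed.

Lemma schwartz_bound k (u : 'rV[R]_k -> C) N : schwartz u ->
  exists2 B : R, 0 <= B & forall x, normc (u x) <= B * wt N x.
Proof.
move=> [_ H]; have [B uB] := H N [::]; exists B.
  by apply: le_trans (uB 0); rewrite mulr_ge0 ?exprn_ge0 // normc_ge0.
by move=> x; apply/le_wt; exact: uB.
Qed.
Lemma schwartz_smooth k (u : 'rV[R]_k -> C) : schwartz u -> smooth u.
Proof. by case. Qed.
Lemma schwartz_partials k (u : 'rV[R]_k -> C) s : schwartz u -> schwartz (partials s u).
Proof.
move=> [su du]; split=> [s' x|N s']; rewrite /partials -foldr_cat.
  exact: su.
exact: du.
Qed.
Lemma schwartz_partial k (u : 'rV[R]_k -> C) i : schwartz u -> schwartz (partial i u).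
Proof. exact: (@schwartz_partials k u [:: i]). Qed.

(** A family containing u0 which is stable, up to linear combinations, under
    derivatives and multiplications by coordinates. *)
Inductive coord_mult k (u0 : 'rV[R]_k -> C) : ('rV[R]_k -> C) -> Prop :=
| coord_mult0 s i : coord_mult u0 (fun x : 'rV[R]_k => (x ord0 i)%:C * partials s u0 x)
| coord_multS i f : coord_mult u0 f -> coord_mult u0 (fun x : 'rV[R]_k => (x ord0 i)%:C * f x)
| coord_multD s : coord_mult u0 (partials s u0).

Lemma schwartz_lin_coord k (u : 'rV[R]_k -> C) : schwartz u ->
  forall f, fspan (coord_mult u) f -> schwartz f.
Proof.
move=> su; apply: schwartz_span => [f|f i|f i Gf]; last exact/fspan_gen/coord_multS.
- suff H N : coord_mult u f -> exists B : R, forall x, normc (f x) <= B * wt N x.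
    by move=> /(H 0%N)[B fB]; exists B => x; have := fB x; rewrite /wt expr0 invr1 mulr1.
  move=> Gf; elim: Gf N => {f} [s i N|i f _ IH N|s N].
  + have [B B0 fB] := schwartz_bound N.+1 (schwartz_partials s su).
    exists B => x; rewrite normcM normcR -le_wt.
    apply: le_trans (_ : japanese x ^+ N * (japanese x * normc (partials s u x)) <= _).
      by rewrite ler_wpM2l ?exprn_ge0 // ler_wpM2r ?normc_ge0 // jp_coord.
    by rewrite mulrA -exprSr; apply/le_wt.
  + have [B fB] := IH N.+1.
    exists B => x; rewrite normcM normcR -le_wt.
    apply: le_trans (_ : japanese x ^+ N * (japanese x * normc (f x)) <= _).
      by rewrite ler_wpM2l ?exprn_ge0 // ler_wpM2r ?normc_ge0 // jp_coord.
    by rewrite mulrA -exprSr; apply/le_wt.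
  + by have [B B0 fB] := schwartz_bound N (schwartz_partials s su); exists B.
- have P1 j f' g' : is_partial i f' g' ->
      is_partial i (fun x : 'rV[R]_k => (x ord0 j)%:C * f' x) (fun x => ((i == j)%:R)%:C * f' x + (x ord0 j)%:C * g' x).
    exact: is_partialM (is_partial_coord i j).
  elim=> {f} [s j|j f Gf [g sg fg]|s].
  + have H := P1 j _ _ (smooth_is_partial i (schwartz_smooth (schwartz_partials s su))).
    eexists; last exact: H.
    apply: fspan_lin; apply: fspan_gen; first exact: coord_multD.
    exact: (coord_mult0 u (i :: s) j).
  + eexists; last exact: (P1 j _ _ fg).
    apply: fspan_lin; first exact: fspan_gen.
    elim: sg => [g' Gg'|c g1 g2 _ H1 _ H2|].
    * exact/fspan_gen/coord_multS.
    * have -> : (fun x : 'rV[R]_k => (x ord0 j)%:C * (c * g1 x + g2 x)) =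
          (fun x : 'rV[R]_k => c * ((x ord0 j)%:C * g1 x) + (x ord0 j)%:C * g2 x).
        by apply/funext => x; ring.
      exact: fspan_lin.
    * have -> : (fun x : 'rV[R]_k => (x ord0 j)%:C * 0) = (fun=> 0 : C).
        by apply/funext => x; rewrite mulr0.
      exact: fspan0.
  + exists (partials (i :: s) u); first exact/fspan_gen/coord_multD.
    exact: smooth_is_partial (schwartz_smooth (schwartz_partials s su)).
Qed.
Lemma schwartz_coord k (u : 'rV[R]_k -> C) i : schwartz u ->
  schwartz (fun x : 'rV[R]_k => (x ord0 i)%:C * u x).
Proof.
by move=> su; apply: (schwartz_lin_coord su); apply/fspan_gen; exact: (coord_mult0 u [::] i).
Qed.
Lemma schwartz_lincomb k f : fspan (@schwartz R k) f -> schwartz f.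
Proof.
apply: schwartz_span => {f} [f sf|f i sf|f i sf].
- have [B B0 fB] := schwartz_bound 0 sf; exists B => x.
  by have := fB x; rewrite /wt expr0 invr1 mulr1.
- exists (partial i f); first exact/fspan_gen/schwartz_partial.
  exact: smooth_is_partial (schwartz_smooth sf).
- exact/fspan_gen/schwartz_coord.
Qed.
Lemma schwartz_lin k c (u v : 'rV[R]_k -> C) : schwartz u -> schwartz v ->
  schwartz (fun x => c * u x + v x).
Proof. by move=> su sv; apply/schwartz_lincomb/fspan_lin; exact: fspan_gen. Qed.
Lemma schwartz0 k : schwartz (fun _ : 'rV[R]_k => 0 : C).
Proof. exact/schwartz_lincomb/fspan0. Qed.
Lemma schwartz_sum k (I : Type) (r : seq I) (c : I -> C) (F : I -> 'rV[R]_k -> C) :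
  (forall i, schwartz (F i)) -> schwartz (fun x => \sum_(i <- r) c i * F i x).
Proof. by move=> sF; apply/schwartz_lincomb/fspan_sum => i; exact/fspan_gen. Qed.
Lemma schwartzZ k c (u : 'rV[R]_k -> C) : schwartz u -> schwartz (fun x => c * u x).
Proof.
by move=> su; have := schwartz_lin c su (schwartz0 k); under eq_fun do rewrite addr0.
Qed.
Lemma schwartzD k (u v : 'rV[R]_k -> C) : schwartz u -> schwartz v ->
  schwartz (fun x => u x + v x).
Proof. by move=> su sv; have := schwartz_lin 1 su sv; under eq_fun do rewrite mul1r. Qed.
Lemma is_partialJ k (i : 'I_k) (f g : 'rV[R]_k -> C) :
  is_partial i f g -> is_partial i (fun x => (f x)^*%C) (fun x => (g x)^*%C).
Proof.
move=> H x; have [a b] := H x; split.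
  by under eq_fun do rewrite cReJ; rewrite cReJ.
under eq_fun do rewrite cImJ; rewrite cImJ; exact: is_deriveN.
Qed.
Lemma schwartzJ k (u : 'rV[R]_k -> C) : schwartz u -> schwartz (fun x => (u x)^*%C).
Proof.
move=> su; pose P f := exists2 v : 'rV[R]_k -> C, schwartz v & f = (fun x => (v x)^*%C).
apply: (@schwartz_criterion _ _ P); last by exists u.
- move=> f [v sv ->]; have [B B0 fB] := schwartz_bound 0 sv; exists B => x.
  by have := fB x; rewrite /wt expr0 invr1 mulr1 normc_conj.
- move=> f i [v sv ->]; exists (fun x => (partial i v x)^*%C).
    by exists (partial i v) => //; exact: schwartz_partial.
  exact/is_partialJ/smooth_is_partial/schwartz_smooth.
- move=> f i [v sv ->]; exists (fun x : 'rV[R]_k => (x ord0 i)%:C * v x); first exact: schwartz_coord.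
  by apply/funext => x; rewrite rmorphM /= oppr0.
Qed.

Lemma is_partial_pull d k (M : 'M[R]_(d, k)) (b : 'rV[R]_k) (f : 'rV[R]_k -> C) i :
  smooth f -> is_partial i (fun w => f (w *m M + b))
    (fun w => \sum_l (M i l)%:C * partial l f (w *m M + b)).
Proof.
move=> sf w.
have key (g : 'rV[R]_k -> R) : differentiable g (w *m M + b) ->
    is_derive w (e_ i) (fun w => g (w *m M + b)) (\sum_l M i l * 'D_(e_ l) g (w *m M + b)).
  move=> dg; apply: line_is_derive0.
  have -> : (fun t => g ((w + t *: e_ i) *m M + b)) = (fun t => g (w *m M + b + t *: row i M)).
    by apply/funext => t; rewrite mulmxDl -scalemxAl -rowE addrAC.
  apply: line_is_derive; rewrite scale0r addr0.
  suff <- : 'D_(row i M) g (w *m M + b) = \sum_l M i l * 'D_(e_ l) g (w *m M + b).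
    exact/derivableP/diff_derivable.
  rewrite deriveE // (row_sum_delta (row i M)) raddf_sum /=; apply: eq_bigr => l _.
  by rewrite linearZ /= deriveE // mxE.
have [a c] := sf [::] (w *m M + b).
split.
  apply: (is_derive_eq (key _ a)); rewrite (raddf_sum (@complex.Re R)); apply: eq_bigr => l _.
  by rewrite /partial /= mul0r subr0.
apply: (is_derive_eq (key _ c)); rewrite (raddf_sum (@complex.Im R)); apply: eq_bigr => l _.
by rewrite /partial /= mul0r addr0.
Qed.

(** Injectivity lets the size of the argument control that of the variable. *)
Lemma schwartz_pull d k (M : 'M[R]_(d, k)) (U : 'M[R]_(k, d)) (b : 'rV[R]_k)
  (eta : 'rV[R]_d) (u : 'rV[R]_k -> C) : M *m U = 1%:M -> schwartz u ->
  schwartz (fun w => cis (rdot w eta) * u (w *m M + b)).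
Proof.
move=> MU su; pose P f := exists2 v : 'rV[R]_k -> C, schwartz v &
  f = (fun w => cis (rdot w eta) * v (w *m M + b)).
apply: (@schwartz_criterion _ _ P); last by exists u.
- move=> f [v sv ->]; have [B B0 fB] := schwartz_bound 0 sv; exists B => x.
  by rewrite normcM normc_cis mul1r; have := fB (x *m M + b); rewrite /wt expr0 invr1 mulr1.
- move=> f i [v sv ->].
  have H := is_partialM (is_partial_cis (fun x => is_derive_rdot i eta x))
    (is_partial_pull M b i (schwartz_smooth sv)).
  eexists; last exact: H.
  exists (fun y => (0 +i* 1) * (eta ord0 i)%:C * v y + \sum_l (M i l)%:C * partial l v y).
    by apply: schwartz_lin => //; apply: schwartz_sum => l; exact: schwartz_partial.
  by apply/funext => w; ring.
- move=> f i [v sv ->].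
  exists (fun y => (- \sum_l b ord0 l * U l i)%:C * v y +
      \sum_l (U l i)%:C * ((y ord0 l)%:C * v y)).
    by apply: schwartz_lin => //; apply: schwartz_sum => l; exact: schwartz_coord.
  apply/funext => w; rewrite mulrCA; congr (_ * _).
  rewrite [X in _ = _ + X](eq_bigr (fun l => ((U l i)%:C * ((w *m M + b) ord0 l)%:C) *
    v (w *m M + b))); last by move=> l _; rewrite mulrA.
  rewrite -mulr_suml -mulrDl; congr (_ * _).
  have -> : w ord0 i = - (\sum_l b ord0 l * U l i) + \sum_l U l i * (w *m M + b) ord0 l.
    have {1}-> : w = w *m M *m U by rewrite -mulmxA MU mulmx1.
    rewrite mxE addrC -sumrB; apply: eq_bigr => l _.
    by rewrite [in RHS]mxE; ring.
  rewrite rmorphD /=; congr (_ + _); rewrite (rmorph_sum (real_complex R)) /=.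
  by apply: eq_bigr => l _; rewrite rmorphM.
Qed.

Lemma schwartz_tensor k l (u : 'rV[R]_k -> C) (v : 'rV[R]_l -> C) :
  schwartz u -> schwartz v -> schwartz (fun w : 'rV[R]_(k + l) => u (lsubmx w) * v (rsubmx w)).
Proof.
move=> su sv; pose P f := exists u' v', [/\ @schwartz R k u', @schwartz R l v' &
  f = (fun w : 'rV[R]_(k + l) => u' (lsubmx w) * v' (rsubmx w))].
apply: (@schwartz_criterion _ _ P); last by exists u, v.
- move=> f [u' [v' [su' sv' ->]]].
  have [B B0 uB] := schwartz_bound 0 su'; have [B' B'0 vB] := schwartz_bound 0 sv'.
  exists (B * B') => w; rewrite normcM; apply: ler_pM; rewrite ?normc_ge0 //.
    by have := uB (lsubmx w); rewrite /wt expr0 invr1 mulr1.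
  by have := vB (rsubmx w); rewrite /wt expr0 invr1 mulr1.
- have ML : forall w : 'rV[R]_(k + l), lsubmx w = w *m (col_mx 1%:M 0) + 0.
    by move=> w; rewrite addr0 -{2}(hsubmxK w) mul_row_col mulmx1 mulmx0 addr0.
  have MR : forall w : 'rV[R]_(k + l), rsubmx w = w *m (col_mx 0 1%:M) + 0.
    by move=> w; rewrite addr0 -{2}(hsubmxK w) mul_row_col mulmx1 mulmx0 add0r.
  move=> f i [u' [v' [su' sv' ->]]].
  have Hu := is_partial_pull (col_mx 1%:M 0) 0 i (schwartz_smooth su').
  have Hv := is_partial_pull (col_mx 0 1%:M) 0 i (schwartz_smooth sv').
  case: (split_ordP i) Hu Hv => j -> Hu Hv.
    exists (fun w => partial j u' (lsubmx w) * v' (rsubmx w)).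
      by exists (partial j u'), v'; split=> //; exact: schwartz_partial.
    apply: is_partial_ext (is_partialM Hu Hv) => w /=; rewrite -ML -MR //.
    rewrite [X in _ + _ * X]big1 ?mulr0 ?addr0; last by move=> q _; rewrite col_mxEu mxE mul0r.
    rewrite (bigD1 j) //= big1 ?addr0; first by rewrite col_mxEu mxE eqxx mul1r.
    by move=> q qj; rewrite col_mxEu mxE eq_sym (negbTE qj) mul0r.
  exists (fun w => u' (lsubmx w) * partial j v' (rsubmx w)).
    by exists u', (partial j v'); split=> //; exact: schwartz_partial.
  apply: is_partial_ext (is_partialM Hu Hv) => w /=; rewrite -ML -MR //.
  rewrite [X in X * _ + _]big1 ?mul0r ?add0r; last by move=> q _; rewrite col_mxEd mxE mul0r.
  rewrite (bigD1 j) //= big1 ?addr0; first by rewrite col_mxEd mxE eqxx mul1r.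
  by move=> q qj; rewrite col_mxEd mxE eq_sym (negbTE qj) mul0r.
- move=> f i [u' [v' [su' sv' ->]]]; case: (split_ordP i) => j ->.
    exists (fun x : 'rV[R]_k => (x ord0 j)%:C * u' x), v'; split=> //; first exact: schwartz_coord.
    by apply/funext => w; rewrite mulrA mxE.
  exists u', (fun x : 'rV[R]_l => (x ord0 j)%:C * v' x); split=> //; first exact: schwartz_coord.
  by apply/funext => w; rewrite mulrCA mxE.
Qed.

Lemma schwartz_affine d k (M : 'M[R]_(d, k)) (U : 'M[R]_(k, d)) (b : 'rV[R]_k)
  (u : 'rV[R]_k -> C) : M *m U = 1%:M -> schwartz u -> schwartz (fun w => u (w *m M + b)).
Proof.
move=> MU su; have := schwartz_pull b 0 MU su.
by under eq_fun do rewrite rdotC rdot0l cis0 mul1r.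
Qed.
Lemma schwartzM k (u v : 'rV[R]_k -> C) : schwartz u -> schwartz v ->
  schwartz (fun x => u x * v x).
Proof.
move=> su sv.
have MU : (row_mx 1%:M 1%:M : 'M[R]_(k, k + k)) *m col_mx 1%:M 0 = 1%:M.
  by rewrite mul_row_col mulmx1 mulmx0 addr0.
have := schwartz_affine 0 MU (schwartz_tensor su sv).
by under eq_fun do rewrite addr0 mul_mx_row !mulmx1 row_mxKl row_mxKr.
Qed.
Lemma schwartz_slice k l (u : 'rV[R]_(k + l) -> C) (x : 'rV[R]_k) : schwartz u ->
  schwartz (fun y => u (row_mx x y)).
Proof.
move=> su.
have MU : (row_mx 0 1%:M : 'M[R]_(l, k + l)) *m col_mx 0 1%:M = 1%:M.
  by rewrite mul_row_col mulmx1 mulmx0 add0r.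
have := schwartz_affine (row_mx x 0) MU su.
by under eq_fun do rewrite mul_mx_row mulmx0 mulmx1 add_row_mx add0r addr0.
Qed.
Lemma partial_slice k l (u : 'rV[R]_(k + l) -> C) (x : 'rV[R]_k) j : smooth u ->
  partial j (fun y => u (row_mx x y)) = (fun y => partial (rshift k j) u (row_mx x y)).
Proof.
move=> su; apply: is_partialE.
have E y : row_mx x y = y *m (row_mx 0 1%:M : 'M[R]_(l, k + l)) + row_mx x 0.
  by rewrite mul_mx_row mulmx0 mulmx1 add_row_mx add0r addr0.
apply: is_partial_ext (is_partial_pull (row_mx 0 1%:M) (row_mx x 0) j su) => y; rewrite -E //.
rewrite (bigD1 (rshift k j)) //= big1 ?addr0; first by rewrite row_mxEr mxE eqxx mul1r.
move=> q; case: (split_ordP q) => p -> pj; first by rewrite row_mxEl mxE mul0r.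
rewrite row_mxEr mxE; case: eqP => [pE|_]; last by rewrite mul0r.
by move: pj; rewrite pE eqxx.
Qed.

Lemma schwartz_continuous k (u : 'rV[R]_k -> C) : schwartz u ->
  continuous (fun x => Re (u x)) /\ continuous (fun x => Im (u x)).
Proof.
by move=> [su _]; split=> x; have [a b] := su [::] x; exact: differentiable_continuous.
Qed.
Lemma schwartz_meas k (u : 'rV[R]_k -> C) : schwartz u -> cmeasurable u.
Proof.
by move=> /schwartz_continuous[a b]; split; exact: continuous_measurable_rV.
Qed.
Lemma schwartz_cint k (u : 'rV[R]_k -> C) : schwartz u -> cintegrable (leb k) u.
Proof.
move=> su; have [B B0 uB] := schwartz_bound (k + k) su.
exact: cint_dom (schwartz_meas su) (rintZ B (rint_wt2 k)) uB.
Qed.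
End schwartz_space.

(** * Differentiation under the integral sign *)

Section derivation_under_integral.
Context {R : realType} d (T : measurableType d) (mu : {measure set T -> \bar R}).
Local Notation C := R[i].

Lemma rderive_under (f f' : R -> T -> R) (G : T -> R) :
  (forall t : R, -1 < t < 1 -> mu.-integrable setT (EFin \o f t)) ->
  (forall (t : R) y, -1 < t < 1 -> is_derive t 1 (f ^~ y) (f' t y)) ->
  mu.-integrable setT (EFin \o G) -> (forall (t : R) y, -1 < t < 1 -> `|f' t y| <= G y) ->
  is_derive (0 : R) 1 (fun t => \int[mu]_y f t y) (\int[mu]_y f' 0 y).
Proof.
move=> fint fd Gint fG.
have I0 : (-1 : R) < (0 : R) < (1 : R) by rewrite ltrN10 ltr01.
have Iin t : (`](-1 : R), 1[%classic : set R) t -> -1 < t < 1 by rewrite /= in_itv.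
have G0 y : 0 <= G y by exact: le_trans (normr_ge0 _) (fG 0 y I0).
have dE t y : -1 < t < 1 -> derive1 (f ^~ y) t = f' t y.
  by move=> /(fd t y)[_ <-]; rewrite derive1E.
have I0' : (`](-1 : R), 1[%classic : set R) 0 by rewrite /= in_itv.
have H1 t : (`](-1 : R), 1[%classic : set R) t -> mu.-integrable setT (EFin \o f t).
  by move=> /Iin; exact: fint.
have H2 t y : (`](-1 : R), 1[%classic : set R) t -> setT y -> derivable (f ^~ y) t 1.
  by move=> /Iin It _; have [] := fd t y It.
have H3 t y : (`](-1 : R), 1[%classic : set R) t -> setT y -> `|partial1of2 f t y| <= G y.
  by move=> /Iin It _; rewrite /partial1of2 dE // fG.
split.
  exact: (derivable_under_integral measurableT I0' H1 H2 G0 Gint H3).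
rewrite -derive1E (differentiation_under_integral measurableT I0' H1 H2 G0 Gint H3).
by apply: eq_Rintegral => y _; rewrite /partial1of2 dE.
Qed.

Lemma cderive_under (f f' : R -> T -> C) (G : T -> R) :
  (forall t : R, -1 < t < 1 -> cintegrable mu (f t)) ->
  (forall (t : R) y, -1 < t < 1 -> is_derive t 1 (fun t => Re (f t y)) (Re (f' t y)) /\
     is_derive t 1 (fun t => Im (f t y)) (Im (f' t y))) ->
  mu.-integrable setT (EFin \o G) -> (forall (t : R) y, -1 < t < 1 -> normc (f' t y) <= G y) ->
  is_derive (0 : R) 1 (fun t => Re (cintegral mu (f t))) (Re (cintegral mu (f' 0))) /\
  is_derive (0 : R) 1 (fun t => Im (cintegral mu (f t))) (Im (cintegral mu (f' 0))).
Proof.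
move=> fint fd Gint fG; split.
  apply: (@rderive_under (fun t y => Re (f t y)) (fun t y => Re (f' t y)) G) => //.
  - by move=> t /fint[].
  - by move=> t y /(fd t y)[].
  - by move=> t y It; exact: le_trans (normc_Re _) (fG t y It).
apply: (@rderive_under (fun t y => Im (f t y)) (fun t y => Im (f' t y)) G) => //.
- by move=> t /fint[].
- by move=> t y /(fd t y)[].
- by move=> t y It; exact: le_trans (normc_Im _) (fG t y It).
Qed.
End derivation_under_integral.

(** * Oscillatory integrals *)

(** With w = (q, s), the integrals are those over s of A(w L) exp(i w.wN / 2). The
    hypothesis on Pi says that the argument of A determines s when q = 0, which
    gives absolute convergence; the hypothesis on U and V says that w is a
    combination of the argument of A and of the derivative of the phase with
    respect to s, which gives decay in q. *)
Section oscillatory.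
Context {R : realType}.
Local Notation C := R[i].
Local Notation e_ i := (delta_mx ord0 i).
Local Notation ii := ((0 : R) +i* 1).
Variables (a e D : nat) (L : 'M[R]_(a + e, D)) (N : 'M[R]_(a + e)).
Variables (Pi : 'M[R]_(D, e)) (U : 'M[R]_(D, a + e)) (V : 'M[R]_(e, a + e)).
Hypothesis Nsym : N^T = N.
Hypothesis LPi : dsubmx L *m Pi = 1%:M.
Hypothesis nondeg : L *m U + rsubmx N *m V = 1%:M.

Definition osc_phase (w : 'rV[R]_(a + e)) : R := 2^-1 * rdot (w *m N) w.
Definition osc_term (A : 'rV[R]_D -> C) (w : 'rV[R]_(a + e)) : C :=
  A (w *m L) * cis (osc_phase w).
Definition osc_int (A : 'rV[R]_D -> C) (q : 'rV[R]_a) : C :=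
  cintegral (leb e) (fun s => osc_term A (row_mx q s)).
Let dosc i (A : 'rV[R]_D -> C) (w : 'rV[R]_(a + e)) : C :=
  (\sum_l (L i l)%:C * partial l A (w *m L)) * cis (osc_phase w) +
  A (w *m L) * (ii * ((w *m N) ord0 i)%:C * cis (osc_phase w)).

Let dphase i w : is_derive w (e_ i) osc_phase ((w *m N) ord0 i).
Proof.
apply: line_is_derive0.
have Nd v : rdot (e_ i *m N) v = (v *m N) ord0 i.
  by rewrite rdotC /rdot trmx_mul Nsym mulmxA trmx_delta -colE mxE.
have -> : (fun t => osc_phase (w + t *: e_ i)) =
   (fun t : R => (osc_phase w + t * (w *m N) ord0 i) + t ^+ 2 * (2^-1 * rdot (e_ i *m N) (e_ i))).
  apply/funext => t; rewrite /osc_phase mulmxDl -scalemxAl !rdotDl !rdotDr !rdotZl !rdotZr !Nd.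
  have -> : rdot (w *m N) (e_ i) = (w *m N) ord0 i by rewrite rdot_delta.
  by rewrite expr2; field.
have H1 := is_derive_affine (osc_phase w) ((w *m N) ord0 i) 0.
have H2 := is_deriveM (is_deriveX 2 (is_derive_id (0 : R) 1))
  (is_derive_cst (2^-1 * rdot (e_ i *m N) (e_ i)) (0 : R) 1).
apply: (is_derive_eq (is_deriveD H1 H2)).
by rewrite /GRing.scale /=; ring.
Qed.

Let term_partial i A : schwartz A -> is_partial i (osc_term A) (dosc i A).
Proof.
move=> sA; apply: is_partialM; last exact: is_partial_cis (dphase i).
apply: is_partial_ext (is_partial_pull L 0 i (schwartz_smooth sA)) => w; rewrite addr0 //.
Qed.

Let meas_phase : measurable_fun setT osc_phase.
Proof.
apply: measurable_funM; first exact: measurable_cst.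
under eq_fun do rewrite rdotE.
apply: measurable_sum => i; apply: measurable_funM; last exact: measurable_coord.
exact: measurableT_comp (measurable_coord i) (@measurable_mulmx _ _ _ N).
Qed.
Let meas_pull (A : 'rV[R]_D -> C) : schwartz A -> cmeasurable (fun w => A (w *m L)).
Proof. by move=> sA; exact: cmeas_comp (schwartz_meas sA) (@measurable_mulmx _ _ _ L). Qed.
Let meas_term A : schwartz A -> cmeasurable (osc_term A).
Proof. by move=> sA; apply: cmeasM; [exact: meas_pull|exact: cmeas_cis]. Qed.
Let meas_dosc i A : schwartz A -> cmeasurable (dosc i A).
Proof.
move=> sA; apply: cmeasD; apply: cmeasM.
- apply: cmeas_sum => l; apply: cmeasM; first exact: cmeas_cst.
  exact/meas_pull/schwartz_partial.
- exact: cmeas_cis.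
- exact: meas_pull.
- apply: cmeasM; last exact: cmeas_cis.
  apply: cmeasM; first exact: cmeas_cst.
  apply: (cmeasR (h := fun w => (w *m N) ord0 i)).
  exact: measurableT_comp (measurable_coord i) (@measurable_mulmx _ _ _ N).
Qed.
Let meas_row (q : 'rV[R]_a) : measurable_fun setT (fun s : 'rV[R]_e => row_mx q s).
Proof.
apply: (measurableT_comp (@measurable_row_mx R a e) (_ : measurable_fun setT (fun s => (q, s)))).
by apply/measurable_fun_pair => //; exact: measurable_cst.
Qed.

(* the fixed vector by which the phase space point is off-centre in s *)
Let ctr (q : 'rV[R]_a) : 'rV[R]_e := q *m (usubmx L *m Pi).
Let rowPi q s : row_mx q s *m L *m Pi = s + ctr q.
Proof.
rewrite -{1}(vsubmxK L) mul_row_col mulmxDl -!mulmxA LPi mulmx1 addrC.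
by rewrite /ctr.
Qed.

Let wt_center : exists2 K : R, 1 <= K &
  forall M q s, wt M (row_mx q s *m L) <= K ^+ M * wt M (s + ctr q).
Proof.
have [K K1 HK] := jp_mulmx Pi; exists K => // M q s.
have K0 : 0 < K by exact: lt_le_trans ltr01 K1.
rewrite /wt ler_pdivlMr ?jpX_gt0 // mulrC ler_pdivrMr ?jpX_gt0 // -exprMn.
by apply: lerXn2r; rewrite ?nnegrE ?mulr_ge0 // ?(ltW K0) // -rowPi.
Qed.

Let wt_q : exists2 K : R, 0 <= K & exists2 K' : R, 1 <= K' &
  forall M q s, wt M (row_mx q s *m L) <= (K * K') ^+ M * (japanese q ^+ M * wt M s).
Proof.
have [K K1 HK] := wt_center; have [K' K'1 HK'] := jp_mulmx (usubmx L *m Pi).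
have K0 : 0 <= K by exact: le_trans ler01 K1.
have K'0 : 0 <= K' by exact: le_trans ler01 K'1.
exists (K * 2); first by rewrite mulr_ge0.
exists K' => // M q s; apply: le_trans (HK M q s) _.
have := wt_sub M s (- ctr q); rewrite opprK jpN => H.
rewrite -mulrA exprMn -mulrA ler_wpM2l ?exprn_ge0 //; apply: le_trans H _.
rewrite exprMn -!mulrA ler_wpM2l ?exprn_ge0 // mulrA -exprMn ler_wpM2r //.
by apply: lerXn2r; rewrite ?nnegrE ?mulr_ge0 //; exact: HK'.
Qed.

Let term_bound A M : schwartz A -> exists2 B : R, 0 <= B &
  forall q s, normc (osc_term A (row_mx q s)) <= B * (japanese q ^+ M * wt M s).
Proof.
move=> sA; have [B B0 HB] := schwartz_bound M sA; have [K K0 [K' K'1 HK]] := wt_q.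
have K'0 : 0 <= K' by exact: le_trans ler01 K'1.
exists (B * (K * K') ^+ M); first by rewrite mulr_ge0 ?exprn_ge0 ?mulr_ge0.
move=> q s; rewrite normcM normc_cis mulr1 -mulrA.
by apply: le_trans (HB _) _; rewrite ler_wpM2l.
Qed.

Let dosc_split i A w : dosc i A w =
  osc_term (fun x => \sum_l (L i l)%:C * partial l A x) w +
  ii * ((w *m N) ord0 i)%:C * osc_term A w.
Proof. by rewrite /dosc /osc_term; ring. Qed.

Let dosc_bound i A M : schwartz A -> exists2 B : R, 0 <= B &
  forall q s, normc (dosc i A (row_mx q s)) <= B * (japanese q ^+ M.+2 * wt M s).
Proof.
move=> sA; have [B B0 HB] := term_bound M.+1 sA.
have sA' : schwartz (fun x => \sum_l (L i l)%:C * partial l A x).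
  by apply: schwartz_sum => l; exact: schwartz_partial.
have [B' B'0 HB'] := term_bound M.+1 sA'; have [K K1 HK] := jp_mulmx N.
have K0 : 0 <= K by exact: le_trans ler01 K1.
exists (B' + K * B); first by rewrite addr_ge0 ?mulr_ge0.
move=> q s; rewrite dosc_split mulrDl; apply: le_trans (le_normcD _ _) _; apply: lerD.
  apply: le_trans (HB' q s) _; rewrite ler_wpM2l //; apply: ler_pM; rewrite ?exprn_ge0 //.
    by rewrite [leRHS]exprSr ler_peMr ?exprn_ge0.
  exact: wt_le.
have i1 : normc ii = 1 :> R by rewrite /= expr0n expr1n add0r sqrtr1.
rewrite (normcM (ii * _)) (normcM ii) normcR i1 mul1r -mulrA.
apply: le_trans (_ : K * (japanese q * japanese s) * (B * (japanese q ^+ M.+1 * wt M.+1 s)) <= _).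
  apply: ler_pM; [exact: normr_ge0|exact: normc_ge0| |exact: HB].
  apply: le_trans (jp_coord _ _) _; apply: le_trans (HK _) _.
  by rewrite ler_wpM2l // jp_row.
rewrite -mulrA ler_wpM2l // mulrCA ler_wpM2l // mulrACA -exprS ler_wpM2l ?exprn_ge0 //.
by rewrite -addn1 addnC wtD mulrA /wt expr1 divff ?mul1r // gt_eqF.
Qed.

Let cint_term A q : schwartz A -> cintegrable (leb e) (fun s => osc_term A (row_mx q s)).
Proof.
move=> sA; have [B B0 HB] := term_bound (e + e) sA.
apply: (cint_dom (k := fun s => (B * japanese q ^+ (e + e)) * wt (e + e) s)).
- exact: cmeas_comp (meas_term sA) (meas_row q).
- exact: rintZ (rint_wt2 e).
- by move=> s; rewrite -mulrA.
Qed.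

Let cint_dosc i A q : schwartz A -> cintegrable (leb e) (fun s => dosc i A (row_mx q s)).
Proof.
move=> sA; have [B B0 HB] := dosc_bound i (e + e) sA.
apply: (cint_dom (k := fun s => (B * japanese q ^+ (e + e).+2) * wt (e + e) s)).
- exact: cmeas_comp (meas_dosc _ sA) (meas_row q).
- exact: rintZ (rint_wt2 e).
- by move=> s; rewrite -mulrA.
Qed.

Let jp_scale k (v : 'rV[R]_k) (t : R) : -1 < t < 1 -> japanese (t *: v) <= japanese v.
Proof.
move=> /andP[t1 t2]; rewrite -[leRHS]mul1r; apply: le_jp => //.
rewrite expr1n mul1r lerD2l rdotZl rdotZr mulrA ler_piMl ?rdot_ge0 //.
by nra.
Qed.

Let line_derive i A q : schwartz A ->
  is_derive (0 : R) 1 (fun t => Re (cintegral (leb e) (fun s => osc_term A (row_mx q s + t *: e_ i))))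
    (Re (cintegral (leb e) (fun s => dosc i A (row_mx q s)))) /\
  is_derive (0 : R) 1 (fun t => Im (cintegral (leb e) (fun s => osc_term A (row_mx q s + t *: e_ i))))
    (Im (cintegral (leb e) (fun s => dosc i A (row_mx q s)))).
Proof.
move=> sA; pose dq : 'rV[R]_a := lsubmx (e_ i); pose ds : 'rV[R]_e := rsubmx (e_ i).
have rowE s t : row_mx q s + t *: e_ i = row_mx (q + t *: dq) (s + t *: ds).
  by rewrite -add_row_mx -scale_row_mx hsubmxK.
have [B B0 HB] := dosc_bound i (e + e) sA.
have -> : (fun s => dosc i A (row_mx q s)) =
    (fun s => dosc i A (row_mx q s + 0 *: e_ i)).
  by apply/funext => s; rewrite scale0r addr0.
pose Q := 2 * (japanese q * japanese dq).
have Q0 : 0 <= Q by rewrite !mulr_ge0.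
apply: (cderive_under (f := fun t s => osc_term A (row_mx q s + t *: e_ i))
  (f' := fun t s => dosc i A (row_mx q s + t *: e_ i))
  (G := fun s => (B * (Q ^+ (e + e).+2 * (2 ^+ (e + e) * japanese ds ^+ (e + e)))) * wt (e + e) s)).
- move=> t It; have := cint_shift (t *: ds) (cint_term (q + t *: dq) sA).
  by congr (cintegrable _ _); apply/funext => s; rewrite rowE.
- move=> t s It.
  have := term_partial i sA (row_mx q s + t *: e_ i).
  by move=> [H1 H2]; split; apply: (line_is_derive (f := fun w => _ (osc_term A w))).
- exact: rintZ (rint_wt2 e).
- move=> t s It; rewrite rowE; apply: le_trans (HB _ _) _.
  rewrite -mulrA ler_wpM2l // -mulrA; apply: ler_pM; rewrite ?exprn_ge0 //.
    apply: lerXn2r; rewrite ?nnegrE //; apply: le_trans (jpD _ _) _.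
    by rewrite ler_wpM2l // ler_wpM2l // jp_scale.
  have := wt_sub (e + e) s (- (t *: ds)); rewrite opprK jpN => H.
  apply: le_trans H _; rewrite -mulrA ler_wpM2l ?exprn_ge0 // ler_wpM2r //.
  by apply: lerXn2r; rewrite ?nnegrE // jp_scale.
Qed.

(* integration by parts: a translation of s does not change the integral *)
Let dosc_right r A q : schwartz A ->
  cintegral (leb e) (fun s => dosc (rshift a r) A (row_mx q s)) = 0.
Proof.
move=> sA; have E (t : R) : cintegral (leb e)
    (fun s => osc_term A (row_mx q s + t *: e_ (rshift a r))) = osc_int A q.
  rewrite -[RHS](cintegral_shift (t *: e_ r) (cint_term q sA)).
  apply: eq_cintegral => s; congr osc_term.
  rewrite -[e_ (rshift a r)]hsubmxK.
  have -> : lsubmx (e_ (rshift a r) : 'rV[R]_(a + e)) = 0.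
    by apply/rowP => j; rewrite !mxE eq_lrshift.
  have -> : rsubmx (e_ (rshift a r) : 'rV[R]_(a + e)) = e_ r.
    by apply/rowP => j; rewrite !mxE eq_rshift.
  by rewrite scale_row_mx scaler0 add_row_mx addr0.
have FE (f : C -> R) : (fun t : R => f (cintegral (leb e)
    (fun s => osc_term A (row_mx q s + t *: e_ (rshift a r))))) = cst (f (osc_int A q)).
  by apply/funext => t; rewrite E.
have [] := line_derive (rshift a r) q sA.
rewrite (FE (@complex.Re R)) (FE (@complex.Im R)) => -[_ H1] [_ H2].
by apply: ReIm_inj; rewrite -?H1 -?H2 derive_cst.
Qed.

Let dosc_left j A : schwartz A ->
  is_partial j (osc_int A) (fun q => cintegral (leb e) (fun s => dosc (lshift e j) A (row_mx q s))).
Proof.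
move=> sA q; have := line_derive (lshift e j) q sA.
have E (t : R) : cintegral (leb e) (fun s => osc_term A (row_mx q s + t *: e_ (lshift e j))) =
    osc_int A (q + t *: e_ j).
  apply: eq_cintegral => s; congr osc_term; rewrite -[e_ (lshift e j)]hsubmxK.
  have -> : rsubmx (e_ (lshift e j) : 'rV[R]_(a + e)) = 0.
    by apply/rowP => i; rewrite !mxE eq_rlshift.
  have -> : lsubmx (e_ (lshift e j) : 'rV[R]_(a + e)) = e_ j.
    by apply/rowP => i; rewrite !mxE eq_lshift.
  by rewrite scale_row_mx scaler0 add_row_mx addr0.
move=> [H1 H2]; split; apply: line_is_derive0.
  by under eq_fun do rewrite -E.
by under eq_fun do rewrite -E.
Qed.

(* the amplitude whose oscillatory integral is multiplied by the i-th coordinate *)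
Let mult i (A : 'rV[R]_D -> C) (y : 'rV[R]_D) : C :=
  \sum_l (U l i)%:C * ((y ord0 l)%:C * A y) +
  \sum_r (ii * (V r i)%:C) * \sum_l (L (rshift a r) l)%:C * partial l A y.

Let schwartz_mult i A : schwartz A -> schwartz (mult i A).
Proof.
move=> sA; apply: schwartzD; apply: schwartz_sum => l; first exact: schwartz_coord.
by apply: schwartz_sum => r; exact: schwartz_partial.
Qed.

Let int_mult i A q : schwartz A ->
  cintegrable (leb e) (fun s => ((row_mx q s) ord0 i)%:C * osc_term A (row_mx q s)) /\
  cintegral (leb e) (fun s => ((row_mx q s) ord0 i)%:C * osc_term A (row_mx q s)) =
  osc_int (mult i A) q.
Proof.
move=> sA.
have sA' r : schwartz (fun y => \sum_l (L (rshift a r) l)%:C * partial l A y).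
  by apply: schwartz_sum => l; exact: schwartz_partial.
have E s : ((row_mx q s) ord0 i)%:C * osc_term A (row_mx q s) =
   osc_term (mult i A) (row_mx q s) +
   \sum_r (- (ii * (V r i)%:C)) * dosc (rshift a r) A (row_mx q s).
  set w := row_mx q s.
  have wE : w ord0 i = \sum_l U l i * (w *m L) ord0 l + \sum_r V r i * (w *m N) ord0 (rshift a r).
    have {1}-> : w = w *m L *m U + w *m rsubmx N *m V.
      by rewrite -!mulmxA -mulmxDr nondeg mulmx1.
    rewrite mxE; congr (_ + _); rewrite mxE; apply: eq_bigr => l _; first by rewrite mulrC.
    by rewrite mulrC; congr (_ * _); rewrite !mxE; apply: eq_bigr => p _; rewrite !mxE.
  rewrite wE rmorphD /= mulrDl /osc_term /mult mulrDl -addrA; congr (_ + _).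
    rewrite (rmorph_sum (real_complex R)) /= !mulr_suml; apply: eq_bigr => l _.
    by rewrite rmorphM /=; ring.
  rewrite (rmorph_sum (real_complex R)) /= !mulr_suml -big_split /=; apply: eq_bigr => r _.
  have i2 : ii * ii = -1 :> C by apply: ReIm_inj; rewrite /= ?mulr0 ?mul0r ?mulr1 ?sub0r ?addr0 ?oppr0.
  rewrite dosc_split /osc_term rmorphM /=.
  set S := \sum_(l < D) _.
  transitivity (- (ii * ii) * ((V r i)%:C * ((w *m N) ord0 (rshift a r))%:C * (A (w *m L) * cis (osc_phase w)))).
    by rewrite i2 opprK mul1r.
  by ring.
have I1 := cint_term q (schwartz_mult i sA).
have I2 r : cintegrable (leb e) (fun s => - (ii * (V r i)%:C) * dosc (rshift a r) A (row_mx q s)).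
  exact/cintZ/cint_dosc.
rewrite (funext E); split; first by apply: cintD => //; exact: cint_sum.
rewrite cintegralD //; last exact: cint_sum.
rewrite cintegral_sum // big1 ?addr0 // => r _.
by rewrite cintegralZ; [rewrite dosc_right // mulr0|exact: cint_dosc].
Qed.

(** Derivatives and coordinate multiplications of an oscillatory integral are
    again oscillatory integrals with the same phase: the coordinates of the
    parameter are combinations of the arguments of the amplitude and of the
    derivatives of the phase in the integration variables, and the latter are
    removed by an integration by parts. *)
Lemma schwartz_osc A : schwartz A -> schwartz (osc_int A).
Proof.
move=> sA; pose P f := exists2 A', schwartz A' & f = osc_int A'.
have oscD (I : Type) (r : seq I) (c : I -> C) (F : I -> 'rV[R]_D -> C) q : (forall i, schwartz (F i)) ->
   \sum_(i <- r) c i * osc_int (F i) q = osc_int (fun y => \sum_(i <- r) c i * F i y) q.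
  move=> sF; have CT i : cintegrable (leb e) (fun s => osc_term (F i) (row_mx q s)).
    exact: cint_term.
  transitivity (cintegral (leb e) (fun s => \sum_(i <- r) c i * osc_term (F i) (row_mx q s))).
    rewrite cintegral_sum => [|i]; last exact: cintZ.
    by apply: eq_bigr => i _; rewrite cintegralZ.
  by apply: eq_cintegral => s; rewrite /osc_term mulr_suml; apply: eq_bigr => i _; rewrite mulrA.
apply: (@schwartz_criterion _ _ P); last by exists A.
- move=> f [A' sA' ->]; have [K K1 HK] := wt_center.
  have [B B0 HB] := schwartz_bound (e + e) sA'.
  exists (2 * ((B * K ^+ (e + e)) * \int[leb e]_s wt (e + e) s)) => q.
  have [I3 E3] := rint_shift (ctr q) (rint_wt2 e).
  rewrite -E3 -RintegralZl //; apply: normc_cintegral.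
  + exact: cmeas_comp (meas_term sA') (meas_row q).
  + exact: rintZ I3.
  + move=> s; rewrite normcM normc_cis mulr1 -mulrA; apply: le_trans (HB _) _.
    by rewrite ler_wpM2l.
- move=> f j [A' sA' ->]; eexists; last exact: dosc_left.
  pose A1 x := \sum_l (L (lshift e j) l)%:C * partial l A' x.
  have sA1 : schwartz A1 by apply: schwartz_sum => l; exact: schwartz_partial.
  pose A2 x := \sum_p (ii * (N p (lshift e j))%:C) * mult p A' x.
  have sA2 : schwartz A2 by apply: schwartz_sum => l; exact: schwartz_mult.
  exists (fun x => A1 x + A2 x); first exact: schwartzD.
  apply/funext => q; rewrite /osc_int.
  transitivity (osc_int A1 q + osc_int A2 q); last first.
    rewrite /osc_int -cintegralD; try exact: cint_term.
    by apply: eq_cintegral => s; rewrite /osc_term mulrDl.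
  have -> : osc_int A2 q = \sum_p (ii * (N p (lshift e j))%:C) * osc_int (mult p A') q.
    by rewrite oscD // => p; exact: schwartz_mult.
  rewrite (eq_bigr (fun p => (ii * (N p (lshift e j))%:C) * cintegral (leb e)
    (fun s => ((row_mx q s) ord0 p)%:C * osc_term A' (row_mx q s)))); last first.
    by move=> p _; rewrite (int_mult p q sA').2.
  rewrite (eq_bigr (fun p => cintegral (leb e) (fun s => (ii * (N p (lshift e j))%:C) *
    (((row_mx q s) ord0 p)%:C * osc_term A' (row_mx q s))))); last first.
    by move=> p _; rewrite cintegralZ //; exact: (int_mult p q sA').1.
  rewrite -cintegral_sum => [|p]; last exact/cintZ/(int_mult p q sA').1.
  rewrite -cintegralD; first last.
  + by apply: cint_sum => p; exact/cintZ/(int_mult p q sA').1.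
  + exact: cint_term.
  apply: eq_cintegral => s; rewrite dosc_split; congr (_ + _).
  rewrite mxE (rmorph_sum (real_complex R)) /= mulr_sumr mulr_suml; apply: eq_bigr => p _.
  by rewrite rmorphM /=; ring.
- move=> f j [A' sA' ->]; exists (mult (lshift e j) A'); first exact: schwartz_mult.
  apply/funext => q; rewrite -(int_mult (lshift e j) q sA').2 /osc_int -cintegralZ; last exact: cint_term.
  by apply: eq_cintegral => s; rewrite row_mxEl.
Qed.
End oscillatory.

(** * Integral transforms of Schwartz functions *)

Section osc_instances.
Context {R : realType}.
Local Notation C := R[i].

Lemma mx_id (k : nat) (X : 'M[R]_k) : (forall w : 'rV[R]_k, w *m X = w) -> X = 1%:M.
Proof. by move=> H; apply/row_matrixP => i; rewrite rowE H rowE mulmx1. Qed.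

(** The form in which oscillatory integrals occur: the phase is a scalar product of
    two linear functions X and Y of (q, s). *)
Lemma schwartz_osc_fun a e D d (L : 'M[R]_(a + e, D)) (Xu Yu : 'M[R]_(a, d))
  (Xd Yd : 'M[R]_(e, d)) (Pi : 'M[R]_(D, e)) (U : 'M[R]_(D, a + e)) (V : 'M[R]_(e, a + e))
  (A : 'rV[R]_D -> C) (f : 'rV[R]_a -> C) :
  (forall s : 'rV[R]_e, (row_mx 0 s : 'rV[R]_(a + e)) *m L *m Pi = s) ->
  (forall (q : 'rV[R]_a) (s : 'rV[R]_e), row_mx q s *m L *m U +
    ((q *m Xu + s *m Xd) *m Yd^T + (q *m Yu + s *m Yd) *m Xd^T) *m V = row_mx q s) ->
  schwartz A ->
  (forall q, f q = cintegral (leb e) (fun s => A (row_mx q s *m L) *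
     cis (rdot (q *m Xu + s *m Xd) (q *m Yu + s *m Yd)))) ->
  schwartz f.
Proof.
move=> LP nd sA fE.
pose X := col_mx Xu Xd; pose Y := col_mx Yu Yd; pose N := X *m Y^T + Y *m X^T.
have -> : f = osc_int L N A.
  apply/funext => q; rewrite fE; apply: eq_cintegral => s; rewrite /osc_term; congr (_ * cis _).
  rewrite /osc_phase /N mulmxDr !mulmxA !mul_row_col.
  set x := _ + s *m Xd; set y := _ + s *m Yd.
  have E (z z' : 'rV[R]_d) (Z : 'M[R]_(a + e, d)) : row_mx q s *m Z = z' ->
      rdot (z *m Z^T) (row_mx q s) = rdot z z'.
    by move=> <-; rewrite /rdot trmx_mul mulmxA.
  rewrite [X in _ = _ * X]rdotDl (E x y Y) ?(E y x X) ?mul_row_col //.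
  by rewrite (rdotC y x); field.
apply: (@schwartz_osc R a e D L N Pi U V) => //.
- by rewrite /N linearD /= !trmx_mul !trmxK addrC.
- apply: mx_id => s; rewrite mulmxA -[RHS](LP s); congr (_ *m _).
  by rewrite -{2}(vsubmxK L) mul_row_col mul0mx add0r.
apply: mx_id => w; rewrite -(hsubmxK w) mulmxDr -[RHS]nd !mulmxA; congr (_ + _ *m _).
have -> (Z : 'rV[R]_(a + e)) (W : 'M[R]_(a + e)) : Z *m rsubmx W = rsubmx (Z *m W).
  by rewrite -{2}(hsubmxK W) mul_mx_row row_mxKr.
by rewrite /N mulmxDr !mulmxA !mul_row_col !tr_col_mx !mul_mx_row add_row_mx row_mxKr.
Qed.

Definition mxs := (mul_row_col, mul_mx_row, tr_col_mx, tr_row_mx, tr_scalar_mx, trmx0,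
  mul_mx_scalar, mulmx0, mul0mx, add_row_mx, row_mxKl, row_mxKr, scale_row_mx, opp_row_mx,
  addr0, add0r, oppr0, scale1r, scaler0).
Local Ltac rows := rewrite ?mxs;
  repeat (lazymatch goal with |- row_mx _ _ = row_mx _ _ => congr (row_mx _ _) end);
  (let i := fresh "i" in apply/rowP => i; rewrite ?mxE; by field).

Definition fourier k (F : 'rV[R]_k -> C) (eta : 'rV[R]_k) : C :=
  cintegral (leb k) (fun x => F x * cis (rdot eta x)).

Lemma schwartz_fourier k (F : 'rV[R]_k -> C) : schwartz F -> schwartz (fourier F).
Proof.
move=> sF.
apply: (@schwartz_osc_fun k k k k (col_mx 0 1%:M) 1%:M 0 0 1%:M 1%:M (row_mx 0 1%:M)
  (row_mx 1%:M 0) F) => //.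
- by move=> s; rows.
- by move=> q s; rows.
- by move=> q; apply: eq_cintegral => s; rewrite !mxs.
Qed.

Lemma schwartz_wigner k (u v : 'rV[R]_k -> C) : schwartz u -> schwartz v -> schwartz (wigner u v).
Proof.
move=> su sv; pose h : R := 2^-1.
apply: (@schwartz_osc_fun (k + k) k (k + k) k
  (col_mx (col_mx (row_mx 1%:M 1%:M) 0) (row_mx (- h)%:M h%:M))
  0 (col_mx 0 1%:M) 1%:M 0 (col_mx (-1)%:M 1%:M)
  (col_mx (row_mx (row_mx h%:M 0) (-1)%:M) (row_mx (row_mx h%:M 0) 1%:M))
  (row_mx (row_mx 0 1%:M) 0) _ _ _ _ (schwartz_tensor su sv)).
- by move=> s; rewrite /h; rows.
- by move=> q s; rewrite -(hsubmxK q) /h; rows.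
- move=> q; rewrite -(hsubmxK q) /wigner; apply: eq_cintegral => s; rewrite !mxs scaleNr.
  by rewrite -mulrA mulrC.
Qed.

(** Rapid decrease jointly in the position of the symbol and in the variable: the
    pieces of v cut out by remote translates of chi are small, which makes their
    sums over a lattice converge. *)
Lemma schwartz_weyl_transpose k (chi : 'rV[R]_(k + k) -> C) (v : 'rV[R]_k -> C) :
  schwartz chi -> schwartz v ->
  schwartz (fun w : 'rV[R]_((k + k) + k) => weyl_transpose (translate chi (lsubmx w)) v (rsubmx w)).
Proof.
move=> sc sv; apply: schwartzZ; pose h : R := 2^-1.
apply: (@schwartz_osc_fun ((k + k) + k) (k + k) ((k + k) + k) k
  (col_mx (col_mx (col_mx (row_mx (row_mx (-1)%:M 0) 0) (row_mx (row_mx 0 (-1)%:M) 0))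
                  (row_mx (row_mx h%:M 0) 0))
          (col_mx (row_mx (row_mx h%:M 0) 1%:M) (row_mx (row_mx 0 1%:M) 0)))
  (col_mx 0 (-1)%:M) 0 (col_mx 1%:M 0) (col_mx 0 1%:M)
  (col_mx (col_mx 0 (row_mx 0 1%:M)) (row_mx 1%:M 0))
  (col_mx (col_mx (row_mx (row_mx (row_mx (-1)%:M 0) 0) 0) (row_mx (row_mx (row_mx 0 (-1)%:M) 0) 0))
          (row_mx (row_mx (row_mx 1%:M 0) 1%:M) (row_mx 1%:M 0)))
  (col_mx (row_mx (row_mx (row_mx 0 1%:M) 0) (row_mx 0 1%:M))
          (row_mx (row_mx (row_mx (- h)%:M 0) (-1)%:M) 0))
  _ _ _ _ (schwartz_tensor sc sv)).
- by move=> s; rewrite -(hsubmxK s); rows.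
- move=> q s; rewrite -(hsubmxK s) -(hsubmxK q) -(hsubmxK (lsubmx q)) /h; rows.
- move=> q; apply: eq_cintegral => s; rewrite -(hsubmxK s) -(hsubmxK q) -(hsubmxK (lsubmx q)).
  rewrite !mxs /weyl_kernel /translate !mxs.
  move: (lsubmx s) (rsubmx s) (lsubmx (lsubmx q)) (rsubmx (lsubmx q)) (rsubmx q) => x th s1 s2 p.
  rewrite -mulrA mulrC -/(cis _); congr (chi _ * v x * cis (rdot _ th)); first by rewrite /h; rows.
  by rows.
  Fail idtac.
Qed.

(** The short-time Fourier transform of F with window h, which measures the part of F
    near the phase space point rho. *)
Definition stft k (h F : 'rV[R]_k -> C) (rho : 'rV[R]_(k + k)) : C :=
  cintegral (leb k) (fun s => F s * (cis (rdot (rsubmx rho) s) * (h (s - lsubmx rho))^*%C)).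

Lemma schwartz_stft_param a d (Th : 'rV[R]_(a + d) -> C) (h : 'rV[R]_d -> C) :
  schwartz Th -> schwartz h ->
  schwartz (fun q : 'rV[R]_(a + (d + d)) =>
    stft h (fun s => Th (row_mx (lsubmx q) s)) (rsubmx q)).
Proof.
move=> sT sh.
apply: (@schwartz_osc_fun (a + (d + d)) d ((a + d) + d) d
  (col_mx (col_mx (row_mx (row_mx 1%:M 0) 0) (col_mx (row_mx 0 (-1)%:M) 0))
          (row_mx (row_mx 0 1%:M) 1%:M))
  0 (col_mx 0 (col_mx 0 1%:M)) 1%:M 0
  (col_mx (col_mx 0 1%:M) 0)
  (col_mx (col_mx (row_mx (row_mx 1%:M 0) 0) (row_mx (row_mx 0 (row_mx 1%:M 0)) 1%:M))
          (row_mx (row_mx 0 (row_mx (-1)%:M 0)) 0))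
  (row_mx (row_mx 0 (row_mx 0 1%:M)) 0)
  _ _ _ _ (schwartz_tensor sT (schwartzJ sh))).
- by move=> s; rows.
- by move=> q s; rewrite -(hsubmxK q) -(hsubmxK (rsubmx q)); rows.
- move=> q; apply: eq_cintegral => s; rewrite -(hsubmxK q) -(hsubmxK (rsubmx q)) !mxs.
  move: (lsubmx q) (lsubmx (rsubmx q)) (rsubmx (rsubmx q)) => x y eta.
  by rewrite (rdotC s) (mulrC (cis _)) mulrA; congr (_ * (h _)^*%C * _); rows.
Qed.

(** The integral in the integration variable of the Weyl quantization at fixed
    frequency; its joint decay allows the sum over the lattice to be taken inside
    the frequency integral. *)
Lemma schwartz_partial_fourier k (chi : 'rV[R]_(k + k) -> C) (F : 'rV[R]_k -> C) :
  schwartz chi -> schwartz F ->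
  schwartz (fun q : 'rV[R]_((k + k) + k) => cintegral (leb k) (fun x =>
    F x * (chi (row_mx (2^-1 *: x + lsubmx (lsubmx q)) (rsubmx (lsubmx q) - rsubmx q)) *
      cis (rdot (rsubmx (lsubmx q)) x)))).
Proof.
move=> sc sF; pose h : R := 2^-1.
apply: (@schwartz_osc_fun ((k + k) + k) k ((k + k) + k) k
  (col_mx (col_mx (col_mx (row_mx (row_mx 1%:M 0) 0) (row_mx (row_mx 0 1%:M) 0))
                  (row_mx (row_mx 0 (-1)%:M) 0))
          (row_mx (row_mx h%:M 0) 1%:M))
  0 (col_mx (col_mx 0 1%:M) 0) 1%:M 0
  (col_mx 0 1%:M)
  (col_mx (col_mx (row_mx (row_mx (row_mx 1%:M 0) 0) 0) (row_mx (row_mx 0 (-1)%:M) 0))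
          (row_mx (row_mx (row_mx (- h)%:M 0) 0) 1%:M))
  (row_mx (row_mx (row_mx 0 1%:M) 1%:M) 0)
  _ _ _ _ (schwartz_tensor sc sF)).
- by move=> s; rows.
- by move=> q s; rewrite -(hsubmxK q) -(hsubmxK (lsubmx q)) /h; rows.
- move=> q; apply: eq_cintegral => s; rewrite -(hsubmxK q) -(hsubmxK (lsubmx q)) !mxs.
  move: (lsubmx (lsubmx q)) (rsubmx (lsubmx q)) (rsubmx q) => P th s2.
  rewrite (rdotC s) mulrA (mulrC (F s)); congr (chi _ * F s * _); rewrite /h; rows.
Qed.
End osc_instances.

(** * Gaussians *)

Section gaussian.
Context {R : realType}.
Local Notation C := R[i].
Local Notation e_ i := (delta_mx ord0 i).
Local Notation ii := ((0 : R) +i* 1).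

Lemma continuous_qform k (B : 'M[R]_k) : continuous (fun t : 'rV[R]_k => rdot (t *m B) t).
Proof.
have -> : (fun t : 'rV[R]_k => rdot (t *m B) t) =
    (fun t => \sum_i (\sum_j t ord0 j * B j i) * t ord0 i).
  by apply/funext => t; rewrite rdotE; apply: eq_bigr => i _; rewrite mxE.
apply: continuous_sum_rV => i x; apply: continuousM; last exact: coord_continuous.
apply: (@continuous_sum_rV R k _ _ (fun j (x : 'rV[R]_k) => x ord0 j * B j i)) => j {}x.
by apply: continuousM; [exact: coord_continuous|exact: cst_continuous].
Qed.

(** A positive definite form is bounded below on the unit sphere, which is compact. *)
Lemma posdef_lower k (B : 'M[R]_k) : (forall y : 'rV[R]_k, y != 0 -> 0 < rdot (y *m B) y) ->
  exists2 c : R, 0 < c & forall t : 'rV[R]_k, c * rdot t t <= rdot (t *m B) t.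
Proof.
move=> pB; pose A := [set t : 'rV[R]_k | rdot t t = 1].
have z0 (t : 'rV[R]_k) : t = 0 -> rdot t t = 0 by move=> ->; rewrite rdot0l.
have pos (t : 'rV[R]_k) : t != 0 -> 0 < rdot t t.
  move=> t0; rewrite lt_neqAle rdot_ge0 andbT eq_sym; apply: contra t0.
  rewrite rdotE psumr_eq0 => [|i _]; last exact: mulr_ge0 (sqr_ge0 _) || exact: sqr_ge0.
  move=> /allP H; apply/eqP/rowP => i; rewrite mxE.
  by have := H i (mem_index_enum i); rewrite /= mulf_eq0 orbb => /eqP.
have nrm (t : 'rV[R]_k) : t != 0 -> A ((Num.sqrt (rdot t t))^-1 *: t).
  move=> t0; rewrite /A /= rdotZl rdotZr mulrA -invfM -expr2 sqr_sqrtr ?rdot_ge0 //.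
  by rewrite mulVf // gt_eqF // pos.
have scl (t : 'rV[R]_k) (c : R) : (forall u, A u -> c <= rdot (u *m B) u) ->
    c * rdot t t <= rdot (t *m B) t.
  move=> H; have [->|t0] := eqVneq t 0; first by rewrite mul0mx !rdot0l mulr0.
  have := H _ (nrm t t0); rewrite -scalemxAl rdotZl rdotZr mulrA -invfM -expr2.
  rewrite sqr_sqrtr ?rdot_ge0 // => H1.
  by rewrite -ler_pdivlMr ?pos // mulrC.
have [A0|/set0P/negP] := pselect (A !=set0); last first.
  rewrite negbK => /eqP A0; exists 1 => // t; apply: scl => u; by rewrite A0.
have cA : compact A.
  apply: bounded_closed_compact.
    rewrite /bounded_set; exists 1; split => // x x1 t At; apply: le_trans (ltW x1).
    have [->|t0] := eqVneq `|t| 0; first exact: ler01.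
    have [[i j] /= E] := mx_norm_neq0 t0.
    have -> : `|t| = `|t i j| by exact: E.
    rewrite (ord1 i) -sqrtr_sqr -(sqrtr1 R) ler_sqrt // -At rdotE (bigD1 j) //= expr2 lerDl.
    by apply: sumr_ge0 => l _; exact: sqr_ge0.
  exact: ((continuous_closedP _).1 (@continuous_rdot R k) _ (@closed_eq R 1)).
have [c cA1 cmin] := EVT_min_rV A0 cA (continuous_subspaceT (@continuous_qform k B)).
exists (rdot (c *m B) c).
  apply: pB; apply/eqP => /z0; move: cA1; rewrite inE /A /= => -> /eqP; by rewrite oner_eq0.
by move=> t; apply: scl => u Au; apply: cmin; rewrite inE.
Qed.

Lemma expR_decay k (c : R) N : 0 < c -> exists2 K : R, 0 <= K &
  forall t : 'rV[R]_k, expR (- (c * rdot t t)) <= K * wt N t.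
Proof.
move=> c0; case: N => [|N].
  exists 1 => // t; rewrite /wt expr0 invr1 mulr1 -[leRHS](expR0 R) ler_expR oppr_le0.
  by rewrite mulr_ge0 ?rdot_ge0 // ltW.
pose d := Num.min 1 (c / N.+1%:R).
have d0 : 0 < d by rewrite lt_min ltr01 divr_gt0.
exists (d^-1 ^+ N.+1); first by rewrite exprn_ge0 // invr_ge0 ltW.
move=> t; rewrite expRN /wt -exprVn -exprMn.
have -> : expR (c * rdot t t) = expR (c / N.+1%:R * rdot t t) ^+ N.+1.
  by rewrite -expRM_natl; congr expR; field.
rewrite -exprVn; apply: lerXn2r; rewrite ?nnegrE ?invr_ge0 ?expR_ge0 //.
  by rewrite mulr_ge0 // invr_ge0 // ltW.
rewrite -invfM lef_pV2 ?posrE ?expR_gt0 ?mulr_gt0 //.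
apply: le_trans (expR_ge1Dx _); have jr : japanese t <= 1 + rdot t t.
  by rewrite -jp_sq expr2 ler_peMr.
have r0 := rdot_ge0 t; apply: le_trans (ler_wpM2l (ltW d0) jr) _.
rewrite mulrDr mulr1; apply: lerD; first by rewrite ge_min lexx.
by rewrite ler_wpM2r // ge_min lexx orbT.
Qed.

(** The exponential of i/2 times the quadratic form of A + iB. *)
Definition gauss k (A B : 'M[R]_k) (t : 'rV[R]_k) : C :=
  (expR (- (2^-1 * rdot (t *m B) t)))%:C * cis (2^-1 * rdot (t *m A) t).

(** The derivatives of a Gaussian are its products with polynomials. *)
Inductive polyf k : ('rV[R]_k -> C) -> Prop :=
| polyf_cst c : polyf (fun=> c)
| polyf_coord i p : polyf p -> polyf (fun x : 'rV[R]_k => (x ord0 i)%:C * p x)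
| polyf_add p q : polyf p -> polyf q -> polyf (fun x => p x + q x).

Lemma polyf_scale k c (p : 'rV[R]_k -> C) : polyf p -> polyf (fun x => c * p x).
Proof.
elim=> [c'|i q pq IH|q q' _ IH _ IH']; first exact: polyf_cst.
  rewrite [X in polyf X](_ : _ = fun x : 'rV[R]_k => (x ord0 i)%:C * (c * q x)).
    exact: polyf_coord.
  by apply/funext => x; rewrite mulrCA.
rewrite [X in polyf X](_ : _ = fun x => c * q x + c * q' x); first exact: polyf_add.
by apply/funext => x; rewrite mulrDr.
Qed.

Lemma polyf_sum k (I : Type) (r : seq I) (F : I -> 'rV[R]_k -> C) :
  (forall i, polyf (F i)) -> polyf (fun x => \sum_(i <- r) F i x).
Proof.
move=> pF; elim: r => [|i r IH].
  by rewrite [X in polyf X](_ : _ = fun=> 0); [exact: polyf_cst|apply/funext => x; rewrite big_nil].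
rewrite [X in polyf X](_ : _ = fun x => F i x + \sum_(j <- r) F j x); first exact: polyf_add.
by apply/funext => x; rewrite big_cons.
Qed.

Lemma polyf_bound k (p : 'rV[R]_k -> C) : polyf p -> exists N (B : R),
  forall x, normc (p x) <= B * japanese x ^+ N.
Proof.
elim=> [c|i q _ [N [B HB]]|q q' _ [N [B HB]] _ [N' [B' HB']]].
- by exists 0%N, (normc c) => x; rewrite expr0 mulr1.
- exists N.+1, B => x; rewrite normcM normcR exprS mulrCA.
  by apply: ler_pM => //; [exact: normc_ge0|exact: jp_coord].
exists (N + N')%N, (`|B| + `|B'|) => x; apply: le_trans (le_normcD _ _) _; rewrite mulrDl.
have X0 M (b : R) : b * japanese x ^+ M <= `|b| * japanese x ^+ M.
  by rewrite ler_wpM2r ?exprn_ge0 // ler_norm.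
apply: lerD; [apply: le_trans (HB x) _|apply: le_trans (HB' x) _]; apply: le_trans (X0 _ _) _;
  by rewrite ler_wpM2l // ler_weXn2l ?jp_ge1 // ?leq_addr ?leq_addl.
Qed.

Lemma polyf_partial k i (p : 'rV[R]_k -> C) : polyf p -> exists2 q, polyf q & is_partial i p q.
Proof.
elim=> [c|j q pq [q1 pq1 d1]|q q' _ [q1 pq1 d1] _ [q2 pq2 d2]].
- by exists (fun=> 0); [exact: polyf_cst|exact: is_partial_cst].
- eexists; last exact: is_partialM (is_partial_coord i j) d1.
  apply: polyf_add; [exact: polyf_scale|exact: polyf_coord].
- by eexists; last exact: is_partialD d1 d2; exact: polyf_add.
Qed.

Lemma is_derive_qform k (B : 'M[R]_k) i (w : 'rV[R]_k) : B^T = B ->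
  is_derive w (e_ i) (fun w => 2^-1 * rdot (w *m B) w) ((w *m B) ord0 i).
Proof.
move=> Bs; apply: line_is_derive0.
have Nd v : rdot (e_ i *m B) v = (v *m B) ord0 i.
  by rewrite rdotC /rdot trmx_mul Bs mulmxA trmx_delta -colE mxE.
have -> : (fun t => 2^-1 * rdot ((w + t *: e_ i) *m B) (w + t *: e_ i)) =
   (fun t : R => (2^-1 * rdot (w *m B) w + t * (w *m B) ord0 i) +
      t ^+ 2 * (2^-1 * rdot (e_ i *m B) (e_ i))).
  apply/funext => t; rewrite mulmxDl -scalemxAl !rdotDl !rdotDr !rdotZl !rdotZr !Nd.
  by rewrite rdot_delta expr2; field.
have H1 := is_derive_affine (2^-1 * rdot (w *m B) w) ((w *m B) ord0 i) 0.
have H2 := is_deriveM (is_deriveX 2 (is_derive_id (0 : R) 1))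
  (is_derive_cst (2^-1 * rdot (e_ i *m B) (e_ i)) (0 : R) 1).
apply: (is_derive_eq (is_deriveD H1 H2)).
by rewrite /GRing.scale /=; ring.
Qed.

Lemma gauss_partial k (A B : 'M[R]_k) i : A^T = A -> B^T = B ->
  is_partial i (gauss A B) (fun t => (- ((t *m B) ord0 i)%:C + ii * ((t *m A) ord0 i)%:C) * gauss A B t).
Proof.
move=> As Bs; have H1 : is_partial i (fun t : 'rV[R]_k => (expR (- (2^-1 * rdot (t *m B) t)))%:C)
   (fun t => (- (t *m B) ord0 i * expR (- (2^-1 * rdot (t *m B) t)))%:C).
  apply: is_partialR => x; have H := is_deriveN (is_derive_qform i x Bs).
  apply: line_is_derive0.
  have K : is_derive (0 : R) 1 (fun t : R => - (2^-1 * rdot ((x + t *: e_ i) *m B) (x + t *: e_ i)))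
      (- (x *m B) ord0 i).
    apply: (line_is_derive (f := fun w : 'rV[R]_k => - (2^-1 * rdot (w *m B) w))).
    by rewrite scale0r addr0.
  have E := is_derive_expR (- (2^-1 * rdot ((x + (0 : R) *: e_ i) *m B) (x + (0 : R) *: e_ i))).
  have := @is_derive1_comp _ _ (fun t : R => - (2^-1 * rdot ((x + t *: e_ i) *m B) (x + t *: e_ i))) _ _ _ E K.
  by move=> H'; apply: (is_derive_eq H'); rewrite scale0r addr0 mulrC.
have H2 := is_partial_cis (fun x => is_derive_qform i x As).
apply: is_partial_ext (is_partialM H1 H2) => t //.
by rewrite /gauss rmorphM rmorphN /=; ring.
Qed.

Lemma schwartz_gauss k (A B : 'M[R]_k) : A^T = A -> B^T = B ->
  (forall y : 'rV[R]_k, y != 0 -> 0 < rdot (y *m B) y) -> schwartz (gauss A B).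
Proof.
move=> As Bs pB; have [c c0 Hc] := posdef_lower pB.
have lin (M : 'M[R]_k) i : polyf (fun t : 'rV[R]_k => ((t *m M) ord0 i)%:C).
  rewrite [X in polyf X](_ : _ = fun t : 'rV[R]_k => \sum_j (t ord0 j)%:C * (M j i)%:C).
    by apply: polyf_sum => j; apply: polyf_coord; exact: polyf_cst.
  apply/funext => t; rewrite mxE (rmorph_sum (real_complex R)).
  by apply: eq_bigr => j _; rewrite rmorphM.
have mul p q : @polyf k p -> polyf q -> polyf (fun x => p x * q x).
  move=> pp pq; elim: pp => [z|i p1 _ IH|p1 p2 _ IH1 _ IH2]; first exact: polyf_scale.
    rewrite [X in polyf X](_ : _ = fun x : 'rV[R]_k => (x ord0 i)%:C * (p1 x * q x)).
      exact: polyf_coord.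
    by apply/funext => x; rewrite mulrA.
  rewrite [X in polyf X](_ : _ = fun x => p1 x * q x + p2 x * q x); first exact: polyf_add.
  by apply/funext => x; rewrite mulrDl.
apply: (@schwartz_criterion R k (fun f => exists2 p, polyf p & f = (fun x => p x * gauss A B x))).
- move=> _ [p pp ->]; have [N [M HM]] := polyf_bound pp.
  have [K K0 HK] := expR_decay k N (divr_gt0 c0 (ltr0n _ 2)); exists (`|M| * K) => x.
  rewrite normcM /gauss normcM normc_cis mulr1 normcR ger0_norm ?expR_ge0 //.
  have -> : `|M| * K = (`|M| * japanese x ^+ N) * (K * wt N x) by rewrite mulrACA wtK mulr1.
  apply: ler_pM; rewrite ?normc_ge0 ?expR_ge0 //.
    by apply: le_trans (HM x) _; rewrite ler_wpM2r ?exprn_ge0 // ler_norm.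
  apply: le_trans _ (HK x); rewrite ler_expR lerN2.
  by rewrite mulrAC (mulrC _ 2^-1) ler_wpM2l.
- move=> _ i [p pp ->]; have [q pq d] := polyf_partial i pp.
  eexists; last exact: is_partialM d (gauss_partial i As Bs).
  exists (fun x => q x + p x * (- ((x *m B) ord0 i)%:C + ii * ((x *m A) ord0 i)%:C)); last first.
    by apply/funext => x; ring.
  apply: polyf_add => //; apply: mul => //; apply: polyf_add; last exact: polyf_scale.
  rewrite [X in polyf X](_ : _ = fun x : 'rV[R]_k => (-1) * ((x *m B) ord0 i)%:C).
    exact: polyf_scale.
  by apply/funext => x; rewrite mulN1r.
- move=> _ i [p pp ->]; exists (fun x : 'rV[R]_k => (x ord0 i)%:C * p x); first exact: polyf_coord.
  by apply/funext => x; rewrite mulrA.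
- exists (fun=> 1); first exact: polyf_cst.
  by apply/funext => x; rewrite mul1r.
Qed.
End gaussian.

(** * Fourier inversion and the Gabor transform *)

Section fourier_inversion.
Context {R : realType}.
Local Notation C := R[i].

Lemma cJM (x y : C) : (x * y)^*%C = x^*%C * y^*%C.
Proof. exact: rmorphM. Qed.

Lemma schwartz_rint k (u : 'rV[R]_k -> C) : schwartz u ->
  (leb k).-integrable setT (EFin \o (fun x => normc (u x))).
Proof. by move=> su; apply: cint_normc; exact: schwartz_cint. Qed.

Lemma mul_conj_normc (z : C) : z * z^*%C = (normc z ^+ 2)%:C.
Proof. by apply: ReIm_inj; rewrite ?cReM ?cImM ?cReJ ?cImJ /= ?normc_sq; ring. Qed.

(** A continuous nonnegative function which is positive somewhere has a positive
    integral. *)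
Lemma int_normc_sq_neq0 k (u : 'rV[R]_k -> C) x0 : schwartz u -> u x0 != 0 ->
  cintegral (leb k) (fun x => u x * (u x)^*%C) != 0.
Proof.
move=> su u0; have su2 := schwartzM su (schwartzJ su).
pose f x := normc (u x) ^+ 2.
have uE : (fun x => u x * (u x)^*%C) = (fun x => (f x)%:C).
  by apply/funext => x; exact: mul_conj_normc.
have f0 x : 0 <= f x by exact: sqr_ge0.
have fx0 : 0 < f x0.
  rewrite /f exprn_gt0 // lt_neqAle normc_ge0 andbT eq_sym.
  by apply: contra u0 => /eqP H; apply/eqP; exact: eq0_normc.
have cf : continuous f.
  have [c1 c2] := schwartz_continuous su2; have -> : f = fun x => Re (u x * (u x)^*%C).
    by apply/funext => x; rewrite mul_conj_normc.
  exact: c1.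
have If : (leb k).-integrable setT (EFin \o f).
  have := (schwartz_cint su2).1; congr (_.-integrable _ _); apply/funext => x /=.
  by rewrite mul_conj_normc.
pose e := f x0 / 2; have e0 : 0 < e by rewrite divr_gt0.
have : nbhs x0 (fun y => e < f y).
  have := cf x0 => /(cvgr_gt _); apply.
  by rewrite /e ltr_pdivrMr // mulr_natr mulr2n ltrDr.
move=> /nbhs_ballP[r /= r0 Hr].
pose a : 'rV[R]_k := x0 - const_mx (r / 2); pose b : 'rV[R]_k := x0 + const_mx (r / 2).
have ab i : a ord0 i <= b ord0 i by rewrite !mxE lerD2l; lra.
pose B := [set v : 'rV[R]_k | forall i, a ord0 i <= v ord0 i <= b ord0 i].
have BE v : B v -> e < f v.
  move=> Bv; apply: Hr; rewrite -ball_normE /= /ball_ /=.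
  have [->|t0] := eqVneq `|x0 - v| 0; first exact: r0.
  have [[i j] /= E] := mx_norm_neq0 t0.
  have -> : `|x0 - v| = `|(x0 - v) i j| by exact: E.
  by rewrite (ord1 i); have := Bv j; rewrite !mxE ltr_norml => /andP[H1 H2]; apply/andP; split; lra.
have I0 : 0 < \int[leb k]_x f x.
  have mf := measurable_int _ If.
  have H := @le_integral_comp_abse _ _ _ (leb k) setT measurableT (EFin \o f) e id
    (@measurable_id _ _ _) (fun _ h => h) (fun _ _ _ _ h => h) mf e0.
  have IE : (\int[leb k]_x `|(EFin \o f) x| = (\int[leb k]_x f x)%:E)%E.
    rewrite /Rintegral fineK; last exact: integrable_fin_num.
    by apply: eq_integral => x _; rewrite /= ger0_norm.
  rewrite setTI IE in H; rewrite -lte_fin; apply: lt_le_trans H.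
  rewrite mule_gt0 // ?lte_fin //.
  apply: (@lt_le_trans _ _ (leb k B)).
    rewrite rV_lebesgue_box // lte_fin; apply: prodr_gt0 => i _; rewrite !mxE; lra.
  apply: le_measure; rewrite ?inE.
  - exact: (measurable_box (fun i => a ord0 i) (fun i => b ord0 i)).
  - rewrite -[X in measurable X]setTI; apply: emeasurable_fun_c_infty => //.
    exact: measurableT_comp.
  - by move=> v /BE /ltW; rewrite /= lee_fin ger0_norm.
rewrite uE; apply/eqP => /(congr1 (@complex.Re R)); rewrite /cintegral /= => H.
by move: I0; rewrite H ltxx.
Qed.

Lemma measurable_rVD d (T : measurableType d) k (f g : T -> 'rV[R]_k) :
  measurable_fun setT f -> measurable_fun setT g -> measurable_fun setT (fun x => f x + g x).
Proof.
move=> mf mg; apply/measurable_fun_rVP => i; under eq_fun do rewrite mxE.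
by apply: measurable_funD; apply: (measurableT_comp (measurable_coord i)).
Qed.

Lemma measurable_rVZ d (T : measurableType d) k (c : R) (f : T -> 'rV[R]_k) :
  measurable_fun setT f -> measurable_fun setT (fun x => c *: f x).
Proof.
move=> mf; apply/measurable_fun_rVP => i; under eq_fun do rewrite mxE.
by apply: measurable_funM; [exact: measurable_cst|apply: (measurableT_comp (measurable_coord i))].
Qed.

Lemma measurable_rVN d (T : measurableType d) k (f : T -> 'rV[R]_k) :
  measurable_fun setT f -> measurable_fun setT (fun x => - f x).
Proof. by move=> mf; under eq_fun do rewrite -scaleN1r; exact: measurable_rVZ. Qed.

Lemma measurable_rdot d (T : measurableType d) k (f g : T -> 'rV[R]_k) :
  measurable_fun setT f -> measurable_fun setT g -> measurable_fun setT (fun x => rdot (f x) (g x)).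
Proof.
move=> mf mg; under eq_fun do rewrite rdotE.
apply: measurable_sum => i.
by apply: measurable_funM; apply: (measurableT_comp (measurable_coord i)).
Qed.

Lemma dilation k (e : R) : e != 0 -> exists c c' : R, [/\ c * c' = 1,
  forall f : 'rV[R]_k -> C, cintegrable (leb k) f -> cintegrable (leb k) (fun x => f (e *: x)) /\
     cintegral (leb k) (fun x => f (e *: x)) = c%:C * cintegral (leb k) f &
  forall f : 'rV[R]_k -> C, cintegrable (leb k) f -> cintegrable (leb k) (fun x => f (e^-1 *: x)) /\
     cintegral (leb k) (fun x => f (e^-1 *: x)) = c'%:C * cintegral (leb k) f].
Proof.
move=> e0; have U (r : R) : r != 0 -> (r%:M : 'M[R]_k) \in unitmx.
  by move=> r0; rewrite unitmxE det_scalar unitrX // unitfE.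
have [c c0 Hc] := leb_linear (U _ e0); have [c' c'0 Hc'] := leb_linear (U _ (invr_neq0 e0)).
have fE (r : R) (f : 'rV[R]_k -> C) : (fun x => f (r *: x)) = (fun x => f (x *m r%:M)).
  by apply/funext => x; rewrite mul_mx_scalar.
exists c, c'; split.
- have mU := @measurable_unit_box R k; have lU := @leb_unit_box R k.
  have mU' : measurable ((fun x : 'rV[R]_k => x *m (e^-1)%:M) @^-1` @unit_box R k).
    by rewrite -[X in measurable X]setTI; exact: measurable_mulmx.
  have := Hc _ mU'; rewrite (Hc' _ mU) lU.
  rewrite [X in leb k X](_ : _ = @unit_box R k) ?lU.
    by rewrite mule1 -EFinM => -[<-].
  by apply/funext => x /=; rewrite -mulmxA -scalar_mxM divff // mulmx1.
- move=> f If; rewrite fE; split.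
    exact: (cint_change (@measurable_mulmx R k k _) (ltW c0) Hc If).
  exact: (cintegral_change (@measurable_mulmx R k k _) (ltW c0) Hc If).
- move=> f If; rewrite fE; split.
    exact: (cint_change (@measurable_mulmx R k k _) (ltW c'0) Hc' If).
  exact: (cintegral_change (@measurable_mulmx R k k _) (ltW c'0) Hc' If).
Qed.

Lemma ccvg_dilate k (u : 'rV[R]_k -> C) x p : schwartz u ->
  ccvg (fun j => u (j.+1%:R^-1 *: x + p)) (u p).
Proof.
move=> su; have [c1 c2] := schwartz_continuous su.
have H : (fun j => (j.+1%:R^-1 : R) *: x + p) @ \oo --> (0 : R) *: x + p.
  apply: cvgD; last exact: cvg_cst.
  by apply: cvgZr_tmp; exact: cvg_harmonic.
rewrite scale0r add0r in H.
by split; apply: (@continuous_cvg _ _ _ _ _ _ (fun y => _ (u y)) _ _ H); [exact: c1|exact: c2].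
Qed.

Definition gauss1 k : 'rV[R]_k -> C := gauss 0 1%:M.

Lemma schwartz_gauss_scalar k (c : R) : 0 < c -> schwartz (@gauss R k 0 c%:M).
Proof.
move=> c0; apply: schwartz_gauss; rewrite ?trmx0 ?tr_scalar_mx // => y y0.
rewrite mul_mx_scalar rdotZl mulr_gt0 // lt_neqAle rdot_ge0 andbT eq_sym.
apply: contra y0; rewrite rdotE psumr_eq0 => [|i _]; last exact: sqr_ge0.
move=> /allP H; apply/eqP/rowP => i; rewrite mxE.
by have := H i (mem_index_enum i); rewrite /= mulf_eq0 orbb => /eqP.
Qed.

Lemma schwartz_gauss1 k : schwartz (@gauss1 k).
Proof. exact: schwartz_gauss_scalar. Qed.

Lemma gauss1_0 k : @gauss1 k 0 = 1.
Proof. by rewrite /gauss1 /gauss !mul0mx !rdot0l mulr0 oppr0 expR0 cis0 mulr1. Qed.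

Lemma normc_gauss1_le1 k x : normc (@gauss1 k x) <= 1.
Proof.
rewrite /gauss1 /gauss normcM normc_cis mulr1 normcR ger0_norm ?expR_ge0 //.
by rewrite -[leRHS](expR0 R) ler_expR oppr_le0 mulmx1 mulr_ge0 ?rdot_ge0.
Qed.

Let K0 k : C := cintegral (leb k) (fourier (@gauss1 k)).

Let inversion_gauss k (F : 'rV[R]_k -> C) (p : 'rV[R]_k) (e : R) : schwartz F -> e != 0 ->
  cintegral (leb k) (fun th => gauss1 (e *: th) * (cis (- rdot th p) * fourier F th)) =
  cintegral (leb k) (fun y => F (e *: y + p) * fourier (@gauss1 k) y).
Proof.
move=> sF e0; have [c [c' [cc' Hc Hc']]] := dilation k e0.
have sg := @schwartz_gauss1 k; have [K K00 HK] := schwartz_bound 0 sF.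
have Ig := (Hc _ (schwartz_cint sg)).1.
transitivity (cintegral (leb k) (fun th => cintegral (leb k) (fun x =>
    gauss1 (e *: th) * F x * cis (rdot th (x - p))))).
  apply: eq_cintegral => th; rewrite mulrA /fourier -cintegralZ; last first.
    apply: (cint_dom (k := fun x => normc (F x))); last 1 first.
    - by move=> x; rewrite normcM normc_cis mulr1.
    - apply: cmeasM; first exact: schwartz_meas.
      by apply: cmeas_cis; apply: measurable_rdot => //; exact: measurable_cst.
    - exact: schwartz_rint.
  by apply: eq_cintegral => x; rewrite rdotDr rdotNr cisD; ring.
transitivity (cintegral (leb k) (fun x => cintegral (leb k) (fun th =>
    gauss1 (e *: th) * F x * cis (rdot th (x - p))))).
  apply: (@fub_swap R _ _ _ _ (leb k) (leb k) (fun th => normc (gauss1 (e *: th))) (fun x => normc (F x))).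
  - exact: cint_normc.
  - exact: schwartz_rint.
  - apply: cmeasM; first apply: cmeasM.
    + exact: cmeas_comp (schwartz_meas sg) (measurable_rVZ _ measurable_fst).
    + exact: cmeas_comp (schwartz_meas sF) measurable_snd.
    + apply: cmeas_cis; apply: measurable_rdot; first exact: measurable_fst.
      by apply: measurable_rVD; [exact: measurable_snd|exact: measurable_cst].
  - by move=> th x; rewrite normcM normc_cis mulr1 normcM !ger0_norm // normc_ge0.
have If z : cintegrable (leb k) (fun s => gauss1 s * cis (rdot (e^-1 *: z) s)).
  apply: (cint_dom (k := fun s => normc (gauss1 s))); last 1 first.
  - by move=> x; rewrite normcM normc_cis mulr1.
  - apply: cmeasM; first exact: schwartz_meas.
    by apply: cmeas_cis; apply: measurable_rdot => //; exact: measurable_cst.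
  - exact: schwartz_rint.
pose G x := F (x + p) * (c%:C * fourier (@gauss1 k) (e^-1 *: x)).
transitivity (cintegral (leb k) (fun x => G (x - p))).
  apply: eq_cintegral => x; rewrite /G subrK -(Hc _ (If (x - p))).2 -cintegralZ; last exact: (Hc _ (If _)).1.
  apply: eq_cintegral => th; rewrite [LHS]mulrAC [LHS]mulrC; congr (_ * (_ * cis _)).
  by rewrite rdotZl rdotZr mulrA mulVf // mul1r rdotC.
have sH := schwartz_fourier sg.
have IG' : cintegrable (leb k) (fun y => F (e *: y + p) * fourier (@gauss1 k) y).
  apply: (cint_dom (k := fun y => K * normc (fourier (@gauss1 k) y))).
  - apply: cmeasM; last exact: schwartz_meas.
    apply: cmeas_comp (schwartz_meas sF) (measurable_rVD (measurable_rVZ _ _) (measurable_cst _)).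
    exact: measurable_id.
  - exact/rintZ/schwartz_rint.
  - move=> y; rewrite normcM ler_wpM2r ?normc_ge0 //; apply: le_trans (HK _) _.
    by rewrite /wt expr0 invr1 mulr1.
have GE : G = fun x => c%:C * (fun y => F (e *: y + p) * fourier (@gauss1 k) y) (e^-1 *: x).
  by apply/funext => x; rewrite /G scalerA mulfV // scale1r; ring.
have IG : cintegrable (leb k) G by rewrite GE; apply: cintZ; exact: (Hc' _ IG').1.
rewrite (cintegral_shift (- p) IG) GE cintegralZ; last exact: (Hc' _ IG').1.
by rewrite (Hc' _ IG').2 mulrA -rmorphM cc' mul1r.
Qed.

Let inversion k (F : 'rV[R]_k -> C) (p : 'rV[R]_k) : schwartz F ->
  cintegral (leb k) (fun th => cis (- rdot th p) * fourier F th) = K0 k * F p.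
Proof.
move=> sF; have sg := @schwartz_gauss1 k; have sH := schwartz_fourier sF.
have sG := schwartz_fourier sg; have [K K00 HK] := schwartz_bound 0 sF.
have mid := @measurable_id _ 'rV[R]_k setT.
have mcis : cmeasurable (fun th : 'rV[R]_k => cis (- rdot th p)).
  apply: cmeas_cis; apply: measurable_funN; apply: measurable_rdot => //; exact: measurable_cst.
have [_ c1] : cintegrable (leb k) (fun th => cis (- rdot th p) * fourier F th) /\
    ccvg (fun j => cintegral (leb k) (fun th => gauss1 (j.+1%:R^-1 *: th) *
      (cis (- rdot th p) * fourier F th)))
    (cintegral (leb k) (fun th => cis (- rdot th p) * fourier F th)).
  apply: (cintegral_dct (k := fun th => normc (fourier F th))).
  - move=> j; apply: cmeasM.
      exact: cmeas_comp (schwartz_meas sg) (measurable_rVZ _ mid).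
    exact: cmeasM mcis (schwartz_meas sH).
  - move=> th; rewrite -[X in ccvg _ X]mul1r -(gauss1_0 k); apply: ccvgM; last exact: ccvg_cst.
    have := ccvg_dilate th 0 sg; congr ccvg; apply/funext => j; by rewrite addr0.
  - exact: schwartz_rint.
  - move=> j th; rewrite normcM (normcM (cis _)) normc_cis mul1r ler_piMl ?normc_ge0 //.
    exact: normc_gauss1_le1.
have [_ c2] : cintegrable (leb k) (fun y => F p * fourier (@gauss1 k) y) /\
    ccvg (fun j => cintegral (leb k) (fun y => F (j.+1%:R^-1 *: y + p) * fourier (@gauss1 k) y))
    (cintegral (leb k) (fun y => F p * fourier (@gauss1 k) y)).
  apply: (cintegral_dct (k := fun y => K * normc (fourier (@gauss1 k) y))).
  - move=> j; apply: cmeasM; last exact: schwartz_meas.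
    apply: cmeas_comp (schwartz_meas sF) (measurable_rVD (measurable_rVZ _ _) (measurable_cst _)).
    exact: measurable_id.
  - by move=> y; apply: ccvgM; [exact: ccvg_dilate|exact: ccvg_cst].
  - exact/rintZ/schwartz_rint.
  - move=> j y; rewrite normcM ler_wpM2r ?normc_ge0 //; apply: le_trans (HK _) _.
    by rewrite /wt expr0 invr1 mulr1.
rewrite /K0 mulrC -cintegralZ; last exact: schwartz_cint.
apply: ccvg_unique c1 _; move: c2; congr ccvg; apply/funext => j.
by rewrite inversion_gauss // invr_neq0 // pnatr_eq0.
Qed.

Let K0_neq0 k : K0 k != 0.
Proof.
apply/eqP => K0E; have sg := @schwartz_gauss1 k; have sG := schwartz_fourier sg.
have G0 : fourier (@gauss1 k) 0 != 0.
  have sd := @schwartz_gauss_scalar k 2^-1 ltac:(by rewrite invr_gt0).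
  have d0 : @gauss R k 0 (2^-1)%:M 0 != 0.
    by rewrite /gauss !mul0mx !rdot0l mulr0 oppr0 expR0 cis0 mulr1 oner_neq0.
  have := int_normc_sq_neq0 sd d0; congr (_ != _); apply: eq_cintegral => x.
  rewrite mul_conj_normc rdot0l cis0 mulr1 /gauss1 /gauss normcM normc_cis mulr1 normcR.
  rewrite ger0_norm ?expR_ge0 // mulmx0 rdot0l mulr0 cis0 mulr1 expr2 -expRD; congr (expR _)%:C.
  by rewrite mul_mx_scalar mulmx1 rdotZl; field.
have /eqP := int_normc_sq_neq0 sG G0; apply.
have mid := @measurable_id _ 'rV[R]_k setT.
transitivity (cintegral (leb k) (fun th => cintegral (leb k) (fun x =>
    fourier (@gauss1 k) th * ((gauss1 x)^*%C * cis (- rdot th x))))).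
  apply: eq_cintegral => th; have Ig : cintegrable (leb k) (fun x => gauss1 x * cis (rdot th x)).
    apply: (cint_dom (k := fun x => normc (gauss1 x))); last 1 first.
    - by move=> x; rewrite normcM normc_cis mulr1.
    - apply: cmeasM; first exact: schwartz_meas.
      by apply: cmeas_cis; apply: measurable_rdot => //; exact: measurable_cst.
    - exact: schwartz_rint.
  have E x : (gauss1 x)^*%C * cis (- rdot th x) = (@gauss1 k x * cis (rdot th x))^*%C.
    by rewrite cJM cisJ.
  rewrite cintegralZ; last by rewrite (funext E); exact: cintJ.
  by congr (_ * _); rewrite (funext E) cintegralJ.
transitivity (cintegral (leb k) (fun x => cintegral (leb k) (fun th =>
    fourier (@gauss1 k) th * ((gauss1 x)^*%C * cis (- rdot th x))))).
  apply: (@fub_swap R _ _ _ _ (leb k) (leb k) (fun th => normc (fourier (@gauss1 k) th)) (fun x => normc (@gauss1 k x))).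
  - exact: schwartz_rint.
  - exact: schwartz_rint.
  - apply: cmeasM; first exact: cmeas_comp (schwartz_meas sG) measurable_fst.
    apply: cmeasM; first exact/cmeasJ/(cmeas_comp (schwartz_meas sg) measurable_snd).
    apply: cmeas_cis; apply: measurable_funN; apply: measurable_rdot.
      exact: measurable_fst.
    exact: measurable_snd.
  - move=> th x; rewrite normcM (normcM (_^*)%C) normc_cis mulr1 normc_conj.
    by rewrite !ger0_norm // normc_ge0.
rewrite -(@cintegral0 R _ _ (leb k)); apply: eq_cintegral => x.
have := inversion x sg; rewrite K0E mul0r => H.
rewrite -[RHS](mulr0 (gauss1 x)^*%C) -H -cintegralZ.
  by apply: eq_cintegral => th; ring.
apply: (cint_dom (k := fun th => normc (fourier (@gauss1 k) th))); last 1 first.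
- by move=> th; rewrite normcM normc_cis mul1r.
- apply: cmeasM; last exact: schwartz_meas.
  by apply: cmeas_cis; apply: measurable_funN; apply: measurable_rdot => //; exact: measurable_cst.
- exact: schwartz_rint.
Qed.

(** Regularizing by dilated Gaussians gives the inversion formula with the
    integral of the transform of a Gaussian as constant; that this constant
    does not vanish follows from Parseval's formula for the Gaussian itself. *)
Lemma fourier_inversion k : exists2 K : C, K != 0 &
  forall (F : 'rV[R]_k -> C) p, schwartz F ->
  cintegral (leb k) (fun th => cis (- rdot th p) * fourier F th) = K * F p.
Proof. by exists (K0 k); [exact: K0_neq0|move=> F p sF; exact: inversion]. Qed.

End fourier_inversion.

Section gabor.
Context {R : realType}.
Local Notation C := R[i].

(** Translations of phase space, acting on functions up to a phase factor. *)
Definition tau k (rho : 'rV[R]_(k + k)) (F : 'rV[R]_k -> C) (t : 'rV[R]_k) : C :=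
  cis (- rdot (rsubmx rho) t) * F (t - lsubmx rho).

Lemma schwartz_tau k rho (F : 'rV[R]_k -> C) : schwartz F -> schwartz (tau rho F).
Proof.
move=> sF; rewrite /tau; have := schwartz_pull (- lsubmx rho) (- rsubmx rho) (mulmx1 1%:M) sF.
congr schwartz; apply/funext => t; by rewrite rdotNr rdotC mulmx1.
Qed.

Lemma normc_tau k rho (F : 'rV[R]_k -> C) t : normc (tau rho F t) = normc (F (t - lsubmx rho)).
Proof. by rewrite /tau normcM normc_cis mul1r. Qed.

Lemma stftE k (h F : 'rV[R]_k -> C) rho :
  stft h F rho = cintegral (leb k) (fun s => F s * (tau rho h s)^*%C).
Proof. by apply: eq_cintegral => s; rewrite /tau cJM cisJ opprK. Qed.

Lemma schwartz_stft k (h F : 'rV[R]_k -> C) : schwartz h -> schwartz F -> schwartz (stft h F).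
Proof.
move=> sh sF; have := schwartz_stft_param (schwartz_tensor (@schwartz_gauss1 R 1) sF) sh.
move=> /(schwartz_slice 0); congr schwartz; apply/funext => rho; apply: eq_cintegral => s.
by rewrite !row_mxKl !row_mxKr gauss1_0 mul1r.
Qed.

Lemma stft_tau k (h F : 'rV[R]_k -> C) rho rho' : schwartz h -> schwartz F ->
  normc (stft h (tau rho F) rho') = normc (stft h F (rho' - rho)).
Proof.
move=> sh sF; rewrite stftE.
have I1 : cintegrable (leb k) (fun s => tau rho F s * (tau rho' h s)^*%C).
  by apply: schwartz_cint; apply: schwartzM; [|apply: schwartzJ]; exact: schwartz_tau.
rewrite -(cintegral_shift (lsubmx rho) I1).
have I2 : cintegrable (leb k) (fun s => F s * (tau (rho' - rho) h s)^*%C).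
  by apply: schwartz_cint; apply: schwartzM => //; apply: schwartzJ; exact: schwartz_tau.
have -> : cintegral (leb k) (fun x => tau rho F (x + lsubmx rho) * (tau rho' h (x + lsubmx rho))^*%C)
    = cis (rdot (rsubmx (rho' - rho)) (lsubmx rho)) * stft h F (rho' - rho).
  rewrite stftE -cintegralZ //; apply: eq_cintegral => s.
  rewrite /tau addrK (cJM (cis _)) (cJM (cis _)) !cisJ !opprK mulrCA mulrA.
  have -> : s + lsubmx rho - lsubmx rho' = s - lsubmx (rho' - rho).
    by apply/rowP => i; rewrite !mxE; ring.
  set H := (h _)^*%C.
  transitivity (cis (rdot (rsubmx rho') (s + lsubmx rho) - rdot (rsubmx rho) (s + lsubmx rho)) * (F s * H)).
    by rewrite cisD; ring.
  have -> : rdot (rsubmx rho') (s + lsubmx rho) - rdot (rsubmx rho) (s + lsubmx rho) =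
      rdot (rsubmx (rho' - rho)) (lsubmx rho) + rdot (rsubmx (rho' - rho)) s.
    by rewrite linearB /= !rdotDl !rdotNl !rdotDr; ring.
  by rewrite cisD; ring.
by rewrite normcM normc_cis mul1r.
Qed.

Lemma cmeas_tau k d (T : measurableType d) (F : 'rV[R]_k -> C)
   (f : T -> 'rV[R]_(k + k)) (g : T -> 'rV[R]_k) :
  schwartz F -> measurable_fun setT f -> measurable_fun setT g ->
  cmeasurable (fun p => tau (f p) F (g p)).
Proof.
move=> sF mf mg; apply: cmeasM.
  apply: cmeas_cis; apply: measurable_funN; apply: measurable_rdot => //.
  exact: measurableT_comp (@measurable_rsubmx R k k) mf.
apply: cmeas_comp (schwartz_meas sF) _; apply: measurable_rVD => //; apply: measurable_rVN.
exact: measurableT_comp (@measurable_lsubmx R k k) mf.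
Qed.

(** The frequency integral is a Fourier inversion for each position; the
    remaining position integral is a constant. *)
Lemma gabor_inversion k (h : 'rV[R]_k -> C) t0 : schwartz h -> h t0 != 0 -> exists2 K : C, K != 0 &
  forall F s, schwartz F ->
  cintegral (leb (k + k)) (fun rho => stft h F rho * tau rho h s) = K * F s.
Proof.
move=> sh h0; have [K Kn0 HK] := @fourier_inversion R k.
have shN : schwartz (fun y => h (- y)).
  have := @schwartz_affine R k k (- 1%:M) (- 1%:M) 0 h; rewrite mulNmx mul1mx opprK => /(_ erefl sh).
  by congr schwartz; apply/funext => y; rewrite mulmxN mulmx1 addr0.
have hN0 : h (- - t0) != 0 by rewrite opprK.
exists (K * cintegral (leb k) (fun y => h (- y) * (h (- y))^*%C)).
  by rewrite mulf_neq0 // (int_normc_sq_neq0 shN hN0).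
move=> F s sF; have sV := schwartz_stft sh sF.
have [B B0 HB] := schwartz_bound ((k + k) + (k + k)) sV; have [M M0 HM] := schwartz_bound 0 sh.
have HM' x : normc (h x) <= M by apply: le_trans (HM _) _; rewrite /wt expr0 invr1 mulr1.
rewrite (@fubini_rV1 R k k (fun y => B * M * wt (k + k) y) (@wt R k (k + k))); last 4 first.
- exact: rintZ (rint_wt2 k).
- exact: rint_wt2.
- apply: cmeasM; first exact: schwartz_meas.
  apply: (cmeas_tau (f := fun x => x) (g := fun=> s)) => //; exact: measurable_cst.
- move=> y eta; rewrite normcM normc_tau !ger0_norm ?mulr_ge0 ?wt_ge0 //.
  apply: le_trans (ler_pM _ _ (HB _) (HM' _)) _; rewrite ?normc_ge0 //.
  rewrite -!mulrA ler_wpM2l // mulrC ler_wpM2l //; exact: wt_row.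
transitivity (cintegral (leb k) (fun y => (K * F s) * ((fun y => h (- y) * (h (- y))^*%C) (y - s)))).
  apply: eq_cintegral => y; pose G x := F x * (h (x - y))^*%C.
  have sG : schwartz G.
    apply: schwartzM => //; apply: schwartzJ.
    have := @schwartz_affine R k k 1%:M 1%:M (- y) h (mulmx1 _) sh.
    by congr schwartz; apply/funext => z; rewrite mulmx1.
  transitivity (cintegral (leb k) (fun eta => (cis (- rdot eta s) * fourier G eta) * h (s - y))).
    apply: eq_cintegral => eta; rewrite /tau row_mxKl row_mxKr mulrA (mulrC (stft _ _ _)).
    congr (_ * _ * _); apply: eq_cintegral => x; rewrite row_mxKl row_mxKr /G.
    by rewrite -mulrA; congr (_ * _); rewrite mulrC.
  rewrite cintegralZr; last first.
    apply: (cint_dom (k := fun th => normc (fourier G th))); last 1 first.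
    - by move=> th; rewrite normcM normc_cis mul1r.
    - apply: cmeasM; last exact/schwartz_meas/schwartz_fourier.
      apply: cmeas_cis; apply: measurable_funN; apply: measurable_rdot.
        exact: measurable_id.
      exact: measurable_cst.
    - exact/schwartz_rint/schwartz_fourier.
  by rewrite HK // /G opprB; ring.
have sh2 := schwartzM shN (schwartzJ shN).
rewrite cintegralZ; last exact: cint_shift (schwartz_cint sh2).
by rewrite (cintegral_shift (- s) (schwartz_cint sh2)); ring.
Qed.
End gabor.

(** * Weyl quantization and phase space translations *)

Section weyl_covariance.
Context {R : realType}.
Local Notation C := R[i].

Lemma cint_weyl k (chi : 'rV[R]_(k + k) -> C) (v : 'rV[R]_k -> C) g p :
  schwartz chi -> schwartz v ->
  cmeasurable (fun w : 'rV[R]_(k + k) => weyl_kernel (translate chi g) (lsubmx w) p (rsubmx w) * v (lsubmx w)) /\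
  exists2 B : R, 0 <= B & forall x th : 'rV[R]_k,
    normc (weyl_kernel (translate chi g) x p th * v x) <=
    `|B * wt (k + k) x| * `|wt (k + k) (th - rsubmx g)|.
Proof.
move=> sc sv; have [B B0 HB] := schwartz_bound (k + k) sc.
have [B' B'0 HB'] := schwartz_bound (k + k) sv; split.
  have ml := @measurable_lsubmx R k k; have mr := @measurable_rsubmx R k k.
  apply: cmeasM; last exact: cmeas_comp (schwartz_meas sv) ml.
  apply: cmeasM.
    apply: (cmeas_cis (h := fun w : 'rV[R]_(k + k) => rdot (lsubmx w - p) (rsubmx w))).
    apply: measurable_rdot => //; apply: measurable_rVD => //; exact: measurable_cst.
  apply: cmeas_comp (schwartz_meas sc) _; apply: measurable_rVD; last exact: measurable_cst.
  apply: (measurableT_comp (@measurable_row_mx R k k) (_ : measurable_fun setT (fun w => (_, _)))).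
  apply/measurable_fun_pair => //; apply: measurable_rVZ; exact: measurable_rVD.
exists (B' * B); first exact: mulr_ge0.
move=> x th; rewrite /weyl_kernel normcM (normcM (cexp _)) -/(cis _) normc_cis mul1r.
rewrite !ger0_norm ?mulr_ge0 ?wt_ge0 //.
have -> : B' * B * wt (k + k) x * wt (k + k) (th - rsubmx g) =
  (B * wt (k + k) (th - rsubmx g)) * (B' * wt (k + k) x) by ring.
apply: ler_pM; rewrite ?normc_ge0 //; apply: le_trans (HB _) _; rewrite ler_wpM2l //.
rewrite -[in leLHS](hsubmxK g) opp_row_mx add_row_mx.
by have := wt_row 0 (k + k) (2^-1 *: (x + p) - lsubmx g) (th - rsubmx g); rewrite {2}/wt expr0 invr1 mul1r.
Qed.

Lemma cint_weyl_int k (chi : 'rV[R]_(k + k) -> C) (v : 'rV[R]_k -> C) g p :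
  schwartz chi -> schwartz v ->
  cintegrable (leb (k + k)) (fun w : 'rV[R]_(k + k) =>
    weyl_kernel (translate chi g) (lsubmx w) p (rsubmx w) * v (lsubmx w)) /\
  cintegral (leb (k + k)) (fun w : 'rV[R]_(k + k) =>
    weyl_kernel (translate chi g) (lsubmx w) p (rsubmx w) * v (lsubmx w)) =
  cintegral (leb k) (fun th => cintegral (leb k) (fun x =>
    weyl_kernel (translate chi g) x p th * v x)).
Proof.
move=> sc sv; have [mf [B B0 HB]] := cint_weyl g p sc sv.
have I1 := rintZ B (rint_wt2 (R := R) k).
have I2 := (rint_shift (- rsubmx g) (rint_wt2 (R := R) k)).1.
have HB' x th : normc (weyl_kernel (translate chi g) (lsubmx (row_mx x th)) p (rsubmx (row_mx x th)) *
   v (lsubmx (row_mx x th))) <= `|B * wt (k + k) x| * `|wt (k + k) (th - rsubmx g)|.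
  by rewrite row_mxKl row_mxKr.
split; first exact: (cint_rV I1 I2 mf HB').
rewrite (fubini_rV2 I1 I2 mf HB'); apply: eq_cintegral => th; apply: eq_cintegral => x.
by rewrite row_mxKl row_mxKr.
Qed.

(** The quantization of a translated symbol is conjugated by the phase space
    translation, exactly and not only to leading order. *)
Lemma weyl_covariance k (chi : 'rV[R]_(k + k) -> C) (F : 'rV[R]_k -> C) g rho :
  schwartz chi -> schwartz F ->
  weyl_transpose (translate chi g) (tau rho F) =
  tau rho (weyl_transpose (translate chi (g - rho)) F).
Proof.
move=> sc sF; apply/funext => p; rewrite /weyl_transpose /tau mulrCA; congr (_ * _).
rewrite -(cintegral_shift rho (cint_weyl_int g p sc (schwartz_tau rho sF)).1).
rewrite -cintegralZ; last exact: (cint_weyl_int (g - rho) (p - lsubmx rho) sc sF).1.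
apply: eq_cintegral => w; rewrite /weyl_kernel /tau /translate -!/(cis _).
have -> : lsubmx (w + rho) = lsubmx w + lsubmx rho by rewrite linearD.
have -> : rsubmx (w + rho) = rsubmx w + rsubmx rho by rewrite linearD.
rewrite addrK; set x := lsubmx w; set th := rsubmx w.
have -> : row_mx (2^-1 *: (x + lsubmx rho + p)) (th + rsubmx rho) - g =
    row_mx (2^-1 *: (x + (p - lsubmx rho))) th - (g - rho).
  have -> : row_mx (2^-1 *: (x + lsubmx rho + p)) (th + rsubmx rho) =
      row_mx (2^-1 *: (x + (p - lsubmx rho))) th + row_mx (lsubmx rho) (rsubmx rho).
    by rewrite add_row_mx; congr row_mx; apply/rowP => i; rewrite !mxE; field.
  by rewrite hsubmxK opprB -addrA.
set X := chi _.
transitivity (cis (rdot (x + lsubmx rho - p) (th + rsubmx rho) - rdot (rsubmx rho) (x + lsubmx rho)) * X * F x).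
  by rewrite cisD; ring.
have -> : rdot (x + lsubmx rho - p) (th + rsubmx rho) - rdot (rsubmx rho) (x + lsubmx rho) =
    - rdot (rsubmx rho) p + rdot (x - (p - lsubmx rho)) th.
  rewrite !rdotDr !rdotDl !rdotNl !rdotDl !rdotNl !(rdotC (rsubmx rho)); ring.
by rewrite cisD; ring.
Qed.

Lemma partials_lin k s c (u v : 'rV[R]_k -> C) : schwartz u -> schwartz v ->
  partials s (fun x => c * u x + v x) = (fun x => c * partials s u x + partials s v x).
Proof.
move=> su sv; elim: s => [|i s IH] //=; rewrite IH; apply: is_partialE.
have Hp w : schwartz w -> is_partial i (partials s w) (partial i (partials s w)).
  by move=> sw; exact/smooth_is_partial/schwartz_smooth/schwartz_partials.
by apply: is_partialD; [apply: is_partialZ|]; exact: Hp.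
Qed.

Lemma partials_sum k s (I : Type) (r : seq I) (F : I -> 'rV[R]_k -> C) :
  (forall i, schwartz (F i)) -> schwartz (fun x => \sum_(i <- r) F i x) /\
  partials s (fun x => \sum_(i <- r) F i x) = (fun x => \sum_(i <- r) partials s (F i) x).
Proof.
move=> sF; elim: r => [|i r [IH IHE]].
  have E (G : I -> 'rV[R]_k -> C) : (fun x => \sum_(i <- [::]) G i x) = fun=> 0.
    by apply/funext => x; rewrite big_nil.
  rewrite !E; split; first exact: schwartz0.
  by elim: s => [|i s /= ->] //; apply: is_partialE; exact: is_partial_cst.
have E (G : I -> 'rV[R]_k -> C) : (fun x => \sum_(j <- i :: r) G j x) =
    fun x => 1 * G i x + \sum_(j <- r) G j x.
  by apply/funext => x; rewrite big_cons mul1r.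
by rewrite !E; split; [exact: schwartz_lin|rewrite partials_lin // IHE].
Qed.

Lemma partials_slice k l s (u : 'rV[R]_(k + l) -> C) (x : 'rV[R]_k) : schwartz u ->
  partials s (fun y => u (row_mx x y)) = (fun y => partials (map (@rshift k l) s) u (row_mx x y)).
Proof.
move=> su; elim: s => [|i s IH] //=; rewrite IH partial_slice //.
exact/schwartz_smooth/schwartz_partials.
Qed.

Section tempered.
Variables (k : nat) (a : Defs.distribution (R := R) k).
Hypothesis ta : tempered a.

Lemma tempered0 : a (fun=> 0) = 0.
Proof.
have := ta.1 (-1) _ _ (schwartz0 k) (schwartz0 k).
have -> : (fun _ : 'rV[R]_k => -1 * 0 + 0 : C) = fun=> 0 by apply/funext => x; rewrite mulr0 addr0.
by rewrite mulN1r addNr.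
Qed.

Lemma temperedZ c u : schwartz u -> a (fun x => c * u x) = c * a u.
Proof.
move=> su; have := ta.1 c _ _ su (schwartz0 k); rewrite tempered0 addr0 => <-.
by congr a; apply/funext => x; rewrite addr0.
Qed.

Lemma tempered_sum (I : Type) (r : seq I) (F : I -> 'rV[R]_k -> C) :
  (forall i, schwartz (F i)) -> a (fun x => \sum_(i <- r) F i x) = \sum_(i <- r) a (F i).
Proof.
move=> sF; elim: r => [|i r IH].
  rewrite big_nil; transitivity (a (fun=> 0)); last exact: tempered0.
  by congr a; apply/funext => x; rewrite big_nil.
have := ta.1 1 _ _ (sF i) (partials_sum [::] r sF).1; rewrite mul1r IH big_cons => <-.
by congr a; apply/funext => x; rewrite big_cons mul1r.
Qed.

Lemma tempered_bound : exists (N : nat) (A : R), 0 <= A /\ forall (u : 'rV[R]_k -> C) (Q : R), schwartz u ->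
  (forall s x, (size s <= N)%N -> japanese x ^+ N * normc (partials s u x) <= Q) ->
  normc (a u) <= A * Q.
Proof.
have [_ [A [N HA]]] := ta; exists N, `|A|; split => // u Q su HQ.
apply: le_trans (HA u su) _; set S := schwartz_seminorm _ _.
have [S0 SQ] : 0 <= S /\ S <= Q.
  pose E := [set r | exists s x, (size s <= N)%N /\ r = japanese x ^+ N * normc (partials s u x)].
  have E0 : E (japanese (0 : 'rV[R]_k) ^+ N * normc (partials [::] u 0)) by exists [::], 0.
  have HE : ubound E Q by move=> _ [s [x [Hs ->]]]; exact: HQ.
  split; last by apply: ge_sup; [eexists; exact: E0|].
  by apply: le_trans (ub_le_sup _ E0); [rewrite mulr_ge0 ?exprn_ge0 ?normc_ge0|exists Q].
by apply: le_trans (ler_wpM2r S0 (ler_norm A)) _; rewrite ler_wpM2l.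
Qed.

Lemma tempered_tau : exists (N : nat) (A : R), 0 <= A /\ forall rho (u : 'rV[R]_k -> C) (Q : R), schwartz u ->
  (forall s x, (size s <= N)%N -> japanese x ^+ N * normc (partials s u x) <= Q) ->
  normc (a (tau rho u)) <= A * (japanese rho ^+ (N + N) * Q).
Proof.
have [N [A [A0 HA]]] := tempered_bound; exists N, (A * (2 ^+ (N + N))); split.
  by rewrite mulr_ge0 ?exprn_ge0.
move=> rho u Q su HQ; rewrite -mulrA; apply: HA; first exact: schwartz_tau.
have Q0 : 0 <= Q.
  by apply: le_trans (HQ [::] 0 (leq0n _)); rewrite mulr_ge0 ?exprn_ge0 ?normc_ge0.
pose y := lsubmx rho; pose eta := rsubmx rho; pose r := 2 * japanese rho.
have r1 : 1 <= r by rewrite /r; have := jp_ge1 rho; lra.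
have r0 : 0 <= r by exact: le_trans r1.
have jeta i : `|eta ord0 i| <= japanese rho.
  by apply: le_trans (jp_coord _ i) _; rewrite -[in leRHS](hsubmxK rho); exact: jp_rowr.
have D s : exists G, [/\ schwartz G, partials s (tau rho u) = tau rho G &
    forall s' x, (size s' + size s <= N)%N -> japanese x ^+ N * normc (partials s' G x) <= r ^+ size s * Q].
  elim: s => [|i s [G [sG GE HG]]].
    by exists u; split => // s' x; rewrite addn0 expr0 mul1r; exact: HQ.
  pose c : C := - ((0 +i* 1) * (eta ord0 i)%:C).
  exists (fun x => c * G x + partial i G x); split.
  - by apply: schwartz_lin => //; exact: schwartz_partial.
  - rewrite /= GE; apply: is_partialE.
    have H1 : is_partial i (fun t : 'rV[R]_k => cis (- rdot eta t)) (fun t => (0 +i* 1) * (- eta ord0 i)%:C * cis (- rdot eta t)).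
      apply: is_partial_cis => t; have := is_deriveN (is_derive_rdot i eta t).
      by congr is_derive; apply/funext => z /=; rewrite rdotC.
    have H2 : is_partial i (fun t => G (t - y)) (fun t => partial i G (t - y)).
      have := is_partial_pull 1%:M (- y) i (schwartz_smooth sG).
      apply: is_partial_ext => t; first by rewrite mulmx1.
      rewrite mulmx1 (bigD1 i) //= big1 ?addr0; first by rewrite mxE eqxx mul1r.
      by move=> j ji; rewrite mxE eq_sym (negbTE ji) mul0r.
    apply: is_partial_ext (is_partialM H1 H2) => t; first by [].
    by rewrite /tau -/eta -/y /c rmorphN; ring.
  - move=> s' x Hs; rewrite partials_lin //; last exact: schwartz_partial.
    rewrite partialsS; apply: le_trans (ler_wpM2l _ (le_normcD _ _)) _; first by rewrite exprn_ge0.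
    have H1 := HG (rcons s' i) x; rewrite size_rcons addSnnS in H1; have {}H1 := H1 Hs.
    have H2 := HG s' x; have {}H2 := H2 (leq_trans _ Hs); rewrite leq_add2l /= leqnSn in H2.
    have {}H2 := H2 isT.
    have nc : normc c <= japanese rho.
      rewrite /c -mulrN normcM -rmorphN normcR normrN.
      have -> : normc ((0 : R) +i* 1) = 1 by rewrite /= expr0n expr1n add0r sqrtr1.
      by rewrite mul1r.
    rewrite mulrDr (normcM c) mulrCA [size (i :: s)]/= exprS -mulrA.
    have X0 : 0 <= r ^+ size s * Q by rewrite mulr_ge0 ?exprn_ge0.
    apply: (@le_trans _ _ (japanese rho * (r ^+ size s * Q) + r ^+ size s * Q)).
      by apply: lerD => //; apply: ler_pM; rewrite ?mulr_ge0 ?exprn_ge0 ?normc_ge0.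
    by move: X0 (jp_ge1 rho); set X := _ * Q; rewrite /r; nra.
move=> s x Hs; have [G [sG -> HG]] := D s; rewrite normc_tau.
have := HG [::] (x - y); rewrite add0n => /(_ Hs) /= H.
apply: (@le_trans _ _ ((2 * japanese y) ^+ N * (japanese (x - y) ^+ N * normc (G (x - y))))).
  rewrite mulrA -exprMn ler_wpM2r ?normc_ge0 //; apply: lerXn2r; rewrite ?nnegrE ?mulr_ge0 //.
  by apply: le_trans (jp_sub _ y) _; rewrite -!mulrA ler_wpM2l // mulrC.
have jy : japanese y <= japanese rho by rewrite -[in leRHS](hsubmxK rho); exact: jp_rowl.
apply: (@le_trans _ _ (r ^+ N * (r ^+ N * Q))).
  apply: ler_pM; rewrite ?mulr_ge0 ?exprn_ge0 ?mulr_ge0 ?normc_ge0 //.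
    by apply: lerXn2r; rewrite ?nnegrE ?mulr_ge0 // ler_wpM2l.
  by apply: le_trans H _; rewrite ler_wpM2r // ler_weXn2l.
by rewrite /r !exprMn !exprD le_eqVlt; apply/orP; left; apply/eqP; ring.
Qed.
End tempered.
End weyl_covariance.

(** * Lattice sums *)

Section lattice_sums.
Context {R : realType}.
Local Notation C := R[i].

Let phi (t : R) : R := t / (1 + `|t|).

Let phi_le1 t : `|phi t| <= 1.
Proof.
rewrite /phi normrM normfV [X in _ / X]ger0_norm ?addr_ge0 //.
by rewrite ler_pdivrMr ?mul1r ?ltr_wpDr // lerDr.
Qed.

Let phi_step (t : R) : (1 + t ^+ 2)^-1 <= 4 * (phi (t + 1) - phi t).
Proof.
have t2 : 0 < 1 + t ^+ 2 by rewrite ltr_wpDr ?sqr_ge0.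
have inv (y : R) : 0 < y -> y <= 4 * (1 + t ^+ 2) -> (1 + t ^+ 2)^-1 <= 4 * y^-1.
  move=> y0 H; rewrite -[4]invrK -invfM lef_pV2 ?posrE ?mulr_gt0 // ?invr_gt0 //.
  by rewrite ler_pdivrMl.
rewrite /phi; have [t0|t0] := leP 0 t.
  rewrite !ger0_norm ?addr_ge0 //.
  have -> : (t + 1) / (1 + (t + 1)) - t / (1 + t) = ((1 + t) * (2 + t))^-1.
    by field; apply/andP; split; lra.
  by apply: inv; nra.
have [t1|t1] := leP t (-1).
  rewrite !ler0_norm; try lra.
  have -> : (t + 1) / (1 + - (t + 1)) - t / (1 + - t) = ((- t) * (1 - t))^-1.
    by field; repeat (apply/andP; split); lra.
  by apply: inv; nra.
rewrite ger0_norm ?ltr0_norm //; try lra.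
apply: (@le_trans _ _ 1); first by rewrite invf_le1 // lerDl sqr_ge0.
have H1 : (t + 1) / 2 <= (t + 1) / (1 + (t + 1)).
  by rewrite ler_wpM2l ?lef_pV2 ?posrE; lra.
have H2 : (- t) / 2 <= (- t) / (1 + - t).
  by rewrite ler_wpM2l ?lef_pV2 ?posrE; lra.
by rewrite mulNr in H2; lra.
Qed.

(** The bounded increasing function t / (1 + |t|) telescopes the sum. *)
Lemma sum_inverse_squares (N : nat) (s : R) : \sum_(i < N) (1 + (i%:R - s) ^+ 2)^-1 <= 8.
Proof.
have : \sum_(i < N) (1 + (i%:R - s) ^+ 2)^-1 <= 4 * (phi (N%:R - s) - phi (- s)).
  elim: N => [|N IH]; first by rewrite big_ord0 add0r subrr mulr0.
  rewrite big_ord_recr /=; have := phi_step (N%:R - s).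
  by rewrite addrAC natr1 => H; lra.
have := phi_le1 (N%:R - s); have := phi_le1 (- s); rewrite !ler_norml => /andP[] ? ? /andP[] ? ?.
by move=> H; lra.
Qed.

Lemma wt_prod d (x : 'rV[R]_d) : wt (d + d) x <= \prod_i (1 + (x ord0 i) ^+ 2)^-1.
Proof.
rewrite /wt addnn -mul2n exprM jp_sq prodfV lef_pV2 ?posrE; last 2 first.
- by rewrite exprn_gt0 // ltr_wpDr ?rdot_ge0.
- by apply: prodr_gt0 => i _; rewrite ltr_wpDr ?sqr_ge0.
rewrite -[X in _ ^+ X]card_ord -prodr_const; apply: ler_prod => i _.
rewrite addr_ge0 ?sqr_ge0 //= lerD2l rdotE (bigD1 i) //= -expr2 lerDl.
by apply: sumr_ge0 => j _; rewrite -expr2 sqr_ge0.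
Qed.

Let box_row d (j : nat) (f : {ffun 'I_d -> 'I_(j.*2.+1)}) : 'rV[int]_d :=
  \row_i ((f i)%:Z - j%:Z).

(** In the coordinates of a basis the lattice points are integer vectors, and the
    weight is dominated by a product of weights of one integer variable each. *)
Lemma lattice_boxes d (G : set 'rV[R]_d) : lattice G ->
  exists Z : nat -> seq 'rV[R]_d, [/\ forall j, uniq (Z j), forall j g, g \in Z j -> G g,
    forall g, G g -> exists j0, forall j, (j0 <= j)%N -> g \in Z j &
    exists2 c : R, 0 <= c & forall j rho, \sum_(g <- Z j) wt (d + d) (g - rho) <= c].
Proof.
move=> [B uB ->]; pose pt j f := map_mx intr (@box_row d j f) *m B.
have inj j : injective (pt j).
  move=> f g /(congr1 (mulmx^~ (invmx B))); rewrite /pt !mulmxK // => H.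
  apply/ffunP => i; apply: val_inj.
  have := congr1 (fun v : 'rV[R]_d => v ord0 i) H; rewrite !mxE => /intr_inj.
  by move=> /addIr [].
exists (fun j => [seq pt j f | f <- enum {: {ffun 'I_d -> 'I_(j.*2.+1)}}]); split.
- by move=> j; rewrite (map_inj_uniq (@inj j)) enum_uniq.
- by move=> j _ /mapP[f _ ->]; exists (box_row f).
- move=> _ [z _ <-]; exists (\sum_i `|z ord0 i|%N)%N => j Hj.
  have zi i : (`|z ord0 i| <= j)%N by apply: leq_trans Hj; rewrite (bigD1 i) //= leq_addr.
  pose f : {ffun 'I_d -> 'I_(j.*2.+1)} := [ffun i => inord (absz (z ord0 i + j%:Z)%R)].
  apply/mapP; exists f; first by rewrite mem_enum.
  congr (map_mx _ _ *m B); apply/rowP => i; rewrite !mxE ffunE.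
  have H := zi i; have H1 : (absz (z ord0 i + j%:Z)%R < j.*2.+1)%N by lia.
  rewrite inordK //; change (z ord0 i = (absz (z ord0 i + j%:Z)%R)%:Z - j%:Z).
  by lia.
have [K K1 HK] := jp_mulmx (invmx B).
have K0 : 0 <= K by exact: le_trans K1.
exists (K ^+ (d + d) * 8 ^+ d); first by rewrite mulr_ge0 ?exprn_ge0.
move=> j rho; rewrite big_map big_enum /=.
pose r := rho *m invmx B + const_mx j%:R.
have Hw f : wt (d + d) (pt j f - rho) <= K ^+ (d + d) * \prod_i (1 + ((f i)%:R - r ord0 i) ^+ 2)^-1.
  have := HK (pt j f - rho); rewrite mulmxBl /pt mulmxK //; set y := _ - _; set x := _ - _ => H.
  have Hwt : wt (d + d) x <= K ^+ (d + d) * wt (d + d) y.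
    rewrite /wt ler_pdivlMr ?jpX_gt0 // mulrC ler_pdivrMr ?jpX_gt0 // -exprMn.
    by apply: lerXn2r; rewrite ?nnegrE ?mulr_ge0.
  apply: le_trans Hwt _; rewrite ler_wpM2l ?exprn_ge0 //; apply: le_trans (wt_prod _) _.
  rewrite le_eqVlt; apply/orP; left; apply/eqP; apply: eq_bigr => i _; congr (1 + _ ^+ 2)^-1.
  by rewrite !mxE rmorphB /= opprD addrA addrAC.
apply: le_trans (ler_sum _ (fun f _ => Hw f)) _; rewrite -mulr_sumr ler_wpM2l ?exprn_ge0 //.
rewrite -(bigA_distr_bigA (fun i (m : 'I_(j.*2.+1)) => (1 + (m%:R - r ord0 i) ^+ 2)^-1)).
rewrite -[X in _ <= _ ^+ X]card_ord -prodr_const; apply: ler_prod => i _.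
rewrite sum_inverse_squares andbT; apply: sumr_ge0 => m _.
by rewrite invr_ge0 addr_ge0 ?sqr_ge0.
Qed.

Lemma unordered_sum_cvg d (G : set 'rV[R]_d) (Z : nat -> seq 'rV[R]_d) (f : 'rV[R]_d -> C) l :
  (forall j, uniq (Z j)) -> (forall j g, g \in Z j -> G g) ->
  (forall g, G g -> exists j0, forall j, (j0 <= j)%N -> g \in Z j) ->
  unordered_sum G f l -> ccvg (fun j => \sum_(g <- Z j) f g) l.
Proof.
move=> uZ ZG ZA H; apply/ccvgP/cvgr0Pnorm_lt => e e0.
have [A [fA AG HA]] := H e e0.
have [j0 Hj0] : exists j0, forall j, (j0 <= j)%N -> A `<=` [set` Z j].
  have /finite_seqP[t At] := fA; rewrite At in AG *.
  elim: t {At} AG => [_|g t IH AG]; first by exists 0%N.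
  have [j1 H1] := ZA g (AG _ (mem_head _ _)).
  have [j2 H2] : exists j0, forall j, (j0 <= j)%N -> [set` t] `<=` [set` Z j].
    by apply: IH => x xt; apply: AG; rewrite /= inE xt orbT.
  exists (maxn j1 j2) => j; rewrite geq_max => /andP[J1 J2] x; rewrite /= inE => /orP[/eqP ->|xt].
    exact: H1.
  exact: H2 xt.
exists j0 => // j /= Hj; rewrite ger0_norm ?normc_ge0 //.
have := HA [set` Z j] (finite_seq _) (Hj0 j Hj); rewrite -fsbig_seq //; apply.
by move=> g; exact: ZG.
Qed.
End lattice_sums.

(** * Convergence of the localized pieces *)

Section schwartz_convergence.
Context {R : realType}.
Local Notation C := R[i].
Local Notation e_ i := (delta_mx ord0 i).

Lemma ccvg0P (u : nat -> C) : ccvg u 0 <->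
  forall e : R, 0 < e -> exists j0, forall j, (j0 <= j)%N -> normc (u j) < e.
Proof.
split=> [/ccvgP/cvgr0Pnorm_lt H e e0|H].
  have [j0 _ Hj] := H e e0; exists j0 => j /Hj /=; by rewrite subr0 ger0_norm ?normc_ge0.
apply/ccvgP/cvgr0Pnorm_lt => e e0; have [j0 Hj] := H e e0; exists j0 => // j /= /Hj.
by rewrite subr0 ger0_norm ?normc_ge0.
Qed.

Lemma eventually_seqs (I : finType) N (P : seq I -> nat -> Prop) :
  (forall s, exists j0, forall j, (j0 <= j)%N -> P s j) ->
  exists j0, forall j s, (j0 <= j)%N -> (size s <= N)%N -> P s j.
Proof.
elim: N P => [|N IH] P H.
  have [j0 Hj] := H [::]; exists j0 => j s /Hj; by case: s.
have [j0 Hj] := H [::].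
have /choice[f Hf] : forall i, exists j1, forall j s, (j1 <= j)%N -> (size s <= N)%N -> P (i :: s) j.
  by move=> i; apply: (IH (fun s => P (i :: s))) => s; exact: H.
exists (maxn j0 (\max_i f i)) => j s; rewrite geq_max => /andP[J1 J2].
case: s => [_|i s Hs]; first exact: Hj.
by apply: Hf => //; apply: leq_trans J2; exact: leq_bigmax.
Qed.

Lemma taylor2 k i (f g h : 'rV[R]_k -> R) (B : R) x (t : R) :
  (forall y, is_derive y (e_ i) f (g y)) -> (forall y, is_derive y (e_ i) g (h y)) ->
  (forall y, `|h y| <= B) -> `|f (x + t *: e_ i) - f x - t * g x| <= B * t ^+ 2.
Proof.
move=> Df Dg hB.
have G s : `|g (x + s *: e_ i) - g x| <= B * `|s|.
  have := @lipschitz_line R (fun t => g (x + t *: e_ i)) (fun t => h (x + t *: e_ i)) s B.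
  by rewrite scale0r addr0; apply => // r; exact: line_is_derive (Dg _).
pose F (s : R) := f (x + s *: e_ i) + (0 + s * (- g x)).
have := @lipschitz_line R F (fun s => g (x + s *: e_ i) - g x) t (B * `|t|).
rewrite /F scale0r addr0 !add0r mul0r addr0 mulrN addrAC -mulrA -expr2 real_normK ?num_real //.
apply.
  move=> s; apply: is_deriveD; first exact: line_is_derive (Df _).
  exact: is_derive_affine.
move=> s st; apply: le_trans (G s) _; rewrite ler_wpM2l //.
exact: le_trans (normr_ge0 _) (hB x).
Qed.

Section vanishing.
Variables (k : nat) (v : nat -> 'rV[R]_k -> C).
Hypothesis sv : forall j, schwartz (v j).
Hypothesis vB : forall N s, exists B : R, forall j x, japanese x ^+ N * normc (partials s (v j) x) <= B.
Hypothesis v0 : forall x, ccvg (v ^~ x) 0.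

Let vB0 s : exists2 B : R, 0 < B & forall j x, normc (partials s (v j) x) <= B.
Proof.
have [B HB] := vB 0 s; exists (`|B| + 1); first by rewrite ltr_wpDl.
move=> j x; have := HB j x; rewrite expr0 mul1r => /le_trans; apply.
by apply: le_trans (ler_norm B) _; rewrite lerDl.
Qed.

Let vP i s j : is_partial i (partials s (v j)) (partials (i :: s) (v j)).
Proof. exact/smooth_is_partial/schwartz_smooth/schwartz_partials. Qed.

Lemma partials_cvg0 s x : ccvg (fun j => partials s (v j) x) 0.
Proof.
elim: s x => [|i s IH] x; first exact: v0.
apply/ccvg0P => e e0; have [B B0 HB] := vB0 (i :: i :: s).
pose t : R := e / (4 * B); have t0 : 0 < t by rewrite divr_gt0 // mulr_gt0.
have t0' : t != 0 by rewrite gt_eqF.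
have d0 : 0 < e * t / 8 by rewrite divr_gt0 // mulr_gt0.
have [j1 H1] := (ccvg0P _).1 (IH x) _ d0.
have [j2 H2] := (ccvg0P _).1 (IH (x + t *: e_ i)) _ d0.
exists (maxn j1 j2) => j; rewrite geq_max => /andP[/H1 {}H1 /H2 {}H2].
set f := partials s (v j) in H1 H2; set g := partials (i :: s) (v j).
have key (fr gr hr : 'rV[R]_k -> R) : (forall y, is_derive y (e_ i) fr (gr y)) ->
    (forall y, is_derive y (e_ i) gr (hr y)) -> (forall y, `|hr y| <= B) ->
    (forall y, `|fr y| <= normc (f y)) -> `|gr x| < e / 2.
  move=> D1 D2 hB fn; have := taylor2 x t D1 D2 hB.
  have F1 := le_lt_trans (fn x) H1; have F2 := le_lt_trans (fn (x + t *: e_ i)) H2.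
  move: F1 F2; rewrite !ltr_norml !ler_norml => /andP[? ?] /andP[? ?] /andP[? ?].
  have Bt : B * t ^+ 2 = e * t / 4 by rewrite /t; field; rewrite gt_eqF.
  have : `|t * gr x| < t * (e / 2).
    by rewrite ltr_norml; apply/andP; split; nra.
  by rewrite normrM gtr0_norm // ltr_pM2l // -ltr_norml.
have P1 := fun y => (vP i s j y); have P2 := fun y => (vP i (i :: s) j y).
apply: le_lt_trans (normc_leD _) _; rewrite [e]splitr; apply: ltrD.
- apply: (key (fun y => Re (f y)) (fun y => Re (g y)) (fun y => Re (partials (i :: i :: s) (v j) y))).
  + by move=> y; exact: (P1 y).1.
  + by move=> y; exact: (P2 y).1.
  + by move=> y; apply: le_trans (normc_Re _) (HB _ _).
  + by move=> y; exact: normc_Re.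
- apply: (key (fun y => Im (f y)) (fun y => Im (g y)) (fun y => Im (partials (i :: i :: s) (v j) y))).
  + by move=> y; exact: (P1 y).2.
  + by move=> y; exact: (P2 y).2.
  + by move=> y; apply: le_trans (normc_Im _) (HB _ _).
  + by move=> y; exact: normc_Im.
Qed.

Lemma partials_lipschitz s : exists2 L : R, 0 < L & forall j x h,
  normc (partials s (v j) (x + h) - partials s (v j) x) <= L * `|h|.
Proof.
have /choice[B HB] : forall i, exists B : R, 0 < B /\ forall j x, normc (partials (i :: s) (v j) x) <= B.
  by move=> i; have [B B0 H] := vB0 (i :: s); exists B.
pose S := \sum_i B i; have SB i : B i <= S.
  by rewrite /S (bigD1 i) //= lerDl; apply: sumr_ge0 => l _; exact: ltW (HB l).1.
have S0 : 0 <= S by apply: sumr_ge0 => l _; exact: ltW (HB l).1.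
exists (2 * (S * k%:R) + 1); first by rewrite ltr_wpDl // !mulr_ge0.
move=> j x h; apply: le_trans (normc_leD _) _; rewrite cReD cImD cReN cImN.
have key (fr : 'rV[R]_k -> R) gr : (forall i y, is_derive y (e_ i) fr (gr i y)) ->
   (forall i y, `|gr i y| <= S) -> `|fr (x + h) - fr x| <= S * k%:R * `|h|.
  move=> D1 gS; apply: le_trans (mean_value_coord D1 (fun i d _ => gS i (x + d))) _.
  by rewrite -mulrA ler_wpM2l // sum_coord_norm.
rewrite mulrDl mul1r mulr_natl mulr2n mulrDl -addrA; apply: lerD; last apply: ler_wpDr => //.
- apply: (key (fun y => Re (partials s (v j) y)) (fun i y => Re (partials (i :: s) (v j) y))).
  + by move=> i y; exact: (vP i s j y).1.
  + by move=> i y; apply: le_trans (normc_Re _) (le_trans ((HB i).2 _ _) (SB i)).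
- apply: (key (fun y => Im (partials s (v j) y)) (fun i y => Im (partials (i :: s) (v j) y))).
  + by move=> i y; exact: (vP i s j y).2.
  + by move=> i y; apply: le_trans (normc_Im _) (le_trans ((HB i).2 _ _) (SB i)).
Qed.

Lemma compact_jp_ball (r : R) : compact [set x : 'rV[R]_k | japanese x <= r].
Proof.
apply: bounded_closed_compact.
  exists `|r|; split => [|M rM x /= xr]; first exact: num_real.
  have [->|x0] := eqVneq `|x| 0; first exact: le_trans (normr_ge0 r) (ltW rM).
  have [[a b] /= E] := mx_norm_neq0 x0; have -> : `|x| = `|x a b| by exact: E.
  rewrite (ord1 a); apply: le_trans (jp_coord x b) _; apply: le_trans xr _.
  exact: le_trans (ler_norm r) (ltW rM).
exact: ((continuous_closedP _).1 (@continuous_jp R k) _ (@closed_le R r)).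
Qed.

Lemma partials_unif0 N s (e : R) : 0 < e -> exists j0, forall j, (j0 <= j)%N ->
  forall x, japanese x ^+ N * normc (partials s (v j) x) <= e.
Proof.
move=> e0; have [B HB] := vB N.+1 s; pose r := `|B| / e + 1.
have r0 : 0 < r by rewrite ltr_wpDl // divr_ge0 // ltW.
pose e' := e / r ^+ N; have e'0 : 0 < e' by rewrite divr_gt0 // exprn_gt0.
have [L L0 HL] := partials_lipschitz s.
have cov := (compact_near_coveringP _).1 (@compact_jp_ball r) nat \oo
  (fun j x => normc (partials s (v j) x) <= e') _.
have [|j0 _ Hj] := cov.
  move=> x _; have [j1 H1] := (ccvg0P _).1 (partials_cvg0 s x) (e' / 2) (divr_gt0 e'0 (ltr0n _ 2)).
  have d0 : 0 < e' / (2 * L) by rewrite divr_gt0 // mulr_gt0.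
  exists (ball x (e' / (2 * L)), [set j | (j1 <= j)%N]) => /=.
    by split; [exact: nbhsx_ballx|exists j1].
  move=> [y j] /= [+ /H1 Hj]; rewrite -ball_normE /= distrC => yx.
  have := HL j x (y - x); have -> : x + (y - x) = y by rewrite addrC subrK.
  move=> H2.
  have -> : partials s (v j) y = (partials s (v j) y - partials s (v j) x) + partials s (v j) x.
    by rewrite subrK.
  apply: le_trans (le_normcD _ _) _; rewrite [e']splitr; apply: lerD; last exact: ltW.
  apply: le_trans H2 _; rewrite mulrC -ler_pdivlMr // -mulrA -invfM; exact: ltW.
exists j0 => j Hj0 x; have [xr|xr] := leP (japanese x) r.
  have := Hj j Hj0 x xr; rewrite /e' ler_pdivlMr ?exprn_gt0 // mulrC => /(le_trans _); apply.
  by rewrite ler_wpM2r ?normc_ge0 //; apply: lerXn2r; rewrite ?nnegrE // ltW.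
have := HB j x; rewrite exprS -mulrA => H.
have H2 : `|B| <= japanese x * e.
  have : `|B| / e <= japanese x by rewrite (le_trans _ (ltW xr)) // lerDl.
  by rewrite ler_pdivrMr.
by rewrite -(ler_pM2l (jp_gt0 x)); apply: le_trans H (le_trans (ler_norm B) H2).
Qed.

(** Functions bounded in every Schwartz seminorm and tending to zero pointwise
    tend to zero in every seminorm: the derivatives tend to zero by Taylor's
    formula, uniformly on balls by equicontinuity, and uniformly at infinity
    by the bounds with a larger weight. *)
Lemma tempered_cvg0 (a : Defs.distribution (R := R) k) : tempered a -> ccvg (fun j => a (v j)) 0.
Proof.
move=> ta; have [N [A [A0 HA]]] := tempered_bound ta; apply/ccvg0P => e e0.
have d0 : 0 < e / (A + 1) by rewrite divr_gt0 // ltr_wpDl.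
have [j0 Hj] := @eventually_seqs _ N (fun s j => forall x, japanese x ^+ N * normc (partials s (v j) x) <= e / (A + 1))
   (fun s => partials_unif0 N s d0).
exists j0 => j Hj0; apply: le_lt_trans (HA _ (e / (A + 1)) (sv j) _) _.
  by move=> s x Hs; exact: Hj.
by rewrite mulrCA gtr_pMr // ltr_pdivrMr; lra.
Qed.
End vanishing.
End schwartz_convergence.

(** * Symbols adding up to one *)

Section localization.
Context {R : realType}.
Local Notation C := R[i].

Lemma wt_jp k l N (x : 'rV[R]_k) (y : 'rV[R]_l) : japanese x <= japanese y -> wt N y <= wt N x.
Proof. by move=> H; rewrite /wt lef_pV2 ?posrE ?jpX_gt0 //; apply: lerXn2r; rewrite ?nnegrE. Qed.

Variables (k : nat) (chi : 'rV[R]_(k + k) -> C) (Z : nat -> seq 'rV[R]_(k + k)) (c : R).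
Local Notation D := ((k + k) + (k + k))%N.
Hypothesis schi : schwartz chi.
Hypothesis Zc : forall j rho, \sum_(g <- Z j) wt D (g - rho) <= c.
Hypothesis Zchi : forall rho, ccvg (fun j => \sum_(g <- Z j) translate chi g rho) 1.

Let c0 : 0 <= c.
Proof. by apply: le_trans (Zc 0 0); apply: sumr_ge0 => g _. Qed.

Lemma schwartz_piece F g : schwartz F -> schwartz (weyl_transpose (translate chi g) F).
Proof.
move=> sF; have := schwartz_slice g (schwartz_weyl_transpose schi sF).
by congr schwartz; apply/funext => p; rewrite row_mxKl row_mxKr.
Qed.

Let piece_bounds F N s : schwartz F -> exists B : R, forall j x, japanese x ^+ N *
  normc (partials s (fun x => \sum_(g <- Z j) weyl_transpose (translate chi g) F x) x) <= B.
Proof.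
move=> sF; pose T (w : 'rV[R]_((k + k) + k)) := weyl_transpose (translate chi (lsubmx w)) F (rsubmx w).
have sT : schwartz T := schwartz_weyl_transpose schi sF.
have TE g : weyl_transpose (translate chi g) F = fun x => T (row_mx g x).
  by apply/funext => x; rewrite /T row_mxKl row_mxKr.
have [B B0 HB] := schwartz_bound (D + N) (schwartz_partials (map (@rshift (k + k) k) s) sT).
exists (B * c) => j x; rewrite (partials_sum s (Z j) (fun g => schwartz_piece g sF)).2.
apply/le_wt; apply: le_trans (le_normc_sum _ _ _) _.
apply: (@le_trans _ _ (\sum_(g <- Z j) B * (wt D (g - 0) * wt N x))).
  apply: ler_sum => g _; rewrite TE partials_slice // subr0.
  by apply: le_trans (HB _) _; rewrite ler_wpM2l // wt_row.
rewrite -mulr_sumr -mulr_suml mulrA ler_wpM2r ?wt_ge0 // ler_wpM2l //.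
Qed.

Let M : C := ((2 * pi) ^- k)%:C.

Let piece_cvg F p : schwartz F ->
  ccvg (fun j => \sum_(g <- Z j) weyl_transpose (translate chi g) F p)
    (M * cintegral (leb k) (fun th => cis (- rdot th p) * fourier F th)).
Proof.
move=> sF.
pose f (q : 'rV[R]_((k + k) + k)) := cintegral (leb k) (fun x =>
    F x * (chi (row_mx (2^-1 *: x + lsubmx (lsubmx q)) (rsubmx (lsubmx q) - rsubmx q)) *
      cis (rdot (rsubmx (lsubmx q)) x))).
have sf : schwartz f := schwartz_partial_fourier schi sF.
pose q (g : 'rV[R]_(k + k)) (th : 'rV[R]_k) : 'rV[R]_((k + k) + k) :=
  row_mx (row_mx (2^-1 *: p - lsubmx g) th) (rsubmx g).
have [Bc Bc0 HBc] := schwartz_bound D schi.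
have chib x : normc (chi x) <= Bc by apply: le_trans (HBc x) _; rewrite ler_piMr // wt_le1.
have mid := @measurable_id _ 'rV[R]_k setT.
have argE x th g : row_mx (2^-1 *: (x + p)) th - g =
    row_mx (2^-1 *: x + (2^-1 *: p - lsubmx g)) (th - rsubmx g).
  by rewrite -[in LHS](hsubmxK g) opp_row_mx add_row_mx scalerDr addrA.
have fE g th : f (q g th) = cintegral (leb k) (fun x =>
    F x * (translate chi g (row_mx (2^-1 *: (x + p)) th) * cis (rdot th x))).
  by apply: eq_cintegral => x; rewrite /q !row_mxKl !row_mxKr /translate argE.
have cI g th : cintegrable (leb k) (fun x =>
    F x * (translate chi g (row_mx (2^-1 *: (x + p)) th) * cis (rdot th x))).
  apply: (cint_dom (k := fun x => Bc * normc (F x))).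
  - apply: cmeasM; first exact: schwartz_meas.
    apply: cmeasM; last by apply: cmeas_cis; apply: measurable_rdot => //; exact: measurable_cst.
    apply: cmeas_comp (schwartz_meas schi) _; apply: measurable_rVD; last exact: measurable_cst.
    apply: (measurableT_comp (@measurable_row_mx R k k) (_ : measurable_fun setT (fun w => (_, _)))).
    apply/measurable_fun_pair; last exact: measurable_cst.
    by apply: measurable_rVZ; apply: measurable_rVD => //; exact: measurable_cst.
  - exact/rintZ/schwartz_rint.
  - move=> x; rewrite normcM normcM normc_cis mulr1 mulrC ler_wpM2r ?normc_ge0 //; exact: chib.
have [B B0 HB] := schwartz_bound (D + (k + k)) sf.
have fB g th : normc (f (q g th)) <= B * (wt D (g - row_mx (2^-1 *: p) 0) * wt (k + k) th).
  apply: le_trans (HB _) _; rewrite ler_wpM2l // wtD; apply: ler_pM; rewrite ?wt_ge0 //; last first.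
    by apply: wt_jp; apply: le_trans (jp_rowl _ _); exact: jp_rowr.
  apply: wt_jp; rewrite -[leRHS]mul1r; apply: le_jp => //; rewrite expr1n mul1r.
  rewrite -[in leLHS](hsubmxK g) opp_row_mx add_row_mx oppr0 addr0 /q !rdot_row.
  rewrite -opprB rdotNl rdotNr opprK !addrA lerD2r lerDl; exact: rdot_ge0.
have mq g : measurable_fun setT (q g).
  apply: (measurableT_comp (@measurable_row_mx R (k + k) k) (_ : measurable_fun setT (fun w => (_, _)))).
  apply/measurable_fun_pair; last exact: measurable_cst.
  apply: (measurableT_comp (@measurable_row_mx R k k) (_ : measurable_fun setT (fun w => (_, _)))).
  by apply/measurable_fun_pair; [exact: measurable_cst|].
have mf g : cmeasurable (fun th => cis (- rdot th p) * f (q g th)).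
  apply: cmeasM; last exact: cmeas_comp (schwartz_meas sf) (mq g).
  by apply: cmeas_cis; apply: measurable_funN; apply: measurable_rdot => //; exact: measurable_cst.
have If g : cintegrable (leb k) (fun th => cis (- rdot th p) * f (q g th)).
  apply: (cint_dom (k := fun th => (B * wt D (g - row_mx (2^-1 *: p) 0)) * wt (k + k) th)) => //.
  - exact: rintZ (rint_wt2 k).
  - by move=> th; rewrite normcM normc_cis mul1r -mulrA; exact: fB.
have E j : \sum_(g <- Z j) weyl_transpose (translate chi g) F p =
    M * cintegral (leb k) (fun th => \sum_(g <- Z j) cis (- rdot th p) * f (q g th)).
  rewrite cintegral_sum // mulr_sumr; apply: eq_bigr => g _.
  rewrite /weyl_transpose (cint_weyl_int g p schi sF).2; congr (_ * _); apply: eq_cintegral => th.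
  rewrite fE -cintegralZ //; apply: eq_cintegral => x; rewrite /weyl_kernel -/(cis _).
  rewrite rdotDl rdotNl cisD (rdotC x) (rdotC p); ring.
rewrite (funext E); apply: ccvgM; first exact: ccvg_cst.
apply: (cintegral_dct (k := fun th => (B * c) * wt (k + k) th) _ _ _ _).2.
- by move=> j; exact: cmeas_sum.
- move=> th.
  have -> : (fun j => \sum_(g <- Z j) cis (- rdot th p) * f (q g th)) =
     (fun j => cis (- rdot th p) * \sum_(g <- Z j) f (q g th)).
    by apply/funext => j; rewrite mulr_sumr.
  apply: ccvgM; first exact: ccvg_cst.
  have E2 j : \sum_(g <- Z j) f (q g th) = cintegral (leb k) (fun x =>
      F x * ((\sum_(g <- Z j) translate chi g (row_mx (2^-1 *: (x + p)) th)) * cis (rdot th x))).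
    rewrite (eq_bigr _ (fun g _ => fE g th)) -cintegral_sum //; apply: eq_cintegral => x.
    by rewrite -mulr_sumr -mulr_suml.
  rewrite (funext E2); apply: (cintegral_dct (k := fun x => (Bc * c) * normc (F x)) _ _ _ _).2.
  + move=> j; have := cint_meas (cint_sum (Z j) xpredT (fun g => cI g th)).
    by congr cmeasurable; apply/funext => x; rewrite -mulr_sumr -mulr_suml.
  + move=> x; apply: ccvgM; first exact: ccvg_cst.
    by rewrite -[X in ccvg _ X]mul1r; apply: ccvgM; [exact: Zchi|exact: ccvg_cst].
  + exact/rintZ/schwartz_rint.
  + move=> j x; rewrite normcM (normcM (\sum_(_ <- _) _)) normc_cis mulr1 mulrC ler_wpM2r ?normc_ge0 //.
    apply: le_trans (le_normc_sum _ _ _) _.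
    apply: (@le_trans _ _ (\sum_(g <- Z j) Bc * wt D (g - row_mx (2^-1 *: (x + p)) th))).
      by apply: ler_sum => g _; apply: le_trans (HBc _) _; rewrite -wtN opprB.
    by rewrite -mulr_sumr ler_wpM2l.
- exact: rintZ (rint_wt2 k).
- move=> j th; apply: le_trans (le_normc_sum _ _ _) _.
  apply: (@le_trans _ _ (\sum_(g <- Z j) B * (wt D (g - row_mx (2^-1 *: p) 0) * wt (k + k) th))).
    by apply: ler_sum => g _; rewrite normcM normc_cis mul1r; exact: fB.
  by rewrite -mulr_sumr -mulr_suml mulrA ler_wpM2r ?wt_ge0 // ler_wpM2l.
Qed.

(** The localized pieces of a Schwartz function add up to a multiple of it: at
    each point this is Fourier inversion, as the symbols add up to one. *)
Lemma localization_cvg : exists2 K : C, K != 0 & forall (a : Defs.distribution (R := R) k) F,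
  tempered a -> schwartz F ->
  ccvg (fun j => \sum_(g <- Z j) a (weyl_transpose (translate chi g) F)) (K * a F).
Proof.
have [K K0 HK] := @fourier_inversion R k; exists (M * K).
  rewrite mulf_neq0 // /M; apply/eqP => /(congr1 (@complex.Re R)) /= /eqP.
  by rewrite invr_eq0 expf_eq0 mulf_eq0 pnatr_eq0 /= gt_eqF ?pi_gt0 // andbF.
move=> a F ta sF; pose Phi j x := \sum_(g <- Z j) weyl_transpose (translate chi g) F x.
have sPhi j : schwartz (Phi j).
  exact: (partials_sum [::] (Z j) (fun g => schwartz_piece g sF)).1.
pose v j x := - (M * K) * F x + Phi j x.
have H : ccvg (fun j => a (v j)) 0.
  apply: tempered_cvg0 => //.
  - by move=> j; exact: schwartz_lin.
  - move=> N s; have [B HB] := piece_bounds N s sF.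
    have [B' B'0 HB'] := schwartz_bound N (schwartz_partials s sF).
    exists (normc (- (M * K)) * B' + B) => j x; rewrite /v partials_lin //.
    apply: le_trans (ler_wpM2l _ (le_normcD _ _)) _; first by rewrite exprn_ge0.
    rewrite mulrDr; apply: lerD; last exact: HB.
    rewrite (normcM (- _)) mulrCA ler_wpM2l ?normc_ge0 //; apply/le_wt; exact: HB'.
  - move=> x; rewrite /v -(addNr (M * (K * F x))) mulNr mulrA.
    apply: ccvgD; first exact: ccvg_cst.
    by rewrite -mulrA -(HK F x sF); exact: piece_cvg.
have -> : (fun j => \sum_(g <- Z j) a (weyl_transpose (translate chi g) F)) =
    fun j => M * K * a F + a (v j).
  apply/funext => j; rewrite /v ta.1 // mulNr addrA subrr add0r.
  by rewrite tempered_sum // => g; exact: schwartz_piece.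
by rewrite -[X in ccvg _ X]addr0; apply: ccvgD => //; exact: ccvg_cst.
Qed.
End localization.

(** * Square integrable functions *)

Section square_integrable.
Context {R : realType} d (T : measurableType d) (mu : {measure set T -> \bar R}).
Local Notation C := R[i].
Implicit Type f : T -> C.

Lemma L2normE f : L2norm mu f = sqrte (\int[mu]_x (normc (f x) ^+ 2)%:E)%E.
Proof.
rewrite /L2norm unlock -poweR12_sqrt; last by apply: integral_ge0 => x _; rewrite lee_fin sqr_ge0.
congr (_ `^ _)%E; apply: eq_integral => x _.
by rewrite /= ger0_norm ?normc_ge0 // powR_mulrn ?normc_ge0.
Qed.

Lemma L2P f : L2 mu f <->
  cmeasurable f /\ mu.-integrable setT (EFin \o (fun x => normc (f x) ^+ 2)).
Proof.
rewrite /L2 L2normE; set I := (\int[mu]_x _)%E.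
have I0 : (0 <= I)%E by apply: integral_ge0 => x _; rewrite lee_fin sqr_ge0.
have IE : (\int[mu]_x `|(EFin \o (fun x => (normc (f x) ^+ 2)%R)) x| = I)%E.
  by apply: eq_integral => x _; rewrite /= ger0_norm // sqr_ge0.
have sI : (sqrte I < +oo)%E <-> (I < +oo)%E.
  by move: (I) I0 => [r||] //= _; rewrite !ltry.
split=> [[mf /sI fin]|[mf /integrableP[_ fin]]]; split => //.
  apply/integrableP; split; last by rewrite IE.
  by apply/measurable_EFinP; apply: measurable_funX; exact: cmeas_normc.
by apply/sI; rewrite -IE.
Qed.

Lemma L2norm_Rintegral f : L2 mu f ->
  L2norm mu f = (Num.sqrt (\int[mu]_x normc (f x) ^+ 2))%:E.
Proof.
move=> /L2P[_ If]; rewrite L2normE /Rintegral.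
rewrite -[X in sqrte X = _]fineK; first by [].
by have := integrable_fin_num measurableT If.
Qed.

Lemma L2norm_le f (r : R) : L2 mu f -> 0 <= r ->
  (L2norm mu f <= r%:E)%E = (\int[mu]_x normc (f x) ^+ 2 <= r ^+ 2).
Proof.
move=> Lf r0; rewrite L2norm_Rintegral // lee_fin -{1}(ger0_norm r0) -sqrtr_sqr.
by rewrite ler_sqrt ?sqr_ge0.
Qed.

Lemma L2_int_ge0 f : 0 <= \int[mu]_x normc (f x) ^+ 2.
Proof. by apply: Rintegral_ge0 => x _; exact: sqr_ge0. Qed.

(** A weighted arithmetic-geometric mean inequality replaces the Cauchy-Schwarz
    inequality; optimizing over r would give the latter. *)
Lemma rint_square_le f (g : T -> C) (r : R) : L2 mu f -> L2 mu g -> 0 < r ->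
  mu.-integrable setT (EFin \o (fun x => normc (f x) * normc (g x))) /\
  \int[mu]_x (normc (f x) * normc (g x)) <=
  r * (\int[mu]_x normc (f x) ^+ 2) + r^-1 * (\int[mu]_x normc (g x) ^+ 2).
Proof.
move=> /L2P[mf If] /L2P[mg Ig] r0.
have D : mu.-integrable setT (EFin \o (fun x => r * normc (f x) ^+ 2 + r^-1 * normc (g x) ^+ 2)).
  exact: rintD (rintZ r If) (rintZ r^-1 Ig).
have le x : normc (f x) * normc (g x) <= r * normc (f x) ^+ 2 + r^-1 * normc (g x) ^+ 2.
  have := normc_ge0 (f x); have := normc_ge0 (g x); set a := normc (f x); set b := normc (g x) => b0 a0.
  rewrite -(ler_pM2l r0) mulrDr (mulrA r r^-1) divff ?gt_eqF // mul1r.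
  have := sqr_ge0 (r * a - b); have := sqr_ge0 (r * a); have := sqr_ge0 b; nra.
have I : mu.-integrable setT (EFin \o (fun x => normc (f x) * normc (g x))).
  apply: (rint_dom _ D); first by apply: measurable_funM; exact: cmeas_normc.
  by move=> x; rewrite ger0_norm ?mulr_ge0 ?normc_ge0.
split => //; rewrite -!RintegralZl // -RintegralD //; last 2 first.
- exact: rintZ.
- exact: rintZ.
by apply: le_Rintegral.
Qed.

Lemma cint_L2M f g : L2 mu f -> L2 mu g -> cintegrable mu (fun x => f x * g x).
Proof.
move=> Lf Lg; apply: (cint_dom (k := fun x => normc (f x) * normc (g x))).
- by apply: cmeasM; [case/L2P: Lf|case/L2P: Lg].
- exact: (rint_square_le Lf Lg ltr01).1.
- by move=> x; rewrite normcM.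
Qed.

Lemma normc_int_L2M f g (r : R) : L2 mu f -> L2 mu g -> 0 < r ->
  \int[mu]_x normc (f x) ^+ 2 <= r ^+ 2 ->
  normc (cintegral mu (fun x => f x * g x)) <= 2 * (r * (1 + \int[mu]_x normc (g x) ^+ 2)).
Proof.
move=> Lf Lg r0 H; have r0' : 0 < r^-1 by rewrite invr_gt0.
have [I le] := rint_square_le Lf Lg r0'.
apply: le_trans (normc_cintegral (k := fun x => normc (f x) * normc (g x)) _ I _) _.
- by apply: cmeasM; [case/L2P: Lf|case/L2P: Lg].
- by move=> x; rewrite normcM.
rewrite ler_wpM2l //; apply: le_trans le _.
rewrite invrK mulrDr mulr1; apply: lerD => //.
by rewrite mulrC ler_pdivrMr // -expr2.
Qed.
End square_integrable.

Section schwartz_L2.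
Context {R : realType}.
Local Notation C := R[i].

Lemma schwartz_L2 k (u : 'rV[R]_k -> C) : schwartz u -> L2 (leb k) u.
Proof.
move=> su; apply/L2P; split; first exact: schwartz_meas.
have := (schwartz_cint (schwartzM su (schwartzJ su))).1.
by congr (_.-integrable _ _); apply/funext => x /=; rewrite mul_conj_normc.
Qed.

Lemma L2_wt k N : (k + k <= N)%N -> L2 (leb k) (fun x : 'rV[R]_k => (wt N x)%:C).
Proof.
move=> kN; apply/L2P; split; first by apply: cmeasR; exact: measurable_wt.
have -> : (fun x : 'rV[R]_k => normc (wt N x)%:C ^+ 2) = wt (N + N).
  by apply/funext => x; rewrite normcR ger0_norm // wtD expr2.
by apply: rint_wt; exact: leq_trans (leq_addr _ _).
Qed.

Lemma int_normc_tau k rho (u : 'rV[R]_k -> C) : schwartz u ->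
  \int[leb k]_x normc (tau rho u x) ^+ 2 = \int[leb k]_x normc (u x) ^+ 2.
Proof.
move=> su; have /L2P[_ I] := schwartz_L2 su.
have [_ <-] := rint_shift (- lsubmx rho) I.
by apply: eq_Rintegral => x _; rewrite normc_tau.
Qed.
End schwartz_L2.

(** * The Gabor representation of a symbol *)

Section symbol_representation.
Context {R : realType}.
Local Notation C := R[i].
Variables (k : nat) (chi : 'rV[R]_(k + k) -> C) (Z : nat -> seq 'rV[R]_(k + k)) (c : R).
Local Notation D := ((k + k) + (k + k))%N.
Hypothesis schi : schwartz chi.
Hypothesis Zc : forall j rho, \sum_(g <- Z j) wt D (g - rho) <= c.
Hypothesis Zchi : forall rho, ccvg (fun j => \sum_(g <- Z j) translate chi g rho) 1.
Local Notation cut g := (weyl_transpose (translate chi g)).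

(** Decay jointly in the position of the cut and in phase space. *)
Lemma stft_cut_bound (h F : 'rV[R]_k -> C) M N : schwartz h -> schwartz F -> exists2 B : R, 0 <= B &
  forall g rho, normc (stft h (cut g F) rho) <= B * (wt M g * wt N rho).
Proof.
move=> sh sF; have sT := schwartz_weyl_transpose schi sF.
have [B B0 HB] := schwartz_bound (M + N) (schwartz_stft_param sT sh).
exists B => // g rho; apply: le_trans (ler_wpM2l B0 (wt_row M N g rho)).
have := HB (row_mx g rho); rewrite row_mxKl row_mxKr.
have -> // : stft h (fun s => weyl_transpose (translate chi (lsubmx (row_mx g s : 'rV[R]_((k + k) + k)))) F
    (rsubmx (row_mx g s : 'rV[R]_((k + k) + k)))) rho = stft h (cut g F) rho.
by apply: eq_cintegral => s; rewrite row_mxKl row_mxKr.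
Qed.

Lemma cut_seminorm_bound (F : 'rV[R]_k -> C) M N : schwartz F -> exists2 B : R, 0 <= B &
  forall g s x, (size s <= N)%N -> japanese x ^+ N * normc (partials s (cut g F) x) <= B * wt M g.
Proof.
move=> sF; pose T (w : 'rV[R]_((k + k) + k)) := weyl_transpose (translate chi (lsubmx w)) F (rsubmx w).
have sT : schwartz T := schwartz_weyl_transpose schi sF.
suff ev s : exists j0, forall j, (j0 <= j)%N -> forall g x,
    japanese x ^+ N * normc (partials s (cut g F) x) <= j%:R * wt M g.
  by have [B HB] := eventually_seqs N ev; exists B%:R => // g s x Hs; exact: HB.
have [B B0 HB] := schwartz_bound (M + N) (schwartz_partials (map (@rshift (k + k) k) s) sT).
exists (Num.truncn B).+1 => j Hj g x.
have TE : cut g F = fun x => T (row_mx g x) by apply/funext => y; rewrite /T row_mxKl row_mxKr.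
have Bj : B <= j%:R by apply: le_trans (ltW (truncnS_gt B)) _; rewrite ler_nat.
rewrite TE partials_slice //; apply/le_wt; apply: le_trans (HB _) _.
rewrite -mulrA; apply: ler_pM => //; exact: wt_row.
Qed.

Variables (a : Defs.distribution (R := R) k) (f : 'rV[R]_(k + k) -> 'rV[R]_k -> C).
Hypothesis ta : tempered a.
Hypothesis fL2 : forall g, L2 (leb k) (f g).
Hypothesis fa : forall j g u, g \in Z j -> schwartz u ->
  a (cut g u) = cintegral (leb k) (fun x => f g x * u x).

Let aj j u := \sum_(g <- Z j) cintegral (leb k) (fun x => f g x * u x).
Let ajE j u : schwartz u -> aj j u = \sum_(g <- Z j) a (cut g u).
Proof. by move=> su; apply: eq_big_seq => g gZ; rewrite (fa gZ su). Qed.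

(** A priori only polynomial growth is known, from the continuity of the symbol as a
    distribution. *)
Lemma tau_growth (u : 'rV[R]_k -> C) : schwartz u -> exists N (B : R), 0 <= B /\
  forall rho, normc (a (tau rho u)) <= B * japanese rho ^+ N.
Proof.
move=> su; have [N [A [A0 HA]]] := tempered_tau ta.
suff ev s : exists j0, forall j, (j0 <= j)%N -> forall x, japanese x ^+ N * normc (partials s u x) <= j%:R.
  have [B HB] := eventually_seqs N ev; exists (N + N)%N, (A * B%:R); split; first by rewrite mulr_ge0.
  by move=> rho; rewrite -mulrA (mulrC B%:R); apply: HA => // s x Hs; exact: HB.
have [B HB] := su.2 N s; exists (Num.truncn B).+1 => j Hj x; apply: le_trans (HB x) _.
by apply: le_trans (ltW (truncnS_gt B)) _; rewrite ler_nat.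
Qed.

Let aj_growth (u : 'rV[R]_k -> C) : schwartz u -> exists N (B : R), 0 <= B /\
  forall j rho, normc (aj j (tau rho u)) <= B * japanese rho ^+ N.
Proof.
move=> su; have [N [A [A0 HA]]] := tempered_tau ta.
have [B B0 HB] := cut_seminorm_bound D N su.
have c0 : 0 <= c by apply: le_trans (Zc 0 0); apply: sumr_ge0 => g _.
exists (N + N)%N, (A * (B * c)); split; first by rewrite !mulr_ge0.
move=> j rho; rewrite ajE; last exact: schwartz_tau.
apply: le_trans (le_normc_sum _ _ _) _.
apply: (@le_trans _ _ (\sum_(g <- Z j) A * (japanese rho ^+ (N + N) * (B * wt D (g - rho))))).
  apply: ler_sum => g _; rewrite weyl_covariance //; apply: HA; first exact: schwartz_piece.
  by move=> s x Hs; exact: HB.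
rewrite -!mulr_sumr -mulrA ler_wpM2l // mulrC ler_wpM2r ?exprn_ge0 // ler_wpM2l //.
Qed.

Let pair_bound (u : 'rV[R]_k -> C) : schwartz u -> exists2 B : R, 0 <= B & forall (t : 'rV[R]_k) rho,
  normc (tau rho u t) <= B * (japanese rho ^+ (k + k) * wt (k + k) t).
Proof.
move=> su; have [B B0 HB] := schwartz_bound (k + k) su; exists (B * 2 ^+ (k + k)).
  by rewrite mulr_ge0 ?exprn_ge0.
move=> t rho; rewrite normc_tau; apply: le_trans (HB _) _; rewrite -mulrA ler_wpM2l //.
apply: le_trans (wt_sub _ _ _) _; rewrite ler_wpM2l ?exprn_ge0 // ler_wpM2r ?wt_ge0 //.
apply: lerXn2r; rewrite ?nnegrE //; rewrite -[in leRHS](hsubmxK rho); exact: jp_rowl.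
Qed.

Let rint_fwt g : (leb k).-integrable setT (EFin \o (fun t => normc (f g t) * wt (k + k) t)).
Proof.
have [] := rint_square_le (fL2 g) (@L2_wt R k (k + k) (leqnn _)) ltr01.
by move=> + _; congr (_.-integrable _ (EFin \o _)); apply/funext => t; rewrite normcR ger0_norm.
Qed.

Let cmeas_pair g (u : 'rV[R]_k -> C) (w : 'rV[R]_(k + k) -> C) : schwartz u -> cmeasurable w ->
  cmeasurable (fun p : 'rV[R]_k * 'rV[R]_(k + k) => f g p.1 * (w p.2 * tau p.2 u p.1)).
Proof.
move=> su mw; have [mf _] := (L2P _ _).1 (fL2 g).
apply: cmeasM; first exact: cmeas_comp mf measurable_fst.
apply: cmeasM; first exact: cmeas_comp mw measurable_snd.
exact: cmeas_tau su measurable_snd measurable_fst.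
Qed.

Let pair_fub g (u : 'rV[R]_k -> C) (w : 'rV[R]_(k + k) -> C) (W : R) : schwartz u -> cmeasurable w -> 0 <= W ->
  (forall rho, normc (w rho) <= W * wt ((k + k) + D) rho) ->
  exists2 B : R, (leb (k + k)).-integrable setT (EFin \o (fun rho => B * wt D rho)) &
  forall t rho, normc (f g t * (w rho * tau rho u t)) <= `|normc (f g t) * wt (k + k) t| * `|B * wt D rho|.
Proof.
move=> su mw W0 HW; have [B B0 HB] := pair_bound su; exists (W * B); first exact: rintZ (rint_wt2 _).
move=> t rho; rewrite normcM (normcM (w rho)) !ger0_norm ?mulr_ge0 ?normc_ge0 ?wt_ge0 //.
rewrite -[leRHS]mulrA ler_wpM2l ?normc_ge0 //.
apply: le_trans (ler_pM _ _ (HW rho) (HB t rho)) _; rewrite ?normc_ge0 // wtD.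
rewrite le_eqVlt; apply/orP; left; apply/eqP.
transitivity (W * B * wt (k + k) t * wt D rho * (japanese rho ^+ (k + k) * wt (k + k) rho)); first by ring.
by rewrite wtK mulr1; ring.
Qed.

Let meas_fg g (u : 'rV[R]_k -> C) : schwartz u ->
  cmeasurable (fun rho => cintegral (leb k) (fun x => f g x * tau rho u x)).
Proof.
move=> su; pose w (rho : 'rV[R]_(k + k)) : C := (wt ((k + k) + D) rho)%:C.
have mw : cmeasurable w by apply: cmeasR; exact: measurable_wt.
have Hw rho : normc (w rho) <= 1 * wt ((k + k) + D) rho.
  by rewrite mul1r /w normcR ger0_norm.
have [B IB HB] := pair_fub g su mw ler01 Hw.
have M := fub_meas_int2 (rint_fwt g) IB (cmeas_pair g su mw) HB.
have mj : cmeasurable (fun rho : 'rV[R]_(k + k) => (japanese rho ^+ ((k + k) + D))%:C).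
  by apply: cmeasR; apply: measurable_funX; exact: measurable_jp.
have := cmeasM mj M; congr cmeasurable; apply/funext => rho.
have I := fub_int2 (rint_fwt g) (cmeas_pair g su mw) HB rho.
rewrite -cintegralZ //; apply: eq_cintegral => x.
transitivity ((japanese rho ^+ (k + k + D) * wt (k + k + D) rho)%:C * (f g x * tau rho u x)).
  by rewrite rmorphM /w; ring.
by rewrite wtK mul1r.
Qed.

Lemma meas_tau_symbol (u : 'rV[R]_k -> C) : schwartz u -> cmeasurable (fun rho => a (tau rho u)).
Proof.
move=> su; have [K K0 HK] := localization_cvg schi Zc Zchi.
have m j : cmeasurable (fun rho => aj j (tau rho u)).
  by apply: cmeas_sum => g; exact: meas_fg.
have := cmeas_cvg m (fun rho => eq_ind _ (fun s => ccvg s _) (HK a _ ta (schwartz_tau rho su)) _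
  (funext (fun j => esym (ajE j (schwartz_tau rho su))))).
move=> mK; have := cmeasM (@cmeas_cst R _ _ K^-1) mK; congr cmeasurable; apply/funext => rho.
by rewrite mulrA mulVf // mul1r.
Qed.

Variables (h : 'rV[R]_k -> C) (K1 : C).
Hypothesis sh : schwartz h.
Hypothesis gabor : forall F s, schwartz F ->
  cintegral (leb (k + k)) (fun rho => stft h F rho * tau rho h s) = K1 * F s.

Let gabor_piece g F : schwartz F ->
  cintegrable (leb (k + k)) (fun rho => stft h F rho * cintegral (leb k) (fun x => f g x * tau rho h x)) /\
  cintegral (leb (k + k)) (fun rho => stft h F rho * cintegral (leb k) (fun x => f g x * tau rho h x)) =
  K1 * cintegral (leb k) (fun x => f g x * F x).
Proof.
move=> sF; have sV := schwartz_stft sh sF; have [W W0 HW] := schwartz_bound ((k + k) + D) sV.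
have [B IB HB] := pair_fub g sh (schwartz_meas sV) W0 HW.
have mp := cmeas_pair g sh (schwartz_meas sV).
have fh rho : cintegrable (leb k) (fun x => f g x * tau rho h x).
  by apply: cint_L2M => //; exact/schwartz_L2/schwartz_tau.
have E rho : stft h F rho * cintegral (leb k) (fun x => f g x * tau rho h x) =
    cintegral (leb k) (fun t => f g t * (stft h F rho * tau rho h t)).
  by rewrite -cintegralZ //; apply: eq_cintegral => x; rewrite mulrCA.
rewrite (funext E); split.
  apply: (cint_dom (k := fun rho => (2 * \int[leb k]_t (normc (f g t) * wt (k + k) t)) * `|B * wt D rho|)).
  - have M := fub_meas_int2 (rint_fwt g) IB mp HB; exact: M.
  - have IB' : (leb (k + k)).-integrable setT (EFin \o (fun rho => `|B * wt D rho|)).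
      exact: integrable_abse IB.
    exact: rintZ IB'.
  - move=> rho; rewrite -mulrA -RintegralZr //; apply: normc_cintegral.
    + exact: cint_meas (fub_int2 (rint_fwt g) mp HB rho).
    + have := rintZ `|B * wt D rho| (rint_fwt g); congr (_.-integrable _ _).
      by apply/funext => x /=; rewrite mulrC.
    + move=> t; apply: le_trans (HB t rho) _.
      by rewrite [X in X * _]ger0_norm // mulr_ge0 ?normc_ge0.
have S := fub_swap (rint_fwt g) IB mp HB.
etransitivity; [exact/esym/S|]; rewrite -cintegralZ; last by apply: cint_L2M => //; exact: schwartz_L2.
have [M M0 HM] := schwartz_bound 0 sh.
apply: eq_cintegral => t; rewrite mulrCA -gabor // -cintegralZ //.
apply: (cint_dom (k := fun rho => M * normc (stft h F rho))).
- apply: cmeasM; first exact: schwartz_meas.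
  by apply: (cmeas_tau (f := fun x => x) (g := fun=> t)) => //; exact: measurable_cst.
- exact/rintZ/schwartz_rint.
- move=> rho; rewrite normcM normc_tau mulrC ler_wpM2r ?normc_ge0 //.
  by apply: le_trans (HM _) _; rewrite /wt expr0 invr1 mulr1.
Qed.

(** Each localized piece is a square integrable function, for which this
    is Fubini's theorem; the sums of the pieces along the boxes grow uniformly
    polynomially in rho, so that the limit may be taken under the integral. *)
Lemma symbol_gabor F : schwartz F ->
  cintegrable (leb (k + k)) (fun rho => stft h F rho * a (tau rho h)) /\
  cintegral (leb (k + k)) (fun rho => stft h F rho * a (tau rho h)) = K1 * a F.
Proof.
move=> sF; have [K K0 HK] := localization_cvg schi Zc Zchi.
have sV := schwartz_stft sh sF; have [N [B [B0 HB]]] := aj_growth sh.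
have [W W0 HW] := schwartz_bound (N + D) sV.
have E j : cintegral (leb (k + k)) (fun rho => stft h F rho * aj j (tau rho h)) = K1 * aj j F.
  rewrite /aj mulr_sumr -(eq_bigr _ (fun g _ => (gabor_piece g sF).2)).
  rewrite -cintegral_sum; last by move=> g; exact: (gabor_piece g sF).1.
  by apply: eq_cintegral => rho; rewrite mulr_sumr.
have ajcvg u : schwartz u -> ccvg (fun j => aj j u) (K * a u).
  by move=> su; have := HK a u ta su; congr ccvg; apply/funext => j; rewrite ajE.
have [I L] : cintegrable (leb (k + k)) (fun rho => stft h F rho * (K * a (tau rho h))) /\
   ccvg (fun j => cintegral (leb (k + k)) (fun rho => stft h F rho * aj j (tau rho h)))
   (cintegral (leb (k + k)) (fun rho => stft h F rho * (K * a (tau rho h)))).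
  apply: (cintegral_dct (k := fun rho => (W * B) * wt D rho)).
  - move=> j; apply: cmeasM; first exact: schwartz_meas.
    by apply: cmeas_sum => g; exact: meas_fg.
  - by move=> rho; apply: ccvgM; [exact: ccvg_cst|exact/ajcvg/schwartz_tau].
  - exact: rintZ (rint_wt2 _).
  - move=> j rho; rewrite normcM; apply: le_trans (ler_pM _ _ (HW rho) (HB j rho)) _; rewrite ?normc_ge0 //.
    rewrite wtD le_eqVlt; apply/orP; left; apply/eqP.
    transitivity (W * B * wt D rho * (japanese rho ^+ N * wt N rho)); first by ring.
    by rewrite wtK mulr1.
have E2 rho : stft h F rho * a (tau rho h) = K^-1 * (stft h F rho * (K * a (tau rho h))).
  by rewrite mulrCA (mulrA K^-1) mulVf // mul1r.
rewrite (funext E2); split; first exact: cintZ.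
rewrite cintegralZ //; apply: (mulfI K0); rewrite mulrA mulfV // mul1r mulrCA.
apply: ccvg_unique L _; rewrite (funext E); apply: ccvgM; [exact: ccvg_cst|exact: ajcvg].
Qed.
End symbol_representation.

(** * The phase space bound *)

Section phase_space_bound.
Context {R : realType}.
Local Notation C := R[i].

Definition moderate k (w : 'rV[R]_k -> R) (Cw : R) (N : nat) : Prop :=
  (forall rho, 0 < w rho) /\ forall rho mu, w rho <= Cw * (japanese (rho - mu) ^+ N * w mu).

Lemma order_function_moderate k (m : 'rV[R]_k -> R) : order_function m ->
  exists (C0 : R) (N : nat), 0 <= C0 /\ moderate m C0 N.
Proof.
move=> [m0 [C0 [N0 [C00 N01 Hm]]]]; exists C0, (Num.truncn N0).+1; split; first exact: ltW.
split=> // rho mu; apply: le_trans (Hm rho mu) _; rewrite -mulrA ler_wpM2l ?(ltW C00) //.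
rewrite ler_wpM2r ?(ltW (m0 _)) // -powR_mulrn //; apply: ler_powR; first exact: jp_ge1.
exact: ltW (truncnS_gt N0).
Qed.

Lemma le_of_halves (x y z : R) : (forall i : nat, x <= y + z / 2 ^+ i) -> x <= y.
Proof.
move=> H; rewrite leNgt; apply/negP => yx; have d0 : 0 < x - y by rewrite subr_gt0.
pose i := (Num.truncn (z / (x - y))).+1; have := H i; apply/negP; rewrite -ltNge.
rewrite -ltrBrDl ltr_pdivrMr ?exprn_gt0 // mulrC -ltr_pdivrMr //.
apply: lt_le_trans (truncnS_gt _) _; rewrite -natrX ler_nat; exact/ltnW/ltn_expl.
Qed.

Lemma le_of_eps (x y z : R) : 0 <= z -> (forall e, 0 < e -> x <= y + e * z) -> x <= y.
Proof.
move=> z0 H; apply: (@le_of_halves _ _ z) => i.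
by rewrite mulrC; apply: H; rewrite invr_gt0 exprn_gt0.
Qed.

Variables (k : nat) (chi : 'rV[R]_(k + k) -> C) (Z : nat -> seq 'rV[R]_(k + k)) (c : R).
Local Notation D := ((k + k) + (k + k))%N.
Hypothesis schi : schwartz chi.
Hypothesis Zc : forall j rho, \sum_(g <- Z j) wt D (g - rho) <= c.
Hypothesis Zchi : forall rho, ccvg (fun j => \sum_(g <- Z j) translate chi g rho) 1.
Local Notation cut g := (weyl_transpose (translate chi g)).
Variables (m : 'rV[R]_(k + k) -> R) (C0 : R) (N1 : nat).
Hypotheses (C00 : 0 <= C0) (mm : moderate m C0 N1).
Variables (h : 'rV[R]_k -> C) (K1 : C).
Hypotheses (sh : schwartz h) (K10 : K1 != 0).
Hypothesis gabor : forall F s, schwartz F ->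
  cintegral (leb (k + k)) (fun rho => stft h F rho * tau rho h s) = K1 * F s.

(** The data used of a symbol of norm at most A: its localized pieces are square
    integrable functions f g, with norms controlled by A and m. *)
Definition localized (a : Defs.distribution (R := R) k) (A : R) : Prop :=
  [/\ tempered a, 0 < A & exists f : 'rV[R]_(k + k) -> 'rV[R]_k -> C,
  [/\ forall g, L2 (leb k) (f g),
    forall j g u, g \in Z j -> schwartz u -> a (cut g u) = cintegral (leb k) (fun x => f g x * u x) &
    forall j g, g \in Z j -> \int[leb k]_x normc (f g x) ^+ 2 <= (A * m g) ^+ 2]].

Let c0 : 0 <= c.
Proof. by apply: le_trans (Zc 0 0); apply: sumr_ge0 => g _. Qed.
Let nK1 : 0 < normc K1.
Proof. by rewrite lt_neqAle normc_ge0 andbT eq_sym; apply: contra K10 => /eqP/eq0_normc ->. Qed.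

(* passing from the window h to another function G, by the Gabor representation *)
Let weighted (Cw : R) (Nw : nat) : 0 <= Cw -> exists2 C2 : R, 0 <= C2 & forall w a A B,
  moderate w Cw Nw -> localized a A -> 0 <= B -> (forall rho, normc (a (tau rho h)) <= B * w rho) ->
  forall G Q, schwartz G -> 0 <= Q -> (forall mu, normc (stft h G mu) <= Q * wt (Nw + D) mu) ->
  forall rho, normc (a (tau rho G)) <= C2 * (Q * (B * w rho)).
Proof.
move=> Cw0; pose I : R := \int[leb (k + k)]_x wt D x.
have I0 : 0 <= I by apply: Rintegral_ge0 => x _; exact: wt_ge0.
exists ((normc K1)^-1 * (2 * (Cw * I))); first by rewrite !mulr_ge0 // invr_ge0 ltW.
move=> w a A B [w0 mw] [ta A0 [f [fL2 fa _]]] B0 HB G Q sG Q0 HG rho.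
have [Ig E] := symbol_gabor schi Zc Zchi ta fL2 fa sh gabor (schwartz_tau rho sG).
have [Iw EI] := rint_shift (- rho) (rint_wt2 (R := R) (k + k)).
rewrite -mulrA ler_pdivlMl // -normcM -E.
have := normc_cintegral (cint_meas Ig) (rintZ (Q * B * w rho * Cw) Iw).
rewrite RintegralZl // EI => H.
have -> : 2 * (Cw * I) * (Q * (B * w rho)) = 2 * (Q * B * w rho * Cw * I) by ring.
apply: H => mu; rewrite normcM stft_tau //.
apply: le_trans (ler_pM _ _ (HG _) (HB mu)) _; rewrite ?normc_ge0 // wtD.
have := mw mu rho => H.
apply: le_trans (ler_wpM2l _ (ler_wpM2l B0 H)) _; first by rewrite !mulr_ge0 ?wt_ge0.
rewrite le_eqVlt; apply/orP; left; apply/eqP.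
transitivity (Q * B * w rho * Cw * wt D (mu - rho) * (japanese (mu - rho) ^+ Nw * wt Nw (mu - rho))).
  by ring.
by rewrite wtK mulr1.
Qed.

(** The pieces near rho are controlled by the localized norms, those at
    distance at least r by the bound w, with the gain of a factor 1/r. *)
Let improve (Cw : R) (Nw : nat) : 0 <= Cw -> exists2 C' : R, 0 <= C' & forall w a A B,
  moderate w Cw Nw -> localized a A -> 0 <= B -> (forall rho, normc (a (tau rho h)) <= B * w rho) ->
  forall rho, normc (a (tau rho h)) <= C' * (A * m rho) + B / 2 * w rho.
Proof.
move=> Cw0; have [K K0 HK] := localization_cvg schi Zc Zchi.
have nK : 0 < normc K.
  by rewrite lt_neqAle normc_ge0 andbT eq_sym; apply: contra K0 => /eqP/eq0_normc ->.
have [C2 C20 HC2] := weighted Nw Cw0.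
have [Q0 Q00 HQ0] := stft_cut_bound schi D.+1 (Nw + D) sh sh.
pose H := \int[leb k]_x normc (h x) ^+ 2; have H0 : 0 <= H by exact: L2_int_ge0.
pose r := 1 + 2 * (c * (C2 * Q0)) / normc K.
have cCQ : 0 <= c * (C2 * Q0) by rewrite !mulr_ge0.
have r1 : 1 <= r by rewrite lerDl divr_ge0 // ?mulr_ge0 // ltW.
have r0 : 0 < r by exact: lt_le_trans r1.
pose P := 2 * (1 + H) * C0 * r ^+ (N1 + D).
have P0 : 0 <= P by rewrite !mulr_ge0 ?addr_ge0 ?exprn_ge0 // ltW.
have PE : P = 2 * (1 + H) * C0 * r ^+ (N1 + D) by [].
have rE : r - 1 = 2 * (c * (C2 * Q0) / normc K) by rewrite /r; ring.
clearbody P r; exists (c * P / normc K); first exact: divr_ge0 (mulr_ge0 c0 P0) (ltW nK).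
move=> w a A B mw la B0 HB rho; have [ta A0 [f [fL2 fa fA]]] := la.
have [w0 _] := mw; have [m0 Hm] := mm.
have wr0 := ltW (w0 rho); have mr0 := ltW (m0 rho).
have ri0 : 0 <= r^-1 by rewrite invr_ge0 ltW.
have Tg j g : g \in Z j -> normc (a (cut g (tau rho h))) <=
    (P * (A * m rho) + C2 * Q0 * r^-1 * (B * w rho)) * wt D (g - rho).
  move=> gZ; rewrite mulrDl; have [gr|gr] := leP (japanese (g - rho)) r.
    apply: ler_wpDr; first by rewrite !mulr_ge0 ?wt_ge0.
    have st := schwartz_tau rho sh; rewrite (fa _ _ _ gZ st).
    have Am : 0 < A * m g by rewrite mulr_gt0.
    apply: le_trans (normc_int_L2M (fL2 g) (schwartz_L2 st) Am (fA _ _ gZ)) _.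
    rewrite int_normc_tau // -/H.
    have mg : m g <= C0 * (r ^+ N1 * m rho).
      apply: le_trans (Hm g rho) _; rewrite ler_wpM2l // ler_wpM2r ?(ltW (m0 _)) //.
      by apply: lerXn2r; rewrite ?nnegrE // ltW.
    have one : 1 <= r ^+ D * wt D (g - rho).
      rewrite -(wtK D (g - rho)) ler_wpM2r ?wt_ge0 //.
      by apply: lerXn2r; rewrite ?nnegrE // ltW.
    apply: (@le_trans _ _ (2 * (1 + H) * A * (C0 * (r ^+ N1 * m rho)) * 1)).
      rewrite mulr1 [leLHS](_ : _ = 2 * (1 + H) * A * m g); last by ring.
      by rewrite ler_wpM2l // !mulr_ge0 ?addr_ge0 // ltW.
    apply: le_trans (ler_wpM2l _ one) _.
      by rewrite !mulr_ge0 ?addr_ge0 ?exprn_ge0 // ltW.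
    by rewrite PE (exprD _ N1) le_eqVlt; apply/orP; left; apply/eqP; ring.
  apply: ler_wpDl; first by rewrite !mulr_ge0 ?wt_ge0 // ltW.
  rewrite weyl_covariance //.
  have HV mu : normc (stft h (cut (g - rho) h) mu) <= Q0 * wt D.+1 (g - rho) * wt (Nw + D) mu.
    by rewrite -mulrA; exact: HQ0.
  have Q1 : 0 <= Q0 * wt D.+1 (g - rho) by rewrite mulr_ge0 ?wt_ge0.
  apply: le_trans (HC2 w a A B mw la B0 HB _ _ (schwartz_piece schi (g - rho) sh) Q1 HV rho) _.
  have -> : wt D.+1 (g - rho) = (japanese (g - rho))^-1 * wt D (g - rho).
    by rewrite -addn1 addnC wtD /wt expr1.
  have jr : (japanese (g - rho))^-1 <= r^-1 by rewrite lef_pV2 ?posrE // ltW.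
  rewrite [leRHS](_ : _ = r^-1 * (C2 * Q0 * (B * w rho) * wt D (g - rho))); last by ring.
  rewrite [leLHS](_ : _ = (japanese (g - rho))^-1 * (C2 * Q0 * (B * w rho) * wt D (g - rho))); last by ring.
  by rewrite ler_wpM2r // !mulr_ge0 ?wt_ge0 // ltW.
have bnd : normc (K * a (tau rho h)) <= c * (P * (A * m rho) + C2 * Q0 * r^-1 * (B * w rho)).
  apply: ccvg_normc_le (HK a _ ta (schwartz_tau rho sh)) _ => j.
  apply: le_trans (le_normc_sum _ _ _) _.
  apply: (@le_trans _ _ (\sum_(g <- Z j) (P * (A * m rho) + C2 * Q0 * r^-1 * (B * w rho)) * wt D (g - rho))).
    by rewrite big_seq [leRHS]big_seq; apply: ler_sum => g gZ; exact: (Tg j).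
  rewrite -mulr_sumr mulrC ler_wpM2r //.
  by rewrite addr_ge0 // !mulr_ge0 ?invr_ge0 // ltW.
rewrite normcM mulrC -ler_pdivlMr // in bnd; apply: le_trans bnd _.
have -> : c * (P * (A * m rho) + C2 * Q0 * r^-1 * (B * w rho)) / normc K =
   c * P / normc K * (A * m rho) + (c * (C2 * Q0) / normc K / r) * (B * w rho) by ring.
rewrite lerD2l [leRHS](_ : _ = 2^-1 * (B * w rho)); last by ring.
rewrite ler_wpM2r ?mulr_ge0 //.
rewrite ler_pdivrMr //; lra.
Qed.

(* improve halves the constant B of the a priori bound at each application *)
Let iterate (Cw : R) (Nw : nat) : 0 <= Cw -> exists2 C' : R, 0 <= C' & forall w a A B,
  moderate w Cw Nw -> (forall rho, m rho <= w rho) -> localized a A -> 0 <= B ->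
  (forall rho, normc (a (tau rho h)) <= B * w rho) ->
  forall rho, normc (a (tau rho h)) <= C' * (A * w rho).
Proof.
move=> Cw0; have [C' C'0 HC'] := improve Nw Cw0; exists (2 * C'); first exact: mulr_ge0.
move=> w a A B mw le la B0 HB; have A0 : 0 < A by case: la.
have step i rho : normc (a (tau rho h)) <= (2 * C' * A + B / 2 ^+ i) * w rho.
  elim: i rho => [|i IH] rho.
    rewrite expr0 divr1 mulrDl; apply: ler_wpDl (HB rho).
    by rewrite !mulr_ge0 // ltW // (mw.1 rho).
  have Bi : 0 <= 2 * C' * A + B / 2 ^+ i by rewrite addr_ge0 ?divr_ge0 ?mulr_ge0 ?exprn_ge0 // ltW.
  apply: le_trans (HC' w a A _ mw la Bi IH rho) _.
  apply: (@le_trans _ _ (C' * (A * w rho) + (2 * C' * A + B / 2 ^+ i) / 2 * w rho)).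
    by rewrite lerD2r ler_wpM2l // ler_wpM2l // ltW.
  rewrite exprS invfM le_eqVlt; apply/orP; left; apply/eqP; field.
  by rewrite expf_neq0 // pnatr_eq0.
move=> rho; apply: (@le_of_halves _ _ (B * w rho)) => i.
by apply: le_trans (step i rho) _; rewrite le_eqVlt; apply/orP; left; apply/eqP; ring.
Qed.

(** The weight m plus a small multiple of a power of the Japanese bracket admits the a
    priori bound; letting the multiple tend to zero gives a bound by m itself, with a
    constant depending on the growth of the symbol, from which the iteration with
    the weight m removes this dependence. *)
Let window_bound : exists2 C' : R, 0 <= C' & forall a A, localized a A ->
  forall rho, normc (a (tau rho h)) <= C' * (A * m rho).
Proof.
have [C1 C10 HC1] := iterate N1 C00; exists C1 => // a A la.
have [ta A0 _] := la; have [m0 Hm] := mm.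
have [Na [B [B0 HB]]] := tau_growth ta sh.
have Cw0 : 0 <= C0 + 2 ^+ Na by rewrite addr_ge0 ?exprn_ge0.
have [C' C'0 HC'] := iterate (N1 + Na) Cw0.
suff coarse rho : normc (a (tau rho h)) <= C' * A * m rho.
  apply: (HC1 m a A (C' * A)) => //; by rewrite mulr_ge0 // ltW.
apply: (@le_of_eps _ _ (C' * A * japanese rho ^+ Na)); first by rewrite !mulr_ge0 ?exprn_ge0 // ltW.
move=> e e0; pose w mu := m mu + e * japanese mu ^+ Na.
have w0 mu : 0 < w mu by rewrite ltr_pwDl ?mulr_ge0 ?exprn_ge0 // ltW.
have mw : moderate w (C0 + 2 ^+ Na) (N1 + Na).
  split=> // r mu; pose X := japanese (r - mu).
  have X1 : 1 <= X by exact: jp_ge1.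
  have X00 : 0 <= X by exact: le_trans X1.
  have e1 : m r <= C0 * (X ^+ (N1 + Na) * m mu).
    apply: le_trans (Hm r mu) _; rewrite ler_wpM2l // ler_wpM2r ?(ltW (m0 _)) //.
    by rewrite ler_weXn2l // leq_addr.
  have e2 : e * japanese r ^+ Na <= 2 ^+ Na * (X ^+ (N1 + Na) * (e * japanese mu ^+ Na)).
    rewrite [leRHS](_ : _ = e * (2 ^+ Na * (X ^+ (N1 + Na) * japanese mu ^+ Na))); last by ring.
    rewrite ler_wpM2l ?(ltW e0) //.
    apply: (@le_trans _ _ ((2 * (X * japanese mu)) ^+ Na)).
      by apply: lerXn2r; rewrite ?nnegrE ?mulr_ge0 //; exact: jp_sub.
    rewrite exprMn ler_wpM2l ?exprn_ge0 // exprMn ler_wpM2r ?exprn_ge0 //.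
    by rewrite ler_weXn2l // leq_addl.
  have X0 : 0 <= X ^+ (N1 + Na) by rewrite exprn_ge0 // (le_trans ler01).
  rewrite /w mulrDr mulrDr !mulrDl; apply: le_trans (lerD e1 e2) _.
  have p1 : 0 <= 2 ^+ Na * (X ^+ (N1 + Na) * m mu) by rewrite !mulr_ge0 ?exprn_ge0 // ltW.
  have p2 : 0 <= C0 * (X ^+ (N1 + Na) * (e * japanese mu ^+ Na)) by rewrite !mulr_ge0 ?exprn_ge0 // ltW.
  by lra.
apply: le_trans (HC' w a A (B / e) mw _ la _ _ rho) _.
- by move=> mu; rewrite /w lerDl mulr_ge0 ?exprn_ge0 // ltW.
- by rewrite divr_ge0 // ltW.
- move=> mu; apply: le_trans (HB mu) _; rewrite /w mulrDr; apply: ler_wpDl.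
    by rewrite !mulr_ge0 ?invr_ge0 // ltW.
  by rewrite mulrA divfK // gt_eqF.
- by rewrite /w le_eqVlt; apply/orP; left; apply/eqP; ring.
Qed.

(** From the window, the bound passes to all Schwartz functions by the Gabor
    representation. *)
Lemma symbol_bound_tau F : schwartz F -> exists2 CF : R, 0 <= CF & forall a A, localized a A ->
  forall rho, normc (a (tau rho F)) <= CF * (A * m rho).
Proof.
move=> sF; have [C1 C10 HC1] := window_bound; have [C2 C20 HC2] := weighted N1 C00.
have [Q Q0 HQ] := schwartz_bound (N1 + D) (schwartz_stft sh sF).
exists (C2 * (Q * C1)); first by rewrite !mulr_ge0.
move=> a A la rho; have A0 : 0 < A by case: la.
have CA : 0 <= C1 * A by rewrite mulr_ge0 // ltW.
have HB rho' : normc (a (tau rho' h)) <= C1 * A * m rho' by rewrite -mulrA; exact: HC1.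
apply: le_trans (HC2 m a A _ mm la CA HB F Q sF Q0 HQ rho) _.
by rewrite le_eqVlt; apply/orP; left; apply/eqP; ring.
Qed.
End phase_space_bound.

(** * Geometry of the Bargmann transform *)

Section complex_rows.
Context {R : realType}.
Local Notation C := R[i].
Local Notation ii := ((0 : R) +i* 1).

Definition rRe k (z : 'rV[C]_k) : 'rV[R]_k := map_mx (@complex.Re R) z.
Definition rIm k (z : 'rV[C]_k) : 'rV[R]_k := map_mx (@complex.Im R) z.
Definition cdot k (z w : 'rV[C]_k) : C := (z *m w^T) ord0 ord0.

Lemma cdotE k (z w : 'rV[C]_k) : cdot z w = \sum_i z ord0 i * w ord0 i.
Proof. by rewrite /cdot mxE; apply: eq_bigr => i _; rewrite mxE. Qed.
Lemma cdotDl k (x y z : 'rV[C]_k) : cdot (x + y) z = cdot x z + cdot y z.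
Proof. by rewrite /cdot mulmxDl mxE. Qed.
Lemma cdotC k (z w : 'rV[C]_k) : cdot z w = cdot w z.
Proof. by rewrite !cdotE; apply: eq_bigr => i _; rewrite mulrC. Qed.
Lemma cdot_mulmx k l (z : 'rV[C]_k) (M : 'M[C]_(k, l)) w : cdot (z *m M) w = cdot z (w *m M^T).
Proof. by rewrite /cdot trmx_mul trmxK mulmxA. Qed.

Lemma Re_cdot_real k (z : 'rV[C]_k) t : Re (cdot z (toC t)) = rdot (rRe z) t.
Proof.
rewrite cdotE rdotE (raddf_sum (@complex.Re R)); apply: eq_bigr => i _.
by rewrite !mxE /= cReM /= mulr0 subr0.
Qed.
Lemma Im_cdot_real k (z : 'rV[C]_k) t : Im (cdot z (toC t)) = rdot (rIm z) t.
Proof.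
rewrite cdotE rdotE (raddf_sum (@complex.Im R)); apply: eq_bigr => i _.
by rewrite !mxE /= cImM /= mulr0 add0r.
Qed.
Lemma rRe_mul k l (M : 'M[C]_(k, l)) t : rRe (toC t *m M) = t *m map_mx (@complex.Re R) M.
Proof.
apply/rowP => i; rewrite !mxE (raddf_sum (@complex.Re R)); apply: eq_bigr => j _.
by rewrite !mxE /= cReM /= mul0r subr0.
Qed.
Lemma rIm_mul k l (M : 'M[C]_(k, l)) t : rIm (toC t *m M) = t *m map_mx (@complex.Im R) M.
Proof.
apply/rowP => i; rewrite !mxE (raddf_sum (@complex.Im R)); apply: eq_bigr => j _.
by rewrite !mxE /= cImM /= mul0r addr0.
Qed.
Lemma rReD k (z w : 'rV[C]_k) : rRe (z + w) = rRe z + rRe w.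
Proof. by apply/rowP => i; rewrite !mxE cReD. Qed.
Lemma rImD k (z w : 'rV[C]_k) : rIm (z + w) = rIm z + rIm w.
Proof. by apply/rowP => i; rewrite !mxE cImD. Qed.
Lemma rReZ k (t : R) (z : 'rV[C]_k) : rRe (t%:C *: z) = t *: rRe z.
Proof. by apply/rowP => i; rewrite !mxE cReM /= mul0r subr0. Qed.
Lemma rImZ k (t : R) (z : 'rV[C]_k) : rIm (t%:C *: z) = t *: rIm z.
Proof. by apply/rowP => i; rewrite !mxE cImM /= mul0r addr0. Qed.
Lemma rReI k (z : 'rV[C]_k) : rRe (ii *: z) = - rIm z.
Proof. by apply/rowP => i; rewrite !mxE cReM /= mul0r mul1r sub0r. Qed.
Lemma rImI k (z : 'rV[C]_k) : rIm (ii *: z) = rRe z.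
Proof. by apply/rowP => i; rewrite !mxE cImM /= mul0r mul1r add0r. Qed.
Lemma rRe_toC k (t : 'rV[R]_k) : rRe (toC t) = t.
Proof. by apply/rowP => i; rewrite !mxE. Qed.
Lemma rIm_toC k (t : 'rV[R]_k) : rIm (toC t) = 0.
Proof. by apply/rowP => i; rewrite !mxE. Qed.
Lemma toC_eq k (z : 'rV[C]_k) : rIm z = 0 -> z = toC (rRe z).
Proof.
move=> H; apply/rowP => i; apply: ReIm_inj; rewrite !mxE //=.
by have := congr1 (fun v : 'rV[R]_k => v ord0 i) H; rewrite !mxE.
Qed.
Lemma toC_inj k : injective (@toC R k).
Proof. by move=> s t /(congr1 (@rRe k)); rewrite !rRe_toC. Qed.
Lemma rRe0 k : rRe (0 : 'rV[C]_k) = 0. Proof. by apply/rowP => i; rewrite !mxE. Qed.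
Lemma rIm0 k : rIm (0 : 'rV[C]_k) = 0. Proof. by apply/rowP => i; rewrite !mxE. Qed.
Lemma rRe_cplx n (w : 'rV[R]_(n + n)) : rRe (cplx w) = lsubmx w.
Proof. by rewrite /cplx rReD rReI rRe_toC rIm_toC oppr0 addr0. Qed.
Lemma rIm_cplx n (w : 'rV[R]_(n + n)) : rIm (cplx w) = rsubmx w.
Proof. by rewrite /cplx rImD rImI rRe_toC rIm_toC add0r. Qed.
Lemma rReIm_inj k (z w : 'rV[C]_k) : rRe z = rRe w -> rIm z = rIm w -> z = w.
Proof.
move=> H1 H2; apply/rowP => i; apply: ReIm_inj.
  by have := congr1 (fun v : 'rV[R]_k => v ord0 i) H1; rewrite !mxE.
by have := congr1 (fun v : 'rV[R]_k => v ord0 i) H2; rewrite !mxE.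
Qed.
Lemma rRe_mulmx k l (M : 'M[C]_(k, l)) z : rRe (z *m M) =
  rRe z *m map_mx (@complex.Re R) M - rIm z *m map_mx (@complex.Im R) M.
Proof.
apply/rowP => i; rewrite !mxE (raddf_sum (@complex.Re R)) -sumrB; apply: eq_bigr => j _.
by rewrite !mxE /= cReM.
Qed.
Lemma rIm_mulmx k l (M : 'M[C]_(k, l)) z : rIm (z *m M) =
  rRe z *m map_mx (@complex.Im R) M + rIm z *m map_mx (@complex.Re R) M.
Proof.
apply/rowP => i; rewrite !mxE (raddf_sum (@complex.Im R)) -big_split; apply: eq_bigr => j _.
by rewrite !mxE /= cImM.
Qed.
End complex_rows.

Section bargmann_geometry.
Context {R : realType}.
Local Notation C := R[i].
Local Notation ii := ((0 : R) +i* 1).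
Variables (n : nat) (Q : 'M[C]_(n + n)).
Hypothesis hQ : bargmann_phase Q.

Let Qs : Q^T = Q. Proof. by case: hQ. Qed.
Let Qxx := ulsubmx Q.
Let Qxy := ursubmx Q.
Let Qyy := drsubmx Q.
Definition reQyy : 'M[R]_n := map_mx (@complex.Re R) (drsubmx Q).
Definition imQyy : 'M[R]_n := map_mx (@complex.Im R) (drsubmx Q).
Local Notation A := reQyy.
Local Notation B := imQyy.

Let Qxxs : Qxx^T = Qxx. Proof. by rewrite /Qxx -{2}Qs trmx_ulsub. Qed.
Let Qyys : Qyy^T = Qyy. Proof. by rewrite /Qyy -{2}Qs trmx_drsub. Qed.
Let Qyx : dlsubmx Q = Qxy^T. Proof. by rewrite /Qxy -{1}Qs trmx_ursub. Qed.
Lemma reQyy_sym : A^T = A. Proof. by rewrite /reQyy map_trmx -/Qyy Qyys. Qed.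
Lemma imQyy_sym : B^T = B. Proof. by rewrite /imQyy map_trmx -/Qyy Qyys. Qed.
Lemma imQyy_pos (y : 'rV[R]_n) : y != 0 -> 0 < rdot (y *m B) y.
Proof. by case: hQ => _ _; apply. Qed.

Let uB : B \in unitmx.
Proof.
rewrite -row_free_unit; apply: inj_row_free => v Hv; apply/eqP; apply: contraT => v0.
by have := imQyy_pos v0; rewrite Hv rdot0l ltxx.
Qed.
Let uQxy : Qxy \in unitmx.
Proof. by rewrite unitmxE unitfE; case: hQ. Qed.

Lemma rdot_sym (M : 'M[R]_n) (x y : 'rV[R]_n) : M^T = M -> rdot (x *m M) y = rdot (y *m M) x.
Proof. by move=> Ms; rewrite [RHS]rdotC /rdot trmx_mul Ms mulmxA. Qed.

Let row_mulQ (x y : 'rV[C]_n) : row_mx x y *m Q =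
  row_mx (x *m Qxx + y *m Qxy^T) (x *m Qxy + y *m Qyy).
Proof. by rewrite -{1}(submxK Q) mul_row_block -/Qxx -/Qxy -/Qyy Qyx. Qed.

Let phaseE (x y : 'rV[C]_n) : phase Q x y =
  2^-1 * cdot (x *m Qxx) x + cdot (x *m Qxy) y + 2^-1 * cdot (y *m Qyy) y.
Proof.
rewrite /phase row_mulQ tr_row_mx mul_row_col mxE -!/(cdot _ _) !cdotDl.
have -> : cdot (y *m Qxy^T) x = cdot (x *m Qxy) y by rewrite cdot_mulmx trmxK cdotC.
by field.
Qed.

(* the maximum point of -Im phase(x, .) and the corresponding covector *)
Let ymax (x : 'rV[C]_n) : 'rV[R]_n := - rIm (x *m Qxy) *m invmx B.
Let eta (x : 'rV[C]_n) : 'rV[R]_n := - rRe (x *m Qxy) - ymax x *m A.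

Let ymaxB x : ymax x *m B = - rIm (x *m Qxy).
Proof. by rewrite /ymax -mulmxA mulVmx // mulmx1. Qed.

Let Re2 (r : R) (z : C) : Re (r%:C * z) = r * Re z.
Proof. by rewrite cReM /= mul0r subr0. Qed.
Let Im2 (r : R) (z : C) : Im (r%:C * z) = r * Im z.
Proof. by rewrite cImM /= mul0r addr0. Qed.
Let halfC : (2^-1 : C) = (2^-1 : R)%:C.
Proof. by rewrite fmorphV rmorph_nat. Qed.

Let ImphaseR x t : - Im (phase Q x (toC t)) =
  (- (2^-1 * Im (cdot (x *m Qxx) x)) + 2^-1 * rdot (ymax x *m B) (ymax x)) -
  2^-1 * rdot ((t - ymax x) *m B) (t - ymax x).
Proof.
rewrite phaseE halfC !cImD !Im2 !Im_cdot_real rIm_mul -/B.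
have -> : rIm (x *m Qxy) = - (ymax x *m B) by rewrite ymaxB opprK.
by rewrite mulmxBl !rdotDl !rdotDr !rdotNl !rdotNr opprK (rdot_sym t (ymax x) imQyy_sym); field.
Qed.

(** The square is completed: the supremum defining Phi is attained at ymax. *)
Lemma Phi_max x t : - Im (phase Q x (toC t)) = Phi Q x - 2^-1 * rdot ((t - ymax x) *m B) (t - ymax x).
Proof.
rewrite ImphaseR; congr (_ - _); set S := _ + _.
have Bge (s : 'rV[R]_n) : 0 <= rdot (s *m B) s.
  have [->|s0] := eqVneq s 0; first by rewrite mul0mx rdot0l.
  exact/ltW/imQyy_pos.
have H t' : - Im (phase Q x (toC t')) <= S.
  by rewrite ImphaseR -/S gerBl mulr_ge0.
apply/le_anti/andP; split.
  apply: ub_le_sup; first by exists S => _ [t' _ <-].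
  by exists (ymax x) => //; rewrite ImphaseR subrr mul0mx rdot0l mulr0 subr0.
apply: ge_sup; first by exists (- Im (phase Q x (toC 0))), 0.
by move=> _ [t' _ <-].
Qed.

Let PhiE x : Phi Q x = - (2^-1 * Im (cdot (x *m Qxx) x)) + 2^-1 * rdot (ymax x *m B) (ymax x).
Proof.
have := Phi_max x (ymax x); rewrite ImphaseR subrr mul0mx rdot0l mulr0 !subr0 => H.
by rewrite H.
Qed.

Let phase_xE (x y : 'rV[C]_n) : phase_x Q x y = x *m Qxx + y *m Qxy^T.
Proof. by rewrite /phase_x row_mulQ row_mxKl. Qed.
Let phase_yE (x y : 'rV[C]_n) : phase_y Q x y = x *m Qxy + y *m Qyy.
Proof. by rewrite /phase_y row_mulQ row_mxKr. Qed.

Let ymaxD x (t : R) v : ymax (x + t%:C *: v) = ymax x + t *: ymax v.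
Proof. by rewrite /ymax mulmxDl -scalemxAl rImD rImZ opprD -scalerN mulmxDl -scalemxAl. Qed.

(* As ymax(x) is a critical point, only the explicit dependence on x counts. *)
Let dPhi_line x v (f : R -> 'rV[C]_n) : (forall t, f t = x + t%:C *: v) ->
  derive1 (fun t : R => Phi Q (f t)) 0 = - Im (cdot (phase_x Q x (toC (ymax x))) v).
Proof.
move=> fE; pose q : R := - (2^-1 * Im (cdot (v *m Qxx) v)) + 2^-1 * rdot (ymax v *m B) (ymax v).
have E : (fun t : R => Phi Q (f t)) =
   (fun t : R => (Phi Q x + t * (- Im (cdot (phase_x Q x (toC (ymax x))) v))) + t ^+ 2 * q).
  apply/funext => t; rewrite fE.
  have cZr a (z w : 'rV[C]_n) : cdot z (a *: w) = a * cdot z w.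
    by rewrite /cdot linearZ -scalemxAr mxE.
  have cDr (z w w' : 'rV[C]_n) : cdot z (w + w') = cdot z w + cdot z w'.
    by rewrite cdotC cdotDl !(cdotC z).
  have e1 : Im (cdot ((x + t%:C *: v) *m Qxx) (x + t%:C *: v)) =
     Im (cdot (x *m Qxx) x) + t * (2 * Im (cdot (x *m Qxx) v)) + t * (t * Im (cdot (v *m Qxx) v)).
    rewrite mulmxDl -scalemxAl cdotDl !cDr !cZr !(cdotC (_ *: _)) !cZr.
    have -> : cdot x (v *m Qxx) = cdot (x *m Qxx) v by rewrite cdot_mulmx Qxxs.
    rewrite (cdotC v) !cImD !Im2; set a := Im _; set b := Im _; set d := Im _; ring.
  have e2 : rdot (ymax (x + t%:C *: v) *m B) (ymax (x + t%:C *: v)) =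
     rdot (ymax x *m B) (ymax x) + 2 * t * rdot (ymax x *m B) (ymax v) + t * (t * rdot (ymax v *m B) (ymax v)).
    rewrite ymaxD; move: (ymax x) (ymax v) => yx yv.
    rewrite mulmxDl -scalemxAl rdotDl !rdotDr !rdotZl !rdotZr (rdot_sym yv yx imQyy_sym); ring.
  have e3 : Im (cdot (phase_x Q x (toC (ymax x))) v) = Im (cdot (x *m Qxx) v) - rdot (ymax x *m B) (ymax v).
    rewrite phase_xE cdotDl cImD; congr (_ + _).
    rewrite cdot_mulmx trmxK cdotC Im_cdot_real.
    by rewrite (rdot_sym _ _ imQyy_sym) ymaxB rdotNl opprK.
  rewrite !PhiE e1 e2 e3 /q.
  move: (Im (cdot (x *m Qxx) x)) (Im (cdot (x *m Qxx) v)) (Im (cdot (v *m Qxx) v)) => a1 a2 a3.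
  move: (rdot (ymax x *m B) (ymax x)) (rdot (ymax x *m B) (ymax v)) (rdot (ymax v *m B) (ymax v)) => b1 b2 b3.
  by rewrite expr2; field.
rewrite E derive1E.
have H1 := is_derive_affine (Phi Q x) (- Im (cdot (phase_x Q x (toC (ymax x))) v)) 0.
have H2 := is_deriveM (is_deriveX 2 (is_derive_id (0 : R) 1)) (is_derive_cst q (0 : R) 1).
have H3 := is_deriveD H1 H2; have := @derive_val _ _ _ _ _ _ _ H3 => ->.
by rewrite /GRing.scale /=; ring.
Qed.

Let dPhiE x : (2 / ii) *: dPhi Q x = phase_x Q x (toC (ymax x)).
Proof.
apply/rowP => j; pose e : 'rV[C]_n := delta_mx ord0 j.
set P := phase_x Q x (toC (ymax x)); pose z := P ord0 j.
have cdelta : cdot P e = z by rewrite /cdot trmx_delta -colE mxE.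
have D1 : derive1 (fun t : R => Phi Q (x + t%:C *: e)) 0 = - Im z by rewrite (dPhi_line (fun _ => erefl)) -/P cdelta.
have D2 : derive1 (fun t : R => Phi Q (x + (t%:C * ii) *: e)) 0 = - Im (ii * z).
  have Hf (t : R) : x + (t%:C * ii) *: e = x + t%:C *: (ii *: e).
    by congr (x + _); exact/esym/scalerA.
  rewrite (dPhi_line Hf) -/P -cdelta; congr (- Im _).
  by rewrite /cdot linearZ -scalemxAr mxE.
rewrite [LHS]mxE [X in _ * X]mxE.
transitivity ((2 / ii) * (2^-1 * (- Im z -i* - Im (ii * z)))).
  by congr (_ * (_ * Complex _ (- _))); [exact: D1|exact: D2].
have i2 : ii * ii = -1 :> C by apply: ReIm_inj; rewrite /= ?mulr0 ?mul0r ?mulr1 ?sub0r ?addr0 ?oppr0.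
have i0 : ii != 0 :> C by apply/eqP => /(congr1 (@complex.Im R)) /= /eqP; rewrite oner_eq0.
have -> : - Im z -i* - Im (ii * z) = ii * z.
  by apply: ReIm_inj; rewrite ?cReM ?cImM /=; ring.
have gen (w z' : C) : w != 0 -> (2 / w) * (2^-1 * (w * z')) = z' by move=> w0; field.
exact: gen i0.
Qed.

(** The canonical transformation maps the critical point and its covector to the
    graph of the derivative of Phi. *)
Lemma toEE x : toE Q x = row_mx (ymax x) (eta x).
Proof.
rewrite /toE; set P := [set _ | _].
have Hy : - phase_y Q x (toC (ymax x)) = toC (eta x).
  rewrite phase_yE.
  have H : rIm (- (x *m Qxy + toC (ymax x) *m Qyy)) = 0.
    rewrite -scaleN1r; have -> : (-1 : C) = ((-1 : R)%:C) by rewrite rmorphN1.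
    by rewrite rImZ rImD rIm_mul -/B ymaxB addrN scaler0.
  rewrite (toC_eq H); congr toC.
  rewrite -scaleN1r; have -> : (-1 : C) = ((-1 : R)%:C) by rewrite rmorphN1.
  by rewrite rReZ rReD rRe_mul -/A scaleN1r opprD.
have toC_row (u v : 'rV[R]_n) : toC (row_mx u v) = row_mx (toC u) (toC v) by exact: map_row_mx.
have P0 : P (row_mx (ymax x) (eta x)).
  by exists x, (toC (ymax x)); rewrite toC_row Hy dPhiE.
have [x' [y' [E1 /eq_row_mx[E2 E3]]]] := @xgetPex _ 0 P (ex_intro _ _ P0).
move: E1; set rho := xget _ _; rewrite -(hsubmxK rho) toC_row => /eq_row_mx[F1 F2].
rewrite -E2 in E3 F2; rewrite dPhiE !phase_xE in E3.
have Ey : y' = toC (ymax x).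
  by move/addrI: E3 => /(congr1 (mulmx^~ (invmx Qxy^T))); rewrite !mulmxK ?unitmx_tr.
rewrite Ey in F1 F2; rewrite Hy in F2.
by rewrite (toC_inj F1) (toC_inj F2).
Qed.

(** Being linear and invertible, the identification preserves integrability and null
    sets. *)
Lemma toE_linear : exists2 L : 'M[R]_(n + n), L \in unitmx &
  forall w, toE Q (cplx w) = w *m L.
Proof.
pose Pr := map_mx (@complex.Re R) Qxy; pose Pi := map_mx (@complex.Im R) Qxy.
pose My := col_mx (- Pi *m invmx B) (- Pr *m invmx B).
pose L := row_mx My (col_mx (- Pr) Pi - My *m A).
have E w : toE Q (cplx w) = w *m L.
  rewrite toEE /L mul_mx_row.
  have Ey : ymax (cplx w) = w *m My.
    rewrite /ymax rIm_mulmx rRe_cplx rIm_cplx -{3}(hsubmxK w) mul_row_col !mulmxA !mulmxN.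
    by rewrite -mulmxDl opprD.
  congr row_mx => //; rewrite mulmxBr mulmxA -Ey /eta; congr (_ - _).
  rewrite rRe_mulmx rRe_cplx rIm_cplx -{3}(hsubmxK w) mul_row_col !mulmxN.
  by rewrite opprB addrC.
exists L => //; rewrite -row_free_unit; apply: inj_row_free => w; rewrite -E toEE => H.
have H0 : row_mx (ymax (cplx w)) (eta (cplx w)) = row_mx 0 0 by rewrite H row_mx0.
have [y0 e0] := eq_row_mx H0.
have i0 : rIm (cplx w *m Qxy) = 0.
  by have := ymaxB (cplx w); rewrite y0 mul0mx => /esym/eqP; rewrite oppr_eq0 => /eqP.
have r0 : rRe (cplx w *m Qxy) = 0.
  by have := e0; rewrite /eta y0 mul0mx subr0 => /eqP; rewrite oppr_eq0 => /eqP.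
have z0 : cplx w *m Qxy = 0.
  by apply: rReIm_inj; rewrite ?i0 ?r0 ?rRe0 ?rIm0.
have c0 : cplx w = 0 by have := congr1 (mulmx^~ (invmx Qxy)) z0; rewrite mulmxK // mul0mx.
rewrite -(hsubmxK w) -rRe_cplx -rIm_cplx c0.
by rewrite rRe0 rIm0 row_mx0.
Qed.

(** The kernel of the Bargmann transform at x, normalized in the weighted space. *)
Definition coherent (x : 'rV[C]_n) (t : 'rV[R]_n) : C :=
  (expR (- Phi Q x))%:C * cexp (ii * phase Q x (toC t)).
Definition bphase (x : 'rV[C]_n) : R :=
  2^-1 * Re (cdot (x *m Qxx) x) - 2^-1 * rdot (lsubmx (toE Q x) *m A) (lsubmx (toE Q x)).

(** The coherent states are, up to a phase, the phase space translates of a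
    single Gaussian by the points which they represent. *)
Lemma coherentE x t : coherent x t = cis (bphase x) * tau (toE Q x) (gauss A B) t.
Proof.
have iE (z : C) : cexp (ii * z) = (expR (- Im z))%:C * cis (Re z).
  have -> : ii * z = (- Im z)%:C + (Re z)%:C * ii.
    by apply: ReIm_inj; rewrite ?cReD ?cImD ?cReM ?cImM /=; ring.
  by rewrite cexpD cexp_real.
rewrite /coherent iE mulrA -rmorphM -expRD Phi_max addKr.
rewrite /tau /gauss toEE row_mxKl row_mxKr.
set s := t - ymax x.
have -> : Re (phase Q x (toC t)) = bphase x + (- rdot (eta x) t + 2^-1 * rdot (s *m A) s).
  rewrite phaseE halfC !cReD !Re2 !Re_cdot_real rRe_mul -/A /bphase toEE row_mxKl.
  by rewrite /eta /s mulmxBl !rdotDl !rdotDr !rdotNl !rdotNr (rdot_sym t (ymax x) reQyy_sym); field.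
by rewrite !cisD; ring.
Qed.

Lemma schwartz_ground : schwartz (gauss A B).
Proof. exact: schwartz_gauss reQyy_sym imQyy_sym imQyy_pos. Qed.
End bargmann_geometry.

(** * Resolution of the identity by coherent states *)

Section polarization.
Context {R : realType} d (T : measurableType d) (mu : {measure set T -> \bar R}).
Local Notation C := R[i].
Local Notation ii := ((0 : R) +i* 1).
Implicit Type f g : T -> C.

Lemma cReZ (r : R) (z : C) : Re (r%:C * z) = r * Re z.
Proof. by rewrite cReM /= mul0r subr0. Qed.
Lemma cImZ (r : R) (z : C) : Im (r%:C * z) = r * Im z.
Proof. by rewrite cImM /= mul0r addr0. Qed.

Lemma L2Z (z : C) f : L2 mu f -> L2 mu (fun x => z * f x).
Proof.
move=> /L2P[mf If]; apply/L2P; split; first by apply: cmeasM => //; exact: cmeas_cst.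
have := rintZ (normc z ^+ 2) If; congr (_.-integrable _ (EFin \o _)).
by apply/funext => x; rewrite normcM exprMn.
Qed.

Lemma normc_sqD (x y : C) : normc (x + y) ^+ 2 =
  normc x ^+ 2 + normc y ^+ 2 + 2 * Re (x * y^*%C).
Proof. by rewrite !normc_sq cReM cReD cImD cReJ cImJ; ring. Qed.

Lemma cint_L2J f g : L2 mu f -> L2 mu g -> cintegrable mu (fun x => f x * (g x)^*%C).
Proof.
move=> Lf /L2P[mg Ig]; apply: cint_L2M => //; apply/L2P; split; first exact: cmeasJ.
by move: Ig; congr (_.-integrable _ (EFin \o _)); apply/funext => x; rewrite normc_conj.
Qed.

Lemma L2D f g : L2 mu f -> L2 mu g -> L2 mu (fun x => f x + g x).
Proof.
move=> Lf Lg; have I := (cint_L2J Lf Lg).1.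
have /L2P[mf If] := Lf; have /L2P[mg Ig] := Lg; apply/L2P; split; first exact: cmeasD.
have := rintD (rintD If Ig) (rintZ 2 I); congr (_.-integrable _ (EFin \o _)).
by apply/funext => x; rewrite normc_sqD.
Qed.

Lemma Re_inner f g : L2 mu f -> L2 mu g ->
  Re (cintegral mu (fun x => f x * (g x)^*%C)) =
  2^-1 * (\int[mu]_x normc (f x + g x) ^+ 2 - \int[mu]_x normc (f x) ^+ 2 - \int[mu]_x normc (g x) ^+ 2).
Proof.
move=> Lf Lg; have I := (cint_L2J Lf Lg).1; have /L2P[mf If] := Lf; have /L2P[mg Ig] := Lg.
have -> : \int[mu]_x normc (f x + g x) ^+ 2 =
    \int[mu]_x (normc (f x) ^+ 2 + normc (g x) ^+ 2 + 2 * Re (f x * (g x)^*%C)).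
  by apply: eq_Rintegral => x _; rewrite normc_sqD.
rewrite RintegralD //; [|exact: rintD|exact: rintZ].
rewrite RintegralD // RintegralZl // /cintegral /=.
by field.
Qed.

Lemma Im_inner f g : L2 mu f -> L2 mu g ->
  Im (cintegral mu (fun x => f x * (g x)^*%C)) =
  Re (cintegral mu (fun x => f x * (ii * g x)^*%C)).
Proof.
move=> Lf Lg; rewrite /cintegral /=; apply: eq_Rintegral => x _.
by rewrite cJM !cReM !cImM /= !cReJ !cImJ; ring.
Qed.
End polarization.

Section coherent_resolution.
Context {R : realType}.
Local Notation C := R[i].
Local Notation ii := ((0 : R) +i* 1).
Variables (n : nat) (Q : 'M[C]_(n + n)) (c : R).
Hypotheses (hQ : bargmann_phase Q) (hc : 0 < c) (hT : bargmann_unitary Q c).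
Local Notation g0 := (gauss (reQyy Q) (imQyy Q)).

Lemma schwartz_coherent x : schwartz (coherent Q x).
Proof.
rewrite (_ : coherent Q x = fun t => cis (bphase Q x) * tau (toE Q x) g0 t).
  exact/schwartzZ/schwartz_tau/schwartz_ground.
by apply/funext => t; exact: coherentE.
Qed.

Definition coherent_transform (u : 'rV[R]_n -> C) (w : 'rV[R]_(n + n)) : C :=
  cintegral (leb n) (fun t => coherent Q (cplx w) t * u t).
Local Notation CT := coherent_transform.

Lemma schwartz_coherent_L2 x : L2 (leb n) (coherent Q x).
Proof. exact/schwartz_L2/schwartz_coherent. Qed.

(** After multiplication by the weight, the transform becomes a pairing with coherent
    states of a fixed norm. *)
Lemma bargmann_coherent u x : L2 (leb n) u ->
  bargmann Q c u x * (expR (- Phi Q x))%:C =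
  c%:C * cintegral (leb n) (fun t => coherent Q x t * u t).
Proof.
move=> Lu; have I : cintegrable (leb n) (fun t => coherent Q x t * u t).
  exact/cint_L2M/Lu/schwartz_coherent_L2.
have E t : cexp (ii * phase Q x (toC t)) * u t = (expR (Phi Q x))%:C * (coherent Q x t * u t).
  by rewrite /coherent !mulrA -rmorphM -expRD addrN expR0 mul1r.
rewrite /bargmann (eq_cintegral _ E) (cintegralZ _ I); set J := cintegral _ _.
transitivity (c%:C * ((expR (Phi Q x))%:C * (expR (- Phi Q x))%:C) * J); first by ring.
by rewrite -rmorphM -expRD addrN expR0 mulr1.
Qed.

Lemma coherent_isometry u : L2 (leb n) u -> L2 (leb (n + n)) (CT u) /\
  c ^+ 2 * (\int[leb (n + n)]_w normc (CT u w) ^+ 2) = \int[leb n]_t normc (u t) ^+ 2.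
Proof.
move=> Lu; have [[_ L] E] := hT.1 u Lu.
have fE : (fun w => bargmann Q c u (cplx w) * (expR (- Phi Q (cplx w)))%:C) = (fun w => c%:C * CT u w).
  by apply/funext => w; rewrite bargmann_coherent.
rewrite /HPhi_norm fE in E; rewrite fE in L.
have cn0 : c%:C != 0 by apply/eqP => /(congr1 (@complex.Re R)) /= /eqP; rewrite gt_eqF.
have LT : L2 (leb (n + n)) (CT u).
  have := L2Z (c%:C)^-1 L; congr L2; apply/funext => w; by rewrite mulrA mulVf // mul1r.
split=> //; have /L2P[_ I] := LT.
rewrite !L2norm_Rintegral // in E; have {E} := EFin_inj E => /(congr1 (fun r => r ^+ 2)).
rewrite !sqr_sqrtr ?L2_int_ge0 // => <-; rewrite -RintegralZl //.
by apply: eq_Rintegral => w _; rewrite normcM exprMn normcR real_normK ?num_real.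
Qed.

Let CTD u v w : L2 (leb n) u -> L2 (leb n) v -> CT (fun t => u t + v t) w = CT u w + CT v w.
Proof.
move=> Lu Lv; rewrite -cintegralD; try exact: cint_L2M (schwartz_coherent_L2 _) _.
by apply: eq_cintegral => t; rewrite mulrDr.
Qed.
Let CTZ z u w : L2 (leb n) u -> CT (fun t => z * u t) w = z * CT u w.
Proof.
move=> Lu; rewrite -cintegralZ; last exact: cint_L2M (schwartz_coherent_L2 _) _.
by apply: eq_cintegral => t; rewrite mulrCA.
Qed.

(** Polarization of the isometry. *)
Lemma coherent_inner u v : L2 (leb n) u -> L2 (leb n) v ->
  (c ^+ 2)%:C * cintegral (leb (n + n)) (fun w => CT u w * (CT v w)^*%C) =
  cintegral (leb n) (fun t => u t * (v t)^*%C).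
Proof.
have key u' v' : L2 (leb n) u' -> L2 (leb n) v' ->
    c ^+ 2 * Re (cintegral (leb (n + n)) (fun w => CT u' w * (CT v' w)^*%C)) =
    Re (cintegral (leb n) (fun t => u' t * (v' t)^*%C)).
  move=> Lu Lv; have [LTu Eu] := coherent_isometry Lu; have [LTv Ev] := coherent_isometry Lv.
  have [_ Euv] := coherent_isometry (L2D Lu Lv).
  have alg (x y z x' y' z' : R) : c ^+ 2 * x = x' -> c ^+ 2 * y = y' -> c ^+ 2 * z = z' ->
      c ^+ 2 * (2^-1 * (x - y - z)) = 2^-1 * (x' - y' - z').
    by move=> <- <- <-; ring.
  rewrite (Re_inner LTu LTv) (Re_inner Lu Lv); apply: alg Eu Ev; etransitivity; last exact: Euv.
  by apply: (congr1 (fun r => c ^+ 2 * r)); apply: eq_Rintegral => w _; rewrite CTD.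
move=> Lu Lv; have [LTu _] := coherent_isometry Lu; have [LTv _] := coherent_isometry Lv.
apply: ReIm_inj; first by rewrite cReZ key.
rewrite cImZ (Im_inner LTu LTv) (Im_inner Lu Lv) -(key u _ Lu (L2Z ii Lv)).
by congr (_ * Re _); apply: eq_cintegral => w; rewrite CTZ.
Qed.

Lemma coherent_transformE u w : schwartz u -> CT u w =
  cis (bphase Q (cplx w)) * (stft g0 (fun t => (u t)^*%C) (toE Q (cplx w)))^*%C.
Proof.
move=> su; have sg := schwartz_tau (toE Q (cplx w)) (schwartz_ground hQ).
rewrite stftE -cintegralJ; last by apply: schwartz_cint; apply: schwartzM; exact: schwartzJ.
rewrite -cintegralZ; last by apply/cintJ/schwartz_cint; apply: schwartzM; exact: schwartzJ.
apply: eq_cintegral => t; rewrite coherentE // cJM !conjcK; ring.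
Qed.

(** Every pairing of two functions is a superposition of products of their
    pairings with the coherent states, as the transform is isometric. *)
Lemma coherent_resolution u k : schwartz u -> schwartz k ->
  (c ^+ 2)%:C * cintegral (leb (n + n)) (fun w =>
     (stft g0 (fun t => (u t)^*%C) (toE Q (cplx w)))^*%C * stft g0 k (toE Q (cplx w))) =
  cintegral (leb n) (fun t => u t * k t).
Proof.
move=> su sk; have sk' := schwartzJ sk.
have := coherent_inner (schwartz_L2 su) (schwartz_L2 sk').
have -> : (fun t => u t * ((k t)^*%C)^*%C) = (fun t => u t * k t).
  by apply/funext => t; rewrite conjcK.
move=> <-; apply: (congr1 (fun z => (c ^+ 2)%:C * z)); apply: eq_cintegral => w.
rewrite !coherent_transformE // cJM cisJ conjcK.
have -> : (fun t => ((k t)^*%C)^*%C) = k by apply/funext => t; rewrite conjcK.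
set b := bphase _ _; set x := (stft _ _ _)^*%C; set y := stft _ _ _.
transitivity (cis b * cis (- b) * (x * y)); last by ring.
by rewrite -cisD addrN cis0 mul1r.
Qed.
End coherent_resolution.

(** * Superpositions *)

Section fubini_integrable.
Context {R : realType} d1 d2 (T1 : measurableType d1) (T2 : measurableType d2).
Local Notation C := R[i].
Variables (m1 : {sigma_finite_measure set T1 -> \bar R}).
Variables (m2 : {sigma_finite_measure set T2 -> \bar R}).
Variables (g : T1 -> R) (h : T2 -> R) (f : T1 -> T2 -> C).
Hypotheses (Ig : m1.-integrable setT (EFin \o g)) (Ih : m2.-integrable setT (EFin \o h)).
Hypothesis mf : cmeasurable (fun p : T1 * T2 => f p.1 p.2).
Hypothesis fgh : forall x y, normc (f x y) <= `|g x| * `|h y|.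

Lemma fub_cint_int1 : cintegrable m1 (fun x => cintegral m2 (f x)).
Proof.
have Ih' : m2.-integrable setT (EFin \o (fun y => `|h y|)) by exact: integrable_abse Ih.
have Ig' : m1.-integrable setT (EFin \o (fun x => `|g x|)) by exact: integrable_abse Ig.
apply: (cint_dom (k := fun x => (2 * \int[m2]_y `|h y|) * `|g x|)).
- have M := fub_meas_int1 Ig Ih mf fgh; exact: M.
- exact: rintZ.
move=> x; have I1 := fub_int1 Ih mf fgh x.
have H := normc_cintegral (cint_meas I1) (rintZ `|g x| Ih') (fgh x).
rewrite RintegralZl // in H; apply: le_trans H _.
by rewrite le_eqVlt; apply/orP; left; apply/eqP; ring.
Qed.
End fubini_integrable.

Section superposition.
Context {R : realType}.
Local Notation C := R[i].
Variables (k : nat) (a : Defs.distribution (R := R) k) (h : 'rV[R]_k -> C) (K1 : C).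
Hypotheses (ta : tempered a) (sh : schwartz h) (K10 : K1 != 0).
Hypothesis mS : cmeasurable (fun rho => a (tau rho h)).
Hypothesis rep : forall F, schwartz F ->
  cintegral (leb (k + k)) (fun rho => stft h F rho * a (tau rho h)) = K1 * a F.
Local Notation D := ((k + k) + (k + k))%N.

(** The Gabor representation turns the commutation of the symbol with a
    superposition into Fubini's theorem. *)
Lemma symbol_superposition d (G : 'rV[R]_(d + k) -> C) : schwartz G ->
  cintegrable (leb d) (fun w => a (fun z => G (row_mx w z))) /\
  forall G0, schwartz G0 -> (forall z, G0 z = cintegral (leb d) (fun w => G (row_mx w z))) ->
  cintegral (leb d) (fun w => a (fun z => G (row_mx w z))) = a G0.
Proof.
move=> sG.
have [N [B [B0 HB]]] := tau_growth ta sh.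
have sV := schwartz_stft_param sG sh.
have [W W0 HW] := schwartz_bound ((d + d) + (N + D)) sV.
pose V w := stft h (fun z => G (row_mx w z)).
have VE w rho : V w rho = stft h (fun s => G (row_mx (lsubmx (row_mx w rho)) s)) (rsubmx (row_mx w rho)).
  by rewrite row_mxKl row_mxKr.
have VB w rho : normc (V w rho) <= W * (wt (d + d) w * wt (N + D) rho).
  by rewrite VE; apply: le_trans (HW _) _; rewrite ler_wpM2l // wt_row.
have mrow : measurable_fun setT (fun p : 'rV[R]_d * 'rV[R]_(k + k) => row_mx p.1 p.2).
  exact: measurable_row_mx.
have mV : cmeasurable (fun p : 'rV[R]_d * 'rV[R]_(k + k) => V p.1 p.2).
  have := cmeas_comp (schwartz_meas sV) mrow; congr cmeasurable.
  by apply/funext => p; rewrite -VE.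
have V0 G0 rho : (forall z, G0 z = cintegral (leb d) (fun w => G (row_mx w z))) ->
  stft h G0 rho = cintegral (leb d) (fun w => V w rho).
  move=> G0E; have [B1 B10 HB1] := schwartz_bound ((d + d) + (k + k)) sG.
  have [M M0 HM] := schwartz_bound 0 (schwartz_tau rho sh).
  rewrite stftE.
  transitivity (cintegral (leb k) (fun z => cintegral (leb d) (fun w => G (row_mx w z) * (tau rho h z)^*%C))).
    apply: eq_cintegral => z; rewrite G0E -cintegralZr //.
    have MU : (row_mx 1%:M 0 : 'M[R]_(d, d + k)) *m col_mx 1%:M 0 = 1%:M.
      by rewrite mul_row_col mulmx1 mulmx0 addr0.
    have := schwartz_cint (schwartz_affine (row_mx 0 z) MU sG).
    by congr cintegrable; apply/funext => w; rewrite mul_mx_row mulmx1 mulmx0 add_row_mx addr0 add0r.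
  have S := @fub_swap R _ _ _ _ (leb k) (leb d) (fun z => (B1 * M) * wt (k + k) z) (@wt R d (d + d))
    (rintZ _ (rint_wt2 k)) (rint_wt2 d) (fun z w => G (row_mx w z) * (tau rho h z)^*%C) _ _.
  rewrite S.
  - by apply: eq_cintegral => w; rewrite /V stftE.
  - apply: cmeasM.
      apply: (cmeas_comp (schwartz_meas sG) (g := fun p : 'rV[R]_k * 'rV[R]_d => row_mx p.2 p.1)).
      apply: (measurableT_comp (@measurable_row_mx R d k) (_ : measurable_fun setT (fun p => (p.2, p.1)))).
      by apply/measurable_fun_pair; [exact: measurable_snd|exact: measurable_fst].
    apply: cmeasJ; exact: cmeas_comp (schwartz_meas (schwartz_tau rho sh)) measurable_fst.
  - move=> z w; rewrite normcM normc_conj !ger0_norm ?mulr_ge0 ?wt_ge0 //.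
    apply: le_trans (ler_pM _ _ (HB1 _) (HM z)) _; rewrite ?normc_ge0 //.
    have -> : B1 * M * wt (k + k) z * wt (d + d) w = B1 * (wt (d + d) w * wt (k + k) z) * M by ring.
    apply: ler_pM; rewrite ?mulr_ge0 ?wt_ge0 //; first by rewrite ler_wpM2l // wt_row.
    by rewrite ler_piMr // wt_le1.
have Iw := rintZ (W * B) (rint_wt2 (R := R) d).
have Ir := rint_wt2 (R := R) (k + k).
have mf : cmeasurable (fun p : 'rV[R]_d * 'rV[R]_(k + k) => V p.1 p.2 * a (tau p.2 h)).
  by apply: cmeasM => //; exact: cmeas_comp mS measurable_snd.
have fgh w rho : normc (V w rho * a (tau rho h)) <= `|W * B * wt (d + d) w| * `|wt D rho|.
  rewrite normcM !ger0_norm ?mulr_ge0 ?wt_ge0 //.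
  apply: le_trans (ler_pM _ _ (VB w rho) (HB rho)) _; rewrite ?normc_ge0 // (wtD N D).
  rewrite le_eqVlt; apply/orP; left; apply/eqP.
  transitivity (W * B * wt (d + d) w * wt D rho * (japanese rho ^+ N * wt N rho)); last by rewrite wtK mulr1.
  by ring.
have E w : a (fun z => G (row_mx w z)) = K1^-1 * cintegral (leb (k + k)) (fun rho => V w rho * a (tau rho h)).
  by rewrite rep ?mulrA ?mulVf ?mul1r //; exact: schwartz_slice.
have I := fub_cint_int1 (f := fun w rho => V w rho * a (tau rho h)) Iw Ir mf fgh.
rewrite (funext E); split; first exact: cintZ.
move=> G0 sG0 G0E; rewrite cintegralZ //; have S := fub_swap Iw Ir mf fgh.
apply: (mulfI K10); rewrite mulrA mulfV // mul1r -rep //.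
etransitivity; first exact: S.
apply: eq_cintegral => rho; rewrite (V0 _ _ G0E) -cintegralZr //.
apply: (cint_dom (k := fun w => W * wt (N + D) rho * wt (d + d) w)).
- have := cmeas_comp mV (_ : measurable_fun setT (fun w : 'rV[R]_d => (w, rho))); apply.
  by apply/measurable_fun_pair => //; exact: measurable_cst.
- exact: rintZ (rint_wt2 d).
- by move=> w; apply: le_trans (VB w rho) _; rewrite -mulrA (mulrC (wt (N + D) rho)).
Qed.
End superposition.

(** * Wigner transforms of coherent states *)

Section wigner_coherent.
Context {R : realType}.
Local Notation C := R[i].
Local Ltac rows := rewrite ?mxs;
  repeat (lazymatch goal with |- row_mx _ _ = row_mx _ _ => congr (row_mx _ _) end);
  (let i := fresh "i" in apply/rowP => i; rewrite ?mxE; by field).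

Lemma wigner_integrand k (u v : 'rV[R]_k -> C) z th : schwartz u -> schwartz v ->
  schwartz (fun t => cexp ((rdot t th)%:C * (0 +i* 1)) * u (z - 2^-1 *: t) * v (z + 2^-1 *: t)).
Proof.
move=> su sv.
have M1 : (2^-1)%:M *m 2%:M = 1%:M :> 'M[R]_k by rewrite -scalar_mxM mulVf.
have M2 : (- 2^-1)%:M *m (- 2)%:M = 1%:M :> 'M[R]_k by rewrite -scalar_mxM mulrNN mulVf.
have := schwartzM (schwartz_pull z th M2 su) (schwartz_affine z M1 sv).
congr schwartz; apply/funext => t.
by rewrite !mul_mx_scalar scaleNr (addrC _ z) (addrC _ z).
Qed.

(** Pairing coherent states at two points localizes the symbol at the midpoint,
    with a frequency given by the difference; this is where the argument of m in
    the kernel bound comes from. *)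
Lemma wigner_tau k (g : 'rV[R]_k -> C) mu nu z : schwartz g ->
  wigner (fun s => (tau mu g s)^*%C) (tau nu g) z =
  cis (- (2^-1 * rdot (lsubmx nu - lsubmx mu) (rsubmx mu + rsubmx nu))) *
  tau (row_mx (2^-1 *: (nu + mu)) (hamJinv (mu - nu))) (wigner (fun s => (g s)^*%C) g) z.
Proof.
move=> sg; pose y := lsubmx mu; pose eta := rsubmx mu; pose x := lsubmx nu; pose xi := rsubmx nu.
rewrite -(hsubmxK z); set z1 := lsubmx z; set th := rsubmx z.
rewrite /wigner /tau /hamJinv !row_mxKl !row_mxKr.
pose z' := z1 - 2^-1 *: (x + y); pose th' := th - 2^-1 *: (xi + eta).
have -> : lsubmx (row_mx z1 th - 2^-1 *: (nu + mu)) = z'.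
  by rewrite linearB /= row_mxKl linearZ /= linearD.
have -> : rsubmx (row_mx z1 th - 2^-1 *: (nu + mu)) = th'.
  by rewrite linearB /= row_mxKr linearZ /= linearD.
pose H t := cexp ((rdot t th')%:C * (0 +i* 1)) * (g (z' - 2^-1 *: t))^*%C * g (z' + 2^-1 *: t).
have sH : cintegrable (leb k) H.
  exact/schwartz_cint/(wigner_integrand _ _ (schwartzJ sg) sg).
rewrite -(cintegral_shift (y - x) sH) -!cintegralZ; last 2 first.
- by apply: cintZ; exact: cint_shift.
- exact: cint_shift.
apply: eq_cintegral => t; rewrite /H -/y -/eta -/x -/xi.
have -> : z' - 2^-1 *: (t + (y - x)) = z1 - 2^-1 *: t - y.
  by apply/rowP => i; rewrite !mxE; field.
have -> : z' + 2^-1 *: (t + (y - x)) = z1 + 2^-1 *: t - x.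
  by apply/rowP => i; rewrite !mxE; field.
rewrite cJM cisJ opprK -!/(cis _).
set G1 := (g _)^*%C; set G2 := g _.
transitivity (cis (rdot t th + rdot eta (z1 - 2^-1 *: t) - rdot xi (z1 + 2^-1 *: t)) * (G1 * G2)).
  by rewrite !cisD; ring.
have -> : rdot t th + rdot eta (z1 - 2^-1 *: t) - rdot xi (z1 + 2^-1 *: t) =
   - (2^-1 * rdot (x - y) (eta + xi)) + (- rdot (row_mx (- rsubmx (mu - nu)) (lsubmx (mu - nu))) (row_mx z1 th) +
   rdot (t + (y - x)) th').
  rewrite !linearB /= -/y -/x -/eta -/xi rdot_row /th' !(rdotDl, rdotDr, rdotNl, rdotNr, rdotZl, rdotZr).
  rewrite (rdotC eta) (rdotC xi) (rdotC eta t) (rdotC xi t) (rdotC z1 eta) (rdotC z1 xi); by field.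
by rewrite !cisD; ring.
Qed.

Lemma schwartz_wigner_left k (V : 'rV[R]_(k + k) -> C) (g v : 'rV[R]_k -> C) :
  schwartz V -> schwartz g -> schwartz v ->
  schwartz (fun q : 'rV[R]_((k + k) + (k + k)) =>
    V (lsubmx q) * wigner (fun s => (tau (lsubmx q) g s)^*%C) v (rsubmx q)).
Proof.
move=> sV sg sv; pose e : R := 2^-1.
apply: (@schwartz_osc_fun R ((k + k) + (k + k)) k (((k + k) + k) + k) (k + k)
  (col_mx (col_mx (col_mx (row_mx (row_mx (row_mx 1%:M 0) (-1)%:M) 0) (row_mx (row_mx (row_mx 0 1%:M) 0) 0))
                  (col_mx (row_mx (row_mx 0 1%:M) 1%:M) 0))
          (row_mx (row_mx 0 (- e)%:M) e%:M))
  (col_mx (col_mx 0 (row_mx 0 1%:M)) 0) (col_mx 0 (col_mx (row_mx 0 1%:M) (row_mx 1%:M 0)))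
  (row_mx 1%:M 0) (row_mx 0 (- e)%:M)
  (col_mx (col_mx 0 (-1)%:M) 1%:M)
  (col_mx (col_mx (col_mx (row_mx (row_mx (row_mx 1%:M 0) (row_mx e%:M 0)) (-1)%:M)
                          (row_mx (row_mx (row_mx 0 1%:M) (row_mx 0 e%:M)) 0))
                  (row_mx (row_mx 0 (row_mx e%:M 0)) (-1)%:M))
          (row_mx (row_mx 0 (row_mx e%:M 0)) 1%:M))
  (row_mx (row_mx 0 (row_mx 0 1%:M)) 0)
  _ _ _ _ (schwartz_tensor (schwartz_tensor sV (schwartzJ sg)) sv)).
- by move=> s; rewrite /e; rows.
- by move=> q s; rewrite -(hsubmxK q) -(hsubmxK (lsubmx q)) -(hsubmxK (rsubmx q)) /e; rows.
- move=> q; rewrite /wigner -cintegralZ; last first.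
    exact/schwartz_cint/(wigner_integrand _ _ (schwartzJ (schwartz_tau _ sg)) sv).
  apply: eq_cintegral => t.
  rewrite -(hsubmxK q) -(hsubmxK (lsubmx q)) -(hsubmxK (rsubmx q)) !mxs /tau !mxs.
  move: (lsubmx (lsubmx q)) (rsubmx (lsubmx q)) (lsubmx (rsubmx q)) (rsubmx (rsubmx q)) => y eta z th.
  rewrite cJM cisJ opprK rdot_row cisD -!/(cis _).
  have -> : z - 2^-1 *: t - y = -1 *: y + z + - e *: t.
    by apply/rowP => i; rewrite /e !mxE; ring.
  have -> : z + - e *: t = z - 2^-1 *: t by rewrite scaleNr.
  by ring.
Qed.

Lemma schwartz_wigner_right k (V : 'rV[R]_(k + k) -> C) (g u : 'rV[R]_k -> C) :
  schwartz V -> schwartz g -> schwartz u ->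
  schwartz (fun q : 'rV[R]_((k + k) + (k + k)) =>
    V (lsubmx q) * wigner u (tau (lsubmx q) g) (rsubmx q)).
Proof.
move=> sV sg su; pose e : R := 2^-1.
apply: (@schwartz_osc_fun R ((k + k) + (k + k)) k (((k + k) + k) + k) (k + k)
  (col_mx (col_mx (col_mx (row_mx (row_mx (row_mx 1%:M 0) (-1)%:M) 0) (row_mx (row_mx (row_mx 0 1%:M) 0) 0))
                  (col_mx (row_mx (row_mx 0 1%:M) 1%:M) 0))
          (row_mx (row_mx 0 e%:M) (- e)%:M))
  (col_mx (col_mx 0 (row_mx 0 (-1)%:M)) 0) (col_mx 0 (col_mx (row_mx 0 1%:M) (row_mx 1%:M 0)))
  (row_mx 1%:M 0) (row_mx 0 e%:M)
  (col_mx (col_mx 0 1%:M) (-1)%:M)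
  (col_mx (col_mx (col_mx (row_mx (row_mx (row_mx 1%:M 0) (row_mx e%:M 0)) 1%:M)
                          (row_mx (row_mx (row_mx 0 1%:M) (row_mx 0 e%:M)) 0))
                  (row_mx (row_mx 0 (row_mx e%:M 0)) 1%:M))
          (row_mx (row_mx 0 (row_mx e%:M 0)) (-1)%:M))
  (row_mx (row_mx 0 (row_mx 0 1%:M)) 0)
  _ _ _ _ (schwartz_tensor (schwartz_tensor sV sg) su)).
- by move=> s; rewrite /e; rows.
- by move=> q s; rewrite -(hsubmxK q) -(hsubmxK (lsubmx q)) -(hsubmxK (rsubmx q)) /e; rows.
- move=> q; rewrite /wigner -cintegralZ; last first.
    exact/schwartz_cint/(wigner_integrand _ _ su (schwartz_tau _ sg)).
  apply: eq_cintegral => t.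
  rewrite -(hsubmxK q) -(hsubmxK (lsubmx q)) -(hsubmxK (rsubmx q)) !mxs /tau !mxs.
  move: (lsubmx (lsubmx q)) (rsubmx (lsubmx q)) (lsubmx (rsubmx q)) (rsubmx (rsubmx q)) => y eta z th.
  rewrite rdot_row cisD -!/(cis _).
  have -> : z + 2^-1 *: t - y = -1 *: y + z + e *: t.
    by apply/rowP => i; rewrite /e !mxE; ring.
  have -> : z - 2^-1 *: t = z + - e *: t by rewrite scaleNr.
  have -> : rdot (-1 *: eta) (z + e *: t) = - rdot eta (z + 2^-1 *: t).
    by rewrite rdotZl mulN1r.
  by ring.
Qed.

(** At a fixed point the Wigner transform pairs one function with a modulated
    reflection of the other, to which the resolution of the identity applies. *)
Lemma wigner_pairing_right k (z : 'rV[R]_(k + k)) : exists kap : R,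
  forall u : 'rV[R]_k -> C, schwartz u -> exists2 r, schwartz r & forall v, schwartz v ->
     wigner u v z = kap%:C * cintegral (leb k) (fun s => v s * r s).
Proof.
have h0 : (2^-1 : R) != 0 by rewrite invr_eq0 pnatr_eq0.
have [kap [_ [_ Hk _]]] := @dilation R k 2^-1 h0; exists kap => u su.
pose z1 := lsubmx z; pose th := rsubmx z.
have N1 : (- 1%:M) *m (- 1%:M) = 1%:M :> 'M[R]_k by rewrite mulNmx mul1mx opprK.
pose r s := cis (- rdot (2 *: z1) th) * (cis (rdot s (2 *: th)) * u (s *m - 1%:M + 2 *: z1)).
have sr : schwartz r by apply: schwartzZ; exact: schwartz_pull N1 su.
exists r => // v sv; have I : cintegrable (leb k) (fun s => v s * r s).
  by apply: schwartz_cint; exact: schwartzM.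
have Is := cint_shift z1 I.
rewrite -(cintegral_shift z1 I) -(Hk _ Is).2; apply: eq_cintegral => t.
rewrite -/z1 -/th -!/(cis _) /r mulmxN mulmx1.
have -> : - (2^-1 *: t + z1) + 2 *: z1 = z1 - 2^-1 *: t.
  by apply/rowP => i; rewrite !mxE; ring.
have -> : rdot t th = - rdot (2 *: z1) th + rdot (2^-1 *: t + z1) (2 *: th).
  by rewrite rdotDl !rdotZl !rdotZr; field.
by rewrite cisD (addrC z1 (2^-1 *: t)); ring.
Qed.

Lemma wigner_pairing_left k (z : 'rV[R]_(k + k)) : exists kap : R,
  forall v : 'rV[R]_k -> C, schwartz v -> exists2 r, schwartz r & forall u, schwartz u ->
     wigner u v z = kap%:C * cintegral (leb k) (fun s => u s * r s).
Proof.
have N1 : (-1 : R) != 0 by rewrite oppr_eq0 oner_eq0.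
have [kap' [_ [_ Hk _]]] := @dilation R k (-1) N1.
have [kap Hr] := wigner_pairing_right (row_mx (lsubmx z) (- rsubmx z)).
exists (kap' * kap) => v sv; have [r sr Er] := Hr v sv; exists r => // u su.
rewrite rmorphM -mulrA -Er // /wigner row_mxKl row_mxKr.
have I := schwartz_cint (wigner_integrand (lsubmx z) (- rsubmx z) sv su).
rewrite -(Hk _ I).2; apply: eq_cintegral => t.
have -> : 2^-1 *: (-1 *: t) = - (2^-1 *: t) by rewrite scaleN1r scalerN.
rewrite opprK; have -> : rdot (-1 *: t) (- rsubmx z) = rdot t (rsubmx z).
  by rewrite rdotZl rdotNr mulN1r opprK.
by rewrite mulrAC.
Qed.
End wigner_coherent.

(** * Symbols applied to Wigner transforms *)

Section symbol_wigner.
Context {R : realType}.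
Local Notation C := R[i].
Variables (n : nat) (Q : 'M[C]_(n + n)) (c : R).
Hypotheses (hQ : bargmann_phase Q) (hc : 0 < c) (hT : bargmann_unitary Q c).
Local Notation g0 := (gauss (reQyy Q) (imQyy Q)).
Local Notation k := (n + n)%N.
Variables (a : Defs.distribution (R := R) k) (h : 'rV[R]_k -> C) (K1 : C).
Hypotheses (ta : tempered a) (sh : schwartz h) (K10 : K1 != 0).
Hypothesis mS : cmeasurable (fun rho => a (tau rho h)).
Hypothesis rep : forall F, schwartz F ->
  cintegral (leb (k + k)) (fun rho => stft h F rho * a (tau rho h)) = K1 * a F.

Let sg0 : schwartz g0. Proof. exact: schwartz_ground. Qed.
Local Notation pt w := (toE Q (cplx w)).

Let cint_pt (f : 'rV[R]_k -> C) : cintegrable (leb k) f -> cintegrable (leb k) (fun w => f (pt w)).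
Proof.
have [L uL LE] := toE_linear hQ; have [kp kp0 Hk] := leb_linear uL => If.
have -> : (fun w => f (pt w)) = (fun w => f (w *m L)) by apply/funext => w; rewrite LE.
exact: (cint_change (@measurable_mulmx R k k L) (ltW kp0) Hk If).
Qed.

Let pull_toE (G : 'rV[R]_(k + k) -> C) : schwartz G ->
  schwartz (fun q : 'rV[R]_(k + k) => (c ^+ 2)%:C * G (row_mx (pt (lsubmx q)) (rsubmx q))).
Proof.
move=> sG; apply: schwartzZ; have [L uL LE] := toE_linear hQ.
have MU : block_mx L 0 0 1%:M *m block_mx (invmx L) 0 0 1%:M = 1%:M :> 'M[R]_(k + k).
  by rewrite mulmx_block !mulmx0 !mul0mx !mulmx1 !addr0 !add0r mulmxV // -scalar_mx_block.
have := schwartz_affine 0 MU sG; congr schwartz; apply/funext => q.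
by rewrite addr0 -{1}(hsubmxK q) mul_row_block !mulmx0 mulmx1 addr0 add0r LE.
Qed.

Let superpose (H : 'rV[R]_k -> C) (X : 'rV[R]_k -> 'rV[R]_k -> C) (G0 : 'rV[R]_k -> C) :
  schwartz (fun q : 'rV[R]_(k + k) => H (lsubmx q) * X (lsubmx q) (rsubmx q)) ->
  (forall rho, schwartz (X rho)) -> schwartz G0 ->
  (forall z, G0 z = (c ^+ 2)%:C * cintegral (leb k) (fun w => H (pt w) * X (pt w) z)) ->
  cintegrable (leb k) (fun w => (c ^+ 2)%:C * (H (pt w) * a (X (pt w)))) /\
  cintegral (leb k) (fun w => (c ^+ 2)%:C * (H (pt w) * a (X (pt w)))) = a G0.
Proof.
move=> sHX sX sG0 E; have sG := pull_toE sHX.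
have GE w z : (fun q : 'rV[R]_(k + k) => (c ^+ 2)%:C * (H (lsubmx (row_mx (pt (lsubmx q)) (rsubmx q))) *
   X (lsubmx (row_mx (pt (lsubmx q)) (rsubmx q))) (rsubmx (row_mx (pt (lsubmx q)) (rsubmx q)))))
   (row_mx w z) = (c ^+ 2)%:C * H (pt w) * X (pt w) z.
  by rewrite !(row_mxKl, row_mxKr) mulrA.
have cI z : cintegrable (leb k) (fun w => H (pt w) * X (pt w) z).
  have [L uL LE] := toE_linear hQ; have [kap kap0 Hk] := leb_linear uL.
  have MU : (row_mx 1%:M 0 : 'M[R]_(k, k + k)) *m col_mx 1%:M 0 = 1%:M.
    by rewrite mul_row_col mulmx1 mulmx0 addr0.
  have I := schwartz_cint (schwartz_affine (row_mx 0 z) MU sHX).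
  have := cint_change (@measurable_mulmx R k k L) (ltW kap0) Hk I.
  congr cintegrable; apply/funext => w.
  by rewrite mul_mx_row mulmx1 mulmx0 add_row_mx addr0 add0r row_mxKl row_mxKr LE.
have aE w : a (fun z => (c ^+ 2)%:C * H (pt w) * X (pt w) z) = (c ^+ 2)%:C * (H (pt w) * a (X (pt w))).
  by rewrite (temperedZ ta _ (sX _)) mulrA.
have [I /(_ G0 sG0) S] := symbol_superposition ta sh K10 mS rep sG.
have /(S) {S} : forall z, G0 z = cintegral (leb k) (fun w => (fun q : 'rV[R]_(k + k) => (c ^+ 2)%:C *
   (H (lsubmx (row_mx (pt (lsubmx q)) (rsubmx q))) *
   X (lsubmx (row_mx (pt (lsubmx q)) (rsubmx q))) (rsubmx (row_mx (pt (lsubmx q)) (rsubmx q)))))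
   (row_mx w z)).
  by move=> z; rewrite E -cintegralZ //; apply: eq_cintegral => w; rewrite GE mulrA.
move: I.
have -> : (fun w => a (fun z => (fun q : 'rV[R]_(k + k) => (c ^+ 2)%:C * (H (lsubmx (row_mx (pt (lsubmx q)) (rsubmx q))) *
   X (lsubmx (row_mx (pt (lsubmx q)) (rsubmx q))) (rsubmx (row_mx (pt (lsubmx q)) (rsubmx q)))))
   (row_mx w z))) = (fun w => (c ^+ 2)%:C * (H (pt w) * a (X (pt w)))).
  by apply/funext => w; rewrite -aE; congr a; apply/funext => z; exact: GE.
by split.
Qed.

Let conj_stft u : schwartz u -> schwartz (fun rho => (stft g0 (fun t => (u t)^*%C) rho)^*%C).
Proof. by move=> su; apply/schwartzJ/schwartz_stft => //; exact: schwartzJ. Qed.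

(** The weight makes the family of Wigner transforms jointly rapidly decreasing. *)
Lemma cmeas_symbol_wigner u : schwartz u -> cmeasurable (fun rho => a (wigner u (tau rho g0))).
Proof.
move=> su; have sX rho : schwartz (wigner u (tau rho g0)) by apply: schwartz_wigner => //; exact: schwartz_tau.
have sG := schwartz_wigner_right (@schwartz_gauss1 R k) sg0 su.
have [I _] := symbol_superposition ta sh K10 mS rep sG.
have mI := cint_meas I.
have m1 : cmeasurable (fun rho : 'rV[R]_k => (expR (2^-1 * rdot rho rho))%:C).
  apply: cmeasR; apply: measurableT_comp; first exact: measurable_expR.
  by apply: measurable_funM; [exact: measurable_cst | apply: measurable_rdot].
have := cmeasM m1 mI; congr cmeasurable; apply/funext => rho.
rewrite (_ : (fun z => _) = (fun z => gauss1 rho * wigner u (tau rho g0) z)); last first.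
  by apply/funext => z; rewrite row_mxKl row_mxKr.
rewrite (temperedZ ta _ (sX rho)) mulrA /gauss1 /gauss mulmx0 mulmx1 rdot0l mulr0 cis0 mulr1.
by rewrite -rmorphM -expRD subrr expR0 mul1r.
Qed.

(** The resolution of the identity in the first argument, taken inside the symbol. *)
Lemma symbol_wigner_left u v : schwartz u -> schwartz v ->
  cintegrable (leb k) (fun w => (c ^+ 2)%:C * ((stft g0 (fun t => (u t)^*%C) (pt w))^*%C *
     a (wigner (fun s => (tau (pt w) g0 s)^*%C) v))) /\
  cintegral (leb k) (fun w => (c ^+ 2)%:C * ((stft g0 (fun t => (u t)^*%C) (pt w))^*%C *
     a (wigner (fun s => (tau (pt w) g0 s)^*%C) v))) = a (wigner u v).
Proof.
move=> su sv; have sgJ rho := schwartzJ (schwartz_tau rho sg0).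
apply: (superpose (H := fun rho => (stft g0 (fun t => (u t)^*%C) rho)^*%C)
   (X := fun rho => wigner (fun s => (tau rho g0 s)^*%C) v)).
- exact: schwartz_wigner_left (conj_stft su) sg0 sv.
- by move=> rho; exact: schwartz_wigner.
- exact: schwartz_wigner.
move=> z; have [kap Hr] := wigner_pairing_left z; have [r sr Er] := Hr v sv.
rewrite Er // -(coherent_resolution hQ hc hT su sr) mulrCA.
apply: (congr1 (fun x => (c ^+ 2)%:C * x)); rewrite -cintegralZ; last first.
  exact: (cint_pt (schwartz_cint (schwartzM (conj_stft su) (schwartz_stft sg0 sr)))).
apply: eq_cintegral => w; rewrite Er // mulrCA; congr (_ * (_ * _)).
by rewrite stftE; apply: eq_cintegral => s; rewrite mulrC.
Qed.

(** The resolution of the identity in the second argument, taken inside the symbol. *)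
Lemma symbol_wigner_right u v : schwartz u -> schwartz v ->
  cintegrable (leb k) (fun w => (c ^+ 2)%:C * (stft g0 v (pt w) * a (wigner u (tau (pt w) g0)))) /\
  cintegral (leb k) (fun w => (c ^+ 2)%:C * (stft g0 v (pt w) * a (wigner u (tau (pt w) g0)))) =
  a (wigner u v).
Proof.
move=> su sv; have st rho := schwartz_tau rho sg0.
apply: (superpose (H := stft g0 v) (X := fun rho => wigner u (tau rho g0))).
- exact: schwartz_wigner_right (schwartz_stft sg0 sv) sg0 su.
- by move=> rho; exact: schwartz_wigner.
- exact: schwartz_wigner.
move=> z; have [kap Hr] := wigner_pairing_right z; have [r sr Er] := Hr u su.
have -> : wigner u v z = kap%:C * cintegral (leb n) (fun s => r s * v s).
  by rewrite Er //; congr (_ * _); apply: eq_cintegral => s; exact: mulrC.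
rewrite -(coherent_resolution hQ hc hT sr sv) mulrCA.
apply: (congr1 (fun x => (c ^+ 2)%:C * x)); rewrite -cintegralZ; last first.
  exact: (cint_pt (schwartz_cint (schwartzM (conj_stft sr) (schwartz_stft sg0 sv)))).
apply: eq_cintegral => w; rewrite Er //.
suff -> : (stft g0 (fun t => (r t)^*%C) (pt w))^*%C = cintegral (leb n) (fun s => tau (pt w) g0 s * r s).
  by rewrite [X in _ * X]mulrC mulrCA.
rewrite stftE -cintegralJ; last by apply: schwartz_cint; apply: schwartzM; apply: schwartzJ.
by apply: eq_cintegral => s; rewrite cJM !conjcK mulrC.
Qed.
End symbol_wigner.

(** * Localization of a symbol along the lattice *)

Section localization.
Context {R : realType}.
Local Notation C := R[i].

Lemma L2_zero k : L2 (leb k) (fun=> 0 : C).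
Proof. exact: schwartz_L2 (schwartz0 k). Qed.

Lemma distr_L2norm_le_trans k (a : Defs.distribution (R := R) k) (r r' : R) :
  r <= r' -> distr_L2norm_le a r -> distr_L2norm_le a r'.
Proof.
move=> rr [f [Lf fa nf]]; exists f; split=> //.
by apply: (le_trans nf); rewrite lee_fin.
Qed.

Lemma distr_L2norm_ge0 k (a : Defs.distribution (R := R) k) (r : R) : distr_L2norm_le a r -> 0 <= r.
Proof.
case=> f [Lf _ nf]; rewrite -lee_fin; apply: le_trans nf.
by rewrite (L2norm_Rintegral Lf) lee_fin sqrtr_ge0.
Qed.

Lemma lattice0 k (G : set 'rV[R]_k) : lattice G -> G 0.
Proof.
move=> [B _ ->]; exists 0 => //.
have -> : map_mx intr (0 : 'rV[int]_k) = 0 :> 'rV[R]_k by apply/rowP => i; rewrite !mxE.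
by rewrite mul0mx.
Qed.

Section bounds.
Variables (k : nat) (G : set 'rV[R]_(k + k)) (chi : 'rV[R]_(k + k) -> C) (m : 'rV[R]_(k + k) -> R).
Hypotheses (hG : lattice G) (m0 : forall rho, 0 < m rho).

Lemma symbol_bound_le (a : Defs.distribution (R := R) k) (A B : R) : A <= B ->
  symbol_bound G chi m a A -> symbol_bound G chi m a B.
Proof. by move=> AB H g Gg; apply: distr_L2norm_le_trans (H g Gg); rewrite ler_pM2r. Qed.

Lemma symbol_bound_ge0 (a : Defs.distribution (R := R) k) (A : R) : symbol_bound G chi m a A -> 0 <= A.
Proof. by move=> /(_ 0 (lattice0 hG))/distr_L2norm_ge0; rewrite pmulr_lge0. Qed.

Lemma symbol_norm_ge0 (a : Defs.distribution (R := R) k) : symbol_space G chi m a -> 0 <= symbol_norm G chi m a.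
Proof. by move=> [_ [A HA]]; apply: lb_le_inf; [exists A | move=> B; exact: symbol_bound_ge0]. Qed.

(** The symbol norm is approached by admissible constants, whether or not it is
    attained. *)
Lemma symbol_norm_bound (a : Defs.distribution (R := R) k) (e : R) : symbol_space G chi m a -> 0 < e ->
  symbol_bound G chi m a (symbol_norm G chi m a + e).
Proof.
move=> [_ [A HA]] e0.
have hi : has_inf (symbol_bound G chi m a).
  by split; [exists A | exists 0 => B; exact: symbol_bound_ge0].
by have [B HB /ltW Be] := inf_adherent e0 hi; exact: symbol_bound_le Be HB.
Qed.

Lemma symbol_bound_localized (Z : nat -> seq 'rV[R]_(k + k)) (a : Defs.distribution (R := R) k) (A : R) :
  (forall j g, g \in Z j -> G g) -> tempered a -> 0 < A -> symbol_bound G chi m a A ->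
  localized chi Z m a A.
Proof.
move=> ZG ta A0 HA; split => //.
have Hf (g : 'rV[R]_(k + k)) : exists f : 'rV[R]_k -> C, L2 (leb k) f /\ (G g ->
    represents f (weyl_on_distr (translate chi g) a) /\ (L2norm (leb k) f <= (A * m g)%:E)%E).
  case: (pselect (G g)) => [Gg|nG]; last by exists (fun=> 0); split; [exact: L2_zero | move=> /nG].
  by have [f [Lf fa nf]] := HA g Gg; exists f.
have [f Pf] := choice Hf; exists f; split.
- by move=> g; exact: (Pf g).1.
- by move=> j g u /ZG Gg su; exact: (((Pf g).2 Gg).1 u su).
move=> j g /ZG Gg; rewrite -(L2norm_le (Pf g).1) ?(mulr_ge0 (ltW A0) (ltW (m0 g))) //.
exact: ((Pf g).2 Gg).2.
Qed.
End bounds.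

(** What the kernel and its bounds use of the symbol space, the lattice and the
    localization being eliminated. *)
Lemma symbol_phase_space k (G : set 'rV[R]_(k + k)) (chi : 'rV[R]_(k + k) -> C) m :
  lattice G -> order_function m -> schwartz chi ->
  (forall rho, unordered_sum G (fun g => translate chi g rho) 1) ->
  exists (h : 'rV[R]_k -> C) (K : C), [/\ schwartz h, K != 0,
    forall F, schwartz F -> exists2 CF : R, 0 <= CF & forall a, symbol_space G chi m a ->
      forall rho, normc (a (tau rho F)) <= CF * (symbol_norm G chi m a * m rho),
    forall a F, symbol_space G chi m a -> schwartz F -> cmeasurable (fun rho => a (tau rho F)) &
    forall a F, symbol_space G chi m a -> schwartz F ->
      cintegral (leb (k + k)) (fun rho => stft h F rho * a (tau rho h)) = K * a F].
Proof.
move=> hG om schi hsum; have [C0 [N1 [C00 mm]]] := order_function_moderate om.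
have [Z [uZ ZG ZA [c c0 Zc]]] := lattice_boxes hG.
have Zchi rho : ccvg (fun j => \sum_(g <- Z j) translate chi g rho) 1.
  exact: unordered_sum_cvg uZ ZG ZA (hsum rho).
have m0 : forall rho, 0 < m rho := mm.1.
have sh := @schwartz_gauss1 R k.
have h0 : @gauss1 R k 0 != 0 by rewrite gauss1_0 oner_neq0.
have [K K0 gabor] := gabor_inversion sh h0.
have loc a : symbol_space G chi m a -> exists A, localized chi Z m a A.
  move=> sa; exists (symbol_norm G chi m a + 1); apply: symbol_bound_localized ZG sa.1 _ _ => //.
    by rewrite ltr_wpDl ?(symbol_norm_ge0 hG m0 sa).
  exact: symbol_norm_bound.
exists (@gauss1 R k), K; split => //.
- move=> F sF; have [CF CF0 HF] := symbol_bound_tau schi Zc Zchi C00 mm sh K0 gabor sF.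
  exists CF => // a sa rho; apply: (@le_of_eps R _ _ (CF * m rho)).
    by rewrite mulr_ge0 // ltW.
  move=> e e0; have S0 := symbol_norm_ge0 hG m0 sa.
  have L : localized chi Z m a (symbol_norm G chi m a + e).
    apply: symbol_bound_localized ZG sa.1 _ _ => //; first by rewrite ltr_wpDl.
    exact: symbol_norm_bound.
  apply: (le_trans (HF a _ L rho)); rewrite le_eqVlt; apply/orP; left; apply/eqP; ring.
- move=> a F sa sF; have [A [ta _ [f [fL2 fa _]]]] := loc a sa.
  exact: (meas_tau_symbol schi Zc Zchi ta fL2 fa sF).
- move=> a F sa sF; have [A [ta _ [f [fL2 fa _]]]] := loc a sa.
  exact: (symbol_gabor schi Zc Zchi ta fL2 fa sh gabor sF).2.
Qed.
End localization.

(** * The effective kernel *)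

Section effective_kernel_construction.
Context {R : realType}.
Local Notation C := R[i].
Local Notation ii := ((0 : R) +i* 1).
Variables (n : nat) (Q : 'M[C]_(n + n)).
Hypothesis hQ : bargmann_phase Q.
Local Notation g0 := (gauss (reQyy Q) (imQyy Q)).
Local Notation k := (n + n)%N.

(** The Wigner transform of two coherent states, up to a phase a phase space
    translate of this one. *)
Definition ground_wigner : 'rV[R]_k -> C := wigner (fun s => (g0 s)^*%C) g0.

Lemma schwartz_ground_wigner : schwartz ground_wigner.
Proof. by apply: schwartz_wigner; [apply: schwartzJ|]; exact: schwartz_ground. Qed.

(** The matrix entry of the quantized symbol between the coherent states at mu and
    nu, without its constant and its phase. *)
Definition coherent_entry (a : Defs.distribution (R := R) k) (nu mu : 'rV[R]_k) : C :=
  a (wigner (fun s => (tau mu g0 s)^*%C) (tau nu g0)).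

Lemma coherent_entryE (a : Defs.distribution (R := R) k) nu mu : tempered a ->
  coherent_entry a nu mu = cis (- (2^-1 * rdot (lsubmx nu - lsubmx mu) (rsubmx mu + rsubmx nu))) *
    a (tau (row_mx (2^-1 *: (nu + mu)) (hamJinv (mu - nu))) ground_wigner).
Proof.
move=> ta; rewrite /coherent_entry -(temperedZ ta); last exact: schwartz_tau schwartz_ground_wigner.
by congr a; apply/funext => z; rewrite wigner_tau //; exact: schwartz_ground.
Qed.

Lemma normc_coherent_entry (m : 'rV[R]_(k + k) -> R) (a : Defs.distribution (R := R) k) (A : R) : tempered a ->
  (forall rho, normc (a (tau rho ground_wigner)) <= A * m rho) ->
  forall nu mu, normc (coherent_entry a nu mu) <= A * kernel_weight m nu mu.
Proof. by move=> ta H nu mu; rewrite coherent_entryE // (normcM (cis _)) normc_cis mul1r; exact: H. Qed.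

Lemma cmeas_coherent_entry d (T : measurableType d) (a : Defs.distribution (R := R) k)
  (f g : T -> 'rV[R]_k) : tempered a -> cmeasurable (fun rho => a (tau rho ground_wigner)) ->
  measurable_fun setT f -> measurable_fun setT g ->
  cmeasurable (fun p => coherent_entry a (f p) (g p)).
Proof.
move=> ta ma mf mg.
have ml (q : T -> 'rV[R]_k) : measurable_fun setT q -> measurable_fun setT (fun p => lsubmx (q p)).
  by move=> mq; apply: (measurableT_comp (@measurable_lsubmx R n n)).
have mr (q : T -> 'rV[R]_k) : measurable_fun setT q -> measurable_fun setT (fun p => rsubmx (q p)).
  by move=> mq; apply: (measurableT_comp (@measurable_rsubmx R n n)).
have -> : (fun p => coherent_entry a (f p) (g p)) = fun p =>
    cis (- (2^-1 * rdot (lsubmx (f p) - lsubmx (g p)) (rsubmx (g p) + rsubmx (f p)))) *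
    a (tau (row_mx (2^-1 *: (f p + g p)) (hamJinv (g p - f p))) ground_wigner).
  by apply/funext => p; exact: coherent_entryE.
apply: cmeasM.
  apply: cmeas_cis; apply: measurable_funN; apply: measurable_funM; first exact: measurable_cst.
  apply: measurable_rdot.
    by apply: measurable_rVD; [exact: ml | apply: measurable_rVN; exact: ml].
  by apply: measurable_rVD; exact: mr.
have row l l' (q : T -> 'rV[R]_l) (q' : T -> 'rV[R]_l') : measurable_fun setT q ->
  measurable_fun setT q' -> measurable_fun setT (fun p => row_mx (q p) (q' p)).
  move=> mq mq'.
  apply: (measurableT_comp (@measurable_row_mx R l l') (_ : measurable_fun setT (fun p => (_, _)))).
  exact/measurable_fun_pair.
apply: (cmeas_comp ma); apply: (row).
  by apply: measurable_rVZ; apply: measurable_rVD.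
have md : measurable_fun setT (fun p => g p - f p).
  by apply: measurable_rVD => //; apply: measurable_rVN.
by apply: (row); [apply: measurable_rVN; exact: mr | exact: ml].
Qed.

Lemma measurable_toE : measurable_fun setT (fun w : 'rV[R]_k => toE Q (cplx w)).
Proof.
have [L _ LE] := toE_linear hQ.
by rewrite [X in measurable_fun _ X](_ : _ = mulmx^~ L); [exact: measurable_mulmx | apply/funext].
Qed.

Lemma measurable_bphase : measurable_fun setT (fun w : 'rV[R]_k => bphase Q (cplx w)).
Proof.
have Rc l (z w : 'rV[C]_l) : Re (cdot z w) = rdot (rRe z) (rRe w) - rdot (rIm z) (rIm w).
  rewrite cdotE !rdotE -sumrB (big_morph (@complex.Re R) (@cReD R) (erefl _)).
  by apply: eq_bigr => i _; rewrite cReM !mxE.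
have mm l (q : 'rV[R]_k -> 'rV[R]_l) (M : 'M[R]_l) : measurable_fun setT q ->
  measurable_fun setT (fun w => q w *m M).
  by move=> mq; apply: (measurableT_comp (@measurable_mulmx R l l M)).
have ml := @measurable_lsubmx R n n; have mr := @measurable_rsubmx R n n.
have mt : measurable_fun setT (fun w : 'rV[R]_k => lsubmx (toE Q (cplx w))).
  exact: (measurableT_comp (@measurable_lsubmx R n n) measurable_toE).
rewrite /bphase; apply: measurable_funB; apply: measurable_funM.
- exact: measurable_cst.
- under eq_fun do rewrite Rc rRe_mulmx rIm_mulmx rRe_cplx rIm_cplx.
  apply: measurable_funB; apply: measurable_rdot => //; apply: measurable_rVD; rewrite ?mm //.
  + exact: mm.
  + by apply: measurable_rVN; exact: mm.
  + exact: mm.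
  + exact: mm.
- exact: measurable_cst.
- by apply: measurable_rdot => //; exact: mm.
Qed.

Variable c : R.
Hypotheses (hc : 0 < c) (hT : bargmann_unitary Q c).

Definition bargmann_kernel (a : Defs.distribution (R := R) k) (x y : 'rV[C]_n) : C :=
  (c ^+ 2 * (2 * pi) ^- n)%:C * cis (bphase Q x - bphase Q y) * coherent_entry a (toE Q x) (toE Q y).

Variables (a : Defs.distribution (R := R) k) (h : 'rV[R]_k -> C) (K1 : C).
Hypotheses (ta : tempered a) (sh : schwartz h) (K10 : K1 != 0).
Hypothesis mS : forall F, schwartz F -> cmeasurable (fun rho => a (tau rho F)).
Hypothesis rep : forall F, schwartz F ->
  cintegral (leb (k + k)) (fun rho => stft h F rho * a (tau rho h)) = K1 * a F.

Lemma cmeas_bargmann_kernel :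
  cmeasurable (fun p : 'rV[R]_k * 'rV[R]_k => bargmann_kernel a (cplx p.1) (cplx p.2)).
Proof.
have m1 := @measurable_fst _ _ 'rV[R]_k 'rV[R]_k; have m2 := @measurable_snd _ _ 'rV[R]_k 'rV[R]_k.
have mb : measurable_fun setT (fun p : 'rV[R]_k * 'rV[R]_k => bphase Q (cplx p.1) - bphase Q (cplx p.2)).
  apply: measurable_funB; first exact: (measurableT_comp measurable_bphase m1).
  exact: (measurableT_comp measurable_bphase m2).
apply: cmeasM; first apply: cmeasM.
- exact: (@cmeas_cst R _ _ (c ^+ 2 * (2 * pi) ^- n)%:C).
- exact: cmeas_cis mb.
- apply: (@cmeas_coherent_entry _ _ a (fun p : 'rV[R]_k * 'rV[R]_k => toE Q (cplx p.1))
    (fun p => toE Q (cplx p.2)) ta (mS schwartz_ground_wigner)).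
    exact: (measurableT_comp measurable_toE m1).
  exact: (measurableT_comp measurable_toE m2).
Qed.

Lemma wignerZr (z : C) (u v : 'rV[R]_n -> C) : schwartz u -> schwartz v ->
  wigner u (fun t => z * v t) = (fun w => z * wigner u v w).
Proof.
move=> su sv; apply/funext => w; rewrite /wigner -cintegralZ; last first.
  exact: schwartz_cint (wigner_integrand _ _ su sv).
by apply: eq_cintegral => t; rewrite mulrCA.
Qed.

(** Pairing with the coherent state at x resolves the argument into coherent
    states at y, whose phases are compensated by those of the kernel. *)
Lemma bargmann_kernel_effective : effective_kernel Q c a (bargmann_kernel a).
Proof.
split; first exact: cmeas_bargmann_kernel.
move=> u su x F; have sg := schwartz_ground hQ; have stx := schwartz_tau (toE Q x) sg.
have [I E] := symbol_wigner_left hQ hc hT ta sh K10 (mS sh) rep su stx.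
have phases_cancel (c2 p' e d : R) (s t q r v : C) : s * t = 1 ->
    e%:C * ((c2 * p')%:C * (q * s) * v) * (d%:C * (t * r)) = (e * (p' * d))%:C * q * (c2%:C * (r * v)).
  move=> st1; rewrite !rmorphM /=; move: e%:C p'%:C d%:C c2%:C => e1 p1 d1 c1.
  transitivity (s * t * (e1 * (p1 * d1) * q * (c1 * (r * v)))); first by ring.
  by rewrite st1 mul1r.
pose z : C := (expR (Phi Q x) * ((2 * pi) ^- n * c))%:C * cis (bphase Q x).
have FE w : F w = z * ((c ^+ 2)%:C * ((stft g0 (fun t : 'rV_n => (u t)^*%C) (toE Q (cplx w)))^*%C *
    a (wigner (fun s : 'rV_n => (tau (toE Q (cplx w)) g0 s)^*%C) (tau (toE Q x) g0)))).
  rewrite /F /z -/(coherent_entry a (toE Q x) (toE Q (cplx w))) -mulrA.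
  rewrite (bargmann_coherent c hQ (cplx w) (schwartz_L2 su)).
  rewrite -/(coherent_transform Q u w) (coherent_transformE hQ w su) /bargmann_kernel.
  rewrite (cisD (bphase Q x)); have := cisD (- bphase Q (cplx w)) (bphase Q (cplx w)).
  by rewrite addNr cis0 => /esym; exact: phases_cancel.
have -> : F = fun w => z * ((c ^+ 2)%:C * ((stft g0 (fun t : 'rV_n => (u t)^*%C) (toE Q (cplx w)))^*%C *
    a (wigner (fun s : 'rV_n => (tau (toE Q (cplx w)) g0 s)^*%C) (tau (toE Q x) g0)))).
  by apply/funext.
split; first exact: cintZ.
rewrite cintegralZ // E /bargmann_distr /weyl_distr.
have -> : (fun y : 'rV[R]_n => cexp (ii * phase Q x (toC y))) =
   (fun t => (expR (Phi Q x))%:C * cis (bphase Q x) * tau (toE Q x) g0 t).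
  apply/funext => t; rewrite -mulrA -coherentE // /coherent mulrA -rmorphM -expRD subrr expR0.
  by rewrite rmorph1 mul1r.
rewrite wignerZr // (temperedZ ta _ (schwartz_wigner su stx)) /z.
move: ((2 * pi) ^- n) (cis _) (a _) => p' q v; rewrite !rmorphM /=.
move: (expR _)%:C p'%:C c%:C => e p d; by ring.
Qed.
End effective_kernel_construction.

(** * Completeness of the space of square integrable functions *)

Section riesz_fischer.
Context {R : realType} d (T : measurableType d) (mu : {measure set T -> \bar R}).
Local Notation C := R[i].

Lemma cintegral_ae (f g : T -> C) : cmeasurable f -> cmeasurable g ->
  (\forall x \ae mu, f x = g x) -> cintegral mu f = cintegral mu g.
Proof.
move=> [mf1 mf2] [mg1 mg2] fg; apply: ReIm_inj; rewrite /cintegral /= /Rintegral; congr fine;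
  apply: ae_eq_integral => //; try exact/measurable_EFinP;
  by apply: filterS fg => x E _ /=; rewrite E.
Qed.

Lemma Rintegral_ae (f g : T -> R) : measurable_fun setT f -> measurable_fun setT g ->
  (\forall x \ae mu, f x = g x) -> \int[mu]_x f x = \int[mu]_x g x.
Proof.
move=> mf mg fg; rewrite /Rintegral; congr fine.
apply: ae_eq_integral => //; try exact/measurable_EFinP.
by apply: filterS fg => x E _ /=; rewrite E.
Qed.

Lemma le_Rintegral_ae (f g : T -> R) : mu.-integrable setT (EFin \o f) -> mu.-integrable setT (EFin \o g) ->
  (\forall x \ae mu, f x <= g x) -> \int[mu]_x f x <= \int[mu]_x g x.
Proof.
move=> If Ig fg; have IB := rintB Ig If; rewrite -subr_ge0 -(RintegralB measurableT Ig If).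
rewrite (@Rintegral_ae _ (fun x => `|g x - f x|)).
- by apply: Rintegral_ge0 => x _; exact: normr_ge0.
- exact: rint_meas IB.
- by apply: measurableT_comp (rint_meas IB).
- by apply: filterS fg => x H; rewrite ger0_norm ?subr_ge0.
Qed.

Lemma sum_halves n : \sum_(0 <= i < n) (2 ^- i : R) <= 2.
Proof.
suff -> : \sum_(0 <= i < n) (2 ^- i : R) = 2 - 2 / 2 ^+ n.
  by rewrite gerBl divr_ge0 ?exprn_ge0.
elim: n => [|n IH]; first by rewrite big_geq // expr0 divr1 subrr.
rewrite big_nat_recr //= IH exprS; have : (2 : R) ^+ n != 0 by rewrite expf_neq0.
by move: (2 ^+ n) => t t0; field; rewrite t0.
Qed.

Section series.
Variables (D : nat -> T -> C) (B : R).
Hypothesis LD : forall j, L2 mu (D j).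
Hypothesis DB : forall j, \int[mu]_x normc (D j x) ^+ 2 <= B / 8 ^+ j.

Let H x : \bar R := (\sum_(0 <= j <oo) (4 ^+ j * normc (D j x) ^+ 2)%:E)%E.
Let h x := fine (H x).
Let pos j x : 0 <= 4 ^+ j * normc (D j x) ^+ 2 :> R.
Proof. by rewrite mulr_ge0 ?exprn_ge0 ?normc_ge0. Qed.
Let H0 x : (0 <= H x)%E. Proof. by apply: nneseries_ge0 => j _ _; rewrite lee_fin. Qed.
Let h0 x : 0 <= h x. Proof. exact: fine_ge0. Qed.
Let B0 : 0 <= B.
Proof. by have := le_trans (L2_int_ge0 mu (D 0)) (DB 0); rewrite expr0 divr1. Qed.

Let mD j : measurable_fun setT (fun x => 4 ^+ j * normc (D j x) ^+ 2 : R).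
Proof.
apply: measurable_funM; first exact: measurable_cst.
by apply: measurable_funX; apply: cmeas_normc; case/L2P: (LD j).
Qed.

Let mH : measurable_fun setT H.
Proof.
apply: ge0_emeasurable_sum => [j x _ _|j _]; first by rewrite lee_fin.
exact/measurable_EFinP.
Qed.

Let HB : (\int[mu]_x H x <= (2 * B)%:E)%E.
Proof.
rewrite integral_nneseries //; last 2 first.
- by move=> j; exact/measurable_EFinP.
- by move=> j x _; rewrite lee_fin.
have E j : (\int[mu]_x (4 ^+ j * normc (D j x) ^+ 2)%:E <= (B / 2 ^+ j)%:E)%E.
  have /L2P[_ I] := LD j; have If := rintZ (4 ^+ j) I.
  have -> : (\int[mu]_x (4 ^+ j * normc (D j x) ^+ 2)%:E = (4 ^+ j * \int[mu]_x normc (D j x) ^+ 2)%:E)%E.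
    by rewrite -RintegralZl // /Rintegral fineK //; exact: integrable_fin_num.
  rewrite lee_fin; apply: le_trans (ler_wpM2l _ (DB j)) _; first by rewrite exprn_ge0.
  have -> : (8 : R) = 4 * 2 by ring.
  rewrite exprMn le_eqVlt; apply/orP; left; apply/eqP.
  have : (4 : R) ^+ j != 0 by rewrite expf_neq0.
  have : (2 : R) ^+ j != 0 by rewrite expf_neq0.
  by move: (4 ^+ j) (2 ^+ j) => s t t0 s0; field; rewrite t0 s0.
apply: lime_le.
  by apply: is_cvg_nneseries => j _ _; apply: integral_ge0 => x _; rewrite lee_fin.
apply: nearW => n; apply: (@le_trans _ _ (\sum_(0 <= j < n) (B / 2 ^+ j)%:E)%E).
  by apply: lee_sum => j _; exact: E.
rewrite sumEFin lee_fin -mulr_sumr mulrC ler_wpM2r //; exact: sum_halves.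
Qed.

Let IH : mu.-integrable setT H.
Proof.
apply/integrableP; split => //.
apply: (@le_lt_trans _ _ (\int[mu]_x H x)%E); last exact: le_lt_trans HB (ltry _).
by rewrite le_eqVlt; apply/orP; left; apply/eqP; apply: eq_integral => x _; rewrite gee0_abs.
Qed.

Let Hfin : \forall x \ae mu, (h x)%:E = H x.
Proof. by apply: filterS (integrable_ae measurableT IH) => x /(_ Logic.I) F; rewrite fineK. Qed.

Let mh : measurable_fun setT h.
Proof. exact: (measurableT_comp (fine_measurable measurableT) mH). Qed.

Let Eh : (\int[mu]_x (h x)%:E = \int[mu]_x H x)%E.
Proof.
apply: ae_eq_integral => //; first exact/measurable_EFinP.
by apply: filterS Hfin => x E _.
Qed.

Let Ih : mu.-integrable setT (EFin \o h).
Proof.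
apply/integrableP; split; first exact/measurable_EFinP.
under eq_integral do rewrite /= ger0_norm ?h0 //.
by rewrite Eh; exact: le_lt_trans HB (ltry _).
Qed.

Let hB : \int[mu]_x h x <= 2 * B.
Proof.
have F : (\int[mu]_x (h x)%:E \is a fin_num)%E by exact: (integrable_fin_num measurableT Ih).
by rewrite -lee_fin /Rintegral fineK // Eh.
Qed.

(* D, modified on the null set where the series diverges *)
Let D' j x := if normc (D j x) <= 2 ^- j * Num.sqrt (h x) then D j x else 0.

Let D'b j x : normc (D' j x) <= 2 ^- j * Num.sqrt (h x).
Proof. by rewrite /D'; case: ifP => // _; rewrite normc0 mulr_ge0 ?invr_ge0 ?exprn_ge0 ?sqrtr_ge0. Qed.

Let mD' j : cmeasurable (D' j).
Proof.
have /L2P[[m1 m2] _] := LD j.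
have mt : measurable_fun setT (fun x => normc (D j x) <= 2 ^- j * Num.sqrt (h x)).
  apply: measurable_fun_ler; first exact: cmeas_normc.
  apply: measurable_funM; first exact: measurable_cst.
  exact: (measurableT_comp (continuous_measurable_fun (@sqrt_continuous R)) mh).
split.
  rewrite (_ : (fun x => _) = fun x => if normc (D j x) <= 2 ^- j * Num.sqrt (h x) then Re (D j x) else 0).
    by apply: measurable_fun_ifT.
  by apply/funext => x; rewrite /D'; case: ifP.
rewrite (_ : (fun x => _) = fun x => if normc (D j x) <= 2 ^- j * Num.sqrt (h x) then Im (D j x) else 0).
  by apply: measurable_fun_ifT.
by apply/funext => x; rewrite /D'; case: ifP.
Qed.

Let D'E : \forall x \ae mu, forall j, D' j x = D j x.
Proof.
apply: filterS Hfin => x E j; rewrite /D' ifT //.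
have L : 4 ^+ j * normc (D j x) ^+ 2 <= h x.
  rewrite -lee_fin E; have := @nneseries_lim_ge R (fun j => (4 ^+ j * normc (D j x) ^+ 2)%:E) xpredT 0 j.+1.
  rewrite big_mkcond /= => /(_ (fun i _ _ => _)) K; apply: le_trans (K _) => [|i]; last by rewrite lee_fin.
  rewrite big_nat_recr //= leeDr // sume_ge0 // => i _; by rewrite lee_fin.
rewrite ler_pdivlMl ?exprn_gt0 // -(@ler_pXn2r _ 2) ?nnegrE ?mulr_ge0 ?exprn_ge0 ?normc_ge0 ?sqrtr_ge0 //.
rewrite sqr_sqrtr // exprMn -exprM mulnC exprM (_ : 2 ^+ 2 = 4 :> R) //; ring.
Qed.

Let S n x := \sum_(0 <= i < n) D' i x.

Let Sb n x : normc (S n x) <= 2 * Num.sqrt (h x).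
Proof.
apply: le_trans (le_normc_sum _ _ _) _.
apply: (@le_trans _ _ (\sum_(0 <= i < n) 2 ^- i * Num.sqrt (h x))); first by apply: ler_sum.
by rewrite -mulr_suml ler_wpM2r ?sqrtr_ge0 // sum_halves.
Qed.

Let Scvg x : exists l, ccvg (fun n => S n x) l.
Proof.
have K (f : C -> R) : (forall z, `|f z| <= normc z) -> (forall y z, f (y + z) = f y + f z) -> f 0 = 0 ->
  cvgn (fun n => f (S n x)).
  move=> fb fD f0.
  have -> : (fun n => f (S n x)) = series (fun i => f (D' i x)).
    by apply/funext => n; rewrite /S /series /= (big_morph f fD f0).
  apply: normed_cvg; apply: (@series_le_cvg _ _ (geometric (Num.sqrt (h x)) 2^-1)).
  - by move=> i /=.
  - by move=> i; rewrite /= mulr_ge0 ?sqrtr_ge0 ?exprn_ge0 ?invr_ge0.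
  - by move=> i; apply: le_trans (fb _) (le_trans (D'b i x) _); rewrite /= exprVn mulrC.
  - by apply: is_cvg_geometric_series; rewrite ger0_norm ?invr_ge0 // invf_lt1 // ltr1n.
have a := K (@complex.Re R) (@normc_Re R) (@cReD R) erefl.
have b := K (@complex.Im R) (@normc_Im R) (@cImD R) erefl.
by exists (limn (fun n => Re (S n x)) +i* limn (fun n => Im (S n x))); split.
Qed.

(** Off the null set where the weighted sum of the squares diverges, the series
    converges geometrically. *)
Lemma L2_series : exists g, [/\ L2 mu g, \int[mu]_x normc (g x) ^+ 2 <= 8 * B &
  forall v, L2 mu v -> ccvg (fun n => \sum_(0 <= i < n) cintegral mu (fun x => D i x * v x))
    (cintegral mu (fun x => g x * v x))].
Proof.
have [g Sg] := choice Scvg.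
have mS n : cmeasurable (S n) by apply: cmeas_sum.
have mg : cmeasurable g := cmeas_cvg mS Sg.
have gb x : normc (g x) <= 2 * Num.sqrt (h x) by apply: ccvg_normc_le (Sg x) _ => n; exact: Sb.
have gb2 x : normc (g x) ^+ 2 <= 4 * h x.
  have -> : 4 * h x = (2 * Num.sqrt (h x)) ^+ 2 by rewrite exprMn sqr_sqrtr //; ring.
  by rewrite ler_pXn2r ?nnegrE ?mulr_ge0 ?normc_ge0 ?sqrtr_ge0.
have mg2 : measurable_fun setT (fun x => normc (g x) ^+ 2) by apply: measurable_funX; exact: cmeas_normc.
have Ig2 : mu.-integrable setT (EFin \o (fun x => normc (g x) ^+ 2)).
  apply: (rint_dom mg2 (rintZ 4 Ih)) => x; by rewrite ger0_norm ?exprn_ge0 ?normc_ge0.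
exists g; split; first by apply/L2P.
  apply: (@le_trans _ _ (\int[mu]_x (4 * h x))).
    by apply: le_Rintegral => //; exact: rintZ.
  rewrite RintegralZl // (_ : 8 * B = 4 * (2 * B)); last by ring.
  by rewrite ler_wpM2l.
move=> v Lv; have /L2P[mv Iv] := Lv.
have SE n : \sum_(0 <= i < n) cintegral mu (fun x => D i x * v x) = cintegral mu (fun x => S n x * v x).
  rewrite -cintegral_sum => [|i]; last exact: cint_L2M.
  apply: cintegral_ae.
  - by apply: cmeas_sum => i; apply: cmeasM => //; case/L2P: (LD i).
  - exact: cmeasM.
  - by apply: filterS D'E => x E; rewrite /S mulr_suml; apply: eq_bigr => i _; rewrite E.
rewrite (funext SE).
apply: (cintegral_dct (k := fun x => 2 * h x + 2 * normc (v x) ^+ 2) _ _ _ _).2.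
- by move=> n; exact: cmeasM.
- by move=> x; apply: ccvgM (Sg x) (ccvg_cst _).
- by apply: rintD; apply: rintZ.
move=> n x; rewrite normcM.
apply: le_trans (ler_wpM2r _ (Sb n x)) _; first exact: normc_ge0.
rewrite -{2}(sqr_sqrtr (h0 x)); move: (Num.sqrt (h x)) (normc (v x)) (normc_ge0 (v x)) (sqrtr_ge0 (h x)).
by move=> s t _ _; have := sqr_ge0 (s - t); have := sqr_ge0 (s + t); nra.
Qed.
End series.
End riesz_fischer.

(** * The adjoint of the coherent state transform *)

Section coherent_adjoint.
Context {R : realType}.
Local Notation C := R[i].
Variables (n : nat) (Q : 'M[C]_(n + n)) (c : R).
Hypotheses (hQ : bargmann_phase Q) (hc : 0 < c) (hT : bargmann_unitary Q c).
Local Notation g0 := (gauss (reQyy Q) (imQyy Q)).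
Local Notation k := (n + n)%N.
Local Notation CT := (coherent_transform Q).

Lemma L2_dom d (T : measurableType d) (mu : {measure set T -> \bar R}) (f g : T -> C) :
  cmeasurable f -> L2 mu g -> (forall x, normc (f x) <= normc (g x)) -> L2 mu f.
Proof.
move=> mf /L2P[mg Ig] fg; apply/L2P; split => //; apply: (rint_dom _ Ig).
  by apply: measurable_funX; exact: cmeas_normc.
by move=> x; rewrite ger0_norm ?exprn_ge0 ?normc_ge0 // ler_pXn2r ?nnegrE ?normc_ge0.
Qed.

Lemma L2J d (T : measurableType d) (mu : {measure set T -> \bar R}) (f : T -> C) :
  L2 mu f -> L2 mu (fun x => (f x)^*%C).
Proof.
move=> Lf; apply: (L2_dom _ Lf) => [|x]; last by rewrite normc_conj.
by apply: cmeasJ; case/L2P: Lf.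
Qed.

Lemma cmeas_coherent : cmeasurable (fun p : 'rV[R]_n * 'rV[R]_k => coherent Q (cplx p.2) p.1).
Proof.
have -> : (fun p : 'rV[R]_n * 'rV[R]_k => coherent Q (cplx p.2) p.1) =
  fun p => cis (bphase Q (cplx p.2)) * tau (toE Q (cplx p.2)) g0 p.1.
  by apply/funext => p; exact: coherentE.
have m2 := @measurable_snd _ _ 'rV[R]_n 'rV[R]_k.
apply: cmeasM; first by apply: cmeas_cis; exact: (measurableT_comp (measurable_bphase hQ) m2).
apply: (cmeas_tau (schwartz_ground hQ)); last exact: measurable_fst.
exact: (measurableT_comp (measurable_toE hQ) m2).
Qed.

(** Decay in t, at the price of a polynomial growth in the base point w. *)
Lemma normc_coherent : exists2 B : R, 0 <= B & forall w t,
  normc (coherent Q (cplx w) t) <= B * japanese w ^+ (n + n) * wt (n + n) t.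
Proof.
have [B B0 HB] := schwartz_bound (n + n) (schwartz_ground hQ).
have [L _ LE] := toE_linear hQ; have [K K1 HK] := jp_mulmx L.
have K0 : 0 <= K := le_trans ler01 K1.
exists (B * (2 ^+ (n + n) * K ^+ (n + n))).
  by rewrite mulr_ge0 // mulr_ge0 ?exprn_ge0.
move=> w t; rewrite coherentE // (normcM (cis _)) normc_cis mul1r /tau (normcM (cis _)) normc_cis mul1r.
apply: le_trans (HB _) _; rewrite -!mulrA ler_wpM2l //; apply: le_trans (wt_sub _ _ _) _.
rewrite ler_wpM2l ?exprn_ge0 // mulrA ler_wpM2r ?wt_ge0 // -exprMn.
apply: lerXn2r; rewrite ?nnegrE ?mulr_ge0 ?jp_ge0 //.
have := jp_rowl (lsubmx (toE Q (cplx w))) (rsubmx (toE Q (cplx w))).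
by rewrite hsubmxK {2}LE => /le_trans; apply; exact: HK.
Qed.

Section truncated.
Variables (W : 'rV[R]_k -> C) (r : R).
Hypotheses (LW : L2 (leb k) W) (Wr : forall w, r < japanese w -> W w = 0).

Let rint_W : (leb k).-integrable setT (EFin \o (fun w => normc (W w))).
Proof.
have /L2P[mW IW] := LW.
apply: (rint_dom _ (rintD IW (rintZ (`|r| ^+ (k + k)) (rint_wt2 k)))); first exact: cmeas_normc.
move=> w; rewrite ger0_norm ?normc_ge0 //.
case: (leP (japanese w) r) => [jr|/Wr ->]; last first.
  by rewrite normc0 expr0n /= add0r mulr_ge0 ?exprn_ge0 ?wt_ge0.
apply: (@le_trans _ _ (normc (W w) ^+ 2 + 1)).
  by have := normc_ge0 (W w); have := sqr_ge0 (normc (W w) - 1); nra.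
rewrite lerD2l -(wtK (k + k) w) ler_wpM2r ?wt_ge0 //; apply: lerXn2r; rewrite ?nnegrE ?jp_ge0 //.
exact: le_trans jr (ler_norm r).
Qed.

(** The rank one superposition over a bounded region is absolutely convergent,
    and its norm is bounded by duality. *)
Lemma coherent_adjoint_truncated : exists g, [/\ L2 (leb n) g,
  forall v, L2 (leb n) v -> cintegral (leb n) (fun t => g t * v t) =
    (c ^+ 2)%:C * cintegral (leb k) (fun w => W w * (CT (fun t => (v t)^*%C) w)^*%C) &
  \int[leb n]_t normc (g t) ^+ 2 <= 16 * (c ^+ 2 * \int[leb k]_w normc (W w) ^+ 2)].
Proof.
have /L2P[mW IW] := LW; have [B B0 HB] := normc_coherent.
pose C1 := B * `|r| ^+ (n + n).
have C10 : 0 <= C1 by rewrite mulr_ge0 ?exprn_ge0.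
have Wb t w : normc (W w * (coherent Q (cplx w) t)^*%C) <= wt (n + n) t * (C1 * normc (W w)).
  rewrite normcM normc_conj; case: (leP (japanese w) r) => [jr|/Wr ->]; last by rewrite normc0 mul0r !mulr0.
  rewrite mulrC mulrA ler_wpM2r ?normc_ge0 //; apply: le_trans (HB w t) _.
  rewrite mulrC ler_wpM2l ?wt_ge0 // ler_wpM2l //; apply: lerXn2r; rewrite ?nnegrE ?jp_ge0 //.
  exact: le_trans jr (ler_norm r).
have mf : cmeasurable (fun p : 'rV[R]_n * 'rV[R]_k => W p.2 * (coherent Q (cplx p.2) p.1)^*%C).
  apply: cmeasM; first exact: cmeas_comp mW measurable_snd.
  by apply: cmeasJ; exact: cmeas_coherent.
have I1 := @rint_wt2 R n; have I2 := rintZ C1 rint_W.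
have fgh t w : normc (W w * (coherent Q (cplx w) t)^*%C) <= `|wt (n + n) t| * `|C1 * normc (W w)|.
  by rewrite !ger0_norm ?mulr_ge0 ?wt_ge0 ?normc_ge0.
pose g t := (c ^+ 2)%:C * cintegral (leb k) (fun w => W w * (coherent Q (cplx w) t)^*%C).
have mg : cmeasurable g.
  apply: cmeasM; first exact: (@cmeas_cst R _ _ (c ^+ 2)%:C).
  exact: (fub_meas_int1 (f := fun t w => W w * (coherent Q (cplx w) t)^*%C) I1 I2 mf fgh).
have Lg : L2 (leb n) g.
  pose G := 2 * (c ^+ 2 * \int[leb k]_w (C1 * normc (W w))).
  have G0 : 0 <= G.
    rewrite mulr_ge0 // mulr_ge0 ?sqr_ge0 // Rintegral_ge0 // => w _.
    by rewrite mulr_ge0 ?normc_ge0.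
  apply: (L2_dom mg (L2Z G%:C (L2_wt (leqnn (n + n))))) => t.
  rewrite normcM normcM !normcR (ger0_norm (sqr_ge0 c)) (ger0_norm G0) (ger0_norm (wt_ge0 _ _)).
  have Mt := fub_meas1 (f := fun t w => W w * (coherent Q (cplx w) t)^*%C) mf t.
  have := normc_cintegral Mt (rintZ (wt (n + n) t) I2) (Wb t).
  rewrite RintegralZl // /G; have := sqr_ge0 c.
  move: (c ^+ 2) (normc _) (\int[_]_w _) (wt _ _) => e x y z e0 H.
  apply: le_trans (ler_wpM2l e0 H) _; rewrite le_eqVlt; apply/orP; left; apply/eqP; ring.
have pair v : L2 (leb n) v -> cintegral (leb n) (fun t => g t * v t) =
    (c ^+ 2)%:C * cintegral (leb k) (fun w => W w * (CT (fun t => (v t)^*%C) w)^*%C).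
  move=> Lv; have /L2P[mv _] := Lv.
  have [I3 _] := rint_square_le (L2_wt (leqnn (n + n))) Lv ltr01.
  have mfv : cmeasurable (fun p : 'rV[R]_n * 'rV[R]_k => W p.2 * (coherent Q (cplx p.2) p.1)^*%C * v p.1).
    by apply: cmeasM => //; exact: cmeas_comp mv measurable_fst.
  have fv t w : normc (W w * (coherent Q (cplx w) t)^*%C * v t) <=
     `|normc (wt (n + n) t)%:C * normc (v t)| * `|C1 * normc (W w)|.
    rewrite normcM normcR !ger0_norm ?mulr_ge0 ?wt_ge0 ?normc_ge0 // mulrAC.
    by rewrite ler_wpM2r ?normc_ge0.
  have S := fub_swap (f := fun t w => W w * (coherent Q (cplx w) t)^*%C * v t) I3 I2 mfv fv.
  transitivity ((c ^+ 2)%:C * cintegral (leb n) (fun t => cintegral (leb k) (fun w => W w * (coherent Q (cplx w) t)^*%C * v t))).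
    rewrite -cintegralZ; last exact: (fub_cint_int1 (f := fun t w => W w * (coherent Q (cplx w) t)^*%C * v t) I3 I2 mfv fv).
    apply: eq_cintegral => t; rewrite /g -mulrA cintegralZr //.
    exact: (fub_int1 (f := fun t w => W w * (coherent Q (cplx w) t)^*%C) I2 mf fgh t).
  apply: (congr1 (fun z => (c ^+ 2)%:C * z)); etransitivity; first exact: S.
  apply: eq_cintegral => w; have LvJ := L2J Lv.
  rewrite /CT -cintegralJ; last exact: (cint_L2M (schwartz_coherent_L2 hQ _) LvJ).
  rewrite -cintegralZ; last first.
    by apply: cintJ; exact: (cint_L2M (schwartz_coherent_L2 hQ _) LvJ).
  by apply: eq_cintegral => t; rewrite (cJM (coherent _ _ _)) conjcK mulrA.
clearbody g; exists g; split => //.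
have Lv := L2J Lg; have P := pair _ Lv.
have [LC EC] := coherent_isometry hQ hc hT Lg.
have E1 : (\int[leb n]_t normc (g t) ^+ 2)%:C = cintegral (leb n) (fun t => g t * (g t)^*%C).
  apply: ReIm_inj; rewrite /cintegral /=.
    by apply: eq_Rintegral => t _; rewrite mul_conj_normc.
  rewrite (@eq_Rintegral _ _ _ _ _ (fun=> 0)) ?Rintegral_cst ?mul0r // => t _.
  by rewrite mul_conj_normc.
have E2 : cintegral (leb k) (fun w => W w * (CT (fun t => ((g t)^*%C)^*%C) w)^*%C) =
   cintegral (leb k) (fun w => W w * (CT g w)^*%C).
  apply: eq_cintegral => w; congr (_ * _^*%C); apply: eq_cintegral => t; by rewrite conjcK.
have r4 : 0 < (4 : R) by [].
have [I4 H4] := rint_square_le LW LC r4.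
have mC : cmeasurable (fun w => W w * (CT g w)^*%C).
  have /L2P[mCT _] := LC; exact: (cmeasM mW (cmeasJ mCT)).
have H5 : normc (cintegral (leb k) (fun w => W w * (CT g w)^*%C)) <= 2 * \int[leb k]_w (normc (W w) * normc (CT g w)).
  have Nb w : normc (W w * (CT g w)^*%C) <= normc (W w) * normc (CT g w) by rewrite normcM normc_conj.
  exact: (normc_cintegral mC I4 Nb).
have := congr1 (@normc R) E1; rewrite P E2 normcR (ger0_norm (L2_int_ge0 _ _)) normcM normcR (ger0_norm (sqr_ge0 c)).
move: EC H4 H5; have := sqr_ge0 c; have := L2_int_ge0 (leb k) W; have := L2_int_ge0 (leb k) (CT g).
move: (\int[_]_w _) (\int[_]_w _) (\int[_]_w _) (\int[_]_w _) (normc _) (c ^+ 2) => x1 x2 x3 x4 y e.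
move=> ? ? e0 H1 H2 H3 H4.
have := ler_wpM2l e0 H3; have := ler_wpM2l e0 H2; lra.
Qed.
End truncated.

Section tails.
Variables (W : 'rV[R]_k -> C).
Hypotheses (LW : L2 (leb k) W).
Let I := \int[leb k]_w normc (W w) ^+ 2.

Let trunc (N : nat) w := if japanese w <= N%:R then W w else 0.
Let tail (N : nat) w := if japanese w <= N%:R then 0 else normc (W w) ^+ 2.

Let mW : cmeasurable W. Proof. by case/L2P: LW. Qed.
Let IW : (leb k).-integrable setT (EFin \o (fun w => normc (W w) ^+ 2)). Proof. by case/L2P: LW. Qed.

Let mjp (N : nat) : measurable_fun setT (fun w : 'rV[R]_k => japanese w <= N%:R).
Proof. by apply: measurable_fun_ler; [exact: measurable_jp | exact: measurable_cst]. Qed.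

Let m_tail N : measurable_fun setT (tail N).
Proof. by apply: measurable_fun_ifT => //; exact: rint_meas IW. Qed.

Let tail_ge0 N w : 0 <= tail N w. Proof. by rewrite /tail; case: ifP; rewrite ?exprn_ge0 ?normc_ge0. Qed.

Let tail_le N w : tail N w <= normc (W w) ^+ 2.
Proof. by rewrite /tail; case: ifP; rewrite ?exprn_ge0 ?normc_ge0. Qed.

Let rint_tail N : (leb k).-integrable setT (EFin \o tail N).
Proof. by apply: (rint_dom (m_tail N) IW) => w; rewrite ger0_norm ?tail_ge0 ?tail_le. Qed.

Let eventually_jp (w : 'rV[R]_k) : exists N0, forall N : nat, (N0 <= N)%N -> japanese w <= N%:R.
Proof.
exists (Num.Def.truncn (japanese w)).+1 => N NN; apply: ltW; apply: (lt_le_trans (truncnS_gt _)).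
by rewrite ler_nat.
Qed.

Let tail_small (j : nat) : exists N0, forall N, (N0 <= N)%N -> \int[leb k]_w tail N w <= I / 8 ^+ j.
Proof.
have I0 : 0 <= I := L2_int_ge0 (leb k) W.
case: (ltP 0 I) => [Ip|In]; last first.
  exists 0%N => N _; have -> : I = 0 by apply/le_anti; rewrite In I0.
  rewrite mul0r; apply: le_trans In; apply: le_Rintegral => // w _; exact: tail_le.
have [|||| _ H] := @rint_dct R _ _ (leb k) tail (fun=> 0) (fun w => normc (W w) ^+ 2).
- exact: m_tail.
- move=> w; apply: cvg_near_cst; have [N0 HN] := eventually_jp w.
  by exists N0 => // N /= NN; rewrite /tail HN.
- exact: IW.
- by move=> N w; rewrite ger0_norm ?tail_ge0 ?tail_le.
move: H; rewrite Rintegral_cst // mul0r => /cvgrPdist_le /(_ (I / 8 ^+ j)).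
rewrite divr_gt0 ?exprn_gt0 // => /(_ isT) [N0 _ HN]; exists N0 => N NN.
by have := HN N NN; rewrite sub0r normrN; apply: le_trans; exact: ler_norm.
Qed.

(** The adjoint on the whole space is the sum of a series over annuli which carry
    geometrically small parts of the norm. *)
Lemma coherent_adjoint : exists g, [/\ L2 (leb n) g,
  forall v, L2 (leb n) v -> cintegral (leb n) (fun t => g t * v t) =
    (c ^+ 2)%:C * cintegral (leb k) (fun w => W w * (CT (fun t => (v t)^*%C) w)^*%C) &
  \int[leb n]_t normc (g t) ^+ 2 <= 128 * (c ^+ 2 * \int[leb k]_w normc (W w) ^+ 2)].
Proof.
have [Nf HN] := choice tail_small.
pose rad j := (\sum_(0 <= i < j) (Nf i.+1).+1)%N.
have radS j : (rad j <= rad j.+1)%N by rewrite /rad big_nat_recr //= leq_addr.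
have rad_ge j : (j <= rad j)%N.
  by elim: j => // j IH; rewrite /rad big_nat_recr //= addnS ltnS (leq_trans IH) // leq_addr.
have rad_tail j : \int[leb k]_w tail (rad j) w <= I / 8 ^+ j.
  case: j => [|j].
    rewrite expr0 divr1; apply: le_Rintegral => // w _; exact: tail_le.
  apply: HN; rewrite /rad big_nat_recr //= addnS ltnW // ltnS; exact: leq_addl.
have m_trunc N : cmeasurable (trunc N).
  have [m1 m2] := mW; split.
    rewrite (_ : (fun w => _) = fun w => if japanese w <= N%:R then Re (W w) else 0).
      exact: measurable_fun_ifT.
    by apply/funext => w; rewrite /trunc; case: ifP.
  rewrite (_ : (fun w => _) = fun w => if japanese w <= N%:R then Im (W w) else 0).
    exact: measurable_fun_ifT.
  by apply/funext => w; rewrite /trunc; case: ifP.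
pose V j w := trunc (rad j.+1) w + (-1) * trunc (rad j) w.
have le_rad j (w : 'rV[R]_k) : japanese w <= (rad j)%:R -> japanese w <= ((rad j.+1)%:R : R).
  by move=> /le_trans; apply; rewrite ler_nat.
have mV j : cmeasurable (V j).
  by apply: cmeasD => //; apply: cmeasM => //; exact: (@cmeas_cst R _ _ (-1)).
have Vtail j w : normc (V j w) ^+ 2 <= tail (rad j) w.
  rewrite /V /trunc /tail; case E: (japanese w <= (rad j)%:R).
    by rewrite (le_rad _ _ E) mulN1r subrr normc0 expr0n.
  by case: ifP => _; rewrite mulr0 addr0 // normc0 expr0n exprn_ge0 ?normc_ge0.
have IV j : (leb k).-integrable setT (EFin \o (fun w => normc (V j w) ^+ 2)).
  apply: (rint_dom _ (rint_tail (rad j))).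
    by apply: measurable_funX; exact: cmeas_normc.
  by move=> w; rewrite ger0_norm ?exprn_ge0 ?normc_ge0.
have LV j : L2 (leb k) (V j).
  by apply/L2P; split.
have Vr j w : ((rad j.+1)%:R : R) < japanese w -> V j w = 0.
  rewrite /V /trunc ltNge => /negP nw; rewrite ifF; last exact/negP.
  by rewrite ifF ?mulr0 ?addr0 //; apply/negP => /le_rad.
have [D HD] := choice (fun j => coherent_adjoint_truncated (LV j) (@Vr j)).
have DB j : \int[leb n]_t normc (D j t) ^+ 2 <= 16 * (c ^+ 2 * I) / 8 ^+ j.
  have [_ _ H] := HD j; apply: (le_trans H); rewrite -!mulrA !ler_wpM2l ?(ltW hc) //.
  apply: le_trans (rad_tail j).
  exact: (le_Rintegral measurableT (IV j) (rint_tail (rad j)) (fun w _ => Vtail j w)).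
have LD j : L2 (leb n) (D j) by have [] := HD j.
have [g [Lg gB Hg]] := L2_series LD DB; exists g; split => //; last first.
  by apply: (le_trans gB); rewrite /I; move: (c ^+ 2) (\int[_]_w _) => x y; rewrite le_eqVlt; apply/orP; left; apply/eqP; ring.
move=> v Lv; apply: ccvg_unique (Hg v Lv) _.
pose X w := (CT (fun t => (v t)^*%C) w)^*%C.
have LX : L2 (leb k) X by apply: L2J; have [] := coherent_isometry hQ hc hT (L2J Lv).
have sumV m w : \sum_(0 <= i < m) V i w = trunc (rad m) w.
  elim: m => [|m IH]; last by rewrite big_nat_recr //= IH /V mulN1r addrCA subrr addr0.
  rewrite big_geq // /trunc /rad big_geq // ifF //; apply/negbTE; rewrite -ltNge; exact: jp_gt0.
have E m : \sum_(0 <= i < m) cintegral (leb n) (fun t => D i t * v t) =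
    (c ^+ 2)%:C * cintegral (leb k) (fun w => trunc (rad m) w * X w).
  transitivity (\sum_(0 <= i < m) (c ^+ 2)%:C * cintegral (leb k) (fun w => V i w * X w)).
    by apply: eq_bigr => i _; have [_ H _] := HD i; exact: H.
  rewrite -mulr_sumr -cintegral_sum => [|i]; last exact: cint_L2M.
  apply: (congr1 (fun z => (c ^+ 2)%:C * z)); apply: eq_cintegral => w.
  by rewrite -sumV mulr_suml.
rewrite (funext E); apply: ccvgM; first exact: ccvg_cst.
have [IWX _] := rint_square_le LW LX ltr01.
have /L2P[mX _] := LX.
apply: (cintegral_dct (k := fun w => normc (W w) * normc (X w)) _ _ IWX _).2.
- by move=> m; exact: cmeasM.
- move=> w; have [N0 HN0] := eventually_jp w.
  split; apply: cvg_near_cst; exists N0 => // m /= Nm;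
    by rewrite /trunc HN0 // (leq_trans Nm).
- move=> m w; rewrite normcM ler_wpM2r ?normc_ge0 // /trunc.
  by case: ifP; rewrite ?normc0 ?normc_ge0.
Qed.
End tails.
End coherent_adjoint.

(** * Boundedness from a dominating kernel *)

Section almost_everywhere.
Context {R : realType}.

(** Invertible linear maps preserve null sets. *)
Lemma ae_linear k (M : 'M[R]_k) (P : 'rV[R]_k -> Prop) : M \in unitmx ->
  (\forall x \ae leb k, P x) -> \forall x \ae leb k, P (x *m M).
Proof.
move=> uM [N [mN N0 PN]]; have [kap _ Hk] := leb_linear uM.
exists (mulmx^~ M @^-1` N); split.
- by rewrite -[X in measurable X]setTI; exact: measurable_mulmx.
- by rewrite Hk // N0 mule0.
- by move=> x; exact: PN.
Qed.

Lemma rint_dom_ae d (T : measurableType d) (mu : {measure set T -> \bar R}) (f g : T -> R) :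
  measurable_fun setT f -> mu.-integrable setT (EFin \o g) -> (\forall x \ae mu, `|f x| <= g x) ->
  mu.-integrable setT (EFin \o f).
Proof.
move=> mf Ig fg; have mg := rint_meas Ig.
apply/integrableP; split; first exact/measurable_EFinP.
have /integrableP[_] := Ig; apply: le_lt_trans.
apply: ae_ge0_le_integral => //.
- by apply: measurableT_comp => //; exact/measurable_EFinP.
- by apply: measurableT_comp => //; exact/measurable_EFinP.
- by apply: filterS fg => x H _; rewrite /= lee_fin (le_trans H) // ler_norm.
Qed.
End almost_everywhere.

Section boundedness.
Context {R : realType}.
Local Notation C := R[i].
Variables (n : nat) (Q : 'M[C]_(n + n)) (c : R).
Hypotheses (hQ : bargmann_phase Q) (hc : 0 < c) (hT : bargmann_unitary Q c).
Local Notation g0 := (gauss (reQyy Q) (imQyy Q)).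
Local Notation k := (n + n)%N.
Local Notation CT := (coherent_transform Q).
Local Notation pt w := (toE Q (cplx w)).
Variables (a : Defs.distribution (R := R) k) (h : 'rV[R]_k -> C) (K1 : C).
Hypotheses (ta : tempered a) (sh : schwartz h) (K10 : K1 != 0).
Hypothesis mS : cmeasurable (fun rho => a (tau rho h)).
Hypothesis rep : forall F, schwartz F ->
  cintegral (leb (k + k)) (fun rho => stft h F rho * a (tau rho h)) = K1 * a F.
Variables (m : 'rV[R]_(k + k) -> R) (A : R).
Hypotheses (m0 : forall rho, 0 < m rho) (A0 : 0 <= A).
Hypothesis am : forall rho, normc (a (tau rho (ground_wigner Q))) <= A * m rho.

Let W u w := a (wigner u (tau (pt w) g0)).

Let W_pointwise (L : 'M[R]_k) (kap : R) u w (e : C) : 0 < kap ->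
  (forall B : set 'rV[R]_k, measurable B -> leb k (mulmx^~ L @^-1` B) = (kap%:E * leb k B)%E) ->
  L \in unitmx -> (forall v, pt v = v *m L) -> schwartz u ->
  ae_integral (leb k) (fun y => (kernel_weight m (pt w) y)%:C * (normc (CT u (y *m invmx L)))%:C) e ->
  normc (W u w) <= 2 * (c ^+ 2 * A * kap) * normc e.
Proof.
move=> kap0 Hk uL LE su [hh [Ihh hhE <-]].
have sw := schwartz_tau (pt w) (schwartz_ground hQ).
rewrite /W; have [I <-] := symbol_wigner_left hQ hc hT ta sh K10 mS rep su sw.
have mI := cint_meas I; have nI := cint_normc I.
apply: le_trans (normc_cintegral mI nI (fun w' => lexx _)) _.
rewrite -mulrA ler_wpM2l //.
have [IR _] := Ihh.
have IRL := rint_change (@measurable_mulmx R k k L) (ltW kap0) Hk IR.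
have ER := Rintegral_change (@measurable_mulmx R k k L) (ltW kap0) Hk IR.
have IS := rintZ (c ^+ 2 * A) IRL.
apply: le_trans (le_Rintegral_ae nI IS _) _.
  apply: filterS (ae_linear uL hhE) => w' E.
  have RE : Re (hh (w' *m L)) = kernel_weight m (pt w) (pt w') * normc (CT u w').
    by rewrite E mulmxK // cReZ -LE.
  have := normc_coherent_entry hQ ta am (pt w) (pt w'); rewrite /coherent_entry.
  have : normc (stft g0 (fun t : 'rV_n => (u t)^*%C) (pt w'))^*%C = normc (CT u w').
    by rewrite (coherent_transformE hQ w' su) (normcM (cis _)) normc_cis mul1r.
  move: (a _) (stft _ _ _)^*%C => X Y YE XE.
  rewrite normcM normcM normcR (ger0_norm (sqr_ge0 c)) RE YE; have := sqr_ge0 c.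
  have := normc_ge0 (CT u w'); move: XE (c ^+ 2).
  move: (normc X) (normc _) (kernel_weight _ _ _) => x y z xz e' y0 e0.
  by rewrite -(mulrA e') ler_wpM2l // (mulrA A) mulrC ler_wpM2r.
rewrite RintegralZl // ER; have := sqr_ge0 c.
have : \int[leb k]_y Re (hh y) <= normc (cintegral (leb k) hh).
  exact: le_trans (ler_norm _) (normc_Re (cintegral (leb k) hh)).
move: (c ^+ 2) (\int[_]_y _) (normc _) => e' x y xy e0.
by rewrite -!mulrA !ler_wpM2l ?(ltW kap0).
Qed.

(** The operator with the kernel weight of m, applied to the modulus of the transform of
    u, dominates the coherent entries almost everywhere. *)
Lemma symbol_entries_L2 : bounded_kernel (kernel_weight m) -> exists2 B : R, 0 <= B &
  forall u, schwartz u -> L2 (leb k) (W u) /\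
    \int[leb k]_w normc (W u w) ^+ 2 <= B * \int[leb n]_t normc (u t) ^+ 2.
Proof.
move=> [A1 HA]; have [L uL LE] := toE_linear hQ.
have uL' : invmx L \in unitmx by rewrite unitmx_inv.
have [kap kap0 Hk] := leb_linear uL; have [kp kp0 Hkp] := leb_linear uL'.
pose D := 2 * (c ^+ 2 * A * kap).
have D0 : 0 <= D by rewrite mulr_ge0 // mulr_ge0 ?(ltW kap0) // mulr_ge0 ?sqr_ge0.
exists (D ^+ 2 * kap * A1 ^+ 2 * kp / c ^+ 2).
  by rewrite divr_ge0 ?sqr_ge0 // mulr_ge0 ?(ltW kp0) // mulr_ge0 ?sqr_ge0 // mulr_ge0 ?sqr_ge0 ?(ltW kap0).
move=> u su; have [LC EC] := coherent_isometry hQ hc hT (schwartz_L2 su).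
have /L2P[mC IC] := LC.
pose f (y : 'rV[R]_k) : C := (normc (CT u (y *m invmx L)))%:C.
have fE y : normc (f y) ^+ 2 = normc (CT u (y *m invmx L)) ^+ 2.
  by rewrite /f normcR ger0_norm ?normc_ge0.
have If := rint_change (@measurable_mulmx R k k (invmx L)) (ltW kp0) Hkp IC.
have Ef := Rintegral_change (@measurable_mulmx R k k (invmx L)) (ltW kp0) Hkp IC.
have Lf : L2 (leb k) f.
  apply/L2P; split.
    by apply: cmeasR; exact: (measurableT_comp (cmeas_normc mC) (@measurable_mulmx R k k (invmx L))).
  by rewrite (_ : (fun x => _) = fun x => normc (CT u (x *m invmx L)) ^+ 2) //; exact/funext.
have [g [Lg gM gA]] := HA f Lf; have /L2P[mg Ig] := Lg.
have gB : \int[leb k]_y normc (g y) ^+ 2 <= A1 ^+ 2 * (kp * \int[leb k]_w normc (CT u w) ^+ 2).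
  move: gA; rewrite !L2norm_Rintegral // -EFinM lee_fin => gA.
  rewrite -Ef -(sqr_sqrtr (L2_int_ge0 (leb k) g)).
  have -> : \int[leb k]_x normc (CT u (x *m invmx L)) ^+ 2 = Num.sqrt (\int[leb k]_x normc (f x) ^+ 2) ^+ 2.
    by rewrite sqr_sqrtr ?L2_int_ge0 //; apply: eq_Rintegral => x _; rewrite fE.
  rewrite -exprMn ler_pXn2r ?nnegrE ?sqrtr_ge0 //; exact: le_trans (sqrtr_ge0 _) gA.
have Wg : \forall w \ae leb k, normc (W u w) <= D * normc (g (w *m L)).
  apply: filterS (ae_linear uL gM) => w; rewrite -{1}LE => H.
  exact: W_pointwise kap0 Hk uL LE su H.
have mW : cmeasurable (W u).
  have M := cmeas_symbol_wigner hQ ta sh K10 mS rep su.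
  exact: cmeas_comp M (measurable_toE hQ).
have IgL := rint_change (@measurable_mulmx R k k L) (ltW kap0) Hk Ig.
have EgL := Rintegral_change (@measurable_mulmx R k k L) (ltW kap0) Hk Ig.
have IDg := rintZ (D ^+ 2) IgL.
have Wg2 : \forall w \ae leb k, normc (W u w) ^+ 2 <= D ^+ 2 * normc (g (w *m L)) ^+ 2.
  apply: filterS Wg => w H; rewrite -exprMn ler_pXn2r ?nnegrE ?normc_ge0 ?(mulr_ge0 D0 (normc_ge0 _)) //.
have IW : (leb k).-integrable setT (EFin \o (fun w => normc (W u w) ^+ 2)).
  apply: (rint_dom_ae _ IDg); first by apply: measurable_funX; exact: cmeas_normc.
  by apply: filterS Wg2 => w; rewrite ger0_norm ?exprn_ge0 ?normc_ge0.
split; first by apply/L2P.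
apply: le_trans (le_Rintegral_ae IW IDg Wg2) _.
rewrite RintegralZl // EgL -EC.
have c2 : c ^+ 2 != 0 by rewrite expf_neq0 // gt_eqF.
move: gB; move: (\int[leb k]_y normc (g y) ^+ 2) (\int[leb k]_w normc (CT u w) ^+ 2) (sqr_ge0 D) => x y D2 gB.
have -> : D ^+ 2 * kap * A1 ^+ 2 * kp / c ^+ 2 * (c ^+ 2 * y) = D ^+ 2 * (kap * (A1 ^+ 2 * (kp * y))).
  by move: (c ^+ 2) (A1 ^+ 2) (D ^+ 2) c2 => e' f' g' e0; field.
by rewrite ler_wpM2l // ler_wpM2l ?(ltW kap0).
Qed.

(** The quantized symbol is recovered from its coherent entries by the adjoint of the
    coherent state transform. *)
Lemma symbol_weyl_bounded : bounded_kernel (kernel_weight m) -> weyl_bounded a.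
Proof.
move=> /symbol_entries_L2[B B0 HB].
pose p : R := (2 * pi) ^- n.
exists (Num.sqrt (128 * (c ^+ 2 * (p ^+ 2 * B)))) => u su.
have [LW WB] := HB u su; have /L2P[mW IW] := LW.
pose V w := p%:C * (cis (bphase Q (cplx w)) * W u w).
have nV w : normc (V w) ^+ 2 = p ^+ 2 * normc (W u w) ^+ 2.
  by rewrite /V normcM (normcM (cis _)) normc_cis mul1r normcR exprMn -normrX ger0_norm ?sqr_ge0.
have LV : L2 (leb k) V.
  apply: L2Z; apply: (L2_dom _ LW) => [|w]; last by rewrite (normcM (cis _)) normc_cis mul1r.
  by apply: cmeasM => //; apply: cmeas_cis; exact: measurable_bphase.
have [g [Lg gE gB]] := coherent_adjoint hQ hc hT LV.
exists g; split => //.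
- move=> v sv; have [I E] := symbol_wigner_right hQ hc hT ta sh K10 mS rep su sv.
  have vJ : (fun t => ((v t)^*%C)^*%C) = v by apply/funext => t; exact: conjcK.
  have VE w : V w * (CT (fun t => (v t)^*%C) w)^*%C = p%:C * (stft g0 v (pt w) * W u w).
    rewrite (coherent_transformE hQ w (schwartzJ sv)) vJ /V (cJM (cis _)) conjcK cisJ.
    have := cisD (bphase Q (cplx w)) (- bphase Q (cplx w)); rewrite subrr cis0.
    move: (cis _) (cis _) (stft _ _ _) (W u w) => s t x y st.
    by rewrite mulrACA (mulrC _ y) -!mulrA -[in RHS](mul1r (x * y)) st; ring.
  have IJ : cintegrable (leb k) (fun w => stft g0 v (pt w) * W u w).
    have := cintZ (c ^+ 2)^-1%:C I.
    rewrite (_ : (fun x => _) = fun w => stft g0 v (pt w) * W u w) //; apply/funext => w.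
    by rewrite mulrA -rmorphM mulVf ?rmorph1 ?mul1r // expf_neq0 // gt_eqF.
  rewrite (gE v (schwartz_L2 sv)) /weyl_distr -E -/p (cintegralZ _ IJ).
  by rewrite (eq_cintegral _ VE) (cintegralZ _ IJ) mulrCA.
rewrite (L2norm_Rintegral Lg) (L2norm_Rintegral (schwartz_L2 su)) -EFinM lee_fin -sqrtrM; last first.
  by rewrite mulr_ge0 // mulr_ge0 ?sqr_ge0 // mulr_ge0 ?sqr_ge0.
apply: ler_wsqrtr; apply: (le_trans gB).
have -> : \int[leb k]_w normc (V w) ^+ 2 = p ^+ 2 * \int[leb k]_w normc (W u w) ^+ 2.
  by rewrite -RintegralZl //; apply: eq_Rintegral => w _; exact: nV.
move: WB (sqr_ge0 c) (sqr_ge0 p); move: (c ^+ 2) (p ^+ 2) => e q.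
move: (\int[leb k]_w _) (\int[leb n]_w _) => x y xy e0 q0.
have -> : 128 * (e * (q * B)) * y = 128 * (e * (q * (B * y))) by ring.
by rewrite !ler_wpM2l.
Qed.
End boundedness.

(** * Effective kernel and boundedness *)

Theorem theorem3p1 (R : realType) (n : nat)
  (m : 'rV[R]_((n + n) + (n + n)) -> R) (hm : order_function m)
  (Gamma : set 'rV[R]_((n + n) + (n + n))) (hGamma : lattice Gamma)
  (chi : 'rV[R]_((n + n) + (n + n)) -> R[i]) (hchi : schwartz chi)
  (hsum : forall rho,
     unordered_sum Gamma (fun gamma => translate chi gamma rho) 1)
  (Q : 'M[R[i]]_(n + n)) (hQ : bargmann_phase Q)
  (c : R) (hc : 0 < c) (hT : bargmann_unitary Q c) :
  (exists A : R, forall a, symbol_space Gamma chi m a ->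
     exists K, effective_kernel Q c a K /\
       forall x y, normc (K x y) <=
         A * symbol_norm Gamma chi m a * kernel_weight m (toE Q x) (toE Q y)) /\
  (bounded_kernel (kernel_weight m) ->
     forall a, symbol_space Gamma chi m a -> weyl_bounded a).

Proof.
have [h [K1 [sh K10 bound mS rep]]] := symbol_phase_space hGamma hm hchi hsum.
have [CF CF0 HF] := bound _ (schwartz_ground_wigner hQ).
split.
- exists (c ^+ 2 * (2 * pi) ^- n * CF) => a sa; exists (bargmann_kernel Q c a); split.
    apply: (bargmann_kernel_effective hQ hc hT sa.1 sh K10) => F sF.
      exact: mS.
    exact: rep.
  move=> x y; have entry_bound rho : normc (a (tau rho (ground_wigner Q))) <=
      CF * symbol_norm Gamma chi m a * m rho by rewrite -mulrA; exact: HF.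
  have := normc_coherent_entry hQ sa.1 entry_bound (toE Q x) (toE Q y).
  rewrite /bargmann_kernel -(mulrA (real_complex R _)) normcM (normcM (cis _)) normc_cis mul1r normcR.
  have e0 : 0 <= c ^+ 2 * (2 * pi) ^- n.
    by rewrite mulr_ge0 ?sqr_ge0 // invr_ge0 exprn_ge0 // mulr_ge0 // pi_ge0.
  rewrite (ger0_norm e0); move: (c ^+ 2 * _) e0 => e e0 H.
  by rewrite -!mulrA ler_wpM2l // mulrA.
- move=> hB a sa.
  have entry_bound rho : normc (a (tau rho (ground_wigner Q))) <=
      CF * symbol_norm Gamma chi m a * m rho by rewrite -mulrA; exact: HF.
  have N0 : 0 <= CF * symbol_norm Gamma chi m a.
    exact: mulr_ge0 CF0 (symbol_norm_ge0 hGamma (proj1 hm) sa).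
  apply: (symbol_weyl_bounded hQ hc hT sa.1 sh K10 (mS _ _ sa sh) _ N0 entry_bound hB) => F sF.
  exact: rep.
Qed.
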